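(* Suppose that $f$ and $g$ satisfy the growth conditions (stated in the context), let $(\beta,\eta)$ be an admissible pair, and let $0\le\epsilon\le\epsilon_0$. Then for any $(t_0,u_0)\in\mathbb{R}\times X^\eta_\epsilon$ there is a unique local solution of the problem $$u_t+(A_\epsilon)_\beta u=(H_\epsilon)_\beta(u),\quad t>t_0,\qquad u(t_0)=u_0 .$$
   Context: Let $\Omega=(0,1)^2\subset\mathbb{R}^2$, $a>0$, and let $\epsilon_0>0$ be sufficiently small. For $0<\epsilon\le\epsilon_0$ let $h_\epsilon(x_1,x_2)=(x_1,\,x_2+\varphi(x_2,\epsilon)\sin(x_1/\epsilon))$, a diffeomorphism of $\Omega$ onto $\Omega_\epsilon=h_\epsilon(\Omega)$, where $\varphi$ is of class $C^2$ and (i) $\varphi(0,\epsilon)=0$; (ii) $\varphi(1,\epsilon)=\epsilon$; (iii) $\partial\varphi/\partial x_2\to0$ uniformly as $\epsilon\to0$; (iv) $\|\varphi(x_2,\epsilon)^2/\epsilon^2\|_{L^2(\Omega)}\to0$ as $\epsilon\to0$; moreover $\varphi(x_2,\epsilon)/\epsilon$ is bounded uniformly in $x_2,\epsilon$. Let $Jh_\epsilon=\det Dh_\epsilon=1+\frac{\partial\varphi}{\partial x_2}(x_2,\epsilon)\sin(x_1/\epsilon)$, $h_0=\mathrm{id}$, $Jh_0=1$, and $\nabla_\epsilon u=(Dh_\epsilon)^{-T}\nabla u$. $H^{-1}(\Omega)$ is the dual of $H^1(\Omega)$. $A_\epsilon:H^1(\Omega)\to H^{-1}(\Omega)$ is $\langle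 A_\epsilon u,\phi\rangle=\int_\Omega\nabla_\epsilon u\cdot\nabla_\epsilon\phi\,|Jh_\epsilon|\,dx+a\int_\Omega u\phi\,|Jh_\epsilon|\,dx$; it is viewed as an unbounded operator in $H^{-1}(\Omega)$ with domain $H^1(\Omega)$, where for given $\epsilon$ a function $u\in L^2(\Omega)$ is identified with $\phi\mapsto\int_\Omega u\phi|Jh_\epsilon|dx$. For $-\frac12\le\alpha\le0$, $X^\alpha_\epsilon$ is the domain of the fractional power $A_\epsilon^{\alpha+1/2}$ in $H^{-1}(\Omega)$; for $0\le\alpha\le1$, $X^\alpha_\epsilon$ is the domain of $A_\epsilon^\alpha$ in $L^2(\Omega)$ (for the restriction of $A_\epsilon$ to $L^2(\Omega)$). So $X_\epsilon^{-1/2}=H^{-1}(\Omega)$, $X^0_\epsilon=L^2(\Omega)$, $X^{1/2}_\epsilon=H^1(\Omega)$; $X^\alpha=X^\alpha_0$; for $|\alpha|\le\frac12$, $X^\alpha_\epsilon=X^\alpha$ with norms equivalent uniformly in $\epsilon$. For $-\frac12\le\beta\le0$, $X^\beta$ is regarded as the dual of $X^{-\beta}$, with pairing $\langle\cdot,\cdot\rangle_{\beta,-\beta}$, and $(A_\epsilon)_\beta$ is the realization of $A_\epsilon$ in $X^\beta_\epsilon$, with domain $X^{\beta+1}_\epsilon$. Let $I_1=\{(x_1,1):0\le x_1\le1\}$, $I_2=\{(1,x_2):0\le x_2\le1\}$, $I_3=\{(x_1,0):0\le x_1\le1\}$, $I_4=\{(0,x_2):0\le x_2\le1\}$. For $\epsilon>0$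 let $\theta_\epsilon=|J_{\partial\Omega}h_\epsilon|$, i.e. $\theta_\epsilon=\sqrt{1+\cos^2(x_1/\epsilon)}$ on $I_1$, $\theta_\epsilon=1+\frac{\partial\varphi}{\partial x_2}(x_2,\epsilon)\sin(1/\epsilon)$ on $I_2$, $\theta_\epsilon=1$ on $I_3\cup I_4$; let $\theta_0=\frac1\pi\int_0^\pi\sqrt{1+\cos^2y}\,dy$ on $I_1$ and $\theta_0=1$ on $I_2\cup I_3\cup I_4$. With $\gamma$ the trace operator, $(H_\epsilon)_\beta:X^\eta_\epsilon\to X^\beta$ is given by $\langle (H_\epsilon)_\beta(u),\phi\rangle_{\beta,-\beta}=\int_\Omega f(u)\phi\,|Jh_\epsilon|\,dx+\int_{\partial\Omega}g(\gamma(u))\gamma(\phi)\,\theta_\epsilon\,d\sigma$ for $\phi\in X^{-\beta}$. Growth conditions: $f\in C^1(\mathbb{R},\mathbb{R})$, $g\in C^2(\mathbb{R},\mathbb{R})$ and there are $\lambda_1,\lambda_2,L_1,L_2>0$ with $|f(u_1)-f(u_2)|\le L_1(1+|u_1|^{\lambda_1}+|u_2|^{\lambda_1})|u_1-u_2|$ and $|g(u_1)-g(u_2)|\le L_2(1+|u_1|^{\lambda_2}+|u_2|^{\lambda_2})|u_1-u_2|$ for all $u_1,u_2\in\mathbb{R}$. Admissible pair $(\beta,\eta)$: $-\frac12\le\beta<-\frac14$ and there are conjugate exponents $p_1,q_1$ with $\frac1{\lambda_1}<p_1<\infty$ and conjugate exponents $p_2,q_2$ with $\frac1{2\lambda_2}<p_2<\infty$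 such that $\beta+1>\eta>\max\{\frac12-\frac1{2(\lambda_1+1)},\ \frac12-\frac1{2p_1\lambda_1},\ \frac12-\frac1{2q_1},\ \frac12-\frac1{4(\lambda_2+1)},\ \frac12-\frac1{4p_2\lambda_2},\ \frac12-\frac1{4q_2}\}$. A local solution on $[t_0,t_1)$ is a continuous $u:[t_0,t_1)\to X^\eta_\epsilon$ with $u(t_0)=u_0$ such that, on $(t_0,t_1)$, $u(t)\in X^{\beta+1}_\epsilon$, $u$ is differentiable into $X^\beta$ and the equation holds. *)

(* Defs.v *)
From HB Require Import structures.
From mathcomp Require Import all_boot all_order all_algebra.
From mathcomp Require Import all_classical all_reals all_analysis.

Set Implicit Arguments.
Unset Strict Implicit.
Unset Printing Implicit Defensive.

Import Order.TTheory GRing.Theory Num.Theory.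
Import numFieldNormedType.Exports.

Local Open Scope classical_set_scope.
Local Open Scope ring_scope.

Section Smooth.
Variable R : realType.

Definition Ck1 (k : nat) (f : R -> R) : Prop :=
  (forall j x, (j < k)%N -> derivable (derive1n j f) x 1) /\
  continuous (derive1n k f).

Definition basis2 (i : 'I_2) : R * R := if i == ord0 then (1, 0) else (0, 1).

Definition coord2 (i : 'I_2) (x : R * R) : R := if i == ord0 then x.1 else x.2.

Fixpoint Ck2 (k : nat) (U : set (R * R)) (f : R * R -> R) : Prop :=
  (forall x, U x -> {for x, continuous f}) /\
  if k is k'.+1 then
    forall i, (forall x, U x -> derivable f x (basis2 i)) /\
              Ck2 k' U (fun x => 'D_(basis2 i) f x)
  else True.

Definition smooth2 (f : R * R -> R) : Prop := forall k, Ck2 k setT f.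

Definition diffeomorphism_on (U : set (R * R)) (F : R * R -> R * R) : Prop :=
  exists G : R * R -> R * R,
    [/\ open (F @` U),
        forall x, U x -> G (F x) = x,
        forall i, Ck2 1 U (fun x => coord2 i (F x)) &
        forall i, Ck2 1 (F @` U) (fun x => coord2 i (G x))].

End Smooth.

Section Square.
Variable R : realType.
Local Notation T := (measurableTypeR R * measurableTypeR R)%type.
Local Notation leb := (@lebesgue_measure R).

Definition Omega : set T := `]0, 1[ `*` `]0, 1[.

Lemma measurable_Omega : measurable Omega.
Proof. by apply: measurableX; exact: measurable_itv. Qed.

Definition lebO : {measure set T -> \bar R} :=
  mrestr (leb \x leb)%E measurable_Omega.

Definition leb01 : {measure set (measurableTypeR R) -> \bar R} :=
  mrestr leb (measurable_itv `[(0 : R), 1]).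

(* Arc-length parametrizations of the top, right, bottom and left edges, in this
   order; the value for k > 3 is irrelevant. *)
Definition edge (k : nat) (t : measurableTypeR R) : T :=
  nth (0, 0) [:: (t, 1); (1, t); (t, 0); (0, t)] k.

Lemma measurable_edge k : measurable_fun setT (edge k).
Proof.
case: k => [|[|[|[|k]]]]; rewrite /edge /= ?nth_nil;
  by [exact: pair2_measurable|exact: pair1_measurable|exact: measurable_cst].
Qed.

Definition edge_measure (k : nat) : {measure set T -> \bar R}.
Proof.
by unshelve refine (pushforward leb01 (edge k)); exact: measurable_edge.
Defined.

(* The arc-length measure of the boundary, as a measure on the plane. *)
Definition sigma : {measure set T -> \bar R} := msum edge_measure 4.

(* Elements of L2(Omega), of L2(boundary) and of their subspaces are represented
   by measurable functions on the plane, up to equality almost everywhere for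
   lebO, resp. sigma. *)
Definition L2fun (mu : {measure set T -> \bar R}) (u : R * R -> R) : Prop :=
  (u : T -> R) \in Lfun mu 2%:E.

Definition L2norm (mu : {measure set T -> \bar R}) (u : R * R -> R) : R :=
  fine ('N[mu]_(2%:E)[EFin \o (u : T -> R)])%E.

Definition test_fun (psi : R * R -> R) : Prop :=
  smooth2 psi /\
  let K := closure [set x | psi x != 0] in compact K /\ K `<=` Omega.

Definition is_weak_partial (i : 'I_2) (u v : R * R -> R) : Prop :=
  L2fun lebO v /\
  forall psi, test_fun psi ->
    \int[lebO]_x (u x * 'D_(basis2 R i) psi x) = - \int[lebO]_x (v x * psi x).

Definition H1 (u : R * R -> R) : Prop :=
  L2fun lebO u /\ forall i, exists v, is_weak_partial i u v.

Definition weak_partial (i : 'I_2) (u : R * R -> R) : R * R -> R :=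
  xget (cst 0) [set v | is_weak_partial i u v].

Definition weak_grad (u : R * R -> R) (x : R * R) : 'cV[R]_2 :=
  \col_i weak_partial i u x.

End Square.

Arguments Omega : clear implicits.

Section Perturbation.
Variable R : realType.
Variable phi : R -> R -> R. (* phi x2 eps *)

Definition hmap (eps : R) (x : R * R) : R * R :=
  if eps == 0 then x
  else (x.1, x.2 + phi x.2 eps * sin (x.1 / eps)).

Definition Dh (eps : R) (x : R * R) : 'M[R]_2 :=
  \matrix_(i, j) 'D_(basis2 R j) (fun y => coord2 i (hmap eps y)) x.

Definition Jh (eps : R) (x : R * R) : R := \det (Dh eps x).

Definition grad_eps (eps : R) (u : R * R -> R) (x : R * R) : 'cV[R]_2 :=
  (invmx (Dh eps x))^T *m weak_grad u x.

(* The first branch is the top edge, the second one the right edge; the corners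
   are negligible. *)
Definition theta (eps : R) (x : R * R) : R :=
  if x.2 == 1 then
    if eps == 0 then
      pi^-1 * \int[@lebesgue_measure R]_(y in `[0, pi])
                 Num.sqrt (1 + cos y ^+ 2)
    else Num.sqrt (1 + cos (x.1 / eps) ^+ 2)
  else if x.1 == 1 then
    if eps == 0 then 1 else 1 + derive1 (phi^~ eps) x.2 * sin (1 / eps)
  else 1.

(* The functions phi^~ eps are C^2 on [0, 1]; as such a function extends to a
   C^2 function on the line, they are taken to be C^2 on the line, all other
   conditions bearing on [0, 1] only.  No regularity in eps is required. *)
Record perturbation (eps1 : R) : Prop := {
  pert_gt0 : 0 < eps1;
  pert_C2 : forall eps : R, 0 < eps <= eps1 -> Ck1 2 (phi^~ eps);
  pert_0 : forall eps : R, 0 < eps <= eps1 -> phi 0 eps = 0;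
  pert_1 : forall eps : R, 0 < eps <= eps1 -> phi 1 eps = eps;
  pert_deriv : forall d : R, 0 < d -> \forall eps \near (0 : R)^'+,
    forall x2 : R, 0 <= x2 <= 1 -> `|derive1 (phi^~ eps) x2| <= d;
  pert_L2 : ('N[lebO R]_(2%:E)[EFin \o (fun x => phi x.2 eps ^+ 2 / eps ^+ 2)%R]
               @[eps --> (0 : R)^'+] --> 0)%E;
  pert_bounded : exists C : R, forall eps x2 : R, 0 < eps <= eps1 -> 0 <= x2 <= 1 ->
    `|phi x2 eps / eps| <= C;
  pert_diffeo : forall eps : R, 0 < eps <= eps1 ->
    diffeomorphism_on (Omega R) (hmap eps) }.

Variable a : R.

(* The identification of u with an element of a dual space. *)
Definition pairing (eps : R) (u psi : R * R -> R) : R :=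
  \int[lebO R]_x (u x * psi x * `|Jh eps x|).

(* The pairing of A_eps u in H^{-1} with psi in H^1. *)
Definition Aop (eps : R) (u psi : R * R -> R) : R :=
  \int[lebO R]_x
     (((grad_eps eps u x)^T *m grad_eps eps psi x) 0 0 * `|Jh eps x|)
  + a * pairing eps u psi.

Definition is_resolvent (eps lam : R) (w v : R * R -> R) : Prop :=
  H1 v /\ forall psi, H1 psi ->
    Aop eps v psi + lam * pairing eps v psi = pairing eps w psi.

Definition resolvent (eps lam : R) (w : R * R -> R) : R * R -> R :=
  xget (cst 0) [set v | is_resolvent eps lam w v].

(* v = A_eps^{-s} w in L2(Omega) for 0 < s < 1, by the formula
     A^{-s} = sin (pi s) / pi * int_0^oo lam^{-s} (lam + A)^{-1} dlam
   (Balakrishnan, Kato), the integral being understood weakly. *)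
Definition is_negpow (eps s : R) (w v : R * R -> R) : Prop :=
  [/\ L2fun (lebO R) w, L2fun (lebO R) v &
      forall psi, L2fun (lebO R) psi ->
        pairing eps v psi =
        sin (pi * s) / pi *
        \int[@lebesgue_measure R]_(lam in `]0, +oo[)
           (lam `^ (- s) * pairing eps (resolvent eps lam w) psi)].

(* X_eps^s, for 0 < s < 1: the domain of A_eps^s, that is the range of
   A_eps^{-s}, with the norm of A_eps^s u in L2(Omega).  With the exponents
   below, eta, beta + 1 and - beta lie strictly between 0 and 1. *)
Definition Xspace (eps s : R) (u : R * R -> R) : Prop :=
  exists w, is_negpow eps s w u.

Definition Apow (eps s : R) (u : R * R -> R) : R * R -> R :=
  xget (cst 0) [set w | is_negpow eps s w u].

Definition Xnorm (eps s : R) (u : R * R -> R) : R :=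
  L2norm (lebO R) (Apow eps s u).

(* X^beta for -1/2 <= beta < 0, as the dual of X^{-beta}, where X = X_0.  Only
   the values of G on X^{-beta} matter. *)
Definition dual_bounded (beta C : R) (G : (R * R -> R) -> R) : Prop :=
  forall psi, Xspace 0 (- beta) psi -> `|G psi| <= C * Xnorm 0 (- beta) psi.

Definition Xdual (beta : R) (G : (R * R -> R) -> R) : Prop :=
  (forall c psi1 psi2, Xspace 0 (- beta) psi1 -> Xspace 0 (- beta) psi2 ->
     G (fun x => c * psi1 x + psi2 x) = c * G psi1 + G psi2) /\
  exists C : R, dual_bounded beta C G.

(* G = (A_eps)_beta u: G belongs to X^beta and, as an element of H^{-1}, that is
   on H^1, it is A_eps u. *)
Definition is_Abeta (eps beta : R) (u : R * R -> R) (G : (R * R -> R) -> R)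
    : Prop :=
  [/\ H1 u, Xdual beta G & forall psi, H1 psi -> G psi = Aop eps u psi].

(* The trace operator: the extension by continuity of the restriction to the
   boundary of functions that are smooth up to the boundary.  It is continuous
   from X^s to L2(boundary) for 1/4 < s <= 1/2 (X^{1/2} being H^1), and these
   extensions are compatible since the spaces X^s decrease with s. *)
Definition is_trace (u v : R * R -> R) : Prop :=
  L2fun (sigma R) v /\
  exists2 s : R, 1 / 4 < s <= 1 / 2 & Xspace 0 s u /\
  exists un : nat -> R * R -> R,
    [/\ forall n, smooth2 (un n),
        forall n, Xspace 0 s (un n),
        Xnorm 0 s (fun x => un n x - u x) @[n --> \oo] --> 0 &
        L2norm (sigma R) (fun x => un n x - v x) @[n --> \oo] --> 0].

Definition trace (u : R * R -> R) : R * R -> R :=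
  xget (cst 0) [set v | is_trace u v].

Variables f g : R -> R.

(* The pairing of (H_eps)_beta (u) in X^beta with psi in X^{-beta}. *)
Definition Hop (eps : R) (u psi : R * R -> R) : R :=
  \int[lebO R]_x (f (u x) * psi x * `|Jh eps x|) +
  \int[sigma R]_x (g (trace u x) * trace psi x * theta eps x).

Definition is_derive_dual (eps beta : R) (u : R -> R * R -> R) (t : R)
    (du : (R * R -> R) -> R) : Prop :=
  Xdual beta du /\
  forall d : R, 0 < d -> \forall s \near (0 : R)^',
    dual_bounded beta d
      (fun psi => s^-1 * pairing eps (fun x => u (t + s) x - u t x) psi
                  - du psi).

Definition local_solution (beta eta eps t0 t1 : R) (u0 : R * R -> R)
    (u : R -> R * R -> R) : Prop :=
  [/\ forall t : R, t0 <= t < t1 -> Xspace eps eta (u t),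
      forall t : R, t0 <= t < t1 ->
        Xnorm eps eta (fun x => u s x - u t x)
          @[s --> within `[t0, t1[%classic (nbhs t)] --> 0,
      u t0 = u0 %[ae lebO R] &
      forall t : R, t0 < t < t1 ->
        Xspace eps (beta + 1) (u t) /\
        exists du Au,
          [/\ is_derive_dual eps beta u t du,
              is_Abeta eps beta (u t) Au &
              forall psi, Xspace 0 (- beta) psi ->
                du psi + Au psi = Hop eps (u t) psi]].

End Perturbation.

Section Conditions.
Variable R : realType.

Record growth_conditions (f g : R -> R) (lam1 lam2 L1 L2 : R) : Prop := {
  growth_f_C1 : Ck1 1 f;
  growth_g_C2 : Ck1 2 g;
  growth_pos : [/\ 0 < lam1, 0 < lam2, 0 < L1 & 0 < L2];
  growth_f : forall u1 u2 : R, `|f u1 - f u2| <=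
    L1 * (1 + `|u1| `^ lam1 + `|u2| `^ lam1) * `|u1 - u2|;
  growth_g : forall u1 u2 : R, `|g u1 - g u2| <=
    L2 * (1 + `|u1| `^ lam2 + `|u2| `^ lam2) * `|u1 - u2| }.

Definition conjugate_exponents (p q : R) : Prop :=
  [/\ 1 < p, 1 < q & p^-1 + q^-1 = 1].

Definition admissible (lam1 lam2 beta eta : R) : Prop :=
  - (1 / 2) <= beta < - (1 / 4) /\
  exists p1 q1 p2 q2 : R,
    [/\ conjugate_exponents p1 q1, conjugate_exponents p2 q2,
        1 / lam1 < p1, 1 / (2 * lam2) < p2 &
        foldr Num.max (1 / 2 - 1 / (2 * (lam1 + 1)))
          [:: 1 / 2 - 1 / (2 * p1 * lam1);
              1 / 2 - 1 / (2 * q1);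
              1 / 2 - 1 / (4 * (lam2 + 1));
              1 / 2 - 1 / (4 * p2 * lam2);
              1 / 2 - 1 / (4 * q2)] < eta < beta + 1].

End Conditions.

(* Main.v *)
From HB Require Import structures.
Require Import Defs.
From mathcomp Require Import all_boot all_order all_algebra.
From mathcomp Require Import all_classical all_reals all_analysis.
From mathcomp Require Import measurable_realfun ring lra.

(** The equation is solved in coordinates.  For each [eps] the form of [A_eps] has an
    orthonormal basis of eigenfunctions [e_k] with eigenvalues [nu_k] ([formA_basis]): the
    form is comparable with the one for [eps = 0], which the cosines diagonalise explicitly
    ([cos_eigenbasis]), so that it inherits compactness, and eigenfunctions are obtained by
    minimising Rayleigh quotients ([eigenbasis_ex]).  A function lies in [X_eps^s] exactly when
    the sequence [nu_k^s c_k] of its weighted coefficients is square summable, with comparable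
    norms ([XspaceP]).  For [0 < s <= 1/2] these spaces do not depend on [eps], by the
    Loewner-Heinz inequality ([heinz], [spaces_agree]).

    The nonlinearity is locally Lipschitz from [X_eps^eta] to the dual of [X^s'] for some
    [s'] strictly between [1/4] and [- beta] ([Hc_lip]).  Indeed [X^s] embeds into [L^p] of the
    square when [2 s > 1 - 2 / p], and traces are in [L^p] of the boundary when
    [2 s > 1 - 1 / p] ([Lp_lebO], [tr_Lp]).  Both follow from one dyadic estimate for cosine
    sums ([Lp_comb]): a block of frequencies of size [N] is bounded through its supremum, which
    costs a factor [N], and its [L^2] norm on the square or on an edge, which costs [1] or
    [N^(1/2)].  With [p = 2 (lam + 1)] the growth conditions make [f(u) - f(v)] and
    [g(u) - g(v)] square integrable ([nem_lip]), and admissibility of [(beta, eta)] gives the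
    conditions on the exponents.

    In coordinates the problem is a diagonal system with a nonlinearity from weight [eta] to
    weight [- s'], and [eta + s' < 1].  The kernel [(t - r)^(-(eta + s'))] of Duhamel's formula
    is integrable, so a contraction yields a solution on a short interval ([fixpoint_ex]).
    Since also [beta + 1 + s' < 1], the solution takes values in [X_eps^(beta + 1)] for
    positive times and is differentiable with values in [X^beta] ([sol_reg], [sol_diff]).
    Conversely, testing a local solution with the eigenfunctions shows that its coordinates
    solve the system ([solution_coords]), where a Gronwall argument, in the form of a repeated
    halving of the difference, gives uniqueness ([uniq_global]).  The same statements hold for
    all small [eps]: smallness only serves to keep [Jh_eps] away from [0] ([mild]). *)

Set Implicit Arguments.
Unset Strict Implicit.
Unset Printing Implicit Defensive.

Import Order.TTheory GRing.Theory Num.Theory.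
Import numFieldNormedType.Exports.

Local Open Scope classical_set_scope.
Local Open Scope ring_scope.


(** * Semi-inner products and eigenbases *)

Section PartialSums.
Variables (V : nmodType) (R : realType).

Lemma sum_split (a : nat -> V) m n : (m <= n)%N ->
  \sum_(k < n) a k = \sum_(k < m) a k + \sum_(k < n - m) a (m + k)%N.
Proof. by move=> mn; rewrite -[in LHS](subnKC mn) big_split_ord. Qed.

Lemma ler_sum_widen (a : nat -> R) m n : (forall k, 0 <= a k) -> (m <= n)%N ->
  \sum_(k < m) a k <= \sum_(k < n) a k.
Proof.
move=> a0 mn; rewrite -(subnKC mn) big_split_ord/= lerDl sumr_ge0// => i _.
Qed.

Lemma filter_forall_ltn (T : Type) (F : set_system T) (P : nat -> T -> Prop) N :
  Filter F -> (forall k, \forall x \near F, P k x) ->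
  \forall x \near F, forall k, (k < N)%N -> P k x.
Proof.
move=> FF h; elim: N => [|N IH]; first exact: nearW.
apply: filterS2 IH (h N) => x h1 h2 k; rewrite ltnS leq_eqVlt => /predU1P[->//|].
exact: h1.
Qed.

End PartialSums.

Section SemiInner.
Variables (R : realType) (V : lmodType R).
Implicit Types (D : V -> Prop) (b : V -> V -> R).

Record semiip D b : Prop := SemiIp {
  sip0 : D 0;
  sipL : forall c u v, D u -> D v -> D (c *: u + v);
  sip_lin : forall c u v w, D u -> D v -> D w ->
    b (c *: u + v) w = c * b u w + b v w;
  sip_sym : forall u v, D u -> D v -> b u v = b v u;
  sip_ge0 : forall u, D u -> 0 <= b u u }.

Definition sconv b (u : nat -> V) (v : V) : Prop := forall e : R, 0 < e ->
  exists N, forall n, (N <= n)%N -> b (u n - v) (u n - v) < e.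

Definition scauchy b (u : nat -> V) : Prop := forall e : R, 0 < e ->
  exists N, forall n m, (N <= n)%N -> (N <= m)%N -> b (u n - u m) (u n - u m) < e.

Definition scomplete D b : Prop := forall u, (forall n, D (u n)) -> scauchy b u ->
  exists2 v, D v & sconv b u v.

Section Theory.
Variables (D : V -> Prop) (b : V -> V -> R).
Hypothesis S : semiip D b.

Lemma sipZ c u : D u -> D (c *: u).
Proof. by move=> Du; rewrite -[_ *: _]addr0; apply: (sipL S) => //; exact: sip0 S. Qed.

Lemma sipD u v : D u -> D v -> D (u + v).
Proof. by move=> Du Dv; rewrite -[u]scale1r; exact: (sipL S). Qed.

Lemma sipN u : D u -> D (- u).
Proof. by rewrite -scaleN1r; exact: sipZ. Qed.

Lemma sipB u v : D u -> D v -> D (u - v).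
Proof. by move=> Du Dv; apply: sipD => //; exact: sipN. Qed.

Lemma sip_sum (I : Type) (r : seq I) (P : pred I) (F : I -> V) :
  (forall i, P i -> D (F i)) -> D (\sum_(i <- r | P i) F i).
Proof. by move=> h; apply: (big_ind D) => //; [exact: sip0 S|exact: sipD]. Qed.

Hint Resolve sipZ sipD sipN sipB : core.

Lemma bDl u v w : D u -> D v -> D w -> b (u + v) w = b u w + b v w.
Proof. by move=> *; rewrite -[u in LHS]scale1r (sip_lin S)// mul1r. Qed.

Lemma b0l w : D w -> b 0 w = 0.
Proof.
move=> Dw; have D0 := sip0 S.
by have := bDl D0 D0 Dw; rewrite addr0 => /eqP; rewrite -subr_eq0 opprD addrA subrr add0r oppr_eq0 => /eqP.
Qed.

Lemma bZl c u w : D u -> D w -> b (c *: u) w = c * b u w.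
Proof.
move=> Du Dw; rewrite -[_ *: _]addr0 (sip_lin S)//; last exact: sip0 S.
by rewrite b0l// addr0.
Qed.

Lemma bNl u w : D u -> D w -> b (- u) w = - b u w.
Proof. by move=> *; rewrite -scaleN1r bZl// mulN1r. Qed.

Lemma bBl u v w : D u -> D v -> D w -> b (u - v) w = b u w - b v w.
Proof. by move=> *; rewrite bDl ?bNl//; exact: sipN. Qed.

Lemma b_suml (I : Type) (r : seq I) (F : I -> V) w :
  (forall i, D (F i)) -> D w -> b (\sum_(i <- r) F i) w = \sum_(i <- r) b (F i) w.
Proof.
move=> DF Dw; elim: r => [|i r IH]; first by rewrite !big_nil b0l.
by rewrite !big_cons bDl ?IH//; exact: sip_sum.
Qed.

Lemma bDr u v w : D u -> D v -> D w -> b w (u + v) = b w u + b w v.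
Proof. by move=> *; rewrite (sip_sym S) ?bDl ?[b _ w](sip_sym S)//; exact: sipD. Qed.

Lemma bZr c u w : D u -> D w -> b w (c *: u) = c * b w u.
Proof. by move=> *; rewrite (sip_sym S) ?bZl ?[b _ w](sip_sym S)//; exact: sipZ. Qed.

Lemma bNr u w : D u -> D w -> b w (- u) = - b w u.
Proof. by move=> *; rewrite -scaleN1r bZr// mulN1r. Qed.

Lemma b_sumr (I : Type) (r : seq I) (F : I -> V) w :
  (forall i, D (F i)) -> D w -> b w (\sum_(i <- r) F i) = \sum_(i <- r) b w (F i).
Proof.
move=> DF Dw; rewrite (sip_sym S)//; last exact: sip_sum.
by rewrite b_suml//; apply: eq_bigr => i _; exact: (sip_sym S).
Qed.

Lemma bDD u v : D u -> D v -> b (u + v) (u + v) = b u u + 2 * b u v + b v v.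
Proof.
move=> Du Dv; rewrite bDl ?bDr//; last exact: sipD.
by rewrite (sip_sym S Dv Du); ring.
Qed.

Lemma bBB u v : D u -> D v -> b (u - v) (u - v) = b u u - 2 * b u v + b v v.
Proof.
move=> Du Dv; rewrite bDD ?bNr ?bNl ?bNr//; [by ring|exact: sipN..].
Qed.

Lemma bBBC u v : D u -> D v -> b (u - v) (u - v) = b (v - u) (v - u).
Proof. by move=> Du Dv; rewrite !bBB// (sip_sym S Du Dv); ring. Qed.

Lemma CS u v : D u -> D v -> b u v ^+ 2 <= b u u * b v v.
Proof.
move=> Du Dv; have hv := sip_ge0 S Dv; have hu := sip_ge0 S Du.
have key t : 0 <= b u u + 2 * t * b u v + t ^+ 2 * b v v.
  have := sip_ge0 S (sipD Du (sipZ t Dv)).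
  by rewrite bDD// ?bZr// ?bZl//; [lra|exact: sipZ..].
have [v0|v0] := eqVneq (b v v) 0.
  have [->|uv0] := eqVneq (b u v) 0; first by rewrite expr0n/= mulr_ge0.
  have := key (- (b u u + 1) / (2 * b u v)).
  rewrite v0 mulr0 addr0.
  have -> : b u u + 2 * (- (b u u + 1) / (2 * b u v)) * b u v = -1 by field.
  by rewrite lerNr oppr0 => /le_lt_trans/(_ ltr01); rewrite ltxx.
have vp : 0 < b v v by rewrite lt_neqAle eq_sym v0.
have := key (- b u v / b v v).
have -> : b u u + 2 * (- b u v / b v v) * b u v + (- b u v / b v v) ^+ 2 * b v v
    = (b u u * b v v - b u v ^+ 2) / b v v by field.
by rewrite pmulr_lge0 ?invr_gt0// subr_ge0.
Qed.

Lemma bD2 u v : D u -> D v -> b (u + v) (u + v) <= 2 * b u u + 2 * b v v.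
Proof.
move=> Du Dv; have := sip_ge0 S (sipB Du Dv).
by rewrite bBB// bDD//; lra.
Qed.

Lemma bB2 u v : D u -> D v -> b (u - v) (u - v) <= 2 * b u u + 2 * b v v.
Proof.
move=> Du Dv; have := sip_ge0 S (sipD Du Dv).
by rewrite bBB// bDD//; lra.
Qed.

Lemma b_tri u v w : D u -> D v -> D w ->
  b (u - w) (u - w) <= 2 * b (u - v) (u - v) + 2 * b (v - w) (v - w).
Proof.
move=> Du Dv Dw; have -> : u - w = (u - v) + (v - w) by rewrite addrA subrK.
by apply: bD2; exact: sipB.
Qed.

Lemma sconv_cauchy u v : (forall n, D (u n)) -> D v -> sconv b u v -> scauchy b u.
Proof.
move=> Du Dv uv e e0; have [|N hN] := uv (e / 4); first by rewrite divr_gt0.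
exists N => n m nN mN; apply: le_lt_trans (b_tri (Du n) Dv (Du m)) _.
by have := hN _ nN; have := hN _ mN; rewrite (bBBC (Du m) Dv); lra.
Qed.


Lemma sconv_normB u v w e : D u -> D v -> D w -> 0 < e ->
  b (u - v) (u - v) < e ^+ 2 / (b w w + 1) -> `|b u w - b v w| < e.
Proof.
move=> Du Dv Dw e0; have wp : 0 < b w w + 1 by rewrite ltr_wpDl// (sip_ge0 S).
have := CS (sipB Du Dv) Dw; rewrite ltr_pdivlMr// => h2 h1.
rewrite -bBl// -ltr_sqr ?nnegrE// ?(ltW e0)// real_normK ?num_real//.
have := sip_ge0 S (sipB Du Dv); have := sip_ge0 S Dw.
by nra.
Qed.

Lemma sconv_ip u v w : (forall n, D (u n)) -> D v -> D w -> sconv b u v ->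
  b (u n) w @[n --> \oo] --> b v w.
Proof.
move=> Du Dv Dw uv; apply/cvgrPdist_lt => e e0.
have wp : 0 < b w w + 1 by rewrite ltr_wpDl// (sip_ge0 S).
have [|N hN] := uv (e ^+ 2 / (b w w + 1)); first by rewrite divr_gt0 ?exprn_gt0.
near=> n; rewrite distrC; apply: sconv_normB => //; apply: hN.
by near: n; exact: nbhs_infty_ge.
Unshelve. all: by end_near. Qed.

Lemma sconv_norm2 u v : (forall n, D (u n)) -> D v -> sconv b u v ->
  b (u n) (u n) @[n --> \oo] --> b v v.
Proof.
move=> Du Dv uv.
have -> : (fun n => b (u n) (u n)) =
    (fun n => b (u n - v) (u n - v) + 2 * b (u n) v - b v v).
  by apply/funext => n; rewrite bBB//; ring.
have h0 : b (u n - v) (u n - v) @[n --> \oo] --> 0.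
  apply/cvgrPdist_lt => e e0; have [N hN] := uv _ e0.
  near=> n; rewrite sub0r normrN ger0_norm ?(sip_ge0 S)//; last exact: sipB.
  by apply: hN; near: n; exact: nbhs_infty_ge.
rewrite [X in _ --> X](_ : _ = 0 + 2 * b v v - b v v); last by ring.
have c2 : (fun=> 2 : R) @ \oo --> (2 : R) by exact: cvg_cst.
have cv : (fun=> b v v) @ \oo --> b v v by exact: cvg_cst.
exact: cvgB (cvgD h0 (cvgM c2 (sconv_ip Du Dv Dv uv))) cv.
Unshelve. all: by end_near. Qed.

Lemma sconv_null u v w : (forall n, D (u n)) -> D v -> D w -> sconv b u v ->
  sconv b u w -> b (v - w) (v - w) = 0.
Proof.
move=> Du Dv Dw uv uw; apply/le_anti; rewrite (sip_ge0 S (sipB Dv Dw)) andbT.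
apply/ler_addgt0Pr => e e0; rewrite add0r.
have [|N hN] := uv (e / 4); first by rewrite divr_gt0.
have [|M hM] := uw (e / 4); first by rewrite divr_gt0.
have := hN (maxn N M); have := hM (maxn N M); rewrite leq_maxl leq_maxr => /(_ isT) h1 /(_ isT) h2.
apply: le_trans (b_tri Dv (Du (maxn N M)) Dw) _.
by rewrite (bBBC Dv)//; lra.
Qed.

End Theory.

(** ** Orthonormal families *)

Section Orthonormal.
Variables (D : V -> Prop) (b : V -> V -> R).
Hypothesis S : semiip D b.
Variable e : nat -> V.
Hypothesis De : forall k, D (e k).
Hypothesis oe : forall j k, b (e j) (e k) = (j == k)%:R.

Definition comb (c : nat -> R) (K : nat) : V := \sum_(k < K) c k *: e k.

Lemma D_comb c K : D (comb c K).
Proof. by apply: (sip_sum S) => i _; exact: (sipZ S). Qed.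
Hint Resolve D_comb : core.

Lemma comb_coef c K j : b (comb c K) (e j) = if (j < K)%N then c j else 0.
Proof.
rewrite /comb (b_suml S)//; last by move=> i; exact: (sipZ S).
under eq_bigr do rewrite (bZl S)// oe.
have [jK|jK] := ltnP j K.
  rewrite (bigD1 (Ordinal jK))//= eqxx mulr1 big1 ?addr0// => i /negbTE.
  by rewrite -val_eqE /= => ->; rewrite mulr0.
rewrite big1// => i _; have := ltn_ord i; case: eqP => [->|]; last by rewrite mulr0.
by rewrite ltnNge jK.
Qed.

Lemma comb_norm c K : b (comb c K) (comb c K) = \sum_(k < K) c k ^+ 2.
Proof.
rewrite {2}/comb (b_sumr S)//; last by move=> i; exact: (sipZ S).
by apply: eq_bigr => i _; rewrite (bZr S)// comb_coef ltn_ord expr2.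
Qed.

Lemma comb_dist u c K : D u ->
  b (u - comb c K) (u - comb c K) =
  b u u - \sum_(k < K) b u (e k) ^+ 2 + \sum_(k < K) (b u (e k) - c k) ^+ 2.
Proof.
move=> Du; rewrite (bBB S)// comb_norm.
rewrite {1}/comb (b_sumr S)//; last by move=> i; exact: (sipZ S).
under eq_bigr do rewrite (bZr S)//.
rewrite -!addrA; congr (_ + _); rewrite mulr_sumr -!sumrN -!big_split/=.
by apply: eq_bigr => i _; ring.
Qed.

Lemma bessel u K : D u -> \sum_(k < K) b u (e k) ^+ 2 <= b u u.
Proof.
move=> Du; have := sip_ge0 S (sipB S Du (D_comb (fun k => b u (e k)) K)).
rewrite comb_dist// [X in _ + X]big1 ?addr0 ?subr_ge0// => i _.
by rewrite subrr expr0n.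
Qed.

Lemma comb_sub c K L : (K <= L)%N ->
  b (comb c L - comb c K) (comb c L - comb c K) =
  \sum_(k < L) c k ^+ 2 - \sum_(k < K) c k ^+ 2.
Proof.
move=> KL; rewrite comb_dist// comb_norm.
rewrite [X in _ + X]big1 ?addr0; last first.
  by move=> i _; rewrite comb_coef (leq_trans _ KL)// subrr expr0n.
congr (_ - _); apply: eq_bigr => i _.
by rewrite comb_coef (leq_trans _ KL).
Qed.

Lemma series_cauchy (a : nat -> R) (M : R) : (forall k, 0 <= a k) ->
  (forall K, \sum_(k < K) a k <= M) -> forall d, 0 < d -> exists N, forall K L,
  (N <= K)%N -> (K <= L)%N -> \sum_(k < L) a k - \sum_(k < K) a k < d.
Proof.
move=> a0 aM d d0.
have nd : {homo (fun K => \sum_(k < K) a k) : m n / (m <= n)%N >-> m <= n}.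
  move=> m n mn; rewrite -(subnKC mn) big_split_ord/= lerDl sumr_ge0//.
have cv : cvgn (fun K => \sum_(k < K) a k).
  by apply: nondecreasing_is_cvgn => //; exists M => _ [n _ <-].
have := cv => /cvgrPdist_lt/(_ _ d0)[N _ hN].
exists N => K L NK KL.
have hL := nondecreasing_cvgn_le nd cv L.
have /= := hN _ NK; rewrite ger0_norm ?subr_ge0 ?(nondecreasing_cvgn_le nd cv)//.
by lra.
Qed.

Hypothesis Cb : scomplete D b.

(** Riesz-Fischer. *)
Lemma riesz_fischer (c : nat -> R) (M : R) : (forall K, \sum_(k < K) c k ^+ 2 <= M) ->
  exists u, [/\ D u, forall k, b u (e k) = c k & sconv b (comb c) u].
Proof.
move=> cM.
have ca : scauchy b (comb c).
  move=> d d0; have [N hN] := series_cauchy (fun k => sqr_ge0 (c k)) cM d0.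
  exists N => n m; wlog nm : n m / (m <= n)%N.
    move=> h nN mN; have [nm|/ltnW nm] := leqP m n; first exact: h.
    by rewrite (bBBC S)//; exact: h.
  by move=> _ mN; rewrite comb_sub//; exact: hN.
have [u Du cu] := Cb (D_comb c) ca.
exists u; split => // k.
apply: cvg_unique (sconv_ip S (D_comb c) Du (De k) cu) _ => //.
apply/cvgrPdist_lt => d d0; near=> n; rewrite comb_coef ifT ?subrr ?normr0//.
by near: n; exact: nbhs_infty_gt.
Unshelve. all: by end_near. Qed.

Hypothesis total : forall u, D u -> (forall k, b u (e k) = 0) -> b u u = 0.

Lemma parseval u : D u -> sconv b (comb (fun k => b u (e k))) u.
Proof.
move=> Du; have [v [Dv vc cv]] :=
  riesz_fischer (c := fun k => b u (e k)) (fun K => bessel K Du).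
have n0 : b (v - u) (v - u) = 0.
  by apply: total => [|k]; [exact: (sipB S)|rewrite (bBl S)// vc subrr].
move=> d d0; have [|N hN] := cv (d / 2); first by rewrite divr_gt0.
exists N => n nN; apply: le_lt_trans (b_tri S (D_comb _ n) Dv Du) _.
by rewrite n0 mulr0 addr0; have := hN _ nN; lra.
Qed.

Lemma parseval_norm u M : D u -> (forall K, \sum_(k < K) b u (e k) ^+ 2 <= M) -> b u u <= M.
Proof.
move=> Du uM; have := sconv_norm2 S (D_comb _) Du (parseval Du).
under eq_fun do rewrite comb_norm.
by move=> /cvgr_to_le; apply; apply: nearW.
Qed.

End Orthonormal.
End SemiInner.

(** * Semilinear parabolic equations in a diagonal system *)

Section Calculus.
Variable R : realType.
Implicit Types (f g : R -> R) (x a b c M : R).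

Lemma derD f g x df dg : is_derive x 1 f df -> is_derive x 1 g dg ->
  is_derive x 1 (fun t => f t + g t) (df + dg).
Proof. by move=> h1 h2; exact: is_deriveD. Qed.

Lemma derM f g x df dg : is_derive x 1 f df -> is_derive x 1 g dg ->
  is_derive x 1 (fun t => f t * g t) (df * g x + f x * dg).
Proof.
by move=> h1 h2; apply: is_derive_eq; rewrite /= addrC [_ *: df]mulrC.
Qed.

Lemma derC x c : is_derive x 1 (fun _ : R => c) 0.
Proof. exact: is_derive_cst. Qed.

Lemma derZ f x df c : is_derive x 1 f df -> is_derive x 1 (fun t => c * f t) (c * df).
Proof. by move=> h; have := derM (derC x c) h; rewrite mul0r add0r. Qed.

Lemma derB f g x df dg : is_derive x 1 f df -> is_derive x 1 g dg ->
  is_derive x 1 (fun t => f t - g t) (df - dg).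
Proof. by move=> h1 h2; exact: is_deriveB. Qed.

Lemma derid x : is_derive x 1 (fun t : R => t) 1.
Proof. exact: is_derive_id. Qed.

Lemma der_comp f g x df dg : is_derive (g x) 1 f df -> is_derive x 1 g dg ->
  is_derive x 1 (fun t => f (g t)) (df * dg).
Proof. by move=> h1 h2; exact: is_derive1_comp. Qed.

Lemma der_exp c x : is_derive x 1 (fun t => expR (c * t)) (c * expR (c * x)).
Proof.
have := der_comp (is_derive_expR (c * x)) (derZ c (derid x)).
by rewrite mulr1 mulrC.
Qed.

Lemma der_sum n (F : 'I_n -> R -> R) x (dF : 'I_n -> R) :
  (forall i, is_derive x 1 (F i) (dF i)) ->
  is_derive x 1 (fun t => \sum_(i < n) F i t) (\sum_(i < n) dF i).
Proof.
elim: n F dF => [|n IH] F dF h.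
  rewrite big_ord0 (_ : (fun _ => _) = fun=> 0); first exact: derC.
  by apply/funext => t; rewrite big_ord0.
rewrite big_ord_recr/= (_ : (fun _ => _) = fun t =>
  \sum_(i < n) F (widen_ord (leqnSn n) i) t + F ord_max t).
  by apply: derD => //; apply: IH.
by apply/funext => t; rewrite big_ord_recr.
Qed.

Lemma der_cont f x df : is_derive x 1 f df -> {for x, continuous f}.
Proof. by move=> [h _]; apply: differentiable_continuous; apply/derivable1_diffP. Qed.

Lemma cont_within f a b : (forall x, a <= x <= b -> {for x, continuous f}) ->
  {within `[a, b], continuous f}.
Proof.
by move=> h; apply: continuous_in_subspaceT => x; rewrite inE/= in_itv/= => /h.
Qed.

Lemma mvt_le f (df : R -> R) a b M : a <= b -> {within `[a, b], continuous f} ->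
  (forall x, a < x < b -> is_derive x 1 f (df x)) ->
  (forall x, a < x < b -> df x <= M) -> f b - f a <= M * (b - a).
Proof.
rewrite le_eqVlt => /predU1P[->|ab] cf hf hM; first by rewrite !subrr mulr0.
have hf' x : x \in `]a, b[ -> is_derive x 1 f (df x).
  by move=> xab; apply: hf; rewrite in_itv/= in xab.
have [x xab ->] := MVT ab hf' cf.
by rewrite ler_wpM2r ?subr_ge0 ?(ltW ab)// hM//; rewrite in_itv/= in xab.
Qed.

Lemma mvt_norm f (df : R -> R) a b M : a <= b -> {within `[a, b], continuous f} ->
  (forall x, a < x < b -> is_derive x 1 f (df x)) ->
  (forall x, a < x < b -> `|df x| <= M) -> `|f b - f a| <= M * (b - a).
Proof.
move=> ab cf hf hM; rewrite ler_norml; apply/andP; split; last first.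
  by apply: mvt_le hf _ => // x /hM; exact: le_trans (ler_norm _).
have cg : {within `[a, b], continuous (fun x => - f x)}.
  by move=> x; apply: continuousN; exact: cf.
have hg x : a < x < b -> is_derive x 1 (fun x => - f x) (- df x).
  by move=> /hf h; have := derZ (-1) h; rewrite mulN1r; under eq_fun do rewrite mulN1r.
have := @mvt_le _ _ a b M ab cg hg; rewrite opprK => h.
have : - f b + f a <= M * (b - a).
  by apply: h => x /hM; apply: le_trans; rewrite -normrN ler_norm.
by lra.
Qed.

Lemma primitive_ex (h : R -> R) a : continuous h ->
  exists P : R -> R, forall x, a < x -> is_derive x 1 P (h x).
Proof.
move=> ch; exists (fun x => \int[lebesgue_measure]_(t in `[a, x]) h t) => x ax.
have [] := @continuous_FTC1_closed _ h a x (x + 1) _ _ ax (ch x).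
- by rewrite ltrDl.
- apply: continuous_compact_integrable; first exact: segment_compact.
  exact: continuous_subspaceT.
by move=> h1 h2; apply: DeriveDef; [exact: h1|rewrite -derive1E; exact: h2].
Qed.

End Calculus.

Section Weights.
Variable R : realType.
Implicit Types (x r s M N : R).

Lemma powR1x r : (1 : R) `^ r = 1.
Proof. by rewrite powR1. Qed.

Lemma powR_le_exp x r : 0 <= x -> 0 <= r <= 1 -> x `^ r <= expR x.
Proof.
move=> x0 /andP[r0 r1].
have [x1|x1] := leP x 1.
  apply: le_trans (_ : 1 <= _); last by apply: le_trans (expR_ge1Dx x); rewrite lerDl.
  by rewrite -(powR1x r) ge0_ler_powR ?nnegrE.
apply: le_trans (_ : x <= _).
  by rewrite -{2}(powRr1 x0) ler_powR// ltW.
by apply: le_trans (expR_ge1Dx x); rewrite lerDr.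
Qed.

Lemma onem_exp_le x r : 0 <= x -> 0 <= r <= 1 -> 1 - expR (- x) <= x `^ r.
Proof.
move=> x0 /andP[r0 r1].
have [x1|x1] := leP x 1.
  apply: le_trans (_ : x <= _); first by have := expR_ge1Dx (- x); lra.
  have [->|xn] := eqVneq x 0; first exact: powR_ge0.
  by apply: ger1_powR => //; rewrite x1 andbT lt_neqAle eq_sym xn x0.
apply: le_trans (_ : 1 <= _); first by have := expR_gt0 (- x); lra.
by rewrite -[leLHS](powR1x r) ge0_ler_powR// ?nnegrE// ltW.
Qed.

Lemma powR_expN x t r : 0 < x -> 0 < t -> 0 <= r <= 1 ->
  x `^ r * expR (- (x * t)) <= t `^ (- r).
Proof.
move=> x0 t0 r01.
rewrite expRN ler_pdivrMr ?expR_gt0// -ler_pdivrMl ?powR_gt0// -powRN opprK.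
rewrite -powRM ?(ltW x0) ?(ltW t0)//.
by rewrite mulrC; apply: powR_le_exp => //; rewrite mulr_ge0 ?ltW.
Qed.

Implicit Types (a b d : nat -> R).

Definition bl2 (a : nat -> R) (M : R) : Prop := forall K, \sum_(k < K) a k ^+ 2 <= M ^+ 2.

Lemma bl2_pair a M K (d : nat -> R) : 0 <= M -> bl2 a M ->
  \sum_(k < K) d k ^+ 2 <= 1 -> \sum_(k < K) a k * d k <= M.
Proof.
move=> M0 aM d1; set s := (X in X <= _).
have h : 0 <= \sum_(k < K) (a k - s * d k) ^+ 2 by apply: sumr_ge0 => i _; exact: sqr_ge0.
have e t : \sum_(k < K) (a k - t * d k) ^+ 2 =
    \sum_(k < K) a k ^+ 2 - 2 * t * (\sum_(k < K) a k * d k) + t ^+ 2 * \sum_(k < K) d k ^+ 2.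
  by rewrite !mulr_sumr -sumrB -big_split/=; apply: eq_bigr => i _; ring.
have := aM K; move: h; rewrite e -/s.
by move: (\sum_(k < K) a k ^+ 2) (\sum_(k < K) d k ^+ 2) d1 => p q; nra.
Qed.

(** Testing against finite sequences linearises the norm: it lets integrals over time be
    estimated through scalar functions and the mean value inequality. *)
Lemma bl2_dual a M : 0 <= M ->
  (forall K (d : nat -> R), \sum_(k < K) d k ^+ 2 <= 1 -> \sum_(k < K) a k * d k <= M) ->
  bl2 a M.
Proof.
move=> M0 h K; set N := (X in X <= _).
have N0 : 0 <= N by apply: sumr_ge0 => i _; exact: sqr_ge0.
have [->|Nn] := eqVneq N 0; first by rewrite sqr_ge0.
have q0 : 0 < Num.sqrt N by rewrite sqrtr_gt0 lt_neqAle eq_sym Nn.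
have q2 : Num.sqrt N ^+ 2 = N by rewrite sqr_sqrtr.
have := h K (fun k => a k / Num.sqrt N).
have -> : \sum_(k < K) (a k / Num.sqrt N) ^+ 2 = 1.
  under eq_bigr do rewrite expr_div_n q2.
  by rewrite -mulr_suml -/N divff.
have -> : \sum_(k < K) a k * (a k / Num.sqrt N) = Num.sqrt N.
  under eq_bigr do rewrite mulrA -expr2.
  by rewrite -mulr_suml -/N -{1}q2; field; rewrite gt_eqF.
by move=> /(_ (lexx _)) h'; rewrite -q2 ler_sqr ?nnegrE// ltW.
Qed.

Lemma bl2D a b M N : 0 <= M -> 0 <= N -> bl2 a M -> bl2 b N ->
  bl2 (fun k => a k + b k) (M + N).
Proof.
move=> M0 N0 aM bN; apply: bl2_dual => [|K d d1]; first exact: addr_ge0.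
under eq_bigr do rewrite mulrDl.
by rewrite big_split/= lerD// bl2_pair.
Qed.

Lemma bl2_le a b M r : 0 <= r -> (forall k, `|a k| <= r * `|b k|) -> bl2 b M ->
  bl2 a (r * M).
Proof.
move=> r0 ab bM K; rewrite exprMn.
apply: le_trans (ler_wpM2l (sqr_ge0 r) (bM K)); rewrite mulr_sumr.
apply: ler_sum => k _; rewrite -[a k ^+ 2]real_normK ?num_real// -[b k ^+ 2]real_normK ?num_real//.
by rewrite -exprMn ler_sqr ?nnegrE// mulr_ge0.
Qed.

Lemma bl2_mon a M N : 0 <= M <= N -> bl2 a M -> bl2 a N.
Proof.
move=> /andP[M0 MN] aM K; apply: le_trans (aM K) _.
by rewrite ler_sqr ?nnegrE// (le_trans M0).
Qed.

Lemma bl2_eq a b M : (forall k, a k = b k) -> bl2 a M -> bl2 b M.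
Proof. by move=> /funext ->. Qed.

Lemma bl2N a M : bl2 a M -> bl2 (fun k => - a k) M.
Proof. by move=> h K; under eq_bigr do rewrite sqrrN. Qed.

Lemma bl2B a b M N : 0 <= M -> 0 <= N -> bl2 a M -> bl2 b N ->
  bl2 (fun k => a k - b k) (M + N).
Proof. by move=> M0 N0 aM /bl2N; exact: bl2D. Qed.

Lemma bl2_0 M : bl2 (fun=> 0) M.
Proof. by move=> K; rewrite big1 ?sqr_ge0// => i _; rewrite expr0n. Qed.

Lemma bl2_coef a M k : 0 <= M -> bl2 a M -> `|a k| <= M.
Proof.
move=> M0 /(_ k.+1); rewrite big_ord_recr/= => h.
rewrite -ler_sqr ?nnegrE// real_normK ?num_real//; apply: le_trans h.
by rewrite lerDr sumr_ge0// => i _; exact: sqr_ge0.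
Qed.

Lemma bl2_lim (a : nat -> nat -> R) b M :
  (forall k, a n k @[n --> \oo] --> b k) -> (forall n, bl2 (a n) M) -> bl2 b M.
Proof.
move=> ab aM K.
have h : \sum_(k < K) a n k ^+ 2 @[n --> \oo] --> \sum_(k < K) b k ^+ 2.
  elim: (K) => [|L IH].
    rewrite big_ord0 (_ : (fun n => _) = fun=> 0); first exact: cvg_cst.
    by apply/funext => n; rewrite big_ord0.
  rewrite big_ord_recr/= (_ : (fun n => _) = fun n => \sum_(k < L) a n k ^+ 2 + a n L * a n L).
    by rewrite expr2; apply: cvgD => //; apply: cvgM.
  by apply/funext => n; rewrite big_ord_recr/= expr2.
by apply: (cvgr_to_le h); apply: nearW => n; exact: aM.
Qed.

End Weights.

Section Duhamel.
Variables (R : realType) (nu : nat -> R) (c0 : R).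
Hypotheses (c0_gt0 : 0 < c0) (nu_c0 : forall k, c0 <= nu k).
Implicit Types (c d : nat -> R) (s r t x M N e : R).

Let nu0 k : 0 < nu k. Proof. exact: lt_le_trans c0_gt0 (nu_c0 k). Qed.
Hint Resolve nu0 : core.

(** Bounds on all partial sums stand for norms: if [c] is the sequence of coefficients
    of [u] in an eigenbasis, [wle s c M] bounds the norm of order [s] of [u] by [M]. *)
Definition wle s c M : Prop := bl2 (fun k => nu k `^ s * c k) M.

Lemma wle_mul s r x c d M : 0 <= x -> (forall k, nu k `^ (s - r) * `|c k| <= x * `|d k|) ->
  wle r d M -> wle s c (x * M).
Proof.
move=> x0 h; apply: bl2_le => // k.
rewrite !normrM !(ger0_norm (powR_ge0 _ _)).
have -> : nu k `^ s = nu k `^ r * nu k `^ (s - r).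
  by rewrite -powRD ?(gt_eqF (nu0 k)) ?implybT//; congr (_ `^ _); ring.
by rewrite -mulrA [leRHS]mulrCA ler_wpM2l ?powR_ge0.
Qed.

Lemma wle_exp s r c M : s <= r -> wle r c M -> wle s c (c0 `^ (s - r) * M).
Proof.
move=> sr; apply: wle_mul; first exact: powR_ge0.
move=> k; rewrite ler_wpM2r// -[s - r]opprB !powRN lef_pV2 ?posrE ?powR_gt0//.
by rewrite ge0_ler_powR ?nnegrE ?subr_ge0// ltW.
Qed.

Lemma wleD s c d M N : 0 <= M -> 0 <= N -> wle s c M -> wle s d N ->
  wle s (fun k => c k + d k) (M + N).
Proof.
move=> M0 N0 h1 h2; apply: bl2_eq (bl2D M0 N0 h1 h2) => k.
by rewrite mulrDr.
Qed.

Lemma wleN s c M : wle s c M -> wle s (fun k => - c k) M.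
Proof. by move=> /bl2N; apply: bl2_eq => k; rewrite mulrN. Qed.

Lemma wleB s c d M N : 0 <= M -> 0 <= N -> wle s c M -> wle s d N ->
  wle s (fun k => c k - d k) (M + N).
Proof. by move=> M0 N0 h1 /wleN; exact: wleD. Qed.

Lemma wle_mon s c M N : 0 <= M <= N -> wle s c M -> wle s c N.
Proof. exact: bl2_mon. Qed.

Lemma wle_eq s c d M : (forall k, c k = d k) -> wle s c M -> wle s d M.
Proof. by move=> /funext ->. Qed.

Lemma wle_coef s c M k : 0 <= M -> wle s c M -> `|c k| <= nu k `^ (- s) * M.
Proof.
move=> M0 /(bl2_coef k M0); rewrite normrM (ger0_norm (powR_ge0 _ _)) => h.
by rewrite powRN mulrC ler_pdivlMr ?powR_gt0// mulrC.
Qed.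

Lemma wle_lim s (c : nat -> nat -> R) d M :
  (forall k, c n k @[n --> \oo] --> d k) -> (forall n, wle s (c n) M) -> wle s d M.
Proof.
move=> cd h; apply: (@bl2_lim _ (fun n k => nu k `^ s * c n k)) => // k.
by apply: cvgM => //; exact: cvg_cst.
Qed.

Section Bound.
Variables (h : R -> nat -> R) (P : nat -> R -> R) (b' : R).
Hypothesis hP : forall k x, -1 < x -> is_derive x 1 (P k) (expR (nu k * x) * h x k).

(** The kernel of the heat semigroup is of order [(t - r)^(-(sg - b'))] from the
    weight [b'] to the weight [sg], which is integrable for [sg - b' < 1]. *)
Lemma duhamel_bound sg s t M : 0 <= sg - b' < 1 -> 0 <= s <= t -> 0 <= M ->
  (forall r, s <= r <= t -> wle b' (h r) M) ->
  wle sg (fun k => expR (- (nu k * t)) * (P k t - P k s))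
    (M / (1 - (sg - b')) * (t - s) `^ (1 - (sg - b'))).
Proof.
set ka := sg - b'; move=> /andP[k0 k1] /andP[s0]; rewrite le_eqVlt => /predU1P[->|st] M0 hM.
  by apply: bl2_eq (bl2_0 _) => k; rewrite subrr !mulr0.
have k1' : 0 < 1 - ka by rewrite subr_gt0.
apply: bl2_dual; first by rewrite mulr_ge0 ?divr_ge0 ?powR_ge0// ltW.
move=> K d d1.
pose Y r := \sum_(k < K) nu k `^ sg * d k * expR (- (nu k * t)) * P k r.
pose dY r := \sum_(k < K) nu k `^ sg * d k * expR (- (nu k * t)) * (expR (nu k * r) * h r k).
have hY r : 0 <= r -> is_derive r 1 Y (dY r).
  move=> r0; apply: der_sum => k; apply: derZ; apply: hP.
  by apply: lt_le_trans r0; rewrite oppr_lt0.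
suff : Y t - Y s <= M / (1 - ka) * (t - s) `^ (1 - ka).
  apply: le_trans; rewrite le_eqVlt; apply/orP; left; apply/eqP.
  by rewrite /Y -sumrB; apply: eq_bigr => k _; ring.
have bY r : s <= r < t -> dY r <= M * (t - r) `^ (- ka).
  move=> /andP[sr rt]; have tr : 0 < t - r by rewrite subr_gt0.
  have w : wle b' (h r) M by apply: hM; rewrite sr ltW.
  have := @wle_mul sg b' ((t - r) `^ (- ka)) (fun k => expR (- (nu k * (t - r))) * h r k) _ _ _ _ w.
  rewrite -/ka => w'; have {}w' : wle sg (fun k => expR (- (nu k * (t - r))) * h r k) ((t - r) `^ (- ka) * M).
    apply: w' => [|k]; first exact: powR_ge0.
    rewrite normrM (ger0_norm (expR_ge0 _)) mulrA ler_wpM2r//.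
    by apply: powR_expN => //; rewrite k0 ltW.
  rewrite mulrC; apply: le_trans (bl2_pair _ w' d1); last by rewrite mulr_ge0 ?powR_ge0.
  rewrite le_eqVlt; apply/orP; left; apply/eqP; apply: eq_bigr => k _.
  have -> : - (nu k * (t - r)) = - (nu k * t) + nu k * r by ring.
  by rewrite expRD; ring.
pose B r := M / (1 - ka) * (t - r) `^ (1 - ka).
have hB r : r < t -> is_derive r 1 B (- (M * (t - r) `^ (- ka))).
  move=> rt; have tr : 0 < t - r by rewrite subr_gt0.
  have h1 : is_derive r 1 (fun x => t - x) (0 - 1) by exact: (derB (derC r t) (derid r)).
  have := derZ (M / (1 - ka)) (@der_comp R (fun y => y `^ (1 - ka)) (fun x => t - x) r _ _ (is_derive1_powR (1 - ka) tr) h1).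
  rewrite (_ : 1 - ka - 1 = - ka); last by ring.
  by move=> hd; apply: is_derive_eq; field; rewrite gt_eqF.
have main r : s <= r < t -> Y r <= Y s + B s.
  move=> /andP[sr rt].
  have := @mvt_le R (fun x => Y x + B x) (fun x => dY x - M * (t - x) `^ (- ka)) s r 0 sr.
  rewrite mul0r subr_le0 => hh.
  apply: le_trans (_ : Y r + B r <= _).
    by rewrite lerDl mulr_ge0 ?divr_ge0 ?powR_ge0// ltW.
  apply: hh.
  - apply: cont_within => x /andP[sx xr]; apply: (@der_cont _ _ _ (dY x - M * (t - x) `^ (- ka))).
    by apply: derD; [apply: hY; exact: le_trans sx|apply: hB; exact: le_lt_trans rt].
  - move=> x /andP[sx xr].
    by apply: derD; [apply: hY; exact: le_trans (ltW sx)|apply: hB; exact: lt_trans rt].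
  - by move=> x /andP[sx xr]; rewrite subr_le0 bY// (ltW sx)/= (lt_trans xr).
rewrite lerBlDl.
have cY : {for t, continuous Y} by apply: der_cont (hY t _); exact: le_trans (ltW st).
apply: (cvgr_to_le (cvg_at_left_filter cY)).
near=> r; apply: main; apply/andP; split; last by near: r; exact: nbhs_left_lt.
by near: r; exact: nbhs_left_ge.
Unshelve. all: by end_near. Qed.

Definition duh t k := expR (- (nu k * t)) * (P k t - P k 0).

(** The increment is split into the integral over [s, t] and the action of the semigroup
    on the integral over [0, s]. *)
Lemma duhamel_holder sg M s t : 0 <= sg - b' < 1 -> 0 <= M -> 0 <= s <= t -> t <= 1 ->
  (forall r, 0 <= r <= t -> wle b' (h r) M) ->
  wle sg (fun k => duh t k - duh s k)
    (4 / (1 - (sg - b')) * M * (t - s) `^ ((1 - (sg - b')) / 2)).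
Proof.
set ka := sg - b'; move=> /andP[k0 k1] M0 /andP[s0 st] t1 hM.
have k1' : 0 < 1 - ka by rewrite subr_gt0.
have [de de0 de2] : exists2 de : R, 0 < de & 1 - ka = 2 * de.
  by exists ((1 - ka) / 2); [rewrite divr_gt0|field].
have de3 : (1 - ka) / 2 = de by lra.
have de1 : de <= 1 by lra.
rewrite de3 de2.
have ts0 : 0 <= t - s by rewrite subr_ge0.
have b1 : wle sg (fun k => (expR (- (nu k * (t - s))) - 1) * duh s k)
    ((t - s) `^ de * (M / de)).
  have : wle (sg + de) (duh s) (M / de).
    have hs r : 0 <= r <= s -> wle b' (h r) M.
      by move=> /andP[r0 rs]; apply: hM; rewrite r0 (le_trans rs).
    have e1 : sg + de - b' = 1 - de by move: de2; rewrite /ka; lra.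
    have := @duhamel_bound (sg + de) 0 s M; rewrite e1 subr0 lexx => /(_ _ s0 M0 hs).
    rewrite (_ : 1 - (1 - de) = de); last by ring.
    rewrite subr_ge0 ltrBlDr ltrDl de0 => w.
    apply: wle_mon (w _); last by rewrite de1.
    rewrite mulr_ge0 ?divr_ge0 ?powR_ge0 ?(ltW de0)//=.
    rewrite ler_piMr ?divr_ge0 ?(ltW de0)//.
    rewrite -[leRHS](powR1x de) ge0_ler_powR ?nnegrE ?(ltW de0)//; exact: le_trans st _.
  apply: wle_mul; first exact: powR_ge0.
  move=> k; rewrite normrM mulrA ler_wpM2r//.
  have -> : sg - (sg + de) = - de by ring.
  rewrite powRN mulrC ler_pdivrMr ?powR_gt0//.
  have nts : 0 <= nu k * (t - s) by rewrite mulr_ge0// ltW.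
  rewrite -normrN opprB ger0_norm ?subr_ge0; last by rewrite -expR0 ler_expR oppr_le0.
  rewrite mulrC -powRM ?(ltW (nu0 k))//; apply: onem_exp_le; first by rewrite mulrC.
  by rewrite (ltW de0) de1.
have b2 : wle sg (fun k => expR (- (nu k * t)) * (P k t - P k s))
    (M / (2 * de) * (t - s) `^ de).
  have := @duhamel_bound sg s t M; rewrite -/ka k0 k1 s0 st de2 => /(_ isT isT M0) w.
  apply: wle_mon (w _); last by move=> r /andP[sr rt]; apply: hM; rewrite rt (le_trans s0).
  have M2 : 0 <= M / (2 * de) by rewrite divr_ge0// mulr_ge0// ltW.
  rewrite mulr_ge0 ?powR_ge0//= ler_wpM2l//.
  have [->|ts] := eqVneq (t - s) 0; first by rewrite !powR0 ?gt_eqF// mulr_gt0.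
  apply: ger_powR; first by rewrite lt_neqAle eq_sym ts ts0; lra.
  by lra.
have := wleD _ _ b1 b2.
rewrite mulr_ge0 ?powR_ge0 ?divr_ge0 ?(ltW de0)//.
rewrite mulr_ge0 ?powR_ge0 ?divr_ge0 ?mulr_ge0 ?(ltW de0)// => /(_ isT isT) w.
apply: wle_mon (wle_eq _ w); last first.
  move=> k; rewrite /duh.
  have -> : - (nu k * t) = - (nu k * (t - s)) + - (nu k * s) by ring.
  by rewrite expRD; ring.
apply/andP; split; first by rewrite addr_ge0// mulr_ge0 ?powR_ge0 ?divr_ge0 ?mulr_ge0 ?(ltW de0).
rewrite mulrC -mulrDl ler_wpM2r ?powR_ge0//.
have -> : M / de + M / (2 * de) = (3 / 2) * (M / de) by field; rewrite gt_eqF.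
have -> : 4 / (2 * de) * M = 2 * (M / de) by field; rewrite gt_eqF.
have : 0 <= M / de by rewrite divr_ge0 ?(ltW de0).
by lra.
Qed.

End Bound.

Section Semigroup.
Variables (u0 : nat -> R) (et r0 : R).
Hypotheses (r0_ge0 : 0 <= r0) (u0_le : wle et u0 r0).

Definition semi t k := expR (- (nu k * t)) * u0 k.

Lemma semi_bound t : 0 <= t -> wle et (semi t) r0.
Proof.
move=> t0; rewrite -[r0]mul1r; apply: wle_mul u0_le => // k.
rewrite subrr powRr0 !mul1r normrM ger0_norm ?expR_ge0// ler_piMl//.
by rewrite -expR0 ler_expR oppr_le0 mulr_ge0// ltW.
Qed.

Lemma semi_reg t rho : 0 < t -> 0 <= rho <= 1 ->
  wle (et + rho) (semi t) (t `^ (- rho) * r0).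
Proof.
move=> t0 hr; apply: wle_mul u0_le => [|k]; first exact: powR_ge0.
rewrite normrM (ger0_norm (expR_ge0 _)) mulrA ler_wpM2r//.
by have -> : et + rho - et = rho by [ring]; exact: powR_expN.
Qed.

Lemma semi_diff s t : s <= t -> forall k,
  `|semi t k - semi s k| <= (1 - expR (- (nu k * (t - s)))) * `|semi s k|.
Proof.
move=> st k; have -> : semi t k - semi s k = - (1 - expR (- (nu k * (t - s)))) * semi s k.
  rewrite /semi; have -> : - (nu k * t) = - (nu k * (t - s)) + - (nu k * s) by ring.
  by rewrite expRD; ring.
have p : 0 <= 1 - expR (- (nu k * (t - s))).
  rewrite subr_ge0 -expR0 ler_expR oppr_le0.
  by rewrite mulr_ge0 ?(ltW (nu0 k))// subr_ge0.
by rewrite normrM normrN (ger0_norm p).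
Qed.

Lemma semi_reg_cont s t rho : 0 < s <= t -> 0 <= rho <= 1 ->
  wle (et + rho) (fun k => semi t k - semi s k) ((t - s) `^ (1 - rho) * (s^-1 * r0)).
Proof.
move=> /andP[s0 st] /andP[rh0 rh1]; have s0' := ltW s0.
have w : wle (et + 1) (semi s) (s^-1 * r0).
  by rewrite -powR_inv1//; apply: semi_reg => //; rewrite ler01 lexx.
apply: wle_mul w => [|k]; first exact: powR_ge0.
have -> : et + rho - (et + 1) = - (1 - rho) by ring.
apply: le_trans (ler_wpM2l (powR_ge0 _ _) (semi_diff st k)) _.
rewrite mulrA ler_wpM2r// powRN mulrC ler_pdivrMr ?powR_gt0//.
rewrite mulrC -powRM ?(ltW (nu0 k)) ?subr_ge0//; apply: onem_exp_le.
  by rewrite mulr_ge0 ?(ltW (nu0 k))// subr_ge0.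
by lra.
Qed.

(** Uniform continuity down to time [0] without regularity of [u0]: a tail of the series
    is small, and finitely many modes remain. *)
Lemma semi_cont e : 0 < e -> exists2 d, 0 < d & forall s t, 0 <= s <= t -> t - s < d ->
  wle et (fun k => semi t k - semi s k) e.
Proof.
move=> e0; have e2 : 0 < e ^+ 2 / 2 by rewrite divr_gt0 ?exprn_gt0.
have [N hN] := series_cauchy (fun k => sqr_ge0 (nu k `^ et * u0 k)) u0_le e2.
pose B := \sum_(k < N) nu k.
have nuB k : (k < N)%N -> nu k <= B.
  by move=> kN; rewrite /B (bigD1 (Ordinal kN))//= lerDl sumr_ge0// => i _; exact: ltW.
have B0 : 0 <= B by apply: sumr_ge0 => i _; exact: ltW.
pose d := e / (2 * (B + 1) * (r0 + 1)).
have B1 : 0 < B + 1 by rewrite ltr_wpDl.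
have r1 : 0 < r0 + 1 by rewrite ltr_wpDl.
have d0 : 0 < d by rewrite divr_gt0// !mulr_gt0.
exists d => // s t /andP[s0 st] tsd K.
have ts0 : 0 <= t - s by rewrite subr_ge0.
pose a k := nu k `^ et * u0 k.
have one k : `|nu k `^ et * (semi t k - semi s k)| <= (1 - expR (- (nu k * (t - s)))) * `|a k|.
  rewrite !normrM (ger0_norm (powR_ge0 _ _)) mulrCA ler_wpM2l ?powR_ge0//.
  apply: le_trans (semi_diff st k) _; rewrite ler_wpM2l//.
    by rewrite subr_ge0 -expR0 ler_expR oppr_le0 mulr_ge0// ltW.
  rewrite normrM ger0_norm ?expR_ge0// ler_piMl//.
  by rewrite -expR0 ler_expR oppr_le0 mulr_ge0// ltW.
have small k : (k < N)%N -> (nu k `^ et * (semi t k - semi s k)) ^+ 2 <= (B * d) ^+ 2 * a k ^+ 2.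
  move=> kN; rewrite -exprMn -[leLHS]real_normK ?num_real// -[leRHS]real_normK ?num_real//.
  rewrite ler_sqr ?nnegrE// [X in _ <= X]normrM (ger0_norm (mulr_ge0 B0 (ltW d0))).
  apply: le_trans (one k) _; rewrite ler_wpM2r//.
  apply: le_trans (_ : nu k * (t - s) <= _).
    by have := expR_ge1Dx (- (nu k * (t - s))); lra.
  by apply: ler_pM => //; [exact: ltW|exact: nuB|exact: ltW].
have big k : (nu k `^ et * (semi t k - semi s k)) ^+ 2 <= a k ^+ 2.
  rewrite -[leLHS]real_normK ?num_real// -[leRHS]real_normK ?num_real// ler_sqr ?nnegrE//.
  apply: le_trans (one k) _; rewrite ler_piMl//.
have h1 L : (L <= N)%N -> \sum_(k < L) (nu k `^ et * (semi t k - semi s k)) ^+ 2 <= e ^+ 2 / 2.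
  move=> LN; apply: le_trans (_ : \sum_(k < L) (B * d) ^+ 2 * a k ^+ 2 <= _).
    by apply: ler_sum => k _; apply: small; exact: leq_trans LN.
  rewrite -mulr_sumr.
  apply: le_trans (_ : (B * d) ^+ 2 * r0 ^+ 2 <= _).
    by rewrite ler_wpM2l ?sqr_ge0//; exact: u0_le.
  rewrite -exprMn.
  have le1 : B * d * r0 <= e / 2.
    have -> : e / 2 = (B + 1) * d * (r0 + 1) by rewrite /d; field; rewrite !gt_eqF.
    apply: ler_pM => //; [by rewrite mulr_ge0// ltW| |by rewrite lerDl].
    by rewrite ler_wpM2r ?(ltW d0)// lerDl.
  have := mulr_ge0 (mulr_ge0 B0 (ltW d0)) r0_ge0.
  by move: (B * d * r0) le1 => z; nra.
have [KN|NK] := leqP K N; first by apply: le_trans (h1 _ KN) _; nra.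
rewrite (sum_split (fun k => (nu k `^ et * (semi t k - semi s k)) ^+ 2) (ltnW NK)).
have := h1 N (leqnn _); have := hN _ _ (leqnn N) (ltnW NK).
rewrite (sum_split (fun k => (nu k `^ et * u0 k) ^+ 2) (ltnW NK)) addrC addKr => h2 h3.
have h4 : \sum_(k < K - N) (nu (N + k)%N `^ et * (semi t (N + k)%N - semi s (N + k)%N)) ^+ 2
   <= \sum_(k < K - N) (nu (N + k)%N `^ et * u0 (N + k)%N) ^+ 2.
  by apply: ler_sum => k _; exact: big.
lra.
Qed.

End Semigroup.
End Duhamel.

Section Clamp.
Variable R : realType.
Implicit Types (T s t : R).

Definition clamp T t := Num.min T (Num.max 0 t).

Lemma clamp_itv T t : 0 <= T -> 0 <= clamp T t <= T.
Proof. by move=> T0; rewrite /clamp le_min T0 le_max lexx ge_min lexx. Qed.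

Lemma clamp_id T t : 0 <= t <= T -> clamp T t = t.
Proof. by move=> /andP[t0 tT]; rewrite /clamp max_r// min_r. Qed.

Lemma clamp_lip T s t : `|clamp T s - clamp T t| <= `|s - t|.
Proof.
have main x y : x <= y -> 0 <= clamp T y - clamp T x <= y - x.
  move=> xy; rewrite /clamp.
  have : Num.max 0 x <= Num.max 0 y <= Num.max 0 x + (y - x).
    by case: (leP 0 x) => ?; case: (leP 0 y) => ?; apply/andP; split; lra.
  move: (Num.max 0 x) (Num.max 0 y) => u v /andP[uv vu].
  by case: (leP T u) => ?; case: (leP T v) => ?; apply/andP; split; lra.
have [st|/ltW ts] := leP s t.
  by have /andP[h1 h2] := main _ _ st; rewrite distrC ger0_norm// distrC ger0_norm// subr_ge0.
by have /andP[h1 h2] := main _ _ ts; rewrite ger0_norm// ger0_norm// subr_ge0.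
Qed.

Lemma root_small (q de : R) : 0 < q -> 0 < de ->
  exists2 T, 0 < T <= 1 & forall t, 0 <= t <= T -> t `^ de <= q.
Proof.
move=> q0 d0; exists (Num.min 1 (q `^ de^-1)).
  by rewrite lt_min ltr01 powR_gt0//= ge_min lexx.
move=> t /andP[t0]; rewrite le_min => /andP[_ tq].
apply: le_trans (_ : (q `^ de^-1) `^ de <= _).
  by rewrite ge0_ler_powR ?nnegrE ?powR_ge0// ltW.
by rewrite -powRrM mulVf ?gt_eqF// powRr1// ltW.
Qed.

Lemma geo_zero (x C : R) : 0 <= C -> (forall n, `|x| <= C / 2 ^+ n) -> x = 0.
Proof.
move=> C0 h; apply/eqP; rewrite -normr_eq0; apply/eqP/le_anti; rewrite normr_ge0 andbT.
have lim0 : C / 2 ^+ n @[n --> \oo] --> 0.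
  have := @cvg_geometric R C (2^-1); rewrite ger0_norm ?invr_ge0// invf_lt1// ltr1n => /(_ isT).
  rewrite (_ : (fun n => C / 2 ^+ n) = geometric C 2^-1)//.
  by apply/funext => n; rewrite /geometric/= exprVn.
by apply: (ler_cvg_to (cvg_cst _) lim0); apply: nearW => n.
Qed.

Lemma geo_cvg (x : nat -> R) C : (forall n m, `|x (m + n)%N - x n| <= C / 2 ^+ n) -> cvgn x.
Proof.
move=> h; apply/cauchy_cvgP/cauchy_exP => e e0.
have lim0 : C / 2 ^+ n @[n --> \oo] --> 0.
  have := @cvg_geometric R C (2^-1); rewrite ger0_norm ?invr_ge0// invf_lt1// ltr1n => /(_ isT).
  rewrite (_ : (fun n => C / 2 ^+ n) = geometric C 2^-1)//.
  by apply/funext => n; rewrite /geometric/= exprVn.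
have /cvgrPdist_lt/(_ _ e0)[N _ hN] := lim0.
exists (x N), N => // n /= Nn; rewrite /ball/= distrC -(subnK Nn).
apply: le_lt_trans (h _ _) _; apply: le_lt_trans (hN N (leqnn _)).
by rewrite sub0r normrN ler_norm.
Qed.

End Clamp.

Section Evolution.
Variables (R : realType) (nu : nat -> R) (c0 : R).
Hypotheses (c0_gt0 : 0 < c0) (nu_c0 : forall k, c0 <= nu k).
Variables (H : (nat -> R) -> nat -> R) (et b' be : R).
Hypotheses (et_b' : 0 <= et - b' < 1) (be_b' : 0 <= be + 1 - b' < 1)
  (be_le : be <= b') (be_et : be < et < be + 1).
Implicit Types (c d : nat -> R) (s r t x M N e m : R) (U W : R -> nat -> R).
Local Notation wle := (wle nu).
Local Notation duh := (duh nu).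
Local Notation semi := (semi nu).

Hypothesis HLip : forall r, 0 <= r -> exists2 L, 0 <= L & forall c d m, 0 <= m ->
  wle et c r -> wle et d r -> wle et (fun k => c k - d k) m ->
  wle b' (fun k => H c k - H d k) (L * m).
Hypothesis HZ : exists2 M, 0 <= M & wle b' (H (fun=> 0)) M.

Let nu0 k : 0 < nu k. Proof. exact: lt_le_trans c0_gt0 (nu_c0 k). Qed.

Lemma Hbound r : 0 <= r -> exists2 M, 0 <= M & forall c, wle et c r -> wle b' (H c) M.
Proof.
move=> r0; have [L L0 hL] := HLip r0; have [M M0 hM] := HZ.
exists (L * r + M) => [|c cr]; first by rewrite addr_ge0// mulr_ge0.
have z : wle et (fun=> 0) r by apply: bl2_eq (bl2_0 r) => k; rewrite mulr0.
have cz : wle et (fun k => c k - 0) r by apply: wle_eq cr => k; rewrite subr0.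
have := wleD (mulr_ge0 L0 r0) M0 (hL _ _ _ r0 cr z cz) hM.
by apply: wle_eq => k; rewrite subrK.
Qed.

Definition ccont U : Prop := forall t e, 0 < e ->
  exists2 d, 0 < d & forall s, `|s - t| < d -> wle et (fun k => U s k - U t k) e.

Lemma Hcoef_cont U r k : 0 <= r -> ccont U -> (forall t, wle et (U t) r) ->
  continuous (fun t => H (U t) k).
Proof.
move=> r0 cU bU t; have [L L0 hL] := HLip r0.
apply/cvgrPdist_lt => e e0.
pose m := e / (nu k `^ (- b') * L + 1).
have p1 : 0 < nu k `^ (- b') * L + 1 by rewrite ltr_wpDl// mulr_ge0// powR_ge0.
have m0 : 0 < m by rewrite divr_gt0.
have [d d0 hd] := cU t m m0.
apply/nbhs_normP; exists d => //= s; rewrite /= distrC => /hd w.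
rewrite distrC; have /(wle_coef c0_gt0 nu_c0 k (mulr_ge0 L0 (ltW m0))) := hL _ _ _ (ltW m0) (bU s) (bU t) w.
move=> /le_lt_trans; apply; rewrite mulrA /m mulrCA gtr_pMr//.
by rewrite ltr_pdivrMr// mul1r ltrDl.
Qed.

Definition is_prim U (P : nat -> R -> R) : Prop := forall k x, -1 < x ->
  is_derive x 1 (P k) (expR (nu k * x) * H (U x) k).

Definition prim U : nat -> R -> R := xget (fun _ _ => 0) [set P | is_prim U P].

Lemma primP U r : 0 <= r -> ccont U -> (forall t, wle et (U t) r) -> is_prim U (prim U).
Proof.
move=> r0 cU bU.
have /choice[P hP] : forall k, exists P : R -> R, forall x, -1 < x ->
    is_derive x 1 P (expR (nu k * x) * H (U x) k).
  move=> k; apply: (@primitive_ex R (fun x => expR (nu k * x) * H (U x) k)) => x.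
  have h1 : {for x, continuous (fun x => expR (nu k * x))} := der_cont (der_exp (nu k) x).
  have h2 : {for x, continuous (fun x => H (U x) k)} by apply: (Hcoef_cont r0 cU bU).
  exact: cvgM h1 h2.
exact: (xgetPex _ (ex_intro _ P hP)).
Qed.

Section Existence.
Variables (u0 : nat -> R) (r0 : R).
Hypotheses (r0_ge0 : 0 <= r0) (u0_le : wle et u0 r0).

Let r := r0 + 1.
Let r_ge0 : 0 <= r. Proof. by rewrite addr_ge0. Qed.

Definition good U : Prop := ccont U /\ forall t, wle et (U t) r.

Definition Phi T U : R -> nat -> R := fun t k =>
  semi u0 (clamp T t) k + duh (prim U) (clamp T t) k.

Let ka := 1 - (et - b').
Let ka0 : 0 < ka. Proof. by rewrite /ka; move: et_b' => /andP[]; lra. Qed.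

Lemma duh0 P k : duh P 0 k = 0.
Proof. by rewrite /duh subrr mulr0. Qed.

(** The smoothing loses [t^(-(et - b'))], which is integrable, so the Duhamel map is a
    contraction on a short interval. Clamping the time keeps functions on the line. *)
Lemma Phi_good : exists2 T, 0 < T <= 1 &
  (forall U, good U -> good (Phi T U)) /\
  forall U W m, 0 <= m -> good U -> good W ->
    (forall t, wle et (fun k => U t k - W t k) m) ->
    forall t, wle et (fun k => Phi T U t k - Phi T W t k) (m / 2).
Proof.
have [L L0 hL] := HLip r_ge0; have [M M0 hM] := Hbound r_ge0.
have [C C0 CE] : exists2 C, 0 < C & 4 / ka = C by exists (4 / ka); rewrite // divr_gt0.
have ML : 0 < M + L + 1 by rewrite ltr_wpDl// addr_ge0.
have q1 : 0 < 2 * C * (M + L + 1) by rewrite !pmulr_rgt0.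
have q0 : 0 < (2 * C * (M + L + 1))^-1 by rewrite invr_gt0.
have ka2 : 0 < ka / 2 by rewrite divr_gt0.
have [T T01 hT] := root_small q0 ka2.
exists T => //; have [T0 T1] := andP T01; have T0' := ltW T0.
have CT x t : 0 <= x -> x <= M + L -> 0 <= t <= T -> C * x * t `^ (ka / 2) <= 1 / 2.
  move=> x0 xM tT; apply: le_trans (ler_wpM2l _ (hT _ tT)) _.
    by rewrite mulr_ge0// ltW.
  rewrite ler_pdivrMr//.
  by have : C * x <= C * (M + L + 1) by [rewrite ler_wpM2l ?(ltW C0)//; lra]; lra.
split=> [U [cU bU]|U W m m0 [cU bU] [cW bW] UW t].
  have hP := primP r_ge0 cU bU.
  have bH t : wle b' (H (U t)) M by apply: hM.
  have hold s t : 0 <= s <= t -> t <= T ->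
      wle et (fun k => duh (prim U) t k - duh (prim U) s k) (C * M * (t - s) `^ (ka / 2)).
    by move=> st tT; rewrite -CE; apply: (duhamel_holder c0_gt0 nu_c0 hP) => //; exact: le_trans T1.
  split=> [t e e0|t]; last first.
    rewrite /Phi; have := clamp_itv t T0'; move: (clamp T t) => x /andP[x0 xT].
    suff w0 : wle et (duh (prim U) x) 1.
      exact: (wleD r0_ge0 ler01 (semi_bound c0_gt0 nu_c0 u0_le x0) w0).
    have := @hold 0 x; rewrite lexx x0 xT => /(_ isT isT) w.
    apply: wle_mon (wle_eq _ w); last by move=> k; rewrite duh0 subr0.
    rewrite !mulr_ge0 ?powR_ge0 ?(ltW C0)//= subr0.
    by apply: le_trans (CT M x _ _ _) _; rewrite ?x0// ?lerDl//; lra.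
  have e2 : 0 < e / 2 by rewrite divr_gt0.
  have [d1 d10 hd1] := semi_cont c0_gt0 nu_c0 r0_ge0 u0_le e2.
  have CM : 0 < C * M + 1 by rewrite ltr_wpDl// mulr_ge0// ltW.
  have [d2 /andP[d20 _] hd2] := root_small (divr_gt0 e2 CM) ka2.
  exists (Num.min d1 d2); first by rewrite lt_min d10.
  have main x y : 0 <= x <= y -> y <= T -> y - x < d1 -> y - x < d2 ->
      wle et (fun k => (semi u0 y k + duh (prim U) y k) - (semi u0 x k + duh (prim U) x k)) e.
    move=> xy yT h1 h2; have [x0 xy'] := andP xy.
    have w1 := hd1 _ _ xy h1; have w2 := hold _ _ xy yT.
    have w2' : wle et (fun k => duh (prim U) y k - duh (prim U) x k) (e / 2).
      apply: wle_mon w2; rewrite !mulr_ge0 ?powR_ge0 ?(ltW C0)//=.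
      have := hd2 (y - x); rewrite subr_ge0 xy' (ltW h2) => /(_ isT) h3.
      apply: le_trans (ler_wpM2l _ h3) _; first by rewrite mulr_ge0// ltW.
      by rewrite mulrCA ler_piMr ?(ltW e2)// ler_pdivrMr// mul1r lerDl.
    have := wleD (ltW e2) (ltW e2) w1 w2'; rewrite -splitr.
    by apply: wle_eq => k; ring.
  move=> s; rewrite lt_min => /andP[st1 st2].
  have [/andP[x0 xT] /andP[y0 yT]] := (clamp_itv s T0', clamp_itv t T0').
  have lip := clamp_lip T s t.
  rewrite /Phi; move: (clamp T s) (clamp T t) x0 xT y0 yT lip => x y x0 xT y0 yT lip.
  have {lip}[l1 l2] : `|x - y| < d1 /\ `|x - y| < d2.
    by split; apply: le_lt_trans lip _.
  have [xy|/ltW yx] := leP x y.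
    rewrite distrC ger0_norm ?subr_ge0// in l1; rewrite distrC ger0_norm ?subr_ge0// in l2.
    have := wleN (main x y _ yT l1 l2); rewrite x0 xy => /(_ isT).
    by apply: wle_eq => k; ring.
  rewrite ger0_norm ?subr_ge0// in l1; rewrite ger0_norm ?subr_ge0// in l2.
  by apply: main => //; rewrite y0.
have hPU := primP r_ge0 cU bU; have hPW := primP r_ge0 cW bW.
pose h t k := H (U t) k - H (W t) k.
pose P k t := prim U k t - prim W k t.
have hP k x : -1 < x -> is_derive x 1 (P k) (expR (nu k * x) * h x k).
  by move=> x1; rewrite mulrBr; apply: derB; [exact: hPU|exact: hPW].
have := clamp_itv t T0'; rewrite /Phi; move: (clamp T t) => x /andP[x0 xT].
have Lm : 0 <= L * m by rewrite mulr_ge0.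
have st : 0 <= (0 : R) <= x by rewrite lexx.
have := duhamel_holder c0_gt0 nu_c0 hP et_b' Lm st (le_trans xT T1) _.
rewrite -/ka CE subr0 => /(_ (fun y _ => hL _ _ _ m0 (bU y) (bW y) (UW y))) w.
apply: wle_mon (wle_eq _ w); last first.
  by move=> k; rewrite duh0 /duh /P; ring.
rewrite !mulr_ge0 ?powR_ge0 ?(ltW C0)//=.
have := CT L x L0 _ _; rewrite x0 xT lerDr M0 => /(_ isT isT) h1.
by rewrite mulrA mulrAC mulrC ler_wpM2l//; move: h1; rewrite div1r.
Qed.

Lemma fixpoint_ex : exists2 T, 0 < T <= 1 & exists2 U, good U &
  forall t k, 0 <= t <= T -> U t k = semi u0 t k + duh (prim U) t k.
Proof.
have [T T01 [gP lP]] := Phi_good; exists T => //.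
pose X n := iter n (Phi T) (fun _ _ => 0).
have gX n : good (X n).
  elim: n => [|n IH]; last exact: gP.
  split=> [t e e0|t]; last by apply: bl2_eq (bl2_0 r) => k; rewrite mulr0.
  by exists 1 => // s _; apply: bl2_eq (bl2_0 e) => k; rewrite subrr mulr0.
have p2 n : 0 < 2 ^+ n :> R by rewrite exprn_gt0.
have dX n t : wle et (fun k => X n.+1 t k - X n t k) (2 * r / 2 ^+ n).
  elim: n t => [|n IH] t.
    rewrite expr0 divr1 mulr2n mulrDl mul1r.
    by apply: wleB => //; [exact: (gX 1%N).2|exact: (gX 0%N).2].
  have -> : 2 * r / 2 ^+ n.+1 = 2 * r / 2 ^+ n / 2 by rewrite exprS; field; rewrite gt_eqF.
  have rn : 0 <= 2 * r / 2 ^+ n by rewrite divr_ge0 ?mulr_ge0// ltW.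
  exact: (lP _ _ _ rn (gX _) (gX _) IH).
have tX (n m : nat) t : wle et (fun k => X (m + n)%N t k - X n t k) (4 * r / 2 ^+ n).
  suff : wle et (fun k => X (m + n)%N t k - X n t k) (4 * r / 2 ^+ n - 4 * r / 2 ^+ (m + n)).
    apply: wle_mon; rewrite subr_ge0 gerBl divr_ge0 ?mulr_ge0 ?(ltW (p2 _))// andbT.
    rewrite ler_wpM2l ?mulr_ge0// lef_pV2 ?posrE// ler_eXn2l ?ltr1n//.
    by rewrite leq_addl.
  elim: m => [|m IH].
    by rewrite subrr; apply: bl2_eq (bl2_0 _) => k; rewrite subrr mulr0.
  have := wleD _ _ (dX (m + n)%N t) IH.
  rewrite divr_ge0 ?mulr_ge0 ?(ltW (p2 _))// subr_ge0.
  have -> : 4 * r / 2 ^+ (m + n) <= 4 * r / 2 ^+ n.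
    by rewrite ler_wpM2l ?mulr_ge0// lef_pV2 ?posrE// ler_eXn2l ?ltr1n// leq_addl.
  move=> /(_ isT isT); rewrite addSn.
  have -> : 2 * r / 2 ^+ (m + n) + (4 * r / 2 ^+ n - 4 * r / 2 ^+ (m + n)) =
      4 * r / 2 ^+ n - 4 * r / 2 ^+ (m + n).+1.
    by rewrite exprS; field; rewrite !gt_eqF.
  by apply: wle_eq => k; ring.
have cX t k : cvgn (fun n => X n t k).
  apply: (@geo_cvg R _ (nu k `^ (- et) * (4 * r))) => n m.
  rewrite -mulrA; apply: (wle_coef c0_gt0 nu_c0 k _ (tX n m t)).
  by rewrite divr_ge0 ?mulr_ge0// ltW.
pose U t k := limn (fun n => X n t k).
have UX n t : wle et (fun k => U t k - X n t k) (4 * r / 2 ^+ n).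
  apply: (@wle_lim _ _ _ (fun (m : nat) k => X (m + n)%N t k - X n t k)) => // k.
  apply: cvgB; last exact: cvg_cst.
  by rewrite (cvg_shiftn n (fun n => X n t k)); exact: cX.
have gU : good U.
  split=> [t e e0|t]; last first.
    by apply: (@wle_lim _ _ _ (fun n => X n t)) => [k|n]; [exact: cX|exact: (gX n).2].
  have [n hn] : exists n, 4 * r / 2 ^+ n <= e / 3.
    have [n] : exists n, 4 * r / (e / 3) <= 2 ^+ n.
      exists (Num.bound (4 * r / (e / 3))).
      apply: le_trans (ltW (archi_boundP _)) _; first by rewrite divr_ge0 ?mulr_ge0 ?divr_ge0// ltW.
      by rewrite -natrX ler_nat ltnW// ltn_expl.
    move=> h; exists n; rewrite ler_pdivrMr// [leRHS]mulrC.
    by rewrite ler_pdivrMr ?divr_gt0// in h.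
  have e3 : 0 < e / 3 by rewrite divr_gt0.
  have [d d0 hd] := (gX n).1 t _ e3; exists d => // s /hd w.
  have w1 : wle et (fun k => U s k - X n s k) (e / 3).
    by apply: wle_mon (UX n s); rewrite hn divr_ge0 ?mulr_ge0// ltW.
  have w2 : wle et (fun k => - (U t k - X n t k)) (e / 3).
    by apply/wleN/wle_mon/(UX n t); rewrite hn divr_ge0 ?mulr_ge0// ltW.
  have := wleD _ _ (wleD _ _ w1 w) w2; rewrite !addr_ge0 ?(ltW e3)// => /(_ isT isT isT isT).
  rewrite (_ : e / 3 + e / 3 + e / 3 = e); last by field.
  by apply: wle_eq => k; ring.
exists U => // t k tT.
suff : U t k - Phi T U t k = 0.
  by rewrite /Phi clamp_id// => /eqP; rewrite subr_eq0 => /eqP.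
apply: (@geo_zero R _ (nu k `^ (- et) * (4 * r))) => [|n].
  by rewrite !mulr_ge0 ?powR_ge0.
have rn : 0 <= 4 * r / 2 ^+ n by rewrite divr_ge0 ?mulr_ge0// ltW.
have w1 := UX n.+1 t.
have w2 := lP _ _ _ rn gU (gX n) (UX n) t.
rewrite -mulrA; apply: (@wle_coef R nu c0 c0_gt0 nu_c0 et (fun k => U t k - Phi T U t k)) => //.
have rn1 : 0 <= 4 * r / 2 ^+ n.+1 by rewrite divr_ge0 ?mulr_ge0// ltW.
have := wleB rn1 (_ : 0 <= 4 * r / 2 ^+ n / 2) w1 w2; rewrite divr_ge0// => /(_ isT).
rewrite (_ : 4 * r / 2 ^+ n.+1 + 4 * r / 2 ^+ n / 2 = 4 * r / 2 ^+ n); last first.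
  by rewrite exprS; field; rewrite gt_eqF.
by apply: wle_eq => j /=; ring.
Qed.

Section Solution.
Variables (T : R) (U : R -> nat -> R).
Hypotheses (T01 : 0 < T <= 1) (gU : good U)
  (UE : forall t k, 0 <= t <= T -> U t k = semi u0 t k + duh (prim U) t k).

Let T0 : 0 < T. Proof. by have /andP[] := T01. Qed.
Let T1 : T <= 1. Proof. by have /andP[] := T01. Qed.
Let hP : is_prim U (prim U). Proof. exact: (primP r_ge0 gU.1 gU.2). Qed.

Lemma sol_init k : U 0 k = u0 k.
Proof.
rewrite UE ?lexx ?(ltW T0)// duh0 addr0 /semi mulr0 oppr0 expR0 mul1r//.
Qed.

Lemma sol_holder : exists2 M, 0 <= M & forall s t, 0 <= s <= t -> t <= T ->
  wle (be + 1) (fun k => duh (prim U) t k - duh (prim U) s k)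
    (M * (t - s) `^ ((1 - (be + 1 - b')) / 2)).
Proof.
have [M M0 hM] := Hbound r_ge0.
have k0 : 0 < 1 - (be + 1 - b') by rewrite subr_gt0; case/andP: be_b'.
exists (4 / (1 - (be + 1 - b')) * M).
  by rewrite mulr_ge0// divr_ge0// ltW.
move=> s t st tT; apply: (duhamel_holder c0_gt0 nu_c0 hP) => //.
  exact: le_trans tT T1.
by move=> x _; apply: hM; exact: gU.2.
Qed.

Let rho := be + 1 - et.
Let rho01 : 0 <= rho <= 1. Proof. by move: be_et; rewrite /rho => /andP[? ?]; lra. Qed.
Let etrho : et + rho = be + 1. Proof. by rewrite /rho; ring. Qed.

(** No regularity in time of the nonlinearity is needed to reach the order [be + 1], because
    it takes values in the slightly better order [b']. *)
Lemma sol_reg t : 0 < t <= T -> exists2 M, 0 <= M & wle (be + 1) (U t) M.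
Proof.
move=> /andP[t0 tT]; have [M M0 hM] := sol_holder.
have := semi_reg c0_gt0 nu_c0 u0_le t0 rho01; rewrite etrho => w1.
have t0' : 0 <= (0 : R) <= t by rewrite lexx ltW.
have w2 := hM _ _ t0' tT.
have p1 : 0 <= t `^ (- rho) * r0 by rewrite mulr_ge0 ?powR_ge0.
have p2 : 0 <= M * (t - 0) `^ ((1 - (be + 1 - b')) / 2) by rewrite mulr_ge0 ?powR_ge0.
exists (t `^ (- rho) * r0 + M * (t - 0) `^ ((1 - (be + 1 - b')) / 2)); first exact: addr_ge0.
apply: wle_eq (wleD p1 p2 w1 w2) => k.
by rewrite duh0 subr0 UE// tT ltW.
Qed.

Lemma sol_reg_cont t e : 0 < t < T -> 0 < e -> exists2 d, 0 < d & forall s, `|s - t| < d ->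
  0 < s < T /\ wle (be + 1) (fun k => U s k - U t k) e.
Proof.
move=> /andP[t0 tT] e0; have [M M0 hM] := sol_holder.
have e2 : 0 < e / 2 by rewrite divr_gt0.
have t2 : 0 < t / 2 by rewrite divr_gt0.
pose B := (t / 2)^-1 * r0; have B0 : 0 <= B by rewrite mulr_ge0// invr_ge0 ltW.
have B1 : 0 < B + 1 by rewrite ltr_wpDl.
have M1 : 0 < M + 1 by rewrite ltr_wpDl.
have rh : 0 < 1 - rho by move: be_et; rewrite /rho => /andP[? ?]; lra.
have ka2 : 0 < (1 - (be + 1 - b')) / 2.
  by rewrite divr_gt0// subr_gt0; case/andP: be_b'.
have [d1 /andP[d10 _] hd1] := root_small (divr_gt0 e2 B1) rh.
have [d2 /andP[d20 _] hd2] := root_small (divr_gt0 e2 M1) ka2.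
have main x y : t / 2 <= x -> x <= y -> y <= T -> y - x < d1 -> y - x < d2 ->
    wle (be + 1) (fun k => U y k - U x k) e.
  move=> tx xy yT h1 h2; have yx0 : 0 <= y - x by rewrite subr_ge0.
  have x0 : 0 < x by exact: lt_le_trans tx.
  have sxy : 0 < x <= y by rewrite x0.
  have := semi_reg_cont c0_gt0 nu_c0 u0_le sxy rho01; rewrite etrho => w1.
  have xy0 : 0 <= x <= y by rewrite ltW.
  have w2 := hM _ _ xy0 yT.
  have w1' : wle (be + 1) (fun k => semi u0 y k - semi u0 x k) (e / 2).
    apply: wle_mon w1; rewrite !mulr_ge0 ?powR_ge0 ?invr_ge0 ?(ltW x0)//=.
    have h3 : x^-1 * r0 <= B by rewrite ler_wpM2r// lef_pV2 ?posrE.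
    apply: le_trans (_ : e / 2 / (B + 1) * B <= _).
      apply: ler_pM => //; rewrite ?powR_ge0 ?mulr_ge0 ?invr_ge0 ?(ltW x0)//.
      by apply: hd1; rewrite yx0 ltW.
    by rewrite -mulrA ler_piMr ?(ltW e2)// mulrC ler_pdivrMr// mul1r lerDl.
  have w2' : wle (be + 1) (fun k => duh (prim U) y k - duh (prim U) x k) (e / 2).
    apply: wle_mon w2; rewrite !mulr_ge0 ?powR_ge0//=.
    apply: le_trans (_ : M * (e / 2 / (M + 1)) <= _).
      by rewrite ler_wpM2l//; apply: hd2; rewrite yx0 ltW.
    by rewrite mulrCA ler_piMr ?(ltW e2)// ler_pdivrMr// mul1r lerDl.
  have := wleD (ltW e2) (ltW e2) w1' w2'; rewrite -splitr.
  apply: wle_eq => k; rewrite !UE; first by ring.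
    by rewrite (ltW x0) (le_trans xy).
  by rewrite yT (le_trans (ltW x0)).
exists (Num.min (Num.min d1 d2) (Num.min (t / 2) (T - t))).
  by rewrite !lt_min d10 d20 t2 subr_gt0.
move=> s; rewrite !lt_min => /andP[/andP[h1 h2] /andP[h3 h4]].
have [a1 a2] : t / 2 < s /\ s < T.
  by move: h3 h4; rewrite !ltr_norml => /andP[? ?] /andP[? ?]; split; lra.
split; first by rewrite a2 (lt_trans t2).
have [st|/ltW ts] := leP s t.
  rewrite distrC ger0_norm ?subr_ge0// in h1; rewrite distrC ger0_norm ?subr_ge0// in h2.
  have := wleN (main _ _ (ltW a1) st (ltW tT) h1 h2).
  by apply: wle_eq => k; ring.
rewrite ger0_norm ?subr_ge0// in h1; rewrite ger0_norm ?subr_ge0// in h2.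
by apply: main => //; [lra|exact: ltW].
Qed.

Definition rhs (c : nat -> R) k := H c k - nu k * c k.

Lemma sol_rhs_cont t e : 0 < t < T -> 0 < e -> exists2 d, 0 < d & forall s, `|s - t| < d ->
  0 < s < T /\ wle be (fun k => rhs (U s) k - rhs (U t) k) e.
Proof.
move=> tT e0; have e2 : 0 < e / 2 by rewrite divr_gt0.
have [d1 d10 h1] := sol_reg_cont tT e2.
have [L L0 hL] := HLip r_ge0.
have p : 0 < c0 `^ (be - b') * L + 1 by rewrite ltr_wpDl// mulr_ge0// powR_ge0.
have [m m0 mE] : exists2 m : R, 0 < m & m * (c0 `^ (be - b') * L + 1) = e / 2.
  exists (e / 2 / (c0 `^ (be - b') * L + 1)); first by rewrite divr_gt0.
  by rewrite divfK// gt_eqF.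
have [d2 d20 h2] := gU.1 t _ m0.
exists (Num.min d1 d2) => [|s]; first by rewrite lt_min d10.
rewrite lt_min => /andP[/h1[sT w1] /h2 w2]; split => //.
have w3 := hL _ _ _ (ltW m0) (gU.2 s) (gU.2 t) w2.
have w3' : wle be (fun k => H (U s) k - H (U t) k) (e / 2).
  apply: wle_mon (wle_exp c0_gt0 nu_c0 be_le w3).
  have cL : 0 <= c0 `^ (be - b') * L by rewrite mulr_ge0 ?powR_ge0.
  by rewrite -mE mulrA; move: cL m0; nra.
have w1' : wle be (fun k => nu k * (U s k - U t k)) (e / 2).
  apply: bl2_eq w1 => k; rewrite powRD ?(gt_eqF (nu0 k)) ?implybT// powRr1 ?(ltW (nu0 k))//.
  by rewrite mulrA.
have := wleB (ltW e2) (ltW e2) w3' w1'; rewrite -splitr.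
by apply: wle_eq => k; rewrite /rhs; ring.
Qed.

Let V t k := semi u0 t k + duh (prim U) t k.

Lemma sol_der t k : -1 < t -> is_derive t 1 (V ^~ k) (H (U t) k - nu k * V t k).
Proof.
move=> t1.
have hexp := der_exp (- nu k) t.
have h1 := derM hexp (derD (derC t (u0 k)) (derB (hP k t1) (derC t (prim U k 0)))).
rewrite (_ : V ^~ k = fun t => expR (- nu k * t) * (u0 k + (prim U k t - prim U k 0))).
  apply: is_derive_eq; rewrite /V /semi /duh !mulNr.
  have := expRxMexpNx_1 (nu k * t) => E.
  rewrite [X in X = _](_ : _ = expR (nu k * t) * expR (- (nu k * t)) * H (U t) k
    - nu k * (expR (- (nu k * t)) * u0 k + expR (- (nu k * t)) * (prim U k t - prim U k 0))).
    by rewrite E mul1r.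
  by ring.
by apply/funext => x; rewrite /V /semi /duh !mulNr; ring.
Qed.

(** The difference quotients converge in the weight [be] because the right-hand
    side is continuous there. *)
Lemma sol_diff t e : 0 < t < T -> 0 < e -> exists2 d, 0 < d & forall s, s != 0 -> `|s| < d ->
  0 < t + s < T /\ wle be (fun k => s^-1 * (U (t + s) k - U t k) - rhs (U t) k) e.
Proof.
move=> tT e0; have [d d0 hd] := sol_rhs_cont tT e0; exists d => // s s0 sd.
have ts : `|t + s - t| < d by rewrite addrAC subrr add0r.
have [tsT _] := hd _ ts; split => //.
apply: bl2_dual => [|K dd d1]; first exact: ltW.
have hdN : \sum_(k < K) (- dd k) ^+ 2 <= 1 by under eq_bigr do rewrite sqrrN.
pose g x := \sum_(k < K) nu k `^ be * dd k * (V x k - x * rhs (U t) k).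
pose dg x := \sum_(k < K) nu k `^ be * dd k * (H (U x) k - nu k * V x k - 1 * rhs (U t) k).
have hg x : -1 < x -> is_derive x 1 g (dg x).
  move=> x1; apply: der_sum => k; apply: derZ; apply: derB; first exact: sol_der.
  by have := derM (derid x) (derC x (rhs (U t) k)); rewrite mulr0 addr0.
have bg x : `|x - t| < d -> 0 < x < T -> `|dg x| <= e.
  move=> xd xT; have [_ w] := hd _ xd.
  have E : dg x = \sum_(k < K) (nu k `^ be * (rhs (U x) k - rhs (U t) k)) * dd k.
    apply: eq_bigr => k _; rewrite {2}/rhs UE; first by rewrite -/(V x k) mul1r; ring.
    by case/andP: xT => /ltW -> /ltW ->.
  rewrite ler_norml E (bl2_pair (ltW e0) w d1) andbT lerNl.
  apply: le_trans (bl2_pair (d := fun k => - dd k) (ltW e0) w hdN).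
  by rewrite -sumrN; apply: ler_sum => k _; rewrite mulrN.
have E : \sum_(k < K) nu k `^ be * (s^-1 * (U (t + s) k - U t k) - rhs (U t) k) * dd k =
    s^-1 * (g (t + s) - g t).
  rewrite /g -sumrB mulr_sumr; apply: eq_bigr => k _.
  rewrite !UE; first by rewrite -!/(V _ k); field.
    by case/andP: tT => /ltW -> /ltW ->.
  by case/andP: tsT => /ltW -> /ltW ->.
rewrite E; have [t0 tT'] := andP tT; have [ts0 tsT'] := andP tsT.
apply: le_trans (ler_norm _) _; rewrite normrM normfV ler_pdivrMl ?normr_gt0//.
rewrite mulrC; have [sp|sn|s00] := ltrgt0P s; last by rewrite s00 eqxx in s0.
- have := @mvt_norm R g dg t (t + s) e; rewrite lerDl (ltW sp) addrAC subrr add0r => hm.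
  apply: hm => //.
  + apply: cont_within => x /andP[tx xs]; apply: der_cont (hg x _).
    by apply: lt_le_trans tx; lra.
  + by move=> x /andP[tx xs]; apply: hg; lra.
  + move=> x /andP[tx xs]; apply: bg; last by lra.
    by move: sd; rewrite (gtr0_norm sp) ger0_norm; lra.
- rewrite distrC -(opprK s); have := @mvt_norm R g dg (t + s) t e.
  rewrite opprK; have -> : t - (t + s) = - s by ring.
  move=> hm; apply: hm => //.
  + by lra.
  + apply: cont_within => x /andP[tx xs]; apply: der_cont (hg x _).
    by apply: lt_le_trans tx; lra.
  + by move=> x /andP[tx xs]; apply: hg; lra.
  + move=> x /andP[tx xs]; apply: bg; last by lra.
    by move: sd; rewrite (ltr0_norm sn) distrC ger0_norm; lra.
Qed.

End Solution.
End Existence.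

(** ** Uniqueness *)

Section Uniqueness.
Variables (T1 : R) (U W : R -> nat -> R).

Definition rcont U : Prop := forall t e, 0 <= t < T1 -> 0 < e ->
  exists2 d, 0 < d & forall s, 0 <= s < T1 -> `|s - t| < d ->
  wle et (fun k => U s k - U t k) e.

Hypotheses (bU : forall t, 0 <= t < T1 -> exists2 M, 0 <= M & wle et (U t) M)
  (bW : forall t, 0 <= t < T1 -> exists2 M, 0 <= M & wle et (W t) M)
  (cU : rcont U) (cW : rcont W)
  (dU : forall t k, 0 < t < T1 -> is_derive t 1 (U ^~ k) (rhs (U t) k))
  (dW : forall t k, 0 < t < T1 -> is_derive t 1 (W ^~ k) (rhs (W t) k))
  (UW0 : forall k, U 0 k = W 0 k).

(* Clamping the time makes the contraction argument, stated for functions on the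
   whole line, apply to a solution known only on a short interval. *)
Let shift X s de : R -> nat -> R := fun x => X (s + clamp de x).

Lemma shift_ccont X s de : rcont X -> 0 <= s -> 0 <= de -> s + de < T1 -> ccont (shift X s de).
Proof.
move=> cX s0 de0 sT t e e0.
have itv y : 0 <= s + clamp de y < T1.
  by have /andP[? ?] := clamp_itv y de0; apply/andP; split; lra.
have [d d0 hd] := cX _ e (itv t) e0; exists d => // y yt; apply: hd => //.
apply: le_lt_trans yt; apply: le_trans (clamp_lip de y t).
by rewrite (_ : _ - _ = clamp de y - clamp de t)//; ring.
Qed.

(** The contraction halves any bound on the difference of two solutions. *)
Lemma uniq_local s : 0 <= s < T1 -> (forall k, U s k = W s k) ->
  exists2 de, 0 < de & s + de < T1 /\ forall t k, s <= t <= s + de -> U t k = W t k.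
Proof.
move=> sT UWs; have [s0 sT1] := andP sT.
have [MU MU0 hMU] := bU sT; have [MW MW0 hMW] := bW sT.
pose r := MU + MW + 1; have r0 : 0 <= r by rewrite /r; lra.
have [dU0 dUp hdU] := cU sT ltr01; have [dW0 dWp hdW] := cW sT ltr01.
have [L L0 hL] := HLip r0.
have ka0 : 0 < 1 - (et - b') by rewrite subr_gt0; case/andP: et_b'.
have L1 : 0 < 2 * (L + 1) by rewrite mulr_gt0// ltr_wpDl.
have [d3 /andP[d30 _] hd3] := root_small (divr_gt0 ka0 L1) ka0.
pose de := Num.min (Num.min (dU0 / 2) (dW0 / 2)) (Num.min ((T1 - s) / 2) d3).
have de0 : 0 < de by rewrite /de !lt_min !divr_gt0// subr_gt0.
have : de <= de by [].
rewrite {2}/de !le_min => /andP[/andP[l1 l2] /andP[l3 l4]].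
have sde : s + de < T1 by lra.
exists de => //; split => //.
pose u := shift U s de; pose w := shift W s de.
have cu : ccont u by apply: shift_ccont => //; exact: ltW.
have cw : ccont w by apply: shift_ccont => //; exact: ltW.
have clp x : 0 <= clamp de x <= de by apply: clamp_itv; exact: ltW.
have itv x : 0 <= s + clamp de x < T1.
  by have /andP[? ?] := clp x; apply/andP; split; lra.
have dist x : `|s + clamp de x - s| <= de.
  by rewrite addrAC subrr add0r; have /andP[? ?] := clp x; rewrite ger0_norm.
have bu x : wle et (u x) r.
  have h : `|s + clamp de x - s| < dU0 by apply: le_lt_trans (dist x) _; lra.
  have := wleD ler01 MU0 (hdU _ (itv x) h) hMU => w1.
  by apply: wle_mon (wle_eq _ w1) => [|k]; [rewrite /r; lra|rewrite subrK].
have bw x : wle et (w x) r.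
  have h : `|s + clamp de x - s| < dW0 by apply: le_lt_trans (dist x) _; lra.
  have := wleD ler01 MW0 (hdW _ (itv x) h) hMW => w1.
  by apply: wle_mon (wle_eq _ w1) => [|k]; [rewrite /r; lra|rewrite subrK].
have hPu := primP r0 cu bu; have hPw := primP r0 cw bw.
pose h t k := H (u t) k - H (w t) k.
pose P k t := prim u k t - prim w k t.
have hP k x : -1 < x -> is_derive x 1 (P k) (expR (nu k * x) * h x k).
  by move=> x1; rewrite mulrBr; apply: derB; [exact: hPu|exact: hPw].
have coefc X (cX : ccont X) k : continuous (fun x => X x k).
  move=> t; apply/cvgrPdist_lt => e e0.
  have p : 0 < nu k `^ (- et) by exact: powR_gt0.
  have [d d0 hd] := cX t (e / (2 * nu k `^ (- et))) (divr_gt0 e0 (mulr_gt0 (ltr0Sn _ 1) p)).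
  apply/nbhs_normP; exists d => //= y; rewrite /= distrC => /hd.
  move=> /(wle_coef c0_gt0 nu_c0 k) => h1; rewrite distrC.
  apply: le_lt_trans (h1 _) _; first by rewrite divr_ge0 ?(ltW e0)// mulr_ge0// ltW.
  have -> : nu k `^ (- et) * (e / (2 * nu k `^ (- et))) = e / 2.
    by field; rewrite gt_eqF.
  by rewrite ltr_pdivrMr// ltr_pMr// ltr1n.
have mild x k : 0 <= x <= de -> u x k - w x k = duh P x k.
  move=> /andP[x0 xde].
  pose g y := expR (nu k * y) * (u y k - w y k) - P k y.
  have cg : {within `[0, x], continuous g}.
    apply: cont_within => y /andP[y0 yx].
    have h1 : {for y, continuous (fun y => expR (nu k * y))} := der_cont (der_exp (nu k) y).
    have h2 : {for y, continuous (P k)} by apply: der_cont (hP k y _); lra.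
    have h3 : {for y, continuous (fun y => u y k)} by apply: (coefc u cu).
    have h4 : {for y, continuous (fun y => w y k)} by apply: (coefc w cw).
    exact: cvgB (cvgM h1 (cvgB h3 h4)) h2.
  have dshift X (dX : forall t k, 0 < t < T1 -> is_derive t 1 (X ^~ k) (rhs (X t) k)) y :
      0 < y < x -> is_derive y 1 (fun y => shift X s de y k) (rhs (shift X s de y) k).
    move=> /andP[y0 yx].
    have yT : 0 < s + y < T1 by apply/andP; split; lra.
    have := @der_comp R (X ^~ k) (fun y => s + y) y _ _ (dX _ k yT) (derD (derC y s) (derid y)).
    rewrite add0r mulr1 => hd.
    have E : rhs (shift X s de y) k = rhs (X (s + y)) k.
      by rewrite /shift clamp_id// (ltW y0)/= ltW// (lt_le_trans yx).
    rewrite E; apply: near_eq_is_derive hd => //.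
    near=> z; rewrite /shift clamp_id//; apply/andP; split.
      by apply: ltW; near: z; exact: lt_nbhsr.
    apply: le_trans xde; apply: ltW; near: z; exact: lt_nbhsl.
  have := @mvt_norm R g (fun=> 0) 0 x 0 x0 cg.
  rewrite mul0r => hm.
  have : `|g x - g 0| <= 0.
    apply: hm => [y yx|y _]; last by rewrite normr0.
    have y1 : -1 < y by lra.
    have hd := derB (derM (der_exp (nu k) y) (derB (dshift U dU y yx) (dshift W dW y yx))) (hP k y y1).
    rewrite (_ : _ + _ - _ = 0) in hd; first exact: hd.
    by rewrite /h /rhs -/u -/w; ring.
  rewrite normr_le0 subr_eq0 => /eqP; rewrite /g mulr0 expR0 mul1r.
  have -> : u 0 k = w 0 k.
    by rewrite /u /w /shift clamp_id ?lexx ?(ltW de0)// addr0 UWs.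
  rewrite subrr add0r => E.
  rewrite /duh (_ : P k x - P k 0 = expR (nu k * x) * (u x k - w x k)); last by move: E; lra.
  by rewrite mulrA [expR (- _) * _]mulrC expRxMexpNx_1 mul1r.
have main m : 0 <= m -> (forall x, wle et (fun k => u x k - w x k) m) ->
    forall x, wle et (fun k => u x k - w x k) (m / 2).
  move=> m0 hm x.
  have -> : (fun k => u x k - w x k) = fun k => u (clamp de x) k - w (clamp de x) k.
    by rewrite /u /w /shift (@clamp_id _ de (clamp de x)).
  have /andP[y0 yde] := clp x; move: (clamp de x) y0 yde => y y0 yde.
  have Lm : 0 <= L * m by rewrite mulr_ge0.
  have st : 0 <= (0 : R) <= y by rewrite lexx.
  have := duhamel_bound c0_gt0 nu_c0 hP et_b' st Lm
    (fun z _ => hL _ _ _ m0 (bu z) (bw z) (hm z)); rewrite subr0 => w1.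
  apply: wle_mon (wle_eq _ w1); last by move=> k; rewrite mild ?y0.
  rewrite mulr_ge0 ?powR_ge0 ?divr_ge0 ?(ltW ka0)//=.
  have yd3 : 0 <= y <= d3 by rewrite y0 (le_trans yde).
  have q : 0 <= L * m / (1 - (et - b')) by rewrite divr_ge0// ltW.
  apply: le_trans (ler_wpM2l q (hd3 _ yd3)) _.
  have -> : L * m / (1 - (et - b')) * ((1 - (et - b')) / (2 * (L + 1))) = m / 2 * (L / (L + 1)).
    by field; rewrite !gt_eqF// ltr_wpDl.
  by rewrite ler_piMr ?divr_ge0// ler_pdivrMr ?ltr_wpDl// mul1r lerDl.
have all n x : wle et (fun k => u x k - w x k) (2 * r / 2 ^+ n).
  elim: n x => [|n IH] x; last first.
    rewrite exprSr invfM mulrA; apply: main => //.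
    by rewrite divr_ge0 ?mulr_ge0// exprn_ge0.
  rewrite expr0 divr1 mulr2n mulrDl mul1r.
  exact: wleB.
move=> t k /andP[st tde]; apply/eqP; rewrite -subr_eq0; apply/eqP.
apply: (@geo_zero R _ (nu k `^ (- et) * (2 * r))) => [|n].
  by rewrite !mulr_ge0 ?powR_ge0.
rewrite -mulrA.
have rn : 0 <= 2 * r / 2 ^+ n by rewrite divr_ge0 ?mulr_ge0// exprn_ge0.
have := wle_coef c0_gt0 nu_c0 k rn (all n (t - s)).
rewrite /u /w /shift clamp_id; first by rewrite (_ : s + (t - s) = t)//; ring.
by apply/andP; split; lra.
Unshelve. all: by end_near. Qed.

(** By [uniq_local], the supremum of the times up to which the solutions agree is the end. *)
Lemma uniq_global t k : 0 <= t < T1 -> U t k = W t k.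
Proof.
move=> tT; have [t0 tT1] := andP tT.
pose S := [set s | 0 <= s <= t /\ forall x j, 0 <= x <= s -> U x j = W x j].
have S0 : S 0.
  split=> [|x j]; first by rewrite lexx.
  by rewrite -eq_le => /eqP <-; exact: UW0.
have Sub : ubound S t by move=> s [/andP[]].
have hS : has_sup S by split; [exists 0|exists t].
have s0 : 0 <= sup S by apply: ub_le_sup => //; exists t.
have st : sup S <= t by apply: ge_sup => //; exists 0.
have below x j : 0 <= x < sup S -> U x j = W x j.
  move=> /andP[x0 xS].
  have e0 : 0 < sup S - x by rewrite subr_gt0.
  have [s [_ hs] xs] := sup_adherent e0 hS.
  by apply: hs; rewrite x0; lra.
have sT : 0 <= sup S < T1 by rewrite s0; lra.
have at_ j : U (sup S) j = W (sup S) j.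
  move: s0; rewrite le_eqVlt => /predU1P[<-|sp]; first exact: UW0.
  apply/eqP; rewrite -subr_eq0; apply/eqP.
  apply: (@geo_zero R _ (nu j `^ (- et) * 2)) => [|n]; first by rewrite mulr_ge0// powR_ge0.
  have p2 : 0 < (2 ^+ n)^-1 :> R by rewrite invr_gt0 exprn_gt0.
  have [d1 d10 h1] := cU sT p2; have [d2 d20 h2] := cW sT p2.
  pose x := sup S - Num.min (Num.min d1 d2 / 2) (sup S / 2).
  have m0 : 0 < Num.min (Num.min d1 d2 / 2) (sup S / 2).
    by rewrite !lt_min !divr_gt0// lt_min d10.
  have m1 : Num.min (Num.min d1 d2 / 2) (sup S / 2) <= Num.min d1 d2 / 2 by rewrite ge_min lexx.
  have m2 : Num.min (Num.min d1 d2 / 2) (sup S / 2) <= sup S / 2 by rewrite ge_min lexx orbT.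
  have m3 : Num.min d1 d2 <= d1 by rewrite ge_min lexx.
  have m4 : Num.min d1 d2 <= d2 by rewrite ge_min lexx orbT.
  have m5 : 0 < Num.min d1 d2 by rewrite lt_min d10.
  have xS : 0 <= x < sup S by rewrite /x; lra.
  have xT : 0 <= x < T1 by lra.
  have dx : `|x - sup S| = Num.min (Num.min d1 d2 / 2) (sup S / 2).
    by rewrite distrC ger0_norm /x; lra.
  have w1 := h1 _ xT; have w2 := h2 _ xT.
  have {}w1 : wle et (fun k => U x k - U (sup S) k) (2 ^+ n)^-1 by apply: w1; rewrite dx; lra.
  have {}w2 : wle et (fun k => W x k - W (sup S) k) (2 ^+ n)^-1 by apply: w2; rewrite dx; lra.
  have := wleB (ltW p2) (ltW p2) w2 w1 => w3.
  have p3 : 0 <= (2 ^+ n)^-1 + (2 ^+ n)^-1 :> R by rewrite addr_ge0// ltW.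
  have := wle_coef c0_gt0 nu_c0 j p3 w3; rewrite (below x j xS).
  rewrite (_ : _ - _ - _ = U (sup S) j - W (sup S) j); last by ring.
  by rewrite -mulrA mulr2n mulrDl mul1r.
have [de de0 [sde hde]] := uniq_local sT at_.
have all x j : 0 <= x <= sup S + de -> U x j = W x j.
  move=> /andP[x0 xs]; have [xS|Sx] := ltP x (sup S); first by apply: below; rewrite x0.
  by apply: hde; rewrite Sx.
have [tS|St] := leP t (sup S + de); first by apply: all; rewrite t0.
have : S (sup S + de).
  by split=> //; rewrite addr_ge0 ?(ltW de0)//= ltW.
move=> /(ub_le_sup (ex_intro _ t Sub)); rewrite gerDl leNgt de0//.
Qed.

End Uniqueness.
End Evolution.

(** * Square-integrable functions *)

Section L2.
Context d (T : measurableType d) (R : realType) (mu : {measure set T -> \bar R}).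
Implicit Types (u v w f g : T -> R) (c : R).

Definition sqi u : Prop :=
  measurable_fun setT u /\ mu.-integrable setT (EFin \o (fun x => u x ^+ 2)).

Lemma Lfun2P u : u \in Lfun mu 2%:E <-> sqi u.
Proof.
split=> [h|[mu_ iu]].
  split; last exact: Lfun2_integrable_sqr.
  by move: h; rewrite inE => /andP[+ _]; rewrite inE.
rewrite inE; apply/andP; split; first by rewrite inE.
rewrite !inE/= /finite_norm unlock.
apply: poweR_lty; move/integrableP: iu => [_]; apply: le_lt_trans.
rewrite le_eqVlt; apply/orP; left; apply/eqP; apply: eq_integral => x _ /=.
by rewrite normrX powR_mulrn.
Qed.

Lemma ge0_fine_Rintegral f : (forall x, 0 <= f x) -> mu.-integrable setT (EFin \o f) ->
  (\int[mu]_x (f x)%:E)%E = (\int[mu]_x f x)%:E.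
Proof.
by move=> f0 fi; rewrite /Rintegral fineK//; exact: integrable_fin_num.
Qed.

Lemma L2normE u : sqi u ->
  fine ('N[mu]_(2%:E)[EFin \o u])%E = Num.sqrt (\int[mu]_x (u x * u x)).
Proof.
move=> [mu_ iu]; rewrite unlock.
have -> : (\int[mu]_x (`|(EFin \o u) x| `^ 2))%E = (\int[mu]_x (u x * u x))%:E.
  rewrite (_ : \int[mu]_x (u x * u x) = \int[mu]_x (u x ^+ 2))%R; last first.
    by apply: eq_Rintegral => x _; rewrite expr2.
  rewrite -ge0_fine_Rintegral//; last by move=> x; exact: sqr_ge0.
  apply: eq_integral => x _ /=.
  by rewrite powR_mulrn// real_normK ?num_real.
by rewrite poweR_EFin/= powR12_sqrt// Rintegral_ge0// => x _; rewrite -expr2 sqr_ge0.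
Qed.

Lemma sqi_mul_int u v : sqi u -> sqi v -> mu.-integrable setT (EFin \o (fun x => u x * v x)).
Proof. by move=> /Lfun2P hu /Lfun2P hv; exact/Lfun1_integrable/Lfun2_mul_Lfun1. Qed.

Lemma mul_int_w u v (w : T -> R) C : sqi u -> sqi v -> measurable_fun setT w ->
  (forall x, `|w x| <= C) -> mu.-integrable setT (EFin \o (fun x => u x * v x * w x)).
Proof.
move=> hu hv mw wC; have hi := sqi_mul_int hu hv.
apply: (@le_integrable _ _ _ _ _ _ _ (EFin \o (fun x => C * (u x * v x)))) => //.
- apply/measurable_EFinP; apply: measurable_funM => //.
  by apply: measurable_funM; [case: hu|case: hv].
- move=> x _; rewrite lee_fin normrM [leRHS]normrM mulrC ler_wpM2r//.
  by apply: le_trans (wC x) _; exact: ler_norm.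
- by have := integrableZl measurableT C hi; apply: eq_integrable => // x _; rewrite /= EFinM.
Qed.

Lemma sqi0 : sqi (cst 0).
Proof.
split; first exact: measurable_cst.
rewrite (_ : EFin \o _ = cst 0%E); first exact: integrable0.
by apply/funext => x; rewrite /= expr0n.
Qed.

Lemma sqi_lin c u v : sqi u -> sqi v -> sqi (c *: u + v).
Proof.
move=> hu hv; have [mu_ _] := hu; have [mv _] := hv; split.
  by apply: measurable_funD => //; apply: measurable_funM => //; exact: measurable_cst.
apply: (@le_integrable _ _ _ _ _ _ _ (EFin \o (fun x => 2 * (c ^+ 2 * (u x ^+ 2)) + 2 * (v x ^+ 2)))) => //.
- apply/measurable_EFinP; apply: measurable_funX.
  by apply: measurable_funD => //; apply: measurable_funM => //; exact: measurable_cst.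
- move=> x _; rewrite lee_fin /= ger0_norm ?sqr_ge0// ger0_norm; last first.
    by have := sqr_ge0 (c * u x); have := sqr_ge0 (v x); rewrite exprMn; lra.
  have -> : (c *: u + v) x = c * u x + v x by [].
  by have := sqr_ge0 (c * u x - v x); rewrite !sqrrD; nra.
- rewrite (_ : EFin \o _ = ((fun x => 2%:E * ((c ^+ 2)%:E * (u x ^+ 2)%:E)) \+ (fun x => 2%:E * (v x ^+ 2)%:E))%E); last first.
    by apply/funext => x; rewrite /= EFinD !EFinM.
  by apply: integrableD => //; do ?apply: integrableZl => //; [case: hu|case: hv].
Qed.

Lemma sqi_bound u v : measurable_fun setT u -> (forall x, `|u x| <= `|v x|) -> sqi v -> sqi u.
Proof.
move=> mu_ uv [mv iv]; split=> //; apply: le_integrable iv => //.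
  by apply/measurable_EFinP; exact: measurable_funX.
move=> x _; rewrite lee_fin /= !normrX ler_sqr ?nnegrE//.
Qed.

Lemma sqi_mulw u (w : T -> R) C : sqi u -> measurable_fun setT w -> (forall x, `|w x| <= C) ->
  sqi (fun x => w x * u x).
Proof.
move=> hu mw wC; apply: (@sqi_bound _ (C *: u)).
- by apply: measurable_funM => //; case: hu.
- move=> x; rewrite normrM [leRHS]normrM ler_wpM2r//; apply: le_trans (wC x) _; exact: ler_norm.
- by rewrite -[C *: u]addr0; apply: sqi_lin => //; exact: sqi0.
Qed.

Lemma Rintegral_sum (I : Type) (r : seq I) (F : I -> T -> R) :
  (forall i, mu.-integrable setT (EFin \o F i)) ->
  \int[mu]_x (\sum_(i <- r) F i x) = \sum_(i <- r) \int[mu]_x F i x /\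
  mu.-integrable setT (EFin \o (fun x => \sum_(i <- r) F i x)).
Proof.
move=> h; elim: r => [|i r [IH1 IH2]].
  rewrite big_nil; split.
    rewrite (_ : (fun x => _) = cst 0) ?Rintegral_cst ?mul0r//.
    by apply/funext => x; rewrite big_nil.
  rewrite (_ : EFin \o _ = cst 0%E); first exact: integrable0.
  by apply/funext => x; rewrite /= big_nil.
rewrite big_cons -IH1; split.
  rewrite -RintegralD//; apply: eq_Rintegral => x _; by rewrite big_cons.
rewrite (_ : EFin \o _ = (fun x => (F i x)%:E + (\sum_(j <- r) F j x)%:E)%E).
  exact: (integrableD measurableT (h i) IH2).
by apply/funext => x; rewrite /= big_cons EFinD.
Qed.

Section Weight.
Variables (W : T -> R) (c1 C1 : R).
Hypotheses (mW : measurable_fun setT W) (c1_gt0 : 0 < c1) (Wb : forall x, c1 <= W x <= C1).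

Definition wip u v : R := \int[mu]_x (u x * v x * W x).

Let W0 x : 0 <= W x. Proof. by have /andP[h _] := Wb x; apply: le_trans h; exact: ltW. Qed.
Let WC x : `|W x| <= C1. Proof. by rewrite ger0_norm//; have /andP[] := Wb x. Qed.

Lemma wip_int u v : sqi u -> sqi v -> mu.-integrable setT (EFin \o (fun x => u x * v x * W x)).
Proof. by move=> hu hv; exact: mul_int_w WC. Qed.

Lemma wip_semiip : semiip sqi wip.
Proof.
split; [exact: sqi0|exact: sqi_lin| | |].
- move=> c u v w hu hv hw; rewrite /wip -RintegralZl//; last exact: wip_int.
  rewrite -RintegralD//; [|by have := integrableZl measurableT c (wip_int hu hw)|exact: wip_int].
  apply: eq_Rintegral => x _; have -> : (c *: u + v) x = c * u x + v x by [].
  by ring.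
- by move=> u v _ _; apply: eq_Rintegral => x _; rewrite [u x * _]mulrC.
- by move=> u _; apply: Rintegral_ge0 => x _; rewrite mulr_ge0// -expr2 sqr_ge0.
Qed.

Lemma wip_null u : sqi u -> wip u u = 0 -> u = cst 0 %[ae mu].
Proof.
move=> hu u0; have [mu_ iu] := hu.
have h : (\int[mu]_x `|(u x * u x * W x)%:E|)%E = 0%E.
  rewrite (_ : (fun x => _) = (fun x => (u x * u x * W x)%:E)); last first.
    by apply/funext => x; rewrite /= ger0_norm// mulr_ge0// -expr2 sqr_ge0.
  rewrite ge0_fine_Rintegral ?[X in X%:E]u0//; last exact: wip_int.
  by move=> x; rewrite mulr_ge0// -expr2 sqr_ge0.
have mf : measurable_fun setT (EFin \o (fun x => u x * u x * W x)).
  by apply/measurable_EFinP; apply: measurable_funM => //; exact: measurable_funM.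
have [/(_ h) + _] := ae_eq_integral_abs mu measurableT mf.
apply: filterS => x /= /(_ I) [] /eqP; rewrite mulf_eq0 => /orP[|/eqP W00 _].
  by rewrite mulf_eq0 orbb => /eqP ->.
by have := Wb x; rewrite W00 leNgt c1_gt0.
Qed.

Lemma ae_wip0 u v : measurable_fun setT u -> measurable_fun setT v ->
  u = cst 0 %[ae mu] -> wip u v = 0.
Proof.
move=> mu_ mv u0; rewrite /wip /Rintegral (ae_eq_integral (cst 0%E))//.
- by rewrite integral_cst// mul0e.
- by apply/measurable_EFinP; apply: measurable_funM => //; exact: measurable_funM.
- by apply: filterS u0 => x /= h _; rewrite h// !mul0r.
Qed.

End Weight.

Definition ip2 u v : R := \int[mu]_x (u x * v x).

Lemma ip2E : ip2 = wip (cst 1).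
Proof.
by apply/funext => u; apply/funext => v; apply: eq_Rintegral => x _; rewrite /cst mulr1.
Qed.

Lemma ip2_semiip : semiip sqi ip2.
Proof. by rewrite ip2E; apply: (@wip_semiip _ 1 1) => // x; rewrite /= lexx. Qed.

Lemma ip2_null u : sqi u -> ip2 u u = 0 -> u = cst 0 %[ae mu].
Proof. by rewrite ip2E; apply: (@wip_null _ 1 1) => // x; rewrite /= lexx. Qed.

Lemma wip_le W c1 C1 u : measurable_fun setT W -> 0 < c1 -> (forall x, c1 <= W x <= C1) ->
  sqi u -> c1 * ip2 u u <= wip W u u <= C1 * ip2 u u.
Proof.
move=> mW c10 Wb hu.
have iW : mu.-integrable setT (EFin \o (fun x => u x * u x * W x)) by exact: (wip_int mW c10 Wb hu hu).
have iu := sqi_mul_int hu hu.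
have uu x : 0 <= u x * u x by rewrite -expr2 sqr_ge0.
rewrite /ip2 -!RintegralZl//; apply/andP; split; apply: le_Rintegral => //.
- by have := integrableZl measurableT c1 iu.
- by move=> x _; have /andP[h _] := Wb x; rewrite mulrC ler_wpM2l.
- by have := integrableZl measurableT C1 iu.
- by move=> x _; have /andP[_ h] := Wb x; rewrite [leRHS]mulrC ler_wpM2l.
Qed.

(** A sequence whose consecutive distances decrease geometrically converges
    almost everywhere: [sum 4^k (u_{k+1} - u_k)^2] has a finite integral. *)
Lemma fast_ae_cvg (u : nat -> T -> R) : (forall k, sqi (u k)) ->
  (forall k, ip2 (u k.+1 - u k) (u k.+1 - u k) <= (16 ^+ k)^-1) ->
  {ae mu, forall x, cvgn (fun k => u k x)}.
Proof.
move=> hu hf.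
pose D k x := 4 ^+ k * ((u k.+1 - u k) x) ^+ 2.
have hd k : sqi (u k.+1 - u k) by apply: (sipB ip2_semiip).
have D0 k x : 0 <= D k x by rewrite mulr_ge0 ?sqr_ge0// exprn_ge0.
have mD k : measurable_fun setT (EFin \o D k).
  apply/measurable_EFinP; apply: measurable_funM; first exact: measurable_cst.
  by apply: measurable_funX; case: (hd k).
have iD k : (\int[mu]_x (D k x)%:E <= ((4 ^+ k)^-1)%:E)%E.
  under eq_integral do rewrite EFinM.
  rewrite ge0_integralZl//; last 2 first.
  - by apply/measurable_EFinP; apply: measurable_funX; case: (hd k).
  - by move=> x _; rewrite lee_fin sqr_ge0.
  rewrite ge0_fine_Rintegral; [|by move=> x; rewrite sqr_ge0|by case: (hd k)].
  rewrite -EFinM lee_fin; apply: le_trans (_ : 4 ^+ k * (16 ^+ k)^-1 <= _).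
    rewrite ler_wpM2l ?exprn_ge0//; apply: le_trans (hf k); rewrite le_eqVlt; apply/orP; left.
    by apply/eqP; apply: eq_Rintegral => x _; rewrite expr2.
  have -> : (16 : R) = 4 * 4 by ring.
  by rewrite exprMn invfM mulrA divff ?mul1r// expf_neq0.
pose F (x : T) : \bar R := (\sum_(0 <= k <oo) (D k x)%:E)%E.
have iF : (\int[mu]_x F x <= 2%:E)%E.
  rewrite /F integral_nneseries//; last by move=> k x _; rewrite lee_fin.
  apply: lime_le; first by apply: is_cvg_nneseries => k _ _; apply: integral_ge0 => x _; rewrite lee_fin.
  apply: nearW => n; apply: le_trans (_ : \sum_(0 <= k < n) ((4 ^+ k)^-1)%:E <= _)%E.
    by apply: lee_sum => k _.
  rewrite sumEFin lee_fin big_mkord.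
  have : \sum_(k < n) (4 ^+ k)^-1 <= 2 - 2 * (4 ^+ n)^-1 :> R.
    elim: n => [|n IH]; first by rewrite big_ord0 expr0 invr1; lra.
    rewrite big_ord_recr/= exprS invfM.
    have : 0 < (4 ^+ n)^-1 :> R by rewrite invr_gt0 exprn_gt0.
    by move: IH; move: (\sum_(_ < n) _) ((4 ^+ n)^-1) => s p; lra.
  by move/le_trans; apply; rewrite gerBl mulr_ge0// invr_ge0 exprn_ge0.
have F0 x : (0 <= F x)%E by apply: nneseries_ge0 => k _ _; rewrite lee_fin.
have mF : measurable_fun setT F.
  by apply: ge0_emeasurable_sum => [k x _ _|k _]; [rewrite lee_fin|exact: mD].
have FI : mu.-integrable setT F.
  apply/integrableP; split => //; under eq_integral do rewrite gee0_abs//.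
  by apply: le_lt_trans iF _; rewrite ltry.
apply: filterS (integrable_ae measurableT FI) => x /(_ I) Fx.
have Dx k : D k x <= fine (F x).
  rewrite -lee_fin fineK//; apply: le_trans (nneseries_lim_ge k.+1 _); last by move=> i _ _; rewrite lee_fin.
  by rewrite big_nat_recr//= leeDr// sume_ge0// => i _; rewrite lee_fin.
have Fx0 : 0 <= fine (F x) by rewrite fine_ge0.
pose s := Num.sqrt (fine (F x)).
have s2 : s ^+ 2 = fine (F x) by rewrite sqr_sqrtr.
have s0 : 0 <= s by exact: sqrtr_ge0.
have p2 n : 0 < 2 ^+ n :> R by rewrite exprn_gt0.
have dk k : `|u k.+1 x - u k x| <= s / 2 ^+ k.
  rewrite -ler_sqr ?nnegrE ?divr_ge0 ?(ltW (p2 k))// real_normK ?num_real//.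
  rewrite expr_div_n s2 -exprM mulnC exprM ler_pdivlMr ?exprn_gt0 ?exprn_gt0// mulrC.
  by have -> : (2 ^+ 2 : R) = 4 by [rewrite expr2; ring]; exact: (Dx k).
apply: (@geo_cvg R _ (2 * s)) => n m.
suff : `|u (m + n)%N x - u n x| <= 2 * s / 2 ^+ n - 2 * s / 2 ^+ (m + n).
  by move/le_trans; apply; rewrite gerBl divr_ge0 ?mulr_ge0// ltW.
elim: m => [|m IH]; first by rewrite add0n !subrr normr0.
have -> : u (m.+1 + n)%N x - u n x = (u (m + n).+1 x - u (m + n)%N x) + (u (m + n)%N x - u n x).
  by rewrite addSn; ring.
apply: le_trans (ler_normD _ _) _; apply: le_trans (lerD (dk _) IH) _.
rewrite addSn exprS le_eqVlt; apply/orP; left; apply/eqP.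
by field; rewrite !gt_eqF.
Qed.

Lemma cauchy_subseq (u : nat -> T -> R) : scauchy ip2 u ->
  exists s : nat -> nat, [/\ (forall k, (k <= s k)%N),
    (forall k m, (k <= m)%N -> (s k <= s m)%N) &
    forall k n m, (s k <= n)%N -> (s k <= m)%N -> ip2 (u n - u m) (u n - u m) < (16 ^+ k)^-1].
Proof.
move=> cu.
have ex k : exists N, forall n m, (N <= n)%N -> (N <= m)%N ->
    ip2 (u n - u m) (u n - u m) < (16 ^+ k)^-1.
  by apply: cu; rewrite invr_gt0 exprn_gt0.
have [N hN] := choice ex.
pose s := fix s k := if k is k'.+1 then maxn (s k').+1 (N k) else N 0%N.
have sS k : (s k < s k.+1)%N by rewrite /= leq_max ltnSn.
have Ns k : (N k <= s k)%N by case: k => //= k; rewrite leq_maxr.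
exists s; split.
- by elim=> // k IH; exact: leq_ltn_trans (sS k).
- by move=> k m /subnK <-; elim: (m - k)%N => // j IH; apply: leq_trans IH _; rewrite addSn ltnW.
- by move=> k n m kn km; apply: hN; exact: leq_trans (Ns k) _.
Qed.

Lemma fatou_lim (h : nat -> T -> R) (g : T -> R) (C : \bar R) :
  (forall k, measurable_fun setT (h k)) -> (forall k x, 0 <= h k x) -> measurable_fun setT g ->
  {ae mu, forall x, h k x @[k --> \oo] --> g x} ->
  (\forall k \near \oo, (\int[mu]_x (h k x)%:E <= C)%E) -> (\int[mu]_x `|g x|%:E <= C)%E.
Proof.
move=> mh h0 mg hg hC.
have F := @fatou _ _ _ mu setT measurableT (fun k x => (h k x)%:E).
rewrite (ae_eq_integral (fun x => limn_einf (fun k => (h k x)%:E)))//; last 3 first.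
- by apply/measurable_EFinP; exact: measurableT_comp.
- rewrite (_ : (fun x => _) = fun x => oppe (limn_esup (fun k => oppe ((h k x)%:E)))); last first.
    by apply/funext => x; rewrite -limn_einfN; congr limn_einf; apply/funext => k; rewrite /comp oppeK.
  apply: measurableT_comp => //; apply: measurable_fun_limn_esup => k.
  by apply: measurableT_comp => //; exact/measurable_EFinP.
- apply: filterS hg => x /= vx _; symmetry; apply: (cvg_limn_einf_sup _).1.
  have -> : `|g x| = g x by apply: ger0_norm; apply: (cvgr_to_ge vx); exact: nearW.
  by apply/cvg_EFin; [exact: nearW|exact: vx].
apply: le_trans (F _ _) _.
- by move=> k; exact/measurable_EFinP.
- by move=> k x _; rewrite lee_fin.
rewrite limn_einf_lim; apply: lime_le; first exact: is_cvg_einfs.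
near=> n; apply: ereal_inf_le.
have [N _ hN] := hC.
exists (\int[mu]_x (h (maxn n N) x)%:E)%E; first by exists (maxn n N) => //=; rewrite leq_maxl.
by apply: hN; rewrite /= leq_maxr.
Unshelve. all: by end_near. Qed.

Lemma fatou_dist (v : nat -> T -> R) g w e : (forall k, sqi (v k)) -> sqi w ->
  measurable_fun setT g -> {ae mu, forall x, v k x @[k --> \oo] --> g x} ->
  (\forall k \near \oo, ip2 (v k - w) (v k - w) <= e) ->
  sqi g /\ ip2 (g - w) (g - w) <= e.
Proof.
move=> hv hw mg vg he.
have hvw k : sqi (v k - w) by apply: (sipB ip2_semiip).
have mgw : measurable_fun setT (g - w) by apply: measurable_funB => //; case: hw.
have sqE (f : T -> R) x : `|f x ^+ 2| = f x ^+ 2 by rewrite ger0_norm ?sqr_ge0.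
have le_e : (\int[mu]_x (((g - w) x) ^+ 2)%:E <= e%:E)%E.
  under eq_integral do rewrite -sqE.
  apply: (@fatou_lim (fun k x => ((v k - w) x) ^+ 2)).
  - by move=> k; apply: measurable_funX; case: (hvw k).
  - by move=> k x; exact: sqr_ge0.
  - exact: measurable_funX.
  - apply: filterS vg => x /= vx.
    have h1 : (fun k => v k x - w x) @ \oo --> g x - w x.
      by apply: cvgB => //; exact: cvg_cst.
    have E : (fun k => (v k x - w x) * (v k x - w x)) @ \oo --> (g x - w x) * (g x - w x).
      exact: (cvgM h1 h1).
    by rewrite expr2; under eq_cvg do rewrite expr2; exact: E.
  apply: filterS he => k hk.
  rewrite ge0_fine_Rintegral; [|by move=> x; rewrite sqr_ge0|by case: (hvw k)].
  rewrite lee_fin; apply: le_trans hk.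
  by rewrite le_eqVlt; apply/orP; left; apply/eqP; apply: eq_Rintegral => x _; exact: expr2.
have sgw : sqi (g - w).
  split => //; apply/integrableP; split.
    by apply/measurable_EFinP; exact: measurable_funX.
  under eq_integral do rewrite gee0_abs ?lee_fin ?sqr_ge0//.
  by apply: le_lt_trans le_e _; rewrite ltry.
split.
  have -> : g = (g - w) + w by rewrite subrK.
  exact: (sipD ip2_semiip).
have [_ isq] := sgw.
move: le_e; rewrite ge0_fine_Rintegral ?lee_fin//; last by move=> x; rewrite sqr_ge0.
Qed.

Lemma ip2_complete : scomplete sqi ip2.
Proof.
move=> u hu cu; have [s [ks sm hs]] := cauchy_subseq cu.
pose v k := u (s k).
have hv k : sqi (v k) by exact: hu.
have vf k : ip2 (v k.+1 - v k) (v k.+1 - v k) <= (16 ^+ k)^-1.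
  by apply: ltW; apply: hs => //; exact: sm.
pose g x := fine (limn_esup (fun k => (v k x)%:E)).
have mg : measurable_fun setT g.
  apply: measurableT_comp; first exact: fine_measurable.
  apply: measurable_fun_limn_esup => k.
  by apply/measurable_EFinP; case: (hv k).
have vg : {ae mu, forall x, v k x @[k --> \oo] --> g x}.
  apply: filterS (fast_ae_cvg hv vf) => x cx.
  have E : (v k x)%:E @[k --> \oo] --> (limn (fun k => v k x))%:E.
    by apply/cvg_EFin; [exact: nearW|exact: cx].
  by rewrite /g (cvg_limn_einf_sup E).2.
have near_ k n : (s k <= n)%N -> sqi g /\ ip2 (g - u n) (g - u n) <= (16 ^+ k)^-1.
  move=> kn; apply: (@fatou_dist v g (u n) _ hv (hu n) mg vg).
  exists k => // m /= km; apply: ltW; apply: hs => //.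
  exact: sm.
have [hg _] := near_ 0%N _ (leqnn _).
exists g => // e e0.
have [k hk] : exists k, (16 ^+ k)^-1 < e.
  exists (Num.bound e^-1); rewrite invf_plt ?posrE ?exprn_gt0//.
  apply: lt_trans (archi_boundP _) _; first by rewrite invr_ge0 ltW.
  by rewrite -natrX ltr_nat ltn_expl.
exists (s k) => n kn; have [_] := near_ k n kn.
rewrite (bBBC ip2_semiip)// => h; exact: le_lt_trans hk.
Qed.

(** A subsequence is chosen fast enough for [fast_ae_cvg]. *)
Lemma ae_subseq (u : nat -> T -> R) g : (forall n, sqi (u n)) -> sqi g -> sconv ip2 u g ->
  exists s : nat -> nat, (forall k, (k <= s k)%N) /\
    {ae mu, forall x, u (s k) x @[k --> \oo] --> g x}.
Proof.
move=> hu hg ug; have cu := sconv_cauchy ip2_semiip hu hg ug.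
have [s [ks sm hs]] := cauchy_subseq cu.
pose v k := u (s k).
have hv k : sqi (v k) by exact: hu.
have vf k : ip2 (v k.+1 - v k) (v k.+1 - v k) <= (16 ^+ k)^-1.
  by apply: ltW; apply: hs => //; exact: sm.
pose f x := fine (limn_esup (fun k => (v k x)%:E)).
have mf : measurable_fun setT f.
  apply: measurableT_comp; first exact: fine_measurable.
  apply: measurable_fun_limn_esup => k.
  by apply/measurable_EFinP; case: (hv k).
have vf' : {ae mu, forall x, v k x @[k --> \oo] --> f x}.
  apply: filterS (fast_ae_cvg hv vf) => x cx.
  have E : (v k x)%:E @[k --> \oo] --> (limn (fun k => v k x))%:E.
    by apply/cvg_EFin; [exact: nearW|exact: cx].
  by rewrite /f (cvg_limn_einf_sup E).2.
have fg e : 0 < e -> sqi f /\ ip2 (f - g) (f - g) <= e.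
  move=> e0; apply: (@fatou_dist v f g _ hv hg mf vf').
  have [N hN] := ug _ e0; exists N => // k /= Nk; apply: ltW; apply: hN.
  exact: leq_trans Nk (ks k).
have [hf _] := fg 1 ltr01.
have fg0 : ip2 (f - g) (f - g) = 0.
  apply/le_anti; rewrite (sip_ge0 ip2_semiip (sipB ip2_semiip hf hg)) andbT.
  by apply/ler_addgt0Pr => e e0; rewrite add0r; have [] := fg e e0.
exists s; split => //.
have := ip2_null (sipB ip2_semiip hf hg) fg0.
apply: filterS2 vf' => x h1 h2.
suff -> : g x = f x by [].
by apply/esym/eqP; rewrite -subr_eq0; apply/eqP; exact: h2.
Qed.

End L2.

(** * The cosine system *)

Section IntegralMrestr.
Context d (T : measurableType d) (R : realType) (mu : {measure set T -> \bar R}).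
Variables (D : set T) (mD : measurable D).
Local Open Scope ereal_scope.

Lemma ge0_integral_mrestr (f : T -> \bar R) : measurable_fun setT f -> (forall x, 0 <= f x) ->
  \int[mrestr mu mD]_x f x = \int[mu]_(x in D) f x.
Proof.
move=> mf f0.
rewrite (@ge0_negligible_integral _ _ _ (mrestr mu mD) setT (~` D))//; last 2 first.
- exact: measurableC.
- by rewrite -[LHS]/(mu (~` D `&` D)) setICl measure0.
rewrite setTD setCK; apply: eq_measure_integral => A mA AD.
by rewrite -[LHS]/(mu (A `&` D)) setIidl.
Qed.

Lemma integral_mrestr (f : T -> \bar R) : measurable_fun setT f ->
  \int[mrestr mu mD]_x f x = \int[mu]_(x in D) f x.
Proof.
move=> mf; rewrite [LHS]integralE [RHS]integralE; congr (_ - _).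
  by apply: ge0_integral_mrestr => //; exact: measurable_funepos.
by apply: ge0_integral_mrestr => //; exact: measurable_funeneg.
Qed.

Lemma ae_mrestr (P : T -> Prop) : {ae mu, forall x, D x -> P x} -> {ae mrestr mu mD, forall x, P x}.
Proof.
move=> [N [mN N0 h]]; exists (N `|` ~` D); split.
- by apply: measurableU => //; exact: measurableC.
- rewrite -[LHS]/(mu ((N `|` ~` D) `&` D)) setIUl setICl setU0.
  by apply/eqP; rewrite eq_le measure_ge0 andbT -N0 le_measure ?inE//; exact: measurableI.
- move=> x /= nP; have [Dx|nDx] := pselect (D x); last by right.
  by left; apply: h => /= hx; apply: nP; exact: hx.
Qed.

End IntegralMrestr.

Section Interval.
Variable R : realType.
Local Notation leb := (@lebesgue_measure R).
Local Notation TR := (measurableTypeR R).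
Local Notation T := (measurableTypeR R * measurableTypeR R)%type.

Definition muI : set TR -> \bar R := mrestr leb (measurable_itv `](0 : R), 1[).

HB.instance Definition _ := Measure.on muI.

Lemma muI_setT : muI setT = 1%E.
Proof.
rewrite -[LHS]/(leb (setT `&` `]0, 1[)) setTI lebesgue_measure_itv/= lte_fin ltr01.
by rewrite oppr0 adde0.
Qed.

Lemma muI_fin : fin_num_fun muI.
Proof.
by apply: lty_fin_num_fun; rewrite -[X in (X < _)%E]/(muI setT) muI_setT ltry.
Qed.

HB.instance Definition _ := Measure_isFinite.Build _ _ _ muI muI_fin.

Lemma lebO_prod (A : set T) : measurable A -> lebO R A = (muI \x muI)%E A.
Proof.
move=> mA; rewrite (@product_measure_unique _ _ _ _ _ muI muI (lebO R))// => B C mB mC.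
rewrite -[LHS]/((leb \x leb)%E (B `*` C `&` Omega R)) -[X in (X * _)%E]/(leb (B `&` `]0, 1[)).
rewrite -[X in (_ * X)%E]/(leb (C `&` `]0, 1[)).
have -> : B `*` C `&` Omega R = (B `&` `]0, 1[) `*` (C `&` `]0, 1[).
  by apply/seteqP; split => [[x y] [[/= ? ?] [? ?]]|[x y] [[/= ? ?] [? ?]]].
rewrite product_measure1E//; apply: measurableI => //; exact: measurable_itv.
Qed.

Lemma integral_lebO (f : T -> \bar R) : (\int[lebO R]_x f x = \int[muI \x muI]_x f x)%E.
Proof. by apply: eq_measure_integral => A mA _; exact: lebO_prod. Qed.

Lemma integrable_lebO (f : T -> \bar R) :
  (lebO R).-integrable setT f <-> (muI \x muI)%E.-integrable setT f.
Proof.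
split=> /integrableP[mf h]; apply/integrableP; (split; first exact: mf).
  by rewrite -integral_lebO.
by rewrite integral_lebO.
Qed.

Lemma ae_lebO (P : T -> Prop) : {ae (muI \x muI)%E, forall x, P x} <-> {ae lebO R, forall x, P x}.
Proof.
split=> -[N [mN N0 h]]; exists N; split => //; first by rewrite lebO_prod.
by rewrite -lebO_prod.
Qed.

Lemma lebO_setT : lebO R setT = 1%E.
Proof.
rewrite lebO_prod// -setXTT product_measure1E// -[X in (X * X)%E]/(muI setT) muI_setT mule1//.
Qed.

Lemma lebO_OmegaC : lebO R (~` Omega R) = 0%E.
Proof. by rewrite -[LHS]/((leb \x leb)%E (~` Omega R `&` Omega R)) setICl measure0. Qed.

Lemma ae_Omega (P : T -> Prop) : (forall x, Omega R x -> P x) -> {ae lebO R, forall x, P x}.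
Proof.
move=> h; exists (~` Omega R); split.
- by apply: measurableC; exact: measurable_Omega.
- exact: lebO_OmegaC.
- by move=> x /= nP Ox; apply: nP; exact: h.
Qed.

Lemma cont_measurable (f : R -> R) : continuous f -> measurable_fun (setT : set TR) (f : TR -> R).
Proof. by move=> cf; apply: continuous_measurable_fun. Qed.

Lemma muI_itv (f : R -> R) : measurable_fun (setT : set TR) (f : TR -> R) ->
  \int[muI]_x f x = \int[leb]_(x in `[0, 1]) f x.
Proof.
move=> mf; rewrite /Rintegral integral_mrestr; last exact/measurable_EFinP.
congr fine; rewrite -integral_itv_bndo_bndc; last first.
  by apply/measurable_EFinP; exact: measurable_funTS.
rewrite -integral_itv_obnd_cbnd//.
by apply/measurable_EFinP; exact: measurable_funTS.
Qed.

Lemma FTC01 (f F : R -> R) : continuous f -> (forall x : R, is_derive x 1 F (f x)) ->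
  \int[muI]_x f x = F 1 - F 0.
Proof.
move=> cf dF; rewrite muI_itv; last exact: cont_measurable.
rewrite /Rintegral (@continuous_FTC2 _ f F)//.
- exact: continuous_subspaceT.
- split => [x _||]; first by have [] := dF x.
    by apply: cvg_at_right_filter; exact: der_cont (dF 0).
  by apply: cvg_at_left_filter; exact: der_cont (dF 1).
- by move=> x _; rewrite derive1E; have [_ ->] := dF x.
Qed.

Lemma muI_bounded_int (f : TR -> R) C : measurable_fun setT f -> (forall x, `|f x| <= C) ->
  muI.-integrable setT (EFin \o f).
Proof.
move=> mf fC; apply: measurable_bounded_integrable => //; first by rewrite -[X in (X < _)%E]/(muI setT) muI_setT ltry.
exists C; split; first exact: num_real.
by move=> M CM x _; apply: le_trans (fC x) (ltW CM).
Qed.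

(** ** Orthonormality *)

Definition cs (n : nat) (x : R) : R :=
  (if n == 0%N then 1 else Num.sqrt 2) * cos (n%:R * pi * x).

Lemma sqrt2_le : Num.sqrt (2 : R) <= 2.
Proof.
have h : Num.sqrt (2 : R) ^+ 2 = 2 by rewrite sqr_sqrtr.
have : 0 <= Num.sqrt (2 : R) by exact: sqrtr_ge0.
by move: h; move: (Num.sqrt 2) => s; nra.
Qed.

Lemma cs_bound n x : `|cs n x| <= 2.
Proof.
rewrite normrM; have c1 : `|cos (n%:R * pi * x)| <= 1 by rewrite ler_norml cos_geN1 cos_le1.
apply: le_trans (_ : 2 * 1 <= _); last by rewrite mulr1.
apply: ler_pM => //; case: ifP => _; first by rewrite normr1 ler1n.
by rewrite ger0_norm ?sqrtr_ge0// sqrt2_le.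
Qed.

Lemma der_cos (c x : R) : is_derive x 1 (fun t => cos (c * t)) (- c * sin (c * x)).
Proof.
have := der_comp (is_derive_cos (c * x)) (derZ c (derid x)).
by rewrite mulr1 mulNr mulrC mulNr.
Qed.

Lemma der_sin (c x : R) : is_derive x 1 (fun t => sin (c * t)) (c * cos (c * x)).
Proof.
have := der_comp (is_derive_sin (c * x)) (derZ c (derid x)).
by rewrite mulr1 mulrC.
Qed.

Lemma cont_cos c : continuous (fun t : R => cos (c * t)).
Proof. by move=> x; exact: der_cont (der_cos c x). Qed.

Lemma cont_sin c : continuous (fun t : R => sin (c * t)).
Proof. by move=> x; exact: der_cont (der_sin c x). Qed.

Lemma meas_cos (c : R) : measurable_fun (setT : set TR) (fun x : TR => cos (c * x)).
Proof. exact: (cont_measurable (@cont_cos c)). Qed.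

Definition gtI (b : R) : TR -> R := fun x : R => (b < x)%R%:R.

Lemma meas_gtI b : measurable_fun setT (gtI b).
Proof.
rewrite (_ : gtI b = \1_(`]b, +oo[%classic)).
  by apply: measurable_indic; exact: measurable_itv.
by apply/funext => x; rewrite /gtI indicE mem_setE in_itv/= andbT.
Qed.

Lemma gtI_bound b x : `|gtI b x| <= 1.
Proof. by rewrite /gtI ger0_norm// lern1 leq_b1. Qed.

Lemma sin_npi n : sin (n%:R * pi) = 0 :> R.
Proof.
elim: n => [|n IH]; first by rewrite mul0r sin0.
by rewrite -natr1 mulrDl mul1r sinDpi IH oppr0.
Qed.

Lemma int_cos n : \int[muI]_x cos (n%:R * pi * x) = (n == 0%N)%:R.
Proof.
case: n => [|n].
  rewrite (_ : (fun x => _) = cst 1) ?Rintegral_cst//; first by rewrite -[X in fine X]/(muI setT) muI_setT mul1r.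
  by apply/funext => x; rewrite !mul0r cos0.
have p0 : n.+1%:R * pi != 0 :> R by rewrite mulf_neq0 ?pnatr_eq0// gt_eqF// pi_gt0.
have h (x : R) : is_derive x 1 (fun x => (n.+1%:R * pi)^-1 * sin (n.+1%:R * pi * x))
    (cos (n.+1%:R * pi * x)).
  by have := derZ (n.+1%:R * pi)^-1 (der_sin (n.+1%:R * pi) x); rewrite mulrA mulVf// mul1r.
rewrite (FTC01 (@cont_cos _) h).
by rewrite mulr1 sin_npi !mulr0 sin0 mulr0 subrr.
Qed.

Lemma cosM (x y : R) : cos x * cos y = 2^-1 * cos (x - y) + 2^-1 * cos (x + y).
Proof. by rewrite cosB cosD; field. Qed.

Lemma cos_natB (m n : nat) (x : R) :
  cos (m%:R * pi * x - n%:R * pi * x) = cos ((maxn m n - minn m n)%N%:R * pi * x).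
Proof.
have [mn|/ltnW nm] := leqP m n.
  rewrite natrB// -[LHS]cosN; congr cos; ring.
rewrite natrB//; congr cos; ring.
Qed.

Lemma cos_natD (m n : nat) (x : R) :
  cos (m%:R * pi * x + n%:R * pi * x) = cos ((m + n)%N%:R * pi * x).
Proof. by rewrite natrD; congr cos; ring. Qed.

Lemma cs_cont n : continuous (cs n).
Proof.
move=> x; have := der_cont (derZ (if n == 0%N then 1 else Num.sqrt 2) (der_cos (n%:R * pi) x)).
exact.
Qed.

Lemma cs_orth m n : \int[muI]_x (cs m x * cs n x) = (m == n)%:R.
Proof.
pose am : R := if m == 0%N then 1 else Num.sqrt 2.
pose an : R := if n == 0%N then 1 else Num.sqrt 2.
have icos k : muI.-integrable setT (EFin \o (fun x => cos (k%:R * pi * x))).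
  apply: (@muI_bounded_int _ 1); first exact: meas_cos.
  by move=> x; rewrite ler_norml cos_geN1 cos_le1.
rewrite (_ : (fun x => _) = (fun x => (am * an / 2) * cos ((maxn m n - minn m n)%N%:R * pi * x)
    + (am * an / 2) * cos ((m + n)%N%:R * pi * x))); last first.
  apply/funext => x; rewrite /cs -/am -/an -cos_natB -cos_natD.
  rewrite mulrACA cosM; ring.
rewrite RintegralD//; [|exact: (integrableZl measurableT _ (icos _))..].
rewrite !RintegralZl// !int_cos addn_eq0 /am /an.
have s2 : Num.sqrt (2 : R) * Num.sqrt 2 = 2 by rewrite -expr2 sqr_sqrtr.
have [->|mn] := eqVneq m n.
  have t1 : (true%:R : R) = 1 by [].
  have f0 : (false%:R : R) = 0 by [].
  rewrite maxnn minnn subnn eqxx andbb; case: eqP => _; rewrite ?s2 t1 ?f0; lra.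
have -> : (maxn m n - minn m n == 0)%N = false.
  apply/negbTE; rewrite subn_eq0 -ltnNge; move: mn; rewrite neq_ltn => /orP[mn|nm].
    by rewrite (maxn_idPr (ltnW mn)) (minn_idPl (ltnW mn)).
  by rewrite (maxn_idPl (ltnW nm)) (minn_idPr (ltnW nm)).
have -> : (m == 0)%N && (n == 0)%N = false.
  by apply/negbTE/negP => /andP[/eqP m0 /eqP n0]; rewrite m0 n0 in mn.
by rewrite !mulr0 addr0.
Qed.

(** ** Completeness in dimension one *)

Lemma bernoulli_sub (z : R) N : 0 <= z <= 1 -> 1 - N%:R * z <= (1 - z) ^+ N.
Proof.
move=> /andP[z0 z1]; elim: N => [|N IH]; first by rewrite mul0r subr0 expr0.
rewrite exprS -natr1; have N0 : 0 <= N%:R :> R by [].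
have : (1 - z) * (1 - N%:R * z) <= (1 - z) * (1 - z) ^+ N by rewrite ler_wpM2l// subr_ge0.
by apply: le_trans; nra.
Qed.

Lemma bernoulli_add (z : R) N : 0 <= z -> 1 + N%:R * z <= (1 + z) ^+ N.
Proof.
move=> z0; elim: N => [|N IH]; first by rewrite mul0r addr0 expr0.
rewrite exprS -natr1; have N0 : 0 <= N%:R :> R by [].
have : (1 + z) * (1 + N%:R * z) <= (1 + z) * (1 + z) ^+ N by rewrite ler_wpM2l// addr_ge0.
by apply: le_trans; nra.
Qed.

Lemma cvg_geo (q : R) : 0 <= q < 1 -> q ^+ n @[n --> \oo] --> 0.
Proof. by move=> /andP[q0 q1]; apply: cvg_expr; rewrite ger0_norm. Qed.

Lemma squeeze0 (f g : nat -> R) l : (forall n, `|f n - l| <= g n) ->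
  g n @[n --> \oo] --> 0 -> f n @[n --> \oo] --> l.
Proof.
move=> fg g0; apply/cvgrPdist_lt => e e0; have /cvgrPdist_lt/(_ _ e0) := g0.
apply: filterS => n; rewrite sub0r normrN distrC => h.
by apply: le_lt_trans (fg n) _; apply: le_lt_trans h; exact: ler_norm.
Qed.

(** Polynomials in [y] that converge to the indicator function of [y < 1/2]. *)
Lemma threshold_lt (y : R) : 0 <= y < 2^-1 -> (1 - y ^+ n) ^+ (2 ^ n) @[n --> \oo] --> (1 : R).
Proof.
move=> /andP[y0 y2]; have q : 0 <= 2 * y < 1.
  by rewrite mulr_ge0//=; lra.
apply: squeeze0 (cvg_geo q) => n.
have z01 : 0 <= y ^+ n <= 1 by rewrite exprn_ge0// exprn_ile1//; lra.
have := bernoulli_sub (2 ^ n) z01.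
have -> : (2 ^ n)%:R * y ^+ n = (2 * y) ^+ n by rewrite exprMn natrX.
have : (1 - y ^+ n) ^+ (2 ^ n) <= 1.
  by apply: exprn_ile1; case/andP: z01 => ? ?; lra.
by move=> h1 h2; rewrite ler_norml; apply/andP; split; lra.
Qed.

Lemma threshold_gt (y : R) : 2^-1 < y <= 1 -> (1 - y ^+ n) ^+ (2 ^ n) @[n --> \oo] --> (0 : R).
Proof.
move=> /andP[y2 y1]; have y0 : 0 < y by lra.
have q : 0 <= (2 * y)^-1 < 1.
  by rewrite invr_ge0 mulr_ge0 ?(ltW y0)//= invf_lt1//; [lra|rewrite mulr_gt0].
apply: squeeze0 (cvg_geo q) => n; rewrite subr0.
have z01 : 0 <= y ^+ n <= 1 by rewrite exprn_ge0 ?(ltW y0)// exprn_ile1//; lra.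
have /andP[z0 z1] := z01.
have yn : 0 < y ^+ n by rewrite exprn_gt0.
have w0 : 0 <= (1 - y ^+ n) ^+ (2 ^ n) by rewrite exprn_ge0// subr_ge0.
rewrite ger0_norm// exprVn.
have -> : (2 * y) ^+ n = (2 ^ n)%:R * y ^+ n by rewrite exprMn natrX.
have := bernoulli_add (2 ^ n) z0.
set N := (2 ^ n)%:R; have N0 : 0 < N :> R by rewrite ltr0n expn_gt0.
have prod1 : (1 - y ^+ n) ^+ (2 ^ n) * (1 + y ^+ n) ^+ (2 ^ n) <= 1.
  by rewrite -exprMn exprn_ile1//; nra.
move=> h; rewrite -[leRHS]div1r ler_pdivlMr ?mulr_gt0//.
by apply: le_trans prod1; rewrite ler_wpM2l//; lra.
Qed.

Section OneDim.
Variable w : TR -> R.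
Hypothesis iw : muI.-integrable setT (EFin \o w).
Hypothesis w_cos : forall n, \int[muI]_x (w x * cos (n%:R * pi * x)) = 0.

Let mw : measurable_fun setT w. Proof. by apply/measurable_EFinP; exact: measurable_int iw. Qed.

Lemma w_mul_int (h : TR -> R) C : measurable_fun setT h -> (forall x, `|h x| <= C) ->
  muI.-integrable setT (EFin \o (fun x => w x * h x)).
Proof.
move=> mh hC; apply: (@le_integrable _ _ _ _ _ _ _ (EFin \o (fun x => C * w x))) => //.
- by apply/measurable_EFinP; exact: measurable_funM.
- move=> x _; rewrite lee_fin /= !normrM mulrC ler_wpM2r//.
  by apply: le_trans (hC x) (ler_norm _).
- exact: (integrableZl measurableT C iw).
Qed.

Lemma w_cos_pow k n : \int[muI]_x (w x * (cos (n%:R * pi * x) * cos (pi * x) ^+ k)) = 0.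
Proof.
have int j (l : nat) : muI.-integrable setT
    (EFin \o (fun x => w x * (cos (j%:R * pi * x) * cos (pi * x) ^+ l))).
  apply: (@w_mul_int _ 1).
    apply: measurable_funM; first exact: meas_cos.
    by apply: measurable_funX; exact: meas_cos.
  move=> x; rewrite normrM normrX.
  have c1 (y : R) : `|cos y| <= 1 by rewrite ler_norml cos_geN1 cos_le1.
  by rewrite mulr_ile1 ?exprn_ge0// exprn_ile1.
elim: k n => [|k IH] n.
  by under eq_Rintegral do rewrite expr0 mulr1; exact: w_cos.
case: n => [|n].
  rewrite -[RHS](IH 1%N); apply: eq_Rintegral => x _.
  by rewrite !mul0r cos0 mul1r exprS mul1r.
rewrite (_ : (fun x => _) = fun x =>
   2^-1 * (w x * (cos (n%:R * pi * x) * cos (pi * x) ^+ k)) +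
   2^-1 * (w x * (cos (n.+2%:R * pi * x) * cos (pi * x) ^+ k))); last first.
  apply/funext => x; rewrite exprS [cos (n.+1%:R * pi * x) * _]mulrA cosM.
  have -> : n.+1%:R * pi * x - pi * x = n%:R * pi * x by rewrite -natr1; ring.
  have -> : n.+1%:R * pi * x + pi * x = n.+2%:R * pi * x by rewrite -[in RHS]natr1; ring.
  ring.
rewrite RintegralD//; [|exact: (integrableZl measurableT _ (int _ _))..].
by rewrite !RintegralZl// !IH mulr0 addr0.
Qed.

Lemma poly_cos_bound (p : {poly R}) : exists C, forall x : R, `|p.[cos (pi * x)]| <= C.
Proof.
exists (\sum_(i < size p) `|p`_i|) => x; rewrite horner_coef.
apply: le_trans (ler_norm_sum _ _ _) _; apply: ler_sum => i _.
rewrite normrM ler_piMr// normrX exprn_ile1//.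
by rewrite ler_norml cos_geN1 cos_le1.
Qed.

Lemma poly_cos_measurable (p : {poly R}) :
  measurable_fun setT (fun x : TR => p.[cos (pi * x)]).
Proof.
rewrite (_ : (fun x => _) = fun x => \sum_(i < size p) p`_i * cos (pi * x) ^+ i); last first.
  by apply/funext => x; rewrite horner_coef.
apply: measurable_sum => i; apply: measurable_funM => //.
by apply: measurable_funX; exact: meas_cos.
Qed.

Lemma w_poly (p : {poly R}) : \int[muI]_x (w x * p.[cos (pi * x)]) = 0.
Proof.
have int (l : nat) : muI.-integrable setT (EFin \o (fun x => w x * cos (pi * x) ^+ l)).
  apply: (@w_mul_int _ 1).
    by apply: measurable_funX; exact: meas_cos.
  move=> x; rewrite normrX.
  by rewrite exprn_ile1// ler_norml cos_geN1 cos_le1.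
rewrite (_ : (fun x => _) = fun x => \sum_(i < size p) p`_i * (w x * cos (pi * x) ^+ i)); last first.
  by apply/funext => x; rewrite horner_coef mulr_sumr; apply: eq_bigr => i _; ring.
have h (i : 'I_(size p)) := integrableZl measurableT p`_i (int i).
rewrite (Rintegral_sum _ h).1 big1// => i _; rewrite RintegralZl//.
rewrite (_ : (fun x => _) = fun x => w x * (cos (0%:R * pi * x) * cos (pi * x) ^+ i)).
  by rewrite w_cos_pow mulr0.
by apply/funext => x; rewrite !mul0r cos0 mul1r.
Qed.

(** Indicator functions of intervals are limits of polynomials in the cosine, to which the
    hypothesis extends by the product formula. *)
Lemma w_above (b : R) : 0 < b < 1 -> \int[muI]_x (w x * gtI b x) = 0.
Proof.
move=> /andP[b0 b1].
pose c := cos (pi * b).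
pose P n : {poly R} := (1 - ((1/2 - c / 4)%:P + (1/4) *: 'X) ^+ n) ^+ (2 ^ n).
have PE n x : (P n).[x] = (1 - (1/2 + (x - c) / 4) ^+ n) ^+ (2 ^ n).
  rewrite /P !hornerE; congr ((1 - _ ^+ n) ^+ _); lra.
have c1 (y : R) : -1 <= cos y <= 1 by rewrite cos_geN1 cos_le1.
have y01 (x : R) : 0 <= 1/2 + (cos (pi * x) - c) / 4 <= 1.
  by have := c1 (pi * x); have := c1 (pi * b); rewrite -/c => /andP[? ?] /andP[? ?]; lra.
have P01 n (x : R) : `|(P n).[cos (pi * x)]| <= 1.
  rewrite PE; have /andP[h1 h2] := y01 x; set y := _ + _ in h1 h2 *.
  have : 0 <= y ^+ n <= 1 by rewrite exprn_ge0// exprn_ile1.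
  move=> /andP[? ?]; rewrite ger0_norm; first by apply: exprn_ile1; lra.
  by apply: exprn_ge0; lra.
have mb := meas_gtI b.
have [] := @dominated_convergence _ _ _ muI setT measurableT
  (fun n x => (w x * (P n).[cos (pi * x)])%:E) (fun x => (w x * gtI b x)%:E)
  (fun x => `|w x|%:E).
- move=> n; apply/measurable_EFinP; apply: measurable_funM => //; exact: poly_cos_measurable.
- by apply/measurable_EFinP; apply: measurable_funM => //; exact: meas_gtI.
- apply: ae_mrestr; exists [set b]; split; first exact: measurable_set1.
    exact: lebesgue_measure_set1.
  move=> x /= nP; apply: contrapT => xb; apply: nP => Ix _.
  apply/cvg_EFin; first exact: nearW.
  rewrite /comp/=.
  have cw : (fun=> w x) @ \oo --> w x by exact: cvg_cst.
  suff cP : (fun n => (P n).[cos (pi * x)]) @ \oo --> gtI b x by exact: (cvgM cw cP).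
  rewrite (_ : (fun n => _) = fun n => (1 - (1/2 + (cos (pi * x) - c) / 4) ^+ n) ^+ (2 ^ n)); last first.
    by apply/funext => n; rewrite PE.
  move: Ix; rewrite in_itv/= => /andP[x0 x1].
  have pi0 := pi_gt0 R.
  have xpi : pi * x \in `[0, pi] by rewrite in_itv/= mulr_ge0 ?ltW//=; nra.
  have bpi : pi * b \in `[0, pi] by rewrite in_itv/= mulr_ge0 ?ltW//=; nra.
  rewrite /gtI; have [bx|] := ltP b x.
    apply: threshold_lt; have /andP[-> _] := y01 x; rewrite /=.
    have : cos (pi * x) < c by rewrite /c ltr_cos// ltr_pM2l.
    by lra.
  rewrite le_eqVlt => /predU1P[xb'|xb']; first by case: xb; rewrite xb'.
  apply: threshold_gt; have /andP[_ ->] := y01 x; rewrite andbT.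
  have : c < cos (pi * x) by rewrite /c ltr_cos// ltr_pM2l.
  by lra.
- by have := integrable_abse iw.
- apply: aeW => x n _ /=; rewrite lee_fin normrM ler_piMr//.
- move=> _ _ cv; rewrite /Rintegral.
  have z n : (\int[muI]_x (w x * (P n).[cos (pi * x)])%:E)%E = 0%E.
    have [C hC] := poly_cos_bound (P n).
    rewrite -[LHS]fineK; first by congr EFin; exact: w_poly.
    by apply: integrable_fin_num => //; exact: (w_mul_int (poly_cos_measurable (P n)) hC).
  suff -> : (\int[muI]_x (w x * gtI b x)%:E)%E = 0%E by [].
  move/cvg_lim : cv => <- //; rewrite (_ : [sequence _]_n = fun=> 0%E) ?lim_cst//.
  by apply/funext => n; exact: z.
Qed.

(** The primitive of [w] vanishes, and so does its derivative almost everywhere. *)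
Lemma cos_complete : w = cst 0 %[ae muI].
Proof.
have iwr : leb.-integrable `]0, 1[ (EFin \o w).
  move/integrableP : iw => [mw' h]; apply/integrableP; split; first exact: measurable_funTS.
  by rewrite -integral_mrestr//; exact: measurableT_comp.
pose f : R -> R := w \_ `]0, 1[.
have IfE : leb.-integrable setT (EFin \o f).
  have := (integrable_mkcond (EFin \o w) (measurable_itv `]0, 1[)).1 iwr.
  by apply: eq_integrable => // x _; rewrite /f /patch/=; case: ifP.
have lf : locally_integrable [set: R] f by exact: integrable_locally.
have If y : leb.-integrable `]-oo, y] (EFin \o f).
  by apply: integrableS IfE => //; exact: measurable_itv.
have tot : \int[muI]_x w x = 0.
  rewrite -[RHS](w_cos 0); apply: eq_Rintegral => x _.
  by rewrite !mul0r cos0 mulr1.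
have above x : \int[muI]_t (w t * gtI x t) = 0.
  have [x0|x0] := leP x 0.
    rewrite -[RHS]tot /Rintegral; congr fine; apply: ae_eq_integral => //.
    - by apply/measurable_EFinP; apply: measurable_funM => //; exact: meas_gtI.
    - exact/measurable_EFinP.
    - apply: ae_mrestr; apply: aeW => t; rewrite /= in_itv/= => /andP[t0 _] _.
      by rewrite /gtI (le_lt_trans x0 t0) mulr1.
  have [x1|x1] := ltP x 1; first by apply: w_above; rewrite x0.
  rewrite /Rintegral (ae_eq_integral (cst 0%E)) ?integral_cst ?mul0e//.
  - by apply/measurable_EFinP; apply: measurable_funM => //; exact: meas_gtI.
  - apply: ae_mrestr; apply: aeW => t; rewrite /= in_itv/= => /andP[_ t1] _.
    by rewrite /gtI ltNge (ltW (lt_le_trans t1 x1)) mulr0.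
have F0 x : \int[leb]_(t in `]-oo, x]) f t = 0.
  have mb := meas_gtI x.
  have ib : muI.-integrable setT (EFin \o (fun t => w t * gtI x t)).
    by apply: (@w_mul_int _ 1) => // t; exact: gtI_bound.
  have : \int[muI]_t (w t - w t * gtI x t) = 0 by rewrite RintegralB// tot above subrr.
  move=> <-; rewrite Rintegral_mkcond [RHS]/Rintegral integral_mrestr; last first.
    apply/measurable_EFinP; apply: measurable_funB => //; exact: measurable_funM.
  rewrite integral_mkcond /Rintegral; congr fine; apply: eq_integral => t _.
  rewrite /f /patch /gtI /= !mem_setE !in_itv/=.
  case: (0 < t < 1); last by case: ifP.
  by rewrite leNgt; case: (x < t); rewrite /= ?mulr1 ?subrr// mulr0 subr0.
have := FTC1Ny If lf; rewrite /= (_ : (fun x => _) = cst 0); last by apply/funext => x; exact: F0.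
move=> [N [mN N0 hN]]; apply: ae_mrestr; exists N; split => // x /= nP.
apply: hN => /= -[_]; rewrite derive1_cst => E; apply: nP => Ix _.
by move: E; rewrite /f patchE mem_set.
Qed.

End OneDim.

(** ** Completeness in dimension two *)

Definition cc (p : nat * nat) (x : R * R) : R := cs p.1 x.1 * cs p.2 x.2.

Lemma meas_cs n : measurable_fun (setT : set TR) (cs n : TR -> R).
Proof. exact: (cont_measurable (@cs_cont n)). Qed.

Lemma meas_cc p : measurable_fun (setT : set T) (cc p : T -> R).
Proof.
apply: measurable_funM.
  exact: (measurableT_comp (meas_cs p.1) measurable_fst).
exact: (measurableT_comp (meas_cs p.2) measurable_snd).
Qed.

Lemma cc_bound p x : `|cc p x| <= 4.
Proof.
rewrite normrM (_ : 4 = 2 * 2); last by ring.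
by apply: ler_pM => //; exact: cs_bound.
Qed.

Lemma lebO_bounded_int (f : T -> R) C : measurable_fun setT f -> (forall x, `|f x| <= C) ->
  (lebO R).-integrable setT (EFin \o f).
Proof.
move=> mf fC; apply: measurable_bounded_integrable => //.
  by rewrite -[X in (X < _)%E]/(lebO R setT) lebO_setT ltry.
exists C; split; first exact: num_real.
by move=> M CM x _; apply: le_trans (fC x) (ltW CM).
Qed.

Lemma bounded_sqi (f : T -> R) C : measurable_fun setT f -> (forall x, `|f x| <= C) ->
  sqi (lebO R) f.
Proof.
move=> mf fC; split => //; apply: (@lebO_bounded_int _ (C ^+ 2)); first exact: measurable_funX.
move=> x; rewrite normrX ler_sqr ?nnegrE//; exact: le_trans (fC x).
Qed.

Lemma cc_sqi p : sqi (lebO R) (cc p).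
Proof. exact: (bounded_sqi (meas_cc p) (cc_bound p)). Qed.

Lemma Rintegral_fubini (f : T -> R) : (lebO R).-integrable setT (EFin \o f) ->
  \int[lebO R]_x f x = \int[muI]_x \int[muI]_y f (x, y) /\
  muI.-integrable setT (EFin \o (fun x => \int[muI]_y f (x, y))).
Proof.
move=> /integrable_lebO fi.
have hF := integrable_fubini_F fi.
have ae1 := ae_integrable1 fi.
have E : ae_eq muI setT (fubini_F muI (EFin \o f)) (EFin \o (fun x => \int[muI]_y f (x, y))).
  apply: filterS ae1 => x hx _; rewrite /fubini_F /Rintegral /= fineK//.
  by apply: integrable_fin_num.
have mE : measurable_fun setT (EFin \o (fun x => \int[muI]_y f (x, y))).
  apply/measurable_EFinP; apply: (measurableT_comp (fine_measurable measurableT)).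
  exact: measurable_int hF.
split.
  rewrite /Rintegral integral_lebO -(integral12_prod_meas1 fi); congr fine.
  by apply: ae_eq_integral => //; exact: measurable_int hF.
apply/integrableP; split => //.
move/integrableP : hF => [mF]; apply: le_lt_trans.
rewrite le_eqVlt; apply/orP; left; apply/eqP.
apply: ae_eq_integral => //.
- exact: measurableT_comp.
- by apply: measurableT_comp => //; exact: measurable_int fi.
- by apply: filterS E => x h Dx; rewrite -(h Dx).
Qed.

Lemma cc_orth p q : \int[lebO R]_x (cc p x * cc q x) = (p == q)%:R.
Proof.
have [|-> _] := @Rintegral_fubini (fun x => cc p x * cc q x).
  exact: (sqi_mul_int (cc_sqi p) (cc_sqi q)).
have E (x : TR) : \int[muI]_y (cc p (x, y) * cc q (x, y)) =
    (cs p.1 x * cs q.1 x) * (p.2 == q.2)%:R.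
  rewrite -cs_orth -RintegralZl//; last first.
    apply: (@muI_bounded_int _ 4); first by apply: measurable_funM; exact: meas_cs.
    move=> y; rewrite normrM (_ : 4 = 2 * 2); last by ring.
    by apply: ler_pM => //; exact: cs_bound.
  by apply: eq_Rintegral => y _; rewrite /cc /=; ring.
under eq_Rintegral do rewrite E.
rewrite RintegralZr//; last first.
  apply: (@muI_bounded_int _ 4); first by apply: measurable_funM; exact: meas_cs.
  move=> y; rewrite normrM (_ : 4 = 2 * 2); last by ring.
  by apply: ler_pM => //; exact: cs_bound.
by rewrite cs_orth -natrM mulnb; clear E; case: p q => [? ?] [? ?].
Qed.

(** Fubini's theorem and completeness in dimension one, applied in each variable. *)
Lemma cc_complete (u : T -> R) : sqi (lebO R) u ->
  (forall p, \int[lebO R]_x (u x * cc p x) = 0) -> u = cst 0 %[ae lebO R].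
Proof.
move=> hu hz; have mu_ : measurable_fun setT u by case: hu.
have iu : (lebO R).-integrable setT (EFin \o u).
  have h1 : sqi (lebO R) (cst 1).
    by apply: (@bounded_sqi _ 1) => // x; rewrite /= normr1.
  have := sqi_mul_int hu h1; apply: eq_integrable => // x _; by rewrite /= mulr1.
have iu' := (integrable_lebO _).1 iu.
have iun n : (lebO R).-integrable setT (EFin \o (fun x => u x * cs n x.2)).
  apply: (@le_integrable _ _ _ _ _ _ _ (EFin \o (fun x => 2 * u x))) => //.
  - apply/measurable_EFinP; apply: measurable_funM => //.
    exact: (measurableT_comp (meas_cs n) measurable_snd).
  - move=> x _; rewrite lee_fin /= normrM [leRHS]normrM mulrC ler_wpM2r//.
    by apply: le_trans (cs_bound _ _) (ler_norm _).
  - exact: (integrableZl measurableT 2 iu).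
pose v n (x : TR) : R := \int[muI]_y (u (x, y) * cs n y).
have vint n : muI.-integrable setT (EFin \o v n) by exact: (Rintegral_fubini (iun n)).2.
have v0 n : v n = cst 0 %[ae muI].
  apply: (cos_complete (vint n)) => m.
  have := hz (m, n).
  have [|-> _] := @Rintegral_fubini (fun x => u x * cc (m, n) x).
    exact: (sqi_mul_int hu (cc_sqi (m, n))).
  move=> E; apply: (@mulfI _ (if m == 0%N then 1 else Num.sqrt 2)).
    by case: ifP => _; rewrite ?oner_eq0// gt_eqF// sqrtr_gt0.
  rewrite mulr0 -RintegralZl//; last first.
    apply: (@le_integrable _ _ _ _ _ _ _ (EFin \o v n)) => //.
      apply/measurable_EFinP; apply: measurable_funM; last exact: meas_cos.
      by apply/measurable_EFinP; exact: measurable_int (vint n).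
    move=> x _; rewrite lee_fin /= normrM ler_piMr//.
    by rewrite ler_norml cos_geN1 cos_le1.
  rewrite -[RHS]E /Rintegral; congr fine; apply: ae_eq_integral => //.
  - apply/measurable_EFinP; apply: measurable_funM => //; apply: measurable_funM; last exact: meas_cos.
    by apply/measurable_EFinP; exact: measurable_int (vint n).
  - have [|_ h] := @Rintegral_fubini (fun x => u x * cc (m, n) x).
      exact: (sqi_mul_int hu (cc_sqi (m, n))).
    exact: measurable_int h.
  apply: filterS (ae_integrable1 ((integrable_lebO _).1 (iun n))) => x hx _.
  congr EFin; rewrite -/(Rintegral _ _ _).
  rewrite (_ : (fun y => _) = fun y => cs m x * (u (x, y) * cs n y)); last first.
    by apply/funext => y; rewrite /cc /=; ring.
  have hx' : muI.-integrable setT (EFin \o (fun y : TR => u (x, y) * cs n y)) by exact: hx.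
  rewrite RintegralZl//.
  by rewrite /cs /v; ring.
have hall : {ae muI, forall x n, v n x = 0} 
  by apply: ae_foralln => n; have := v0 n; apply: filterS => x /= h; exact: h.
have main : {ae muI, forall x, (\int[muI]_y `|u (x, y)|%:E)%E = 0%E}.
  apply: filterS2 hall (ae_integrable1 iu') => x h1 h2.
  have z n : \int[muI]_y (u (x, y) * cos (n%:R * pi * y)) = 0.
    apply: (@mulfI _ (if n == 0%N then 1 else Num.sqrt 2)).
      by case: ifP => _; rewrite ?oner_eq0// gt_eqF// sqrtr_gt0.
    have iy : muI.-integrable setT (EFin \o (fun y => u (x, y) * cos (n%:R * pi * y))).
      apply: (@w_mul_int (fun y => u (x, y)) h2 _ 1); first exact: meas_cos.
      by move=> y; rewrite ler_norml cos_geN1 cos_le1.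
    rewrite mulr0 -RintegralZl// -[RHS](h1 n); apply: eq_Rintegral => y _.
    by rewrite /cs; ring.
  have u0 := cos_complete h2 z.
  have m2 : measurable_fun setT (fun y : TR => (u (x, y))%:E) by exact: measurable_int h2.
  have [_ /(_ _)] := ae_eq_integral_abs muI measurableT m2.
  move=> H; apply: H; apply: filterS u0 => y /= h _; by rewrite h.
apply/ae_lebO.
have muE : measurable_fun setT (EFin \o u) by exact/measurable_EFinP.
have mabsE : measurable_fun (setT : set T) (fun x : T => `|u x|%:E).
  by apply/measurable_EFinP; exact: measurableT_comp.
have [+ _] := ae_eq_integral_abs (muI \x muI)%E measurableT muE.
have -> : (\int[muI \x muI]_x `|(EFin \o u) x|)%E = 0%E.
  rewrite (fubini_tonelli1 (fun x => `|(EFin \o u) x|%E)) /fubini_F/=; last 2 first.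
  - exact: mabsE.
  - by move=> x; rewrite lee_fin.
  rewrite (ae_eq_integral (cst 0%E)) ?integral_cst ?mul0e//.
  - apply: (measurable_fun_fubini_tonelli_F (fun x => `|(EFin \o u) x|%E)) => //.
  - by apply: filterS main => x h _.
by move=> /(_ erefl); apply: filterS => x /= /(_ I) [].
Qed.

End Interval.

(** * Smooth functions on the plane *)
Section Plane.
Variable R : realType.
Local Notation TR := (measurableTypeR R).
Local Notation T := (measurableTypeR R * measurableTypeR R)%type.
Implicit Types (x : R * R) (i : 'I_2).

Definition upd i x (t : R) : R * R := if i == ord0 then (t, x.2) else (x.1, t).
Definition other i x : R := if i == ord0 then x.2 else x.1.

Lemma der_eq (f : R -> R) (t df df' : R) : is_derive t 1 f df -> df = df' -> is_derive t 1 f df'.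
Proof. by move=> h <-. Qed.

Lemma upd_shift i x (h : R) : h *: basis2 R i + x = upd i x (h *: 1 + coord2 i x).
Proof.
case: x => x1 x2; rewrite /basis2 /upd /coord2.
have E (p q : R) : h *: (p, q) + (x1, x2) = (h * p + x1, h * q + x2) by [].
by case: (i == ord0); rewrite E /= ?mulr0 ?add0r.
Qed.

Lemma upd_id i x : upd i x (coord2 i x) = x.
Proof. by case: x => x1 x2; rewrite /upd /coord2; case: (i == ord0). Qed.

Lemma upd_upd i x s t : upd i (upd i x s) t = upd i x t.
Proof. by case: x => x1 x2; rewrite /upd; case: (i == ord0). Qed.

Lemma coord2_upd i x t : coord2 i (upd i x t) = t.
Proof. by case: x => x1 x2; rewrite /upd /coord2; case: (i == ord0). Qed.

Lemma other_upd i x t : other i (upd i x t) = other i x.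
Proof. by case: x => x1 x2; rewrite /upd /other; case: (i == ord0). Qed.

Lemma slice_quotient i f x :
  (fun h : R => h^-1 *: ((f \o shift x) (h *: basis2 R i) - f x)) =
  (fun h : R => h^-1 *: (((f \o upd i x) \o shift (coord2 i x)) (h *: 1) -
                         (f \o upd i x) (coord2 i x))) :> (R -> R).
Proof. by apply/funext => h /=; rewrite upd_shift upd_id. Qed.

(** Restricting to lines reduces partial derivatives to calculus in one variable. *)
Lemma derivable_slice i (f : R * R -> R) x :
  derivable f x (basis2 R i) <-> derivable (f \o upd i x) (coord2 i x) 1.
Proof. by rewrite /derivable slice_quotient. Qed.

Lemma derive_slice i (f : R * R -> R) x :
  'D_(basis2 R i) f x = 'D_1 (f \o upd i x) (coord2 i x).
Proof. by rewrite /derive slice_quotient. Qed.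

Lemma upd_cont i x : continuous (upd i x).
Proof.
move=> t; rewrite /upd; case: (i == ord0).
  exact: (cvg_pair cvg_id (cvg_cst x.2)).
exact: (cvg_pair (cvg_cst x.1) cvg_id).
Qed.

Lemma coord2_cont i : continuous (@coord2 R i).
Proof. by move=> x; rewrite /coord2; case: (i == ord0); [exact: cvg_fst|exact: cvg_snd]. Qed.

Lemma other_cont i : continuous (other i).
Proof. by move=> x; rewrite /other; case: (i == ord0); [exact: cvg_snd|exact: cvg_fst]. Qed.

Lemma meas_coord2 i : measurable_fun (setT : set T) (@coord2 R i : T -> TR).
Proof. by rewrite /coord2; case: (i == ord0); [exact: measurable_fst|exact: measurable_snd]. Qed.

Lemma meas_other i : measurable_fun (setT : set T) (other i : T -> TR).
Proof. by rewrite /other; case: (i == ord0); [exact: measurable_snd|exact: measurable_fst]. Qed.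

(** ** Measurability of continuous functions *)
Lemma open_measurable2 (A : set T) : open (A : set (R * R)) -> measurable A.
Proof.
move=> oA.
pose box (q : (rat * rat) * (rat * rat)) : set T :=
  `]ratr q.1.1, ratr q.1.2[%classic `*` `]ratr q.2.1, ratr q.2.2[%classic.
pose F q : set T := if pselect (box q `<=` A) then box q else set0.
have -> : A = \bigcup_q F q.
  apply/seteqP; split=> [[x y] Axy|x [q _]]; last first.
    by rewrite /F; case: pselect => //= h /h.
  have [/= e e0 he] := (@nbhs_ballP R _ _ _).1 (open_nbhs_nbhs (conj oA Axy)).
  have rats (z : R) : exists p : rat * rat,
      z - e < ratr p.1 < z /\ z < ratr p.2 < z + e.
    have [p] := @rat_in_itvoo R (z - e) z ltac:(by rewrite ltrBlDr ltrDl).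
    have [q] := @rat_in_itvoo R z (z + e) ltac:(by rewrite ltrDl).
    by rewrite !in_itv /= => h1 h2; exists (p, q).
  have [p [hp1 hp2]] := rats x; have [q [hq1 hq2]] := rats y.
  have sub : box (p, q) `<=` A.
    move=> [x' y'] [] /=; rewrite !in_itv /= => h1 h2; apply: he.
    by split; rewrite /ball /= ltr_norml; apply/andP; lra.
  exists (p, q) => //; rewrite /F; case: pselect => //= _.
  by split; rewrite /= in_itv /=; apply/andP; lra.
apply: countable_bigcupT_measurable; first exact: countableP.
move=> [[q1 q2] [q3 q4]]; rewrite /F; case: pselect => //= h.
by apply: measurableX; exact: measurable_itv.
Qed.

Lemma cont_measurable2 (f : R * R -> R) : continuous f -> measurable_fun (setT : set T) (f : T -> R).
Proof.
move=> /continuousP cf; apply: (measurability _ (RGenOpens.measurableE R)).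
move=> _ [_ [a [b ->] <-]]; apply: measurableI => //; apply: open_measurable2.
exact/cf/interval_open.
Qed.

Lemma cont_bounded2 (f : R * R -> R) : continuous f ->
  exists C, forall x, 0 <= x.1 <= 1 -> 0 <= x.2 <= 1 -> `|f x| <= C.
Proof.
move=> cf.
have K : compact (`[(0 : R), 1]%classic `*` `[(0 : R), 1]%classic) by apply: compact_setX; exact: segment_compact.
have := continuous_compact (continuous_subspaceT cf) K.
move/compact_bounded => [M [_ /(_ (`|M| + 1))]] h; exists (`|M| + 1) => x h1 h2.
apply: h => /=; first by rewrite (le_lt_trans (ler_norm _))// ltrDl.
by exists x => //; split; rewrite /= in_itv.
Qed.

(** ** Smooth functions of one variable *)
Fixpoint C1k (k : nat) (F : R -> R) : Prop :=
  if k is k'.+1 then exists2 F', (forall t : R, is_derive t 1 F (F' t)) & C1k k' F'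
  else continuous F.

Lemma C1k_cont k (F : R -> R) : C1k k F -> continuous F.
Proof. by case: k => [|k] // [F' h _] t; exact: der_cont (h t). Qed.

Lemma C1kW k F : C1k k.+1 F -> C1k k F.
Proof.
elim: k F => [|k IH] F [F' h h']; first by move=> t; exact: der_cont (h t).
by exists F' => //; exact: IH.
Qed.

Lemma C1k_add k F G : C1k k F -> C1k k G -> C1k k (F \+ G).
Proof.
elim: k F G => [|k IH] F G /=; first by move=> cF cG t; apply: cvgD; [exact: cF|exact: cG].
move=> [F' hF cF] [G' hG cG]; exists (F' \+ G'); last exact: IH.
by move=> t; exact: derD.
Qed.

Lemma C1k_mul k F G : C1k k F -> C1k k G -> C1k k (F \* G).
Proof.
elim: k F G => [|k IH] F G; first by move=> cF cG t; apply: cvgM; [exact: cF|exact: cG].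
move=> hF hG; have [hF0 hG0] := (C1kW hF, C1kW hG).
case: hF hG => [F' hF cF] [G' hG cG]; exists ((F' \* G) \+ (F \* G')).
  by move=> t; apply: (der_eq (derM (hF t) (hG t))); rewrite /=; ring.
by apply: C1k_add; exact: IH.
Qed.

Lemma C1k_cst k c : C1k k (cst c).
Proof.
elim: k c => [|k IH] c; first by move=> t; exact: cvg_cst.
by exists (cst 0); [move=> t; exact: is_derive_cst|exact: IH].
Qed.

Lemma C1k_affine k F c d : C1k k F -> C1k k (fun t => F (c * t + d)).
Proof.
elim: k F => [|k IH] F.
  move=> cF t; apply: (@continuous_comp _ _ _ (fun t => c * t + d) F); last exact: cF.
  apply: cvgD; last exact: cvg_cst.
  by apply: cvgM; [exact: cvg_cst|exact: cvg_id].
move=> [F' h cF']; exists (fun t => c * F' (c * t + d)).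
  move=> t; have hl : is_derive t 1 (fun t => c * t + d) c.
    apply: (der_eq (derD (derZ c (derid t)) (derC t d))).
    by rewrite /=; ring.
  by apply: (der_eq (der_comp (h _) hl)); rewrite /=; ring.
by apply: (C1k_mul (C1k_cst k c)); exact: IH.
Qed.

Lemma C1k_trig k c : C1k k (fun t => cos (c * t)) /\ C1k k (fun t => sin (c * t)).
Proof.
elim: k => [|k [IHc IHs]]; first by split; [exact: cont_cos|exact: cont_sin].
split.
  exists (fun t => - c * sin (c * t)); first by move=> t; exact: der_cos.
  exact: (C1k_mul (C1k_cst k (- c))).
exists (fun t => c * cos (c * t)); first by move=> t; exact: der_sin.
exact: (C1k_mul (C1k_cst k c)).
Qed.

Lemma C1k_cs k n : C1k k (cs n).
Proof. exact: (C1k_mul (C1k_cst k _) (C1k_trig k _).1). Qed.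

Lemma prod_cont (F G : R -> R) i : continuous F -> continuous G ->
  continuous (fun x => F (coord2 i x) * G (other i x)).
Proof.
move=> cF cG x; apply: cvgM.
- apply: (@continuous_comp _ _ _ (coord2 i) F); [exact: coord2_cont|exact: cF].
- apply: (@continuous_comp _ _ _ (other i) G); [exact: other_cont|exact: cG].
Qed.

Lemma prod_der (F G F' : R -> R) i x : (forall t : R, is_derive t 1 F (F' t)) ->
  is_derive (coord2 i x) 1 ((fun x => F (coord2 i x) * G (other i x)) \o upd i x)
    (F' (coord2 i x) * G (other i x)).
Proof.
move=> h; rewrite (_ : _ \o _ = fun t => G (other i x) * F t); last first.
  by apply/funext => t /=; rewrite coord2_upd other_upd mulrC.
by apply: (der_eq (derZ _ (h _))); rewrite mulrC.
Qed.

Lemma other_swap i j x : i != j -> other i x = coord2 j x /\ coord2 i x = other j x.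
Proof. by case: i => [[|[|]]//] hi; case: j => [[|[|]]//] hj. Qed.

Lemma Ck2_prod k F G i : C1k k F -> C1k k G ->
  Ck2 k setT (fun x => F (coord2 i x) * G (other i x)).
Proof.
elim: k F G i => [|k IH] F G i hF hG.
  by split=> // x _; exact: prod_cont.
split; first by move=> x _; apply: prod_cont; [exact: C1k_cont hF|exact: C1k_cont hG].
have main j F0 G0 : C1k k.+1 F0 -> C1k k.+1 G0 ->
    (forall x, [set: R * R] x ->
       derivable (fun x => F0 (coord2 j x) * G0 (other j x)) x (basis2 R j)) /\
    Ck2 k setT (fun x => 'D_(basis2 R j) (fun x => F0 (coord2 j x) * G0 (other j x)) x).
  move=> [F' h cF'] /C1kW hG0; split=> [x _|].
    by apply/derivable_slice; case: (prod_der G0 j x h).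
  rewrite (_ : (fun x => _) = fun x => F' (coord2 j x) * G0 (other j x)); first exact: IH.
  by apply/funext => x; rewrite derive_slice; case: (prod_der G0 j x h).
move=> j; have [<-|ij] := eqVneq i j; first exact: main.
rewrite (_ : (fun x => _) = fun x => G (coord2 j x) * F (other j x)); first exact: main.
by apply/funext => x; have [-> ->] := other_swap x ij; rewrite mulrC.
Qed.

Lemma smooth_prod F G i : (forall k, C1k k F) -> (forall k, C1k k G) ->
  smooth2 (fun x => F (coord2 i x) * G (other i x)).
Proof. by move=> hF hG k; exact: Ck2_prod. Qed.

Lemma lin_cont (f g : R * R -> R) c x : {for x, continuous f} -> {for x, continuous g} ->
  {for x, continuous (c *: f + g)}.
Proof.
move=> cf cg; rewrite /prop_for /continuous_at.
have h : (c * f y + g y) @[y --> x] --> (c * f x + g x).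
  by apply: cvgD cg; apply: cvgM cf; exact: cvg_cst.
exact: h.
Qed.

Lemma Ck2_lin k (f g : R * R -> R) c : Ck2 k setT f -> Ck2 k setT g ->
  Ck2 k setT (c *: f + g).
Proof.
elim: k f g => [|k IH] f g [cf hf] [cg hg].
  by split; [move=> x _; exact: lin_cont (cf x I) (cg x I)|].
split=> [x _|i]; first exact: lin_cont (cf x I) (cg x I).
have [df kf] := hf i; have [dg kg] := hg i; split=> [x _|].
  by apply: derivableD; [apply: derivableZ; exact: df|exact: dg].
rewrite (_ : (fun x => _) = c *: (fun x => 'D_(basis2 R i) f x) + (fun x => 'D_(basis2 R i) g x)).
  exact: IH.
apply/funext => x; rewrite deriveD; [|exact: derivableZ (df x I)|exact: dg].
by rewrite deriveZ//; exact: df.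
Qed.

Lemma smooth_lin (f g : R * R -> R) c : smooth2 f -> smooth2 g -> smooth2 (c *: f + g).
Proof. by move=> hf hg k; exact: Ck2_lin. Qed.

Lemma smooth_cont (f : R * R -> R) : smooth2 f -> continuous f.
Proof. by move=> /(_ 0%N) [h _] x; exact: h. Qed.

Lemma smooth_der (f : R * R -> R) i : smooth2 f ->
  (forall x, derivable f x (basis2 R i)) /\ smooth2 (fun x => 'D_(basis2 R i) f x).
Proof.
move=> h; split=> [x|k]; first by have [_ /(_ i)[h' _]] := h 1%N; exact: h'.
by have [_ /(_ i)[_]] := h k.+1.
Qed.

Lemma smooth_slice (f : R * R -> R) i x (t : R) : smooth2 f ->
  is_derive t 1 (f \o upd i x) ('D_(basis2 R i) f (upd i x t)).
Proof.
move=> /(smooth_der i) [h _].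
have := h (upd i x t); rewrite derive_slice => /derivable_slice.
rewrite coord2_upd (_ : f \o upd i (upd i x t) = f \o upd i x); last first.
  by apply/funext => s /=; rewrite upd_upd.
by move=> d; apply: DeriveDef.
Qed.

Lemma smooth_cst c : smooth2 (cst c : R * R -> R).
Proof.
have := @smooth_prod (cst c) (cst 1) ord0 (fun k => C1k_cst k c) (fun k => C1k_cst k 1).
by rewrite (_ : (fun x => _) = cst c)//; apply/funext => x; rewrite /= mulr1.
Qed.

Lemma smooth_sum (I : Type) (r : seq I) (c : I -> R) (F : I -> R * R -> R) :
  (forall j, smooth2 (F j)) -> smooth2 (\sum_(j <- r) c j *: F j).
Proof.
move=> hF; elim: r => [|j r IH]; last by rewrite big_cons; exact: smooth_lin.
by rewrite big_nil; exact: (smooth_cst 0).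
Qed.

(** ** Cutoff functions *)
Definition flat (p : {poly R}) (t : R) : R := if 0 < t then p.[t^-1] * expR (- t^-1) else 0.

Lemma powexp_le (n : nat) (y : R) : 0 <= y -> y ^+ n * expR (- y) <= n`!%:R.
Proof.
move=> y0; rewrite -ler_pdivlMr ?expR_gt0// -expRN opprK.
case: n => [|n]; first by rewrite expr0 fact0 mul1r -expR0 ler_expR.
have := expR_ge1Dxn n y0; rewrite -(@ler_pM2l _ (n.+1)`!%:R) ?ltr0n ?fact_gt0// => h.
apply: le_trans h; rewrite mulrDr mulr1 mulrCA divff ?mulr1 ?lerDr//.
Qed.

Lemma polyexp_le (p : {poly R}) : exists C, forall y : R, 0 <= y -> `|p.[y]| * expR (- y) <= C.
Proof.
exists (\sum_(i < size p) `|p`_i| * (i`!%:R)) => y y0.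
rewrite horner_coef; apply: le_trans (_ : (\sum_(i < size p) `|p`_i| * y ^+ i) * expR (- y) <= _).
  rewrite ler_pM2r ?expR_gt0//; apply: le_trans (ler_norm_sum _ _ _) _.
  by apply: ler_sum => i _; rewrite normrM normrX (ger0_norm y0).
rewrite mulr_suml; apply: ler_sum => i _; rewrite -mulrA ler_wpM2l//.
exact: powexp_le.
Qed.

Lemma flat_quad (p : {poly R}) : exists C, forall t, `|flat p t| <= C * t ^+ 2.
Proof.
have [C hC] := polyexp_le (p * 'X^2).
have C0 : 0 <= C by apply: le_trans (hC 0 (lexx _)); rewrite mulr_ge0// expR_ge0.
exists C => t; rewrite /flat; case: ifPn => [t0|_]; last by rewrite normr0 mulr_ge0// sqr_ge0.
have y0 : 0 <= t^-1 by rewrite invr_ge0 ltW.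
have := hC _ y0; rewrite normrM hornerM hornerXn normrM (ger0_norm (expR_ge0 _)) (@ger0_norm _ (_ ^+ 2)) ?sqr_ge0//.
rewrite -(ler_pM2r (exprn_gt0 2 t0)); apply: le_trans.
have e : t^-1 ^+ 2 * t ^+ 2 = 1 by rewrite -exprMn mulVf ?gt_eqF// expr1n.
by rewrite [leRHS]mulrAC -[X in _ <= X * _]mulrA e mulr1.
Qed.

Lemma der_quad (F : R -> R) C : F 0 = 0 -> (forall t, `|F t| <= C * t ^+ 2) -> is_derive (0 : R) 1 F 0.
Proof.
move=> F0 h.
have hc : (fun u : R => u^-1 *: ((F \o shift 0) (u *: 1) - F 0)) @ 0^' --> (0 : R).
  apply/cvgr0Pnorm_le => e e0.
  have C0 : 0 <= C by have := h 1; rewrite expr1n mulr1; apply: le_trans.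
  near=> u; rewrite /= addr0 F0 subr0 /GRing.scale /= mulr1 normrM normfV.
  have u0 : 0 < `|u| by rewrite normr_gt0; near: u; exact: nbhs_dnbhs_neq.
  rewrite mulrC ler_pdivrMr//; apply: le_trans (h u) _.
  rewrite -(ger0_norm (sqr_ge0 u)) normrX expr2 mulrA ler_pM2r//.
  apply: le_trans (_ : (C + 1) * `|u| <= e); first by rewrite ler_wpM2r// lerDl.
  rewrite mulrC -ler_pdivlMr ?ltr_wpDl//.
  near: u; apply: dnbhs0_le; by rewrite divr_gt0// ltr_wpDl.
by apply: DeriveDef; [apply/cvg_ex; exists 0|exact/cvg_lim].
Unshelve. all: end_near. Qed.

Lemma der_flat p (t : R) : is_derive t 1 (flat p) (flat ('X^2 * (p - p^`())) t).
Proof.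
have [t0|t0|->] := ltgtP t 0.
- have hn : \forall s \near t, cst 0 s = flat p s.
    by near=> s; rewrite /flat ltNge ltW//; near: s; exact: lt_nbhsl.
  by apply: (der_eq (near_eq_is_derive hn (derC t 0))); rewrite /flat ltNge ltW.
- have hi : is_derive t 1 (fun s : R => s^-1) (- t ^- 2).
    have ht : t != 0 by rewrite gt_eqF.
    have := @is_deriveV R id t 1 1 ht (derid t).
    by move=> h; apply: (der_eq h); rewrite /GRing.scale /= mulr1.
  have hd := (derM (der_comp (is_derive_poly p _) hi)
                       (der_comp (is_derive_expR _) (derZ (-1) hi))).
  have hn : \forall s \near t, p.[s^-1] * expR (-1 * s^-1) = flat p s.
    by near=> s; rewrite /flat ifT ?mulN1r//; near: s; exact: lt_nbhsr.
  apply: (der_eq (near_eq_is_derive hn hd)); rewrite /flat t0 /= mulN1r hornerM hornerXn hornerD hornerN.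
  by rewrite -exprVn; ring.
- have [C hC] := flat_quad p.
  have F0 : flat p 0 = 0 by rewrite /flat ltxx.
  by apply: (der_eq (der_quad F0 hC)); rewrite /flat ltxx.
Unshelve. all: end_near. Qed.

Lemma C1k_flat k p : C1k k (flat p).
Proof.
elim: k p => [|k IH] p; first by move=> t; exact: der_cont (der_flat p t).
by exists (flat ('X^2 * (p - p^`()))) => //; exact: der_flat.
Qed.

End Plane.

(** * Weak derivatives on the square *)
Section Cutoff.
Variable R : realType.
Implicit Types (t : R).

Let E : R -> R := flat 1.
Let dE : R -> R := flat ('X^2 * (1 - 1^`())).

Lemma EE t : E t = if 0 < t then expR (- t^-1) else 0.
Proof. by rewrite /E /flat hornerE mul1r. Qed.

Lemma dEE t : dE t = if 0 < t then t^-1 ^+ 2 * expR (- t^-1) else 0.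
Proof. by rewrite /dE /flat derivC subr0 mulr1 hornerXn. Qed.

Lemma E_01 t : 0 <= E t <= 1.
Proof.
rewrite EE; case: ifPn => [t0|_]; last by rewrite lexx ler01.
by rewrite expR_ge0 -expR0 ler_expR oppr_le0 invr_ge0 ltW.
Qed.

Lemma E_near1 t : 0 < t + 1 -> 1 - E t <= 2 / (t + 1).
Proof.
move=> t1; have /andP[e0 e1] := E_01 t.
have [t1'|t1'] := leP 1 t; last first.
  apply: le_trans (_ : 1 <= _); first by rewrite lerBlDr lerDl.
  by rewrite ler_pdivlMr// mul1r; lra.
have t0 : 0 < t by lra.
apply: (@le_trans _ _ (t^-1)).
  rewrite EE t0; have := expR_ge1Dx (- t^-1); lra.
by rewrite ler_pdivlMr// mulrC ler_pdivrMr//; lra.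
Qed.

Lemma dE_ge0 t : 0 <= dE t.
Proof. by rewrite dEE; case: ifPn => // t0; rewrite mulr_ge0 ?sqr_ge0 ?expR_ge0. Qed.

Lemma dE_le3 t : 0 < t + 1 -> (t + 1) * dE t <= 3.
Proof.
move=> t1; rewrite dEE; case: ifPn => [t0|_]; last by rewrite mulr0.
have y0 : 0 <= t^-1 by rewrite invr_ge0 ltW.
have -> : (t + 1) * (t^-1 ^+ 2 * expR (- t^-1)) = t^-1 ^+ 1 * expR (- t^-1) + t^-1 ^+ 2 * expR (- t^-1).
  have e : t * t^-1 = 1 by rewrite divff// gt_eqF.
  by rewrite mulrDl mul1r [t^-1 ^+ 2]expr2 !mulrA e mul1r.
have := powexp_le 1 y0; have := powexp_le 2 y0; rewrite !factS fact0 /=; lra.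
Qed.

Lemma dE_small t : 0 < t + 1 -> (t + 1) * dE t <= 6 / (t + 1).
Proof.
move=> t1; have [t1'|t1'] := leP 1 t; last first.
  apply: le_trans (dE_le3 t1) _; rewrite ler_pdivlMr//; lra.
have t0 : 0 < t by lra.
have y0 : 0 <= t^-1 by rewrite invr_ge0 ltW.
rewrite dEE t0; apply: (@le_trans _ _ ((t + 1) * t^-1 ^+ 2)).
  apply: ler_wpM2l; first exact: ltW.
  by rewrite ler_piMr ?sqr_ge0// -expR0 ler_expR oppr_le0.
rewrite ler_pdivlMr// exprVn mulrAC ler_pdivrMr ?exprn_gt0//; nra.
Qed.

(** The cutoff equals 1 in the limit, and [x * dcut n x] stays bounded and tends
    to 0, although [dcut n] itself is of size [n] near the end points. *)
Definition cut (n : nat) t : R := E (n.+1%:R * t + -1) * E (- n.+1%:R * t + (n.+1%:R - 1)).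
Definition dcut (n : nat) t : R :=
  n.+1%:R * dE (n.+1%:R * t + -1) * E (- n.+1%:R * t + (n.+1%:R - 1)) -
  n.+1%:R * E (n.+1%:R * t + -1) * dE (- n.+1%:R * t + (n.+1%:R - 1)).

Lemma C1k_cut k n : C1k k (cut n).
Proof. by apply: C1k_mul; apply: C1k_affine; exact: C1k_flat. Qed.

Lemma der_affine (c d t : R) : is_derive t 1 (fun t => c * t + d) c.
Proof. by apply: (der_eq (derD (derZ c (derid t)) (derC t d))); rewrite /=; ring. Qed.

Lemma der_cut n t : is_derive t 1 (cut n) (dcut n t).
Proof.
have h1 := der_comp (der_flat 1 _) (der_affine n.+1%:R (-1) t).
have h2 := der_comp (der_flat 1 _) (der_affine (- n.+1%:R) (n.+1%:R - 1) t).
by apply: (der_eq (derM h1 h2)); rewrite /dcut /E /dE; ring.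
Qed.

Lemma cut_supp n t : cut n t != 0 -> n.+1%:R^-1 <= t <= 1 - n.+1%:R^-1.
Proof.
rewrite mulf_eq0 negb_or !EE; set N := n.+1%:R.
have N0 : 0 < N by rewrite ltr0n.
have NV : N * N^-1 = 1 by rewrite divff ?gt_eqF.
case: ifPn => [h1|_]; last by rewrite eqxx.
case: ifPn => [h2 _|_]; last by rewrite eqxx andbF.
by apply/andP; split; rewrite -(ler_pM2l N0) ?mulrBr NV; lra.
Qed.

Lemma cut_bound n t : `|cut n t| <= 1.
Proof.
have /andP[h1 h2] := E_01 (n.+1%:R * t + -1).
have /andP[h3 h4] := E_01 (- n.+1%:R * t + (n.+1%:R - 1)).
by rewrite ger0_norm ?mulr_ge0// mulr_ile1.
Qed.

Definition rad (n : nat) t : R := 6 * (t^-1 + (1 - t)^-1) * n.+1%:R^-1.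

Lemma rad_cvg t : rad n t @[n --> \oo] --> (0 : R).
Proof.
rewrite -(mulr0 (6 * (t^-1 + (1 - t)^-1))); apply: cvgM; first exact: cvg_cst.
exact: cvg_harmonic.
Qed.

Lemma cut_near1 n t : 0 < t < 1 -> `|cut n t - 1| <= rad n t.
Proof.
move=> /andP[t0 t1]; pose N : R := n.+1%:R.
have N0 : 0 < N by rewrite ltr0n.
have hx : N * t + -1 + 1 = N * t by ring.
have hy : - N * t + (N - 1) + 1 = N * (1 - t) by ring.
have px : 0 < N * t by rewrite mulr_gt0.
have py : 0 < N * (1 - t) by rewrite mulr_gt0// subr_gt0.
have h1 := @E_near1 (N * t + -1); rewrite hx in h1.
have h2 := @E_near1 (- N * t + (N - 1)); rewrite hy in h2.
have := h1 px; have := h2 py; rewrite /cut -/N.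
have /andP[a1 a2] := E_01 (N * t + -1); have /andP[b1 b2] := E_01 (- N * t + (N - 1)).
move: (E _) (E _) a1 a2 b1 b2 => A B a1 a2 b1 b2 hB hA.
have -> : rad n t = 3 * (2 / (N * t) + 2 / (N * (1 - t))).
  by rewrite /rad -/N !invfM; ring.
have q1 : 0 <= 2 / (N * t) by rewrite divr_ge0// ltW.
have q2 : 0 <= 2 / (N * (1 - t)) by rewrite divr_ge0// ltW.
move: (2 / _) (2 / _) q1 q2 hB hA => p q q1 q2 hB hA.
by rewrite ler_norml; apply/andP; split; nra.
Qed.

Lemma dcut_bound n t C g : 0 < t < 1 -> `|g| <= C * t -> `|g| <= C * (1 - t) ->
  `|g * dcut n t| <= 6 * C /\ `|g * dcut n t| <= C * rad n t.
Proof.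
move=> /andP[t0 t1] g1 g2; pose N : R := n.+1%:R.
have N0 : 0 < N by rewrite ltr0n.
have hx : N * t + -1 + 1 = N * t by ring.
have hy : - N * t + (N - 1) + 1 = N * (1 - t) by ring.
have px : 0 < N * t by rewrite mulr_gt0.
have py : 0 < N * (1 - t) by rewrite mulr_gt0// subr_gt0.
have C0 : 0 <= C by rewrite -(pmulr_lge0 _ t0) (le_trans _ g1).
have main : `|g * dcut n t| <= C * (N * t * dE (N * t + -1) + N * (1 - t) * dE (- N * t + (N - 1))).
  rewrite normrM /dcut -/N mulrDr.
  have /andP[a1 a2] := E_01 (N * t + -1); have /andP[b1 b2] := E_01 (- N * t + (N - 1)).
  have := dE_ge0 (N * t + -1); have := dE_ge0 (- N * t + (N - 1)).
  move: (E _) (E _) (dE _) (dE _) a1 a2 b1 b2 => A B p q a1 a2 b1 b2 q0 p0.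
  apply: le_trans (ler_wpM2l (normr_ge0 g) (ler_normB _ _)) _; rewrite mulrDr; apply: lerD.
    rewrite [X in _ * X]ger0_norm ?mulr_ge0 ?(ltW N0)//.
    rewrite (_ : C * (N * t * p) = (C * t) * (N * p)); last by ring.
    apply: ler_pM => //; first by rewrite !mulr_ge0// ltW.
    by rewrite ler_piMr// mulr_ge0// ltW.
  rewrite [X in _ * X]ger0_norm ?mulr_ge0 ?(ltW N0)//.
  rewrite (_ : C * (N * (1 - t) * q) = (C * (1 - t)) * (N * q)); last by ring.
  apply: ler_pM => //; first by rewrite !mulr_ge0// ltW.
  by rewrite ler_wpM2r// ler_piMr// ltW.
have h1 := @dE_le3 (N * t + -1); have h1' := @dE_small (N * t + -1); rewrite hx in h1 h1'.
have h2 := @dE_le3 (- N * t + (N - 1)); have h2' := @dE_small (- N * t + (N - 1)); rewrite hy in h2 h2'.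
have {}h1 := h1 px; have {}h1' := h1' px; have {}h2 := h2 py; have {}h2' := h2' py.
split; apply: le_trans main _.
  by rewrite [6 * C]mulrC ler_wpM2l//; lra.
rewrite ler_wpM2l//.
have -> : rad n t = 6 / (N * t) + 6 / (N * (1 - t)) by rewrite /rad -/N !invfM; ring.
exact: lerD.
Qed.

End Cutoff.

Section Weak.
Variable R : realType.
Local Notation leb := (@lebesgue_measure R).
Local Notation TR := (measurableTypeR R).
Local Notation T := (measurableTypeR R * measurableTypeR R)%type.
Local Notation sq := (sqi (lebO R)).
Implicit Types (u v w psi : T -> R) (i : 'I_2).

Lemma OmegaP i (x : R * R) : Omega R x <-> 0 < coord2 i x < 1 /\ 0 < other i x < 1.
Proof.
rewrite /Omega /coord2 /other /=; split; case: (i == ord0) => -[];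
  by rewrite /= !in_itv /= => h1 h2; split; rewrite /= ?in_itv.
Qed.

Lemma lebO_int_on (f : T -> R) C : measurable_fun setT f -> (forall x, Omega R x -> `|f x| <= C) ->
  (lebO R).-integrable setT (EFin \o f).
Proof.
move=> mf hf; apply/integrableP; split; first exact/measurable_EFinP.
apply: (@le_lt_trans _ _ (\int[lebO R]_x (`|C|%:E))%E).
  apply: ae_ge0_le_integral => //.
  - by apply/measurable_EFinP; exact: measurableT_comp.
  - apply: ae_Omega => x Ox _ /=; rewrite lee_fin; exact: le_trans (hf _ Ox) (ler_norm _).
rewrite integral_cst//; apply: lte_mul_pinfty => //.
by rewrite -[X in (X < _)%E]/(lebO R setT) lebO_setT ltry.
Qed.

Lemma sqi_on (f : T -> R) C : measurable_fun setT f -> (forall x, Omega R x -> `|f x| <= C) -> sq f.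
Proof.
move=> mf hf; split=> //; apply: (@lebO_int_on _ (C ^+ 2)).
  by apply: measurable_funX.
by move=> x Ox; rewrite normrX ler_sqr ?nnegrE ?hf//; apply: le_trans (hf _ Ox).
Qed.

Lemma cont_on (f : R * R -> R) : continuous f -> exists C : R, forall x, Omega R x -> `|f x| <= C.
Proof.
move=> cf; have [C hC] := cont_bounded2 cf; exists C => x /(OmegaP ord0) [/andP[h1 h2] /andP[h3 h4]].
by apply: hC; apply/andP; split; apply: ltW.
Qed.

Lemma cont_sqi (f : R * R -> R) : continuous f -> sq f.
Proof. by move=> cf; have [C hC] := cont_on cf; apply: sqi_on hC; exact: cont_measurable2. Qed.

Lemma cont_on1 (F : R -> R) : continuous F -> exists C : R, forall t, 0 < t < 1 -> `|F t| <= C.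
Proof.
move=> cF; have cF2 : continuous (fun x : R * R => F x.1).
  by move=> x; apply: (@continuous_comp _ _ _ fst F); [exact: cvg_fst|exact: cF].
have [C hC] := cont_bounded2 cF2; exists C => t /andP[h1 h2].
by apply: (hC (t, t)); apply/andP; split; apply: ltW.
Qed.

Lemma sqi_int u : sq u -> (lebO R).-integrable setT (EFin \o u).
Proof.
move=> hu; have h1 : sq (cst 1) by apply: (@sqi_on _ 1) => // x _; rewrite normr1.
rewrite (_ : u = fun x => u x * cst 1 x); first exact: sqi_mul_int.
by apply/funext => x; rewrite /= mulr1.
Qed.

Lemma sqi_mul_on u (h : T -> R) C : sq u -> measurable_fun setT h ->
  (forall x, Omega R x -> `|h x| <= C) -> (lebO R).-integrable setT (EFin \o (fun x => u x * h x)).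
Proof. by move=> hu mh hC; apply: sqi_mul_int => //; exact: sqi_on hC. Qed.

Lemma int_bounded_cvg u (h : nat -> T -> R) (l : T -> R) C : sq u ->
  (forall n, measurable_fun setT (h n)) -> measurable_fun setT l ->
  (forall n x, Omega R x -> `|h n x| <= C) ->
  (forall x, Omega R x -> h n x @[n --> \oo] --> l x) ->
  \int[lebO R]_x (u x * h n x) @[n --> \oo] --> \int[lebO R]_x (u x * l x).
Proof.
move=> hu mh ml hC hl; have mu0 := hu.1.
have lC x : Omega R x -> `|l x| <= C.
  move=> Ox; have hn : `|h n x| @[n --> \oo] --> `|l x| by exact: cvg_norm (hl x Ox).
  by apply: (cvgr_to_le hn); near=> n; exact: hC.
have [] := @dominated_convergence _ _ _ (lebO R) setT measurableT
  (fun n x => (u x * h n x)%:E) (fun x => (u x * l x)%:E) (fun x => (C * `|u x|)%:E).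
- by move=> n; apply/measurable_EFinP; exact: measurable_funM.
- by apply/measurable_EFinP; exact: measurable_funM.
- apply: ae_Omega => x Ox _; apply: cvg_EFin; first by near=> n.
  rewrite (_ : _ \o _ = fun n => u x * h n x)//.
  by apply: cvgM; [exact: cvg_cst|exact: hl].
- rewrite (_ : (fun x => _) = (fun x => C%:E * (abse \o (EFin \o u)) x)%E)//.
  by apply: integrableZl => //; exact/integrable_abse/sqi_int.
- apply: ae_Omega => x Ox n _; rewrite /= lee_fin normrM mulrC ler_wpM2r//; exact: hC.
move=> i1 _ h2; have i2 n := sqi_mul_on hu (mh n) (hC n).
rewrite /Rintegral; apply: fine_cvg; rewrite fineK; first exact: h2.
by have := integral_fune_fin_num measurableT (sqi_mul_on hu ml lC).
Unshelve. all: end_near. Qed.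

(** ** Test functions *)
Lemma test_out psi x : test_fun psi -> ~ Omega R x -> psi x = 0.
Proof.
move=> [_ [_ h]] nO; apply/eqP/negPn/negP => px; apply: nO; apply: h.
exact: subset_closure.
Qed.

Lemma test_sqi psi : test_fun psi -> sq psi.
Proof. by move=> [h _]; exact/cont_sqi/smooth_cont. Qed.

Lemma test_der_sqi psi i : test_fun psi -> sq (fun x => 'D_(basis2 R i) psi x).
Proof. by move=> [h _]; apply/cont_sqi/smooth_cont; case: (smooth_der i h). Qed.

Lemma test_prod (F G : R -> R) n i : (forall k, C1k k F) -> (forall k, C1k k G) ->
  test_fun (fun x => (F (coord2 i x) * cut n (coord2 i x)) * (G (other i x) * cut n (other i x))).
Proof.
move=> hF hG; split.
  by apply: (@smooth_prod _ (fun t => F t * cut n t) (fun t => G t * cut n t)) => k;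
    apply: C1k_mul => //; exact: C1k_cut.
set N : R := n.+1%:R^-1; have N0 : 0 < N by rewrite invr_gt0 ltr0n.
pose K : set (R * R) := `[N, 1 - N]%classic `*` `[N, 1 - N]%classic.
have cK : compact K by apply: compact_setX; exact: segment_compact.
have clK : closed K.
  by apply: compact_closed => //; exact: norm_hausdorff.
set A := [set x | _].
have AK : closure A `<=` K.
  rewrite (closure_id K).1//; apply: closureS => x; rewrite /A /= => h.
  have h1 : cut n (coord2 i x) != 0 by apply: contra h => /eqP ->; rewrite mulr0 mul0r.
  have h2 : cut n (other i x) != 0 by apply: contra h => /eqP ->; rewrite !mulr0.
  have := cut_supp h1; have := cut_supp h2.
  rewrite /coord2 /other /K; case: (i == ord0) => q1 q2; split; rewrite /= in_itv /=; done.
split; first exact: subclosed_compact (@closed_closure _ A) cK AK.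
move=> x /AK [] /=; rewrite !in_itv /= => h1 h2; split; rewrite /= in_itv /=; lra.
Qed.

Lemma meas1 (F : R -> R) i : continuous F ->
  measurable_fun (setT : set T) (fun x => F (coord2 i x)) /\
  measurable_fun (setT : set T) (fun x => F (other i x)).
Proof.
move=> cF; have mF := cont_measurable cF; split.
- exact: (measurableT_comp mF (@meas_coord2 R i)).
- exact: (measurableT_comp mF (@meas_other R i)).
Qed.

Lemma dcut_cont n : continuous (dcut n : R -> R).
Proof.
have [F' h cF'] := C1k_cut R 1 n; rewrite (_ : dcut n = F') //.
apply/funext => t; have [_ <-] := der_cut n t; by have [_ <-] := h t.
Qed.

(** Integration by parts against products that vanish only on the two sides
    orthogonal to the direction of the derivative. *)
Lemma weak_by_parts i u v (F F' G : R -> R) C : sq u -> is_weak_partial i u v ->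
  (forall k, C1k k F) -> (forall k, C1k k G) -> (forall t : R, is_derive t 1 F (F' t)) ->
  (forall t, 0 < t < 1 -> `|F t| <= C * t /\ `|F t| <= C * (1 - t)) ->
  \int[lebO R]_x (u x * (F' (coord2 i x) * G (other i x))) =
  - \int[lebO R]_x (v x * (F (coord2 i x) * G (other i x))).
Proof.
move=> hu [/Lfun2P hv uv] hF hG dF bF.
have cF := C1k_cont (hF 0%N); have cG := C1k_cont (hG 0%N).
have cF' : continuous F'.
  have [F1 h c1] := hF 1%N; rewrite (_ : F' = F1)//.
  by apply/funext => t; have [_ <-] := dF t; have [_ <-] := h t.
have [BF hBF] := cont_on1 cF; have [BF' hBF'] := cont_on1 cF'; have [BG hBG] := cont_on1 cG.
pose psi n : T -> R := fun x => (F (coord2 i x) * cut n (coord2 i x)) * (G (other i x) * cut n (other i x)).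
pose dpsi n : T -> R := fun x =>
  (F' (coord2 i x) * cut n (coord2 i x) + F (coord2 i x) * dcut n (coord2 i x)) *
  (G (other i x) * cut n (other i x)).
have dE n x : 'D_(basis2 R i) (psi n) x = dpsi n x.
  rewrite derive_slice.
  have [_ h] := @prod_der R (fun t => F t * cut n t) (fun t => G t * cut n t)
    (fun t => F' t * cut n t + F t * dcut n t) i x (fun t => derM (dF t) (der_cut n t)).
  exact: h.
have eqn n : \int[lebO R]_x (u x * dpsi n x) = - \int[lebO R]_x (v x * psi n x).
  by rewrite -(uv _ (test_prod n i hF hG)); apply: eq_Rintegral => x _; rewrite dE.
have cc n : continuous (cut n : R -> R) by exact: C1k_cont (C1k_cut R 0 n).
have M n := (meas1 i (cc n)); have M' n := (meas1 i (@dcut_cont n)).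
have [mF _] := meas1 i cF; have [mF' _] := meas1 i cF'; have [_ mG] := meas1 i cG.
have mulcut n (y B t : R) : `|y| <= B -> `|y * cut n t| <= B.
  by move=> h; rewrite (normrM y) -[leRHS]mulr1; apply: ler_pM => //; exact: cut_bound.
have l1 : \int[lebO R]_x (v x * psi n x) @[n --> \oo] -->
          \int[lebO R]_x (v x * (F (coord2 i x) * G (other i x))).
  apply: (@int_bounded_cvg v psi _ (BF * BG)) => //.
  - move=> n; apply: measurable_funM; apply: measurable_funM => //; [exact: (M n).1|exact: (M n).2].
  - exact: measurable_funM.
  - move=> n x /(OmegaP i)[h1 h2]; rewrite /psi normrM; apply: ler_pM => //.
      exact: (mulcut _ _ _ _ (hBF _ h1)).
    exact: (mulcut _ _ _ _ (hBG _ h2)).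
  - move=> x /(OmegaP i)[h1 h2].
    have -> : F (coord2 i x) * G (other i x) = (F (coord2 i x) * 1) * (G (other i x) * 1) by rewrite !mulr1.
    apply: cvgM; apply: cvgM; try exact: cvg_cst.
      exact: squeeze0 (fun n => cut_near1 n h1) (rad_cvg _).
    exact: squeeze0 (fun n => cut_near1 n h2) (rad_cvg _).
have l2 : \int[lebO R]_x (u x * dpsi n x) @[n --> \oo] -->
          \int[lebO R]_x (u x * (F' (coord2 i x) * G (other i x))).
  apply: (@int_bounded_cvg u dpsi _ ((BF' + 6 * C) * BG)) => //.
  - move=> n; apply: measurable_funM; last by apply: measurable_funM => //; exact: (M n).2.
    apply: measurable_funD; apply: measurable_funM => //; [exact: (M n).1|exact: (M' n).1].
  - exact: measurable_funM.
  - move=> n x /(OmegaP i)[h1 h2]; rewrite /dpsi normrM; apply: ler_pM => //.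
      apply: le_trans (ler_normD _ _) _; apply: lerD.
        exact: (mulcut _ _ _ _ (hBF' _ h1)).
      by have [f1 f2] := bF _ h1; exact: (dcut_bound n h1 f1 f2).1.
    exact: (mulcut _ _ _ _ (hBG _ h2)).
  - move=> x /(OmegaP i)[h1 h2].
    have -> : F' (coord2 i x) * G (other i x) = (F' (coord2 i x) * 1 + 0) * (G (other i x) * 1).
      by rewrite !mulr1 addr0.
    apply: cvgM.
      apply: cvgD.
        apply: cvgM; first exact: cvg_cst.
        exact: squeeze0 (fun n => cut_near1 n h1) (rad_cvg _).
      apply: (@squeeze0 _ _ (fun n => C * rad n (coord2 i x))).
        by move=> n; rewrite subr0; have [f1 f2] := bF _ h1; exact: (dcut_bound n h1 f1 f2).2.
      rewrite -(mulr0 C); apply: cvgM; [exact: cvg_cst|exact: rad_cvg].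
    apply: cvgM; first exact: cvg_cst.
    exact: squeeze0 (fun n => cut_near1 n h2) (rad_cvg _).
have l3 : (- \int[lebO R]_x (v x * psi n x)) @[n --> \oo] -->
          - \int[lebO R]_x (v x * (F (coord2 i x) * G (other i x))) by exact: cvgN l1.
have l2' : (- \int[lebO R]_x (v x * psi n x)) @[n --> \oo] -->
          \int[lebO R]_x (u x * (F' (coord2 i x) * G (other i x))).
  by move: l2; under eq_fun do rewrite eqn.
exact: cvg_unique l2' l3.
Qed.

(** ** Uniqueness and stability of weak derivatives *)
(** Cutoffs turn products of cosines into test functions; in the limit [w] is orthogonal to
    the complete cosine system. *)
Lemma test_separates w : sq w -> (forall psi, test_fun psi -> \int[lebO R]_x (w x * psi x) = 0) ->
  w = cst 0 %[ae lebO R].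
Proof.
move=> hw h; apply: cc_complete => // -[m n].
have [Hm Hn] := (fun k => C1k_cs R k m, fun k => C1k_cs R k n).
have l : \int[lebO R]_x (w x * ((cs m x.1 * cut k x.1) * (cs n x.2 * cut k x.2))) @[k --> \oo] -->
         \int[lebO R]_x (w x * cc (m, n) x).
  have cc' k : continuous (cut k : R -> R) by exact: C1k_cont (C1k_cut R 0 k).
  have cm := C1k_cont (Hm 0%N); have cn := C1k_cont (Hn 0%N).
  have [m1 _] := meas1 ord0 cm; have [_ m2] := meas1 ord0 cn.
  apply: (@int_bounded_cvg w _ _ 4) => //.
  - move=> k; have [m3 m4] := meas1 ord0 (cc' k).
    by apply: measurable_funM; apply: measurable_funM.
  - exact: meas_cc.
  - move=> k x Ox; rewrite (_ : (4 : R) = (2 * 1) * (2 * 1)); last by ring.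
    by rewrite normrM; apply: ler_pM => //; rewrite normrM; apply: ler_pM => //;
      rewrite ?cs_bound ?cut_bound.
  - move=> x /(OmegaP ord0)[h1 h2].
    have -> : cc (m, n) x = (cs m x.1 * 1) * (cs n x.2 * 1) by rewrite !mulr1.
    apply: cvgM; apply: cvgM; try exact: cvg_cst.
      exact: squeeze0 (fun n => cut_near1 n h1) (rad_cvg _).
    exact: squeeze0 (fun n => cut_near1 n h2) (rad_cvg _).
have l0 : \int[lebO R]_x (w x * ((cs m x.1 * cut k x.1) * (cs n x.2 * cut k x.2))) @[k --> \oo] --> (0 : R).
  rewrite (_ : (fun k => _) = cst 0); first exact: cvg_cst.
  by apply/funext => k; exact: (h _ (test_prod k ord0 Hm Hn)).
exact: cvg_unique l l0.
Qed.

Lemma weak_unique i u v w : is_weak_partial i u v -> is_weak_partial i u w ->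
  v = w %[ae lebO R].
Proof.
move=> [/Lfun2P hv h1] [/Lfun2P hw h2].
have hd : sq (-1 *: w + v) by exact: sqi_lin.
have := test_separates hd; case.
  move=> psi tp; have sp := test_sqi tp.
  have S := ip2_semiip (lebO R).
  have := sip_lin S (-1) hw hv sp; rewrite /ip2 => ->.
  by rewrite -[X in _ + X]opprK -h1// -[X in _ * X]opprK -h2//; ring.
move=> N [mN N0 hN]; exists N; split => // x hx; apply: hN => /= hx'; apply: hx => _.
have e : (-1 *: w + v) x = -1 * w x + v x by [].
by move: (hx' I); rewrite e mulN1r addrC; exact: subr0_eq.
Qed.

Lemma weak_cvg i (u v : nat -> T -> R) u' v' : (forall n, sq (u n)) ->
  (forall n, is_weak_partial i (u n) (v n)) -> sq u' -> sq v' ->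
  sconv (ip2 (lebO R)) u u' -> sconv (ip2 (lebO R)) v v' -> is_weak_partial i u' v'.
Proof.
move=> hu huv hu' hv' cu cv; split=> [|psi tp]; first exact/Lfun2P.
have S := ip2_semiip (lebO R).
have hv n : sq (v n) by have [/Lfun2P] := huv n.
have l1 := sconv_ip S hu hu' (test_der_sqi i tp) cu.
have l2 := sconv_ip S hv hv' (test_sqi tp) cv.
have l3 : (- ip2 (lebO R) (v n) psi) @[n --> \oo] --> - ip2 (lebO R) v' psi by exact: cvgN l2.
have l1' : (- ip2 (lebO R) (v n) psi) @[n --> \oo] --> ip2 (lebO R) u' (fun x => 'D_(basis2 R i) psi x).
  rewrite (_ : (fun n => _) = fun n => ip2 (lebO R) (u n) (fun x => 'D_(basis2 R i) psi x)) //.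
  by apply/funext => n; have [_ h] := huv n; rewrite /ip2 h.
exact: cvg_unique l1' l3.
Qed.

Lemma weak_lin i u v u' v' c : sq u -> sq u' -> is_weak_partial i u v -> is_weak_partial i u' v' ->
  is_weak_partial i (c *: u + u') (c *: v + v').
Proof.
move=> hu hu' [/Lfun2P hv h1] [/Lfun2P hv' h2]; split=> [|psi tp].
  by apply/Lfun2P; exact: sqi_lin.
have S := ip2_semiip (lebO R).
have := sip_lin S c hu hu' (test_der_sqi i tp); have := sip_lin S c hv hv' (test_sqi tp).
by rewrite /ip2 => -> ->; rewrite h1// h2//; ring.
Qed.

Lemma Rintegral_ae (f g : T -> R) : measurable_fun setT f -> measurable_fun setT g ->
  f = g %[ae lebO R] -> \int[lebO R]_x f x = \int[lebO R]_x g x.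
Proof.
move=> mf mg h; rewrite /Rintegral; congr fine; apply: ae_eq_integral => //.
- exact/measurable_EFinP.
- exact/measurable_EFinP.
- by move: h; apply: filterS => x h /h ->.
Qed.

Lemma weak_ae i u u' v : sq u -> sq u' -> u = u' %[ae lebO R] -> is_weak_partial i u v ->
  is_weak_partial i u' v.
Proof.
move=> hu hu' E [hv h]; split=> // psi tp; rewrite -h//; apply: Rintegral_ae.
- by apply: measurable_funM; [exact: hu'.1|exact: (test_der_sqi i tp).1].
- by apply: measurable_funM; [exact: hu.1|exact: (test_der_sqi i tp).1].
- by move: E; apply: filterS => x E /E ->.
Qed.

(** ** Classical derivatives *)
Lemma Rfubini i (f : T -> R) : (lebO R).-integrable setT (EFin \o f) ->
  \int[lebO R]_x f x = \int[@muI R]_y \int[@muI R]_t f (upd i (y, y) t).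
Proof.
case: i => -[|[|]]//= hi; last by move=> /Rintegral_fubini [].
move=> /integrable_lebO hf.
have e := integral21_prod_meas1 hf; have mG := measurable_fubini_G hf.
have hae := ae_integrable2 hf.
rewrite [LHS]/Rintegral integral_lebO -e /Rintegral; congr fine.
apply: ae_eq_integral => //.
  apply/measurable_EFinP; apply: (measurableT_comp (fine_measurable measurableT)).
  exact: mG.
apply: filterS hae => y hy _; rewrite /fubini_G /Rintegral /= fineK//.
exact: integrable_fin_num.
Qed.

Lemma int_slice i (f g : R * R -> R) : smooth2 f -> (forall x, g x = 'D_(basis2 R i) f x) ->
  \int[lebO R]_x g x = \int[@muI R]_y (f (upd i (y, y) 1) - f (upd i (y, y) 0)).
Proof.
move=> sf gE; have [df sdf] := smooth_der i sf.
have {gE} -> : g = (fun x => 'D_(basis2 R i) f x) by apply/funext.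
have ig := sqi_int (cont_sqi (smooth_cont sdf)).
have -> := Rfubini i ig; apply: eq_Rintegral => y _.
apply: (@FTC01 R (fun t => 'D_(basis2 R i) f (upd i (y, y) t)) (f \o upd i (y, y))).
  move=> t; apply: (@continuous_comp _ _ _ (upd i (y, y)) (fun x => 'D_(basis2 R i) f x)).
    exact: upd_cont.
  exact: smooth_cont.
by move=> t; exact: smooth_slice.
Qed.

Lemma Ck2W k (f : R * R -> R) : Ck2 k.+1 setT f -> Ck2 k setT f.
Proof.
elim: k f => [|k IH] f [cf h]; first by split.
by split=> // i; have [h1 h2] := h i; split=> //; exact: IH.
Qed.

Lemma Ck2_mul k (f g : R * R -> R) : Ck2 k setT f -> Ck2 k setT g -> Ck2 k setT (f \* g).
Proof.
elim: k f g => [|k IH] f g.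
  by move=> [cf _] [cg _]; split; [move=> x _; apply: cvgM; [exact: cf|exact: cg]|].
move=> kf kg; have [kf0 kg0] := (Ck2W kf, Ck2W kg).
case: kf => cf hf; case: kg => cg hg.
split=> [x _|i]; first by apply: cvgM; [exact: cf|exact: cg].
have [df kf] := hf i; have [dg kg] := hg i; split=> [x _|].
  by apply: derivableM; [exact: df|exact: dg].
rewrite (_ : (fun x => _) = 1 *: (f \* (fun x => 'D_(basis2 R i) g x)) + (g \* (fun x => 'D_(basis2 R i) f x))).
  by apply: Ck2_lin; exact: IH.
apply/funext => x; rewrite deriveM; [|exact: df|exact: dg].
by rewrite scale1r.
Qed.

Lemma smooth_mul (f g : R * R -> R) : smooth2 f -> smooth2 g -> smooth2 (f \* g).
Proof. by move=> hf hg k; exact: Ck2_mul. Qed.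

Lemma derive_mul i (f g : R * R -> R) x : smooth2 f -> smooth2 g ->
  'D_(basis2 R i) (f \* g) x = f x * 'D_(basis2 R i) g x + g x * 'D_(basis2 R i) f x.
Proof.
by move=> /(smooth_der i)[df _] /(smooth_der i)[dg _]; rewrite deriveM.
Qed.

Lemma smooth_weak i (f : R * R -> R) : smooth2 f ->
  is_weak_partial i f (fun x => 'D_(basis2 R i) f x).
Proof.
move=> sf; have [df sdf] := smooth_der i sf; split.
  by apply/Lfun2P; exact/cont_sqi/smooth_cont.
move=> psi tp; have sp := tp.1; have [dp sdp] := smooth_der i sp.
have i1 := sqi_mul_int (cont_sqi (smooth_cont sf)) (test_der_sqi i tp).
have i2 := sqi_mul_int (cont_sqi (smooth_cont sdf)) (test_sqi tp).
apply/eqP; rewrite -addr_eq0 -RintegralD//; apply/eqP.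
rewrite (@int_slice i (f \* psi)).
- rewrite (@eq_Rintegral _ _ _ _ _ (cst 0)); first by rewrite Rintegral_cst// mul0r.
  move=> y _ /=; rewrite !(test_out tp) ?mulr0 ?subr0//.
    by move=> /(OmegaP i); rewrite coord2_upd ltxx => -[].
  by move=> /(OmegaP i); rewrite coord2_upd ltxx andbF => -[].
- exact: smooth_mul.
- by move=> x; rewrite derive_mul// [psi x * _]mulrC.
Qed.

End Weak.

(** ** Diagonalisation of one semi-inner product with respect to another *)

Section Spectral.
Variables (R : realType) (V : lmodType R).
Variables (D Q : V -> Prop) (b A : V -> V -> R).

Record eigenbasis (e : nat -> V) (nu : nat -> R) : Prop := Eigenbasis {
  eig_in : forall k, Q (e k);
  eig_orth : forall j k, b (e j) (e k) = (j == k)%:R;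
  eig_eq : forall k psi, Q psi -> A (e k) psi = nu k * b (e k) psi;
  eig_total : forall u, D u -> (forall k, b u (e k) = 0) -> b u u = 0 }.

Record form_pair (c0 : R) : Prop := FormPair {
  fp_b : semiip D b;
  fp_A : semiip Q A;
  fp_bC : scomplete D b;
  fp_AC : scomplete Q A;
  fp_sub : forall u, Q u -> D u;
  fp_c0 : 0 < c0;
  fp_coer : forall u, Q u -> c0 * b u u <= A u u;
  fp_sat : forall u v, D u -> Q v -> b (u - v) (u - v) = 0 -> Q u;
  fp_null : forall u, Q u -> b u u = 0 -> A u u = 0 }.

Section WithBasis.
Variables (c0 : R) (e : nat -> V) (nu : nat -> R).
Hypothesis F : form_pair c0.
Hypothesis E : eigenbasis e nu.
Implicit Types (c : nat -> R) (M lam : R).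
Let S := fp_b F.
Let SA := fp_A F.
Let QD := fp_sub F.
Let eQ := eig_in E.
Let eD k : D (e k). Proof. exact: QD. Qed.
Let oe := eig_orth E.

Lemma eig_coef k psi : Q psi -> A psi (e k) = nu k * b psi (e k).
Proof.
move=> Qp; rewrite (sip_sym SA)// (eig_eq E)// (sip_sym S)//; exact: QD.
Qed.

Lemma nu_ge k : c0 <= nu k.
Proof.
have := fp_coer F (eQ k); rewrite (eig_eq E)// oe eqxx.
by rewrite !mulr1.
Qed.

Lemma nu_gt0 k : 0 < nu k.
Proof. exact: lt_le_trans (fp_c0 F) (nu_ge k). Qed.

Lemma Q_comb c K : Q (comb e c K).
Proof. by apply: (sip_sum SA) => i _; exact: (sipZ SA). Qed.

Lemma A_comb c K psi : Q psi ->
  A (comb e c K) psi = \sum_(k < K) nu k * c k * b (e k) psi.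
Proof.
move=> Qp; rewrite /comb (b_suml SA)//; last by move=> i; exact: (sipZ SA).
by apply: eq_bigr => i _; rewrite (bZl SA)// (eig_eq E)//; ring.
Qed.

Lemma A_comb_comb c K : A (comb e c K) (comb e c K) = \sum_(k < K) nu k * c k ^+ 2.
Proof.
rewrite A_comb; last exact: Q_comb.
apply: eq_bigr => i _; rewrite (sip_sym S)//; last by apply: QD; exact: Q_comb.
by rewrite (comb_coef S eD oe) ltn_ord; ring.
Qed.

Lemma A_bessel u K : Q u -> \sum_(k < K) nu k * b u (e k) ^+ 2 <= A u u.
Proof.
move=> Qu; have := sip_ge0 SA (sipB SA Qu (Q_comb (fun k => b u (e k)) K)).
rewrite (bBB SA)//; last exact: Q_comb.
rewrite A_comb_comb (sip_sym SA Qu (Q_comb _ _)) A_comb// mulr_sumr => h.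
have -> : \sum_(k < K) nu k * b u (e k) ^+ 2 = \sum_(i < K) 2 * (nu i * b u (e i) * b (e i) u)
   - \sum_(k < K) nu k * b u (e k) ^+ 2.
  rewrite -sumrB; apply: eq_bigr => i _; rewrite [b (e i) u](sip_sym S)//; last exact: QD.
  by ring.
by move: h; lra.
Qed.

(** The domain of the form is the set of the [u] whose coefficients make
    [sum nu_k c_k^2] converge. *)
Lemma A_comb_cauchy c M : (forall K, \sum_(k < K) nu k * c k ^+ 2 <= M) ->
  exists v, [/\ Q v, sconv A (comb e c) v & sconv b (comb e c) v].
Proof.
move=> uM.
have ca : scauchy A (comb e c).
  move=> d d0.
  have nn k : 0 <= nu k * c k ^+ 2 by rewrite mulr_ge0 ?sqr_ge0 ?(ltW (nu_gt0 k)).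
  have [N hN] := series_cauchy nn uM d0.
  exists N => n m; wlog nm : n m / (m <= n)%N.
    move=> h nN mN; have [nm|/ltnW nm] := leqP m n; first exact: h.
    by rewrite (bBBC SA)//; [exact: h|exact: Q_comb..].
  move=> _ mN; apply: le_lt_trans (hN _ _ mN nm).
  rewrite (bBB SA); [|exact: Q_comb..].
  rewrite !A_comb_comb A_comb; last exact: Q_comb.
  have -> : \sum_(k < n) nu k * c k * b (e k) (comb e c m) = \sum_(k < m) nu k * c k ^+ 2.
    rewrite -[in LHS](subnKC nm) big_split_ord/= [X in _ + X]big1 ?addr0.
      apply: eq_bigr => i _; rewrite (sip_sym S)//; last by apply: QD; exact: Q_comb.
      by rewrite (comb_coef S eD oe) ltn_ord; ring.
    move=> i _; rewrite (sip_sym S)//; last by apply: QD; exact: Q_comb.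
    by rewrite (comb_coef S eD oe) ltnNge leq_addr mulr0.
  by lra.
have [v Qv cv] := fp_AC F (Q_comb c) ca.
have cb : sconv b (comb e c) v.
  move=> d d0; have [|N hN] := cv (c0 * d); first by rewrite mulr_gt0 ?(fp_c0 F).
  exists N => n nN; rewrite -(ltr_pM2l (fp_c0 F)).
  by apply: le_lt_trans (hN _ nN); apply: (fp_coer F); apply: (sipB SA) => //; exact: Q_comb.
by exists v.
Qed.

Lemma Q_of_coef u M : D u -> (forall K, \sum_(k < K) nu k * b u (e k) ^+ 2 <= M) -> Q u.
Proof.
move=> Du uM; pose c k := b u (e k).
have [v [Qv _ cb]] := A_comb_cauchy (c := c) uM.
apply: (fp_sat F Du Qv).
have Dc n : D (comb e c n) by apply: QD; exact: Q_comb.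
apply: (sconv_null S Dc Du (QD Qv)) => //.
exact: (parseval S eD oe (fp_bC F) (eig_total E)).
Qed.


Lemma A_parseval u : Q u -> sconv A (comb e (fun k => b u (e k))) u.
Proof.
move=> Qu; have [v [Qv cA cb]] := A_comb_cauchy (c := fun k => b u (e k)) (fun K => A_bessel K Qu).
have Dc n : D (comb e (fun k => b u (e k)) n) by apply: QD; exact: Q_comb.
have n0 : A (v - u) (v - u) = 0.
  apply: (fp_null F); first exact: (sipB SA).
  apply: (sconv_null S Dc (QD Qv) (QD Qu)) => //.
  by apply: (parseval S eD oe (fp_bC F) (eig_total E)); exact: QD.
move=> d d0; have [|N hN] := cA (d / 2); first by rewrite divr_gt0.
exists N => n nN; apply: le_lt_trans (b_tri SA (Q_comb _ n) Qv Qu) _.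
by rewrite n0 mulr0 addr0; have := hN _ nN; lra.
Qed.

Lemma A_series u psi : Q u -> Q psi ->
  \sum_(k < n) nu k * b u (e k) * b psi (e k) @[n --> \oo] --> A u psi.
Proof.
move=> Qu Qp.
rewrite (_ : (fun n => _) = fun n => A (comb e (fun k => b u (e k)) n) psi).
  exact: (sconv_ip SA (fun n => Q_comb _ n) Qu Qp (A_parseval Qu)).
apply/funext => n; rewrite A_comb//; apply: eq_bigr => i _.
by rewrite [b (e i) psi](sip_sym S)//; exact: QD.
Qed.

(** The resolvent acts on coefficients by division by [lam + nu_k]. *)
Lemma resolvent_ex lam w : 0 <= lam -> D w -> exists2 v, Q v &
  forall psi, Q psi -> A v psi + lam * b v psi = b w psi.
Proof.
move=> l0 Dw; pose c k := b w (e k) / (lam + nu k).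
have lp k : 0 < lam + nu k by rewrite ltr_wpDl// nu_gt0.
have cM K : \sum_(k < K) nu k * c k ^+ 2 <= c0^-1 * b w w.
  apply: le_trans (ler_wpM2l _ (bessel S eD oe K Dw)); last by rewrite invr_ge0 (ltW (fp_c0 F)).
  rewrite mulr_sumr; apply: ler_sum => k _; rewrite /c expr_div_n mulrCA.
  rewrite [leRHS]mulrC ler_wpM2l ?sqr_ge0//.
  rewrite ler_pdivrMr ?exprn_gt0//.
  have ? := nu_gt0 k; have ? := nu_ge k; have ? := fp_c0 F.
  rewrite mulrC ler_pdivlMr//; nra.
have [v [Qv cA cb]] := A_comb_cauchy cM.
exists v => // psi Qp; have Dc n : D (comb e c n) by apply: QD; exact: Q_comb.
have h1 := sconv_ip SA (Q_comb c) Qv Qp cA.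
have h2 := sconv_ip S Dc (QD Qv) (QD Qp) cb.
have h3 := sconv_ip S (D_comb S eD _) Dw (QD Qp) (parseval S eD oe (fp_bC F) (eig_total E) Dw).
have cl : (fun=> lam) @ \oo --> lam by exact: cvg_cst.
have h4 : (fun n => A (comb e c n) psi + lam * b (comb e c n) psi) @ \oo -->
    A v psi + lam * b v psi by exact: cvgD h1 (cvgM cl h2).
have /cvg_lim <- // := h4; have /cvg_lim <- // := h3.
congr (lim (_ @ \oo)).
apply/funext => n; rewrite A_comb// /comb.
have Dp := QD Qp.
rewrite !(b_suml S)//; [|by move=> i; exact: (sipZ S)..].
rewrite mulr_sumr -big_split/=; apply: eq_bigr => i _.
rewrite !(bZl S)// /c; field.
by rewrite gt_eqF.
Qed.

Lemma resolvent_coef lam v w : 0 <= lam -> D w -> Q v ->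
  (forall psi, Q psi -> A v psi + lam * b v psi = b w psi) ->
  forall k, b v (e k) = b w (e k) / (lam + nu k).
Proof.
move=> l0 Dw Qv h k; have := h _ (eQ k); rewrite eig_coef// => <-.
by field; rewrite gt_eqF// ltr_wpDl// nu_gt0.
Qed.
End WithBasis.
End Spectral.

(** ** Existence of an eigenbasis *)

Section Existence.
Variables (R : realType) (V : lmodType R).
Variables (D Q : V -> Prop) (b A : V -> V -> R) (c0 : R).
Hypothesis F : form_pair D Q b A c0.

Definition compact_embedding : Prop := forall (u : nat -> V) (M : R),
  (forall n, Q (u n)) -> (forall n, A (u n) (u n) <= M) ->
  exists2 s : nat -> nat, (forall n, (n <= s n)%N) & scauchy b (u \o s).

Hypothesis K : compact_embedding.
Hypothesis dense : forall u, D u -> forall d : R, 0 < d ->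
  exists2 v, Q v & b (u - v) (u - v) < d.
Hypothesis infinite : exists (g : nat -> V) (d : R), [/\ 0 < d, forall k, Q (g k) &
  forall (c : nat -> R) K, d * \sum_(k < K) c k ^+ 2 <= b (comb g c K) (comb g c K)].

Let S := fp_b F.
Let SA := fp_A F.
Let QD := fp_sub F.

Definition perp (s : seq V) (u : V) : Prop := forall g, g \in s -> b u g = 0.

Definition next_eig (s : seq V) (p : V * R) : Prop :=
  [/\ Q p.1, b p.1 p.1 = 1, perp s p.1, A p.1 p.1 = p.2 &
      forall u, Q u -> perp s u -> p.2 * b u u <= A u u].

Definition ortho (s : seq V) : Prop :=
  [/\ uniq s, forall g, g \in s -> Q g & {in s &, forall g h, b g h = (g == h)%:R}].

Lemma unit_perp (s : seq V) : ortho s -> exists u, [/\ Q u, b u u = 1 & perp s u].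
Proof.
move=> [us sQ so]; apply: contrapT => hn.
have null u : Q u -> perp s u -> b u u = 0.
  move=> Qu pu; apply: contrapT => /eqP u0; apply: hn.
  have up : 0 < b u u by rewrite lt_neqAle eq_sym u0 (sip_ge0 S)//; exact: QD.
  have q0 : 0 < Num.sqrt (b u u) by rewrite sqrtr_gt0.
  have q2 : Num.sqrt (b u u) ^+ 2 = b u u by rewrite sqr_sqrtr// ltW.
  have Du := QD Qu; have Dv := sipZ S (Num.sqrt (b u u))^-1 Du.
  exists ((Num.sqrt (b u u))^-1 *: u); split; first exact: (sipZ SA).
    rewrite (bZl S _ Du Dv) (bZr S _ Du Du).
    by rewrite -{3}q2; field; rewrite gt_eqF.
  by move=> g gs; rewrite (bZl S _ Du (QD (sQ _ gs))) (pu g gs) mulr0.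
have [g [d [d0 Qg gd]]] := infinite.
pose f (i : 'I_(size s)) := nth 0 s i.
have Df i : D (f i) by apply/QD/sQ; exact: mem_nth.
(* A linear system with more unknowns than equations has a nonzero solution. *)
pose M : 'M[R]_((size s).+1, size s) := \matrix_(m, i) b (g m) (f i).
have : kermx M != 0.
  by rewrite kermx_eq0 /row_free neq_ltn ltnS rank_leq_col.
rewrite -nz_row_eq0; set v := nz_row _ => v0.
have vM : v *m M = 0 by apply/sub_kermxP; exact: nz_row_sub.
pose c (m : nat) : R := v 0 (inord m).
have Dg m : D (c m *: g m) by apply: (sipZ S); exact: QD.
have Qx : Q (comb g c (size s).+1).
  by apply: (sip_sum SA) => i _; apply: (sipZ SA).
have px : perp s (comb g c (size s).+1).
  move=> h hs; have [i ->] : exists i, h = f i.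
    by move: hs => /(nthP 0)[i isz <-]; exists (Ordinal isz).
  have Dgi (j : 'I_(size s).+1) : D (c j *: g j) by exact: Dg.
  have := congr1 (fun w : 'rV_(size s) => w 0 i) vM; rewrite !mxE => <-.
  rewrite (b_suml S _ Dgi (Df i)); apply: eq_bigr => j _.
  by rewrite mxE (bZl S _ (QD (Qg j)) (Df i)) /c inord_val.
have := gd c (size s).+1; rewrite (null _ Qx px) leNgt => /negP; apply.
rewrite mulr_gt0// lt_neqAle sumr_ge0 ?andbT; last by move=> i _; rewrite sqr_ge0.
apply: contra v0; rewrite eq_sym psumr_eq0; last by move=> i _; rewrite sqr_ge0.
move=> /allP h; apply/eqP/rowP => j; rewrite mxE.
have := h j (mem_index_enum _); rewrite /= sqrf_eq0 /c inord_val => /eqP.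
by [].
Qed.

(** The minimum of the Rayleigh quotient on the orthogonal complement of finitely
    many vectors is attained: a minimising sequence has a subsequence that is
    Cauchy for [b], hence for [A] by the parallelogram identity. *)
Lemma next_eig_ex (s : seq V) : ortho s -> exists p, next_eig s p.
Proof.
move=> os; have [u0 [Qu0 bu0 pu0]] := unit_perp os; have [_ sQ _] := os.
pose E := [set A u u | u in [set u | [/\ Q u, b u u = 1 & perp s u]]].
have E0 : E !=set0 by exists (A u0 u0), u0.
have El : lbound E 0 by move=> _ [u [Qu _ _] <-]; exact: sip_ge0 SA _ Qu.
have hE : has_inf E by split => //; exists 0.
pose I := inf E.
have Ile u : Q u -> perp s u -> I * b u u <= A u u.
  move=> Qu pu; have := sip_ge0 S (QD Qu); rewrite le_eqVlt => /predU1P[<-|u1].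
    by rewrite mulr0; exact: sip_ge0 SA _ Qu.
  have q0 : 0 < Num.sqrt (b u u) by rewrite sqrtr_gt0.
  have q2 : Num.sqrt (b u u) ^+ 2 = b u u by rewrite sqr_sqrtr// ltW.
  have Qv : Q ((Num.sqrt (b u u))^-1 *: u) by exact: (sipZ SA).
  have : I <= A ((Num.sqrt (b u u))^-1 *: u) ((Num.sqrt (b u u))^-1 *: u).
    apply: ge_inf => //; first by exists 0.
    exists ((Num.sqrt (b u u))^-1 *: u) => //; split => //.
      rewrite (bZl S) ?(bZr S)//; [|exact: QD..].
      by rewrite -{3}q2; field; rewrite gt_eqF.
    by move=> g gs; have Dg := QD (sQ _ gs); rewrite (bZl S _ (QD Qu) Dg) (pu g gs) mulr0.
  rewrite (bZl SA) ?(bZr SA)// -ler_pdivlMr//.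
  have -> : A u u / b u u = (Num.sqrt (b u u))^-1 * ((Num.sqrt (b u u))^-1 * A u u).
    by rewrite -[in LHS]q2; field; rewrite gt_eqF.
  by [].
have ex n : exists u, [/\ Q u, b u u = 1, perp s u & A u u < I + n.+1%:R^-1].
  have [|_ [u [Qu u1 pu] <-] h] := @inf_adherent _ E (n.+1%:R^-1) _ hE; first by rewrite invr_gt0.
  by exists u.
have [u /all_and4[Qu u1 pu uI]] := choice ex.
have uM n : A (u n) (u n) <= I + 1.
  by apply: le_trans (ltW (uI n)) _; rewrite lerD2l invf_le1// ler1n.
have [t tn ct] := K Qu uM.
have cA : scauchy A (u \o t).
  move=> d d0; have I1 : 0 < I + 1.
    by apply: lt_le_trans (uM 0%N); apply: lt_le_trans (fp_coer F (Qu _)); rewrite u1 mulr1 (fp_c0 F).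
  have [|N1 h1] := ct (d / 2 / (I + 1)); first by rewrite !divr_gt0.
  have [N2 _ h2] : \forall n \near \oo, n.+1%:R^-1 < d / 8.
    by apply: near_infty_natSinv_lt (PosNum (_ : 0 < d / 8)); rewrite divr_gt0.
  exists (maxn N1 N2) => n m; rewrite !geq_max => /andP[nN1 nN2] /andP[mN1 mN2] /=.
  have Qx := Qu (t n); have Qy := Qu (t m); have Dx := QD Qx; have Dy := QD Qy.
  have px := pu (t n); have py := pu (t m); have x1 := u1 (t n); have y1 := u1 (t m).
  have hx : A (u (t n)) (u (t n)) < I + d / 8.
    by apply: lt_le_trans (uI _) _; rewrite lerD2l ltW//; apply: h2 => /=; exact: leq_trans nN2 (tn _).
  have hy : A (u (t m)) (u (t m)) < I + d / 8.
    by apply: lt_le_trans (uI _) _; rewrite lerD2l ltW//; apply: h2 => /=; exact: leq_trans mN2 (tn _).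
  have := h1 n m nN1 mN1; rewrite /=.
  move: (u (t n)) (u (t m)) Qx Qy Dx Dy px py x1 y1 hx hy => x y Qx Qy Dx Dy px py x1 y1 hx hy.
  rewrite ltr_pdivlMr// => hb.
  have pxy : perp s (x + y).
    move=> g gs; have Qg := (sQ _ gs).
    have Dg := QD Qg; by rewrite (bDl S)// px// py// addr0.
  have := Ile _ (sipD SA Qx Qy) pxy.
  have I0 : 0 <= I by apply: lb_le_inf.
  have := sip_ge0 S (sipB S Dx Dy).
  move: hb; rewrite (bDD S Dx Dy) (bBB S Dx Dy) (bDD SA Qx Qy) (bBB SA Qx Qy) x1 y1.
  by nra.
have Qut n : Q ((u \o t) n) by exact: Qu.
have [f Qf cf] := fp_AC F Qut cA.
have cb : sconv b (u \o t) f.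
  move=> d d0; have [|N hN] := cf (c0 * d); first by rewrite mulr_gt0 ?(fp_c0 F).
  exists N => n nN; rewrite -(ltr_pM2l (fp_c0 F)).
  by apply: le_lt_trans (hN _ nN); apply: (fp_coer F); apply: (sipB SA).
have Dut n : D ((u \o t) n) by exact: QD.
have f1 : b f f = 1.
  have /cvg_lim <- // := sconv_norm2 S Dut (QD Qf) cb.
  by rewrite (_ : (fun n => _) = fun=> 1) ?lim_cst//; apply/funext => n; exact: u1.
have pf : perp s f.
  move=> g gs; have Qg := (sQ _ gs).
  have /cvg_lim <- // := sconv_ip S Dut (QD Qf) (QD Qg) cb.
  by rewrite (_ : (fun n => _) = fun=> 0) ?lim_cst//; apply/funext => n; exact: pu.
have Af : A f f <= I.
  apply/ler_addgt0Pr => d d0; apply: (cvgr_to_le (sconv_norm2 SA Qut Qf cf)).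
  have [N2 _ h2] : \forall n \near \oo, n.+1%:R^-1 < d.
    exact: near_infty_natSinv_lt (PosNum d0).
  exists N2 => // n nN /=; apply: le_trans (ltW (uI _)) _; rewrite lerD2l ltW//.
  by apply: h2 => /=; exact: leq_trans nN (tn _).
exists (f, A f f); split => //= v Qv pv.
by apply: le_trans (Ile v Qv pv); rewrite ler_wpM2r// (sip_ge0 S)//; exact: QD.
Qed.
Fixpoint eigs (n : nat) : seq V :=
  if n is n'.+1 then (xget (0, 0) [set p | next_eig (eigs n') p]).1 :: eigs n' else [::].

Let ev n : V * R := xget (0, 0) [set p | next_eig (eigs n) p].
Let e n := (ev n).1.
Let nu n := (ev n).2.

Lemma eigsP n : ortho (eigs n) /\ next_eig (eigs n) (ev n).
Proof.
have ne k : ortho (eigs k) -> next_eig (eigs k) (ev k).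
  by move=> /next_eig_ex[p hp]; exact: (xgetPex _ (ex_intro _ p hp)).
suff o : ortho (eigs n) by split => //; exact: ne.
elim: n => [|n IH]; first by split.
have [Qe e1 pe _ _] := ne _ IH; have [us sQ so] := IH.
rewrite /= -/(ev n); have nin : (ev n).1 \notin eigs n.
  by apply/negP => /pe; rewrite e1 => /eqP; rewrite oner_eq0.
split => /=; first by rewrite nin.
  by move=> g; rewrite inE => /predU1P[->|/sQ].
move=> g h; rewrite !inE => /predU1P[->|gs] /predU1P[->|hs]; last exact: so.
- by rewrite eqxx.
- by rewrite pe//; case: eqP => // E; rewrite E hs in nin.
- have -> : b g (ev n).1 = b (ev n).1 g by apply: (sip_sym S); apply: QD => //; exact: sQ.
  by rewrite pe//; case: eqP => // E; rewrite -E gs in nin.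
Qed.

Lemma mem_eigs n k : (k < n)%N -> e k \in eigs n.
Proof.
elim: n => // n IH; rewrite ltnS leq_eqVlt /= inE => /predU1P[->|/IH ->].
  by rewrite eqxx.
by rewrite orbT.
Qed.

Lemma eigs_mem n g : g \in eigs n -> exists2 k, (k < n)%N & g = e k.
Proof.
elim: n => // n IH; rewrite /= inE => /predU1P[->|/IH[k kn ->]]; first by exists n.
by exists k => //; exact: ltnW.
Qed.

Lemma quad0 (x y : R) : (forall t, 0 <= 2 * t * x + t ^+ 2 * y) -> x = 0.
Proof.
move=> h; apply: contrapT => /eqP x0.
have y1 : 0 < `|y| + 1 by rewrite ltr_wpDl.
have yp : y < `|y| + 1 by rewrite ltr_pwDr// ler_norm.
have := h (- x / (`|y| + 1)).
have -> : 2 * (- x / (`|y| + 1)) * x + (- x / (`|y| + 1)) ^+ 2 * y =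
   - (x ^+ 2 / (`|y| + 1)) * (2 - y / (`|y| + 1)) by field; rewrite gt_eqF.
rewrite mulNr oppr_ge0; apply/negP; rewrite -ltNge mulr_gt0//.
  by rewrite divr_gt0// exprn_even_gt0.
by rewrite subr_gt0 ltr_pdivrMr// ; lra.
Qed.

(** Minimisers are collected one by one; by compactness their values tend to infinity, and
    a vector orthogonal to all of them has a null norm. *)
Theorem eigenbasis_ex : exists e nu, eigenbasis D Q b A e nu.
Proof.
exists e, nu.
have Qe k : Q (e k) by have [_ []] := eigsP k.
have De k : D (e k) by exact: QD.
have e1 k : b (e k) (e k) = 1 by have [_ []] := eigsP k.
have oe j k : b (e j) (e k) = (j == k)%:R.
  wlog jk : j k / (j <= k)%N.
    move=> h; have [/h//|/ltnW/h] := leqP j k.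
    by rewrite (sip_sym S)// eq_sym.
  move: jk; rewrite leq_eqVlt => /predU1P[->|jk]; first by rewrite eqxx e1.
  rewrite ltn_eqF// (sip_sym S)//; have [_ [_ _ pk _ _]] := eigsP k.
  by apply: pk; exact: mem_eigs.
have ray k u : Q u -> (forall j, (j < k)%N -> b u (e j) = 0) -> nu k * b u u <= A u u.
  have [_ [_ _ _ _ h]] := eigsP k; move=> Qu pu; apply: h => // g /eigs_mem[j jk ->].
  exact: pu.
have Ae k : A (e k) (e k) = nu k by have [_ []] := eigsP k.
have Qc c n : Q (comb e c n) by apply: (sip_sum SA) => i _; exact: (sipZ SA).
have perpc n psi : Q psi -> forall j, (j < n)%N ->
    b (psi - comb e (fun k => b psi (e k)) n) (e j) = 0.
  move=> Qp j jn; rewrite (bBl S (QD Qp) (QD (Qc _ _)) (De j)).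
  by rewrite (comb_coef S De oe) jn subrr.
have eq k : forall psi, Q psi -> A (e k) psi = nu k * b (e k) psi.
  elim/ltn_ind: k => n IH psi Qp.
  pose x := psi - comb e (fun k => b psi (e k)) n.
  have Qx : Q x by exact: (sipB SA).
  have ex : A (e n) x = nu n * b (e n) x.
    apply/eqP; rewrite -subr_eq0; apply/eqP.
    apply: (@quad0 _ (A x x - nu n * b x x)) => t.
    have Qtx : Q (t *: x) by exact: (sipZ SA).
    have := ray n (e n + t *: x) (sipD SA (Qe n) Qtx).
    have pj j : (j < n)%N -> b (e n + t *: x) (e j) = 0.
      move=> jn; rewrite (bDl S (De n) (QD Qtx) (De j)) oe gtn_eqF// add0r.
      by rewrite (bZl S _ (QD Qx) (De j)) perpc// mulr0.
    move=> /(_ pj); rewrite (bDD S (De n) (QD Qtx)) (bDD SA (Qe n) Qtx) e1 Ae.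
    rewrite !(bZr S _ (QD Qx)) ?(bZl S _ (QD Qx))//; [|exact: QD..].
    rewrite !(bZr SA _ Qx)// (bZl SA _ Qx)//.
    by lra.
  have -> : psi = x + comb e (fun k => b psi (e k)) n by rewrite subrK.
  rewrite (bDr SA Qx (Qc _ _) (Qe n)) (bDr S (QD Qx) (QD (Qc _ _)) (De n)) ex mulrDr.
  congr (_ + _); rewrite /comb (b_sumr SA)//; last by move=> i; exact: (sipZ SA).
  rewrite (b_sumr S)//; last by move=> i; exact: (sipZ S).
  rewrite !big1 ?mulr0// => i _.
    by rewrite (bZr S)// oe gtn_eqF// mulr0.
  rewrite (bZr SA)// (sip_sym SA)// IH// oe ltn_eqF// !mulr0//.
have nd m n : (m <= n)%N -> nu m <= nu n.
  move=> mn; have := ray m (e n) (Qe n); rewrite e1 Ae mulr1; apply => j jm.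
  by rewrite oe gtn_eqF// (leq_trans jm).
have unb M : exists n, M < nu n.
  apply: contrapT => h; have eM n : A (e n) (e n) <= M.
    by rewrite Ae leNgt; apply/negP => Mn; apply: h; exists n.
  have [s sn cs] := K Qe eM; have [N hN] := cs 1 ltr01.
  have := hN N (s N).+1 (leqnn _) (leq_trans (sn N) (leqnSn _)).
  rewrite /= (bBB S)// !oe !eqxx ltn_eqF ?mulr0 ?subr0; last exact: sn.
  by rewrite mulr1n; lra.
have res u : Q u -> forall d : R, 0 < d -> exists n,
    b (u - comb e (fun k => b u (e k)) n) (u - comb e (fun k => b u (e k)) n) < d.
  move=> Qu d d0; have Au := sip_ge0 SA Qu.
  have [n hn] := unb (A u u / d); exists n.
  pose r := u - comb e (fun k => b u (e k)) n; rewrite -/r.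
  have Qr : Q r by exact: (sipB SA).
  have Arc : A (comb e (fun k => b u (e k)) n) r = 0.
    rewrite /comb (b_suml SA)//; last by move=> i; exact: (sipZ SA).
    rewrite big1// => i _; rewrite (bZl SA)// eq// (sip_sym S (De i) (QD Qr)).
    by rewrite perpc// !mulr0.
  have : A r r <= A u u.
    have -> : u = r + comb e (fun k => b u (e k)) n by rewrite subrK.
    rewrite (bDD SA Qr (Qc _ _)) [A r (comb _ _ _)](sip_sym SA)// Arc mulr0 addr0 lerDl.
    exact: sip_ge0 SA _ (Qc _ _).
  have := ray n r Qr (perpc n u Qu); move: hn; rewrite ltr_pdivrMr// => hn h1 h2.
  have n0 : 0 < nu n.
    by rewrite -Ae; apply: lt_le_trans (fp_coer F (Qe n)); rewrite e1 mulr1 (fp_c0 F).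
  by rewrite -(ltr_pM2l n0); lra.
split => // u Du u0.
have uv v : Q v -> b u v = 0.
  move=> Qv; apply/eqP; rewrite -normr_eq0; apply/eqP/le_anti; rewrite normr_ge0 andbT.
  apply/ler_addgt0Pr => d d0; rewrite add0r.
  have u1 : 0 < b u u + 1 by rewrite ltr_wpDl// (sip_ge0 S).
  have [|n hn] := res v Qv (d ^+ 2 / (b u u + 1)); first by rewrite divr_gt0 ?exprn_gt0.
  have := sconv_normB S (QD Qv) (QD (Qc _ n)) Du d0 hn.
  rewrite [b (comb _ _ _) u](sip_sym S)//; last exact: QD.
  rewrite (b_sumr S) //; last by move=> i; exact: (sipZ S).
  rewrite big1 ?subr0; first by rewrite (sip_sym S)// => [/ltW|]//; exact: QD.
  by move=> i _; rewrite (bZr S)// u0 mulr0.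
apply/le_anti; rewrite (sip_ge0 S)// andbT; apply/ler_addgt0Pr => d d0; rewrite add0r.
have [v Qv /ltW] := dense Du d0; apply: le_trans.
rewrite (bBB S Du (QD Qv)) (uv v Qv) mulr0 subr0 lerDl.
by apply: (sip_ge0 S); exact: QD.
Qed.
End Existence.

Section CompactFromBasis.
Variables (R : realType) (V : lmodType R).
Variables (D Q : V -> Prop) (b A : V -> V -> R) (c0 : R).
Variables (e : nat -> V) (nu : nat -> R).
Hypothesis F : form_pair D Q b A c0.
Hypothesis E : eigenbasis D Q b A e nu.
Hypothesis nu_oo : forall M, exists N, forall k, (N <= k)%N -> M <= nu k.
Let S := fp_b F.
Let SA := fp_A F.
Let QD := fp_sub F.
Let eQ := eig_in E.
Let eD k : D (e k). Proof. exact: QD. Qed.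
Let oe := eig_orth E.

Lemma norm_head_tail w N B : 0 < B -> (forall k, (N <= k)%N -> B <= nu k) -> Q w ->
  b w w <= \sum_(k < N) b w (e k) ^+ 2 + B^-1 * A w w.
Proof.
move=> B0 hB Qw; apply: (parseval_norm S eD oe (fp_bC F) (eig_total E)) => [|K].
  exact: QD.
have NK := leq_maxl N K.
apply: le_trans (ler_sum_widen (fun k => sqr_ge0 (b w (e k))) (leq_maxr N K)) _.
rewrite (sum_split (fun k => b w (e k) ^+ 2) NK) lerD2l.
apply: le_trans (ler_wpM2l _ (A_bessel F E (maxn N K) Qw)); last by rewrite invr_ge0 ltW.
rewrite (sum_split (fun k => nu k * b w (e k) ^+ 2) NK) mulrDr ler_wpDl//.
  by rewrite mulr_ge0 ?invr_ge0 ?(ltW B0)// sumr_ge0// => i _; rewrite mulr_ge0 ?sqr_ge0// (ltW (nu_gt0 F E _)).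
rewrite mulr_sumr; apply: ler_sum => i _; rewrite mulrA.
rewrite ler_peMl ?sqr_ge0// mulrC ler_pdivlMr// mul1r hB//.
by rewrite leq_addr.
Qed.

(** Along an ultrafilter every coefficient of a bounded sequence converges, and
    the tails are uniformly small since [nu_k] tends to infinity. *)
Lemma compact_of_basis : compact_embedding Q b A.
Proof.
move=> u M Qu uM.
have [U [UU ooU]] := ultraFilterLemma (F := \oo) eventually_filter.
have M0 : 0 <= M by apply: le_trans (uM 0%N); exact: (sip_ge0 SA).
have bk n k : `|b (u n) (e k)| <= M / c0 + 1.
  have h : b (u n) (e k) ^+ 2 <= M / c0.
    apply: le_trans (CS S (QD (Qu n)) (eD k)) _; rewrite oe eqxx mulr1.
    rewrite ler_pdivlMr ?(fp_c0 F)// mulrC; exact: le_trans (fp_coer F (Qu n)) (uM n).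
  rewrite -ler_sqr ?nnegrE ?addr_ge0 ?divr_ge0 ?(ltW (fp_c0 F))// real_normK ?num_real//.
  apply: le_trans h _; have : 0 <= M / c0 by rewrite divr_ge0 ?(ltW (fp_c0 F)).
  by nra.
have FU := @ultra_proper _ _ UU.
have lk k : exists l : R, b (u n) (e k) @[n --> U] --> l.
  have cpt := @segment_compact R (- (M / c0 + 1)) (M / c0 + 1).
  case: (cpt (b (u n) (e k) @[n --> U])).
    apply: (@filterS _ U _ setT) => [n _ /=|]; last exact: filterT.
    by rewrite in_itv/= -ler_norml; exact: bk.
  move=> l [_ cl]; exists l => B nB.
  have [//|UB] := in_ultra_setVsetC ((fun n => b (u n) (e k)) @^-1` B) UU.
  by have [x [nBx Bx]] := cl (~` B) B UB nB.
have near_ (d : R) : 0 < d -> exists2 T, U T & forall i j, T i -> T j -> b (u i - u j) (u i - u j) < d.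
  move=> d0.
  have [N hN] := nu_oo ((4 * M + 1) * 2 / d).
  have B0 : 0 < (4 * M + 1) * 2 / d by rewrite divr_gt0// mulr_gt0// ltr_wpDl// mulr_ge0.
  pose r := d / (8 * (N.+1)%:R).
  have r0 : 0 < r by rewrite divr_gt0.
  have [l hl] := choice lk.
  have hU : \forall n \near U, forall k, (k < N)%N -> `|l k - b (u n) (e k)| < Num.min 1 r.
    apply: filter_forall_ltn => k.
    by have /cvgrPdist_lt := hl k; apply; rewrite lt_min ltr01.
  exists [set n | forall k, (k < N)%N -> `|l k - b (u n) (e k)| < Num.min 1 r] => //.
  move=> i j /= hi hj.
  have Qij := sipB SA (Qu i) (Qu j).
  apply: le_lt_trans (norm_head_tail B0 hN Qij) _.
  have h1 : \sum_(k < N) b (u i - u j) (e k) ^+ 2 <= d / 2.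
    apply: le_trans (_ : \sum_(k < N) 4 * r <= _).
      apply: ler_sum => k _; rewrite (bBl S (QD (Qu i)) (QD (Qu j)) (eD k)).
      have := hi k (ltn_ord k); have := hj k (ltn_ord k); rewrite !lt_min => /andP[a1 a2] /andP[a3 a4].
      move: a1 a2 a3 a4; rewrite !ltr_norml; nra.
    rewrite sumr_const card_ord -[leLHS]mulr_natr /r.
    have N1 : (N.+1)%:R != 0 :> R by rewrite pnatr_eq0.
    rewrite (_ : _ * _ = (d / 2) * (N%:R / N.+1%:R)); last by field.
    by rewrite ler_piMr ?divr_ge0// ?(ltW d0)// ler_pdivrMr// mul1r ler_nat.
  have h2 : ((4 * M + 1) * 2 / d)^-1 * A (u i - u j) (u i - u j) < d / 2.
    have : A (u i - u j) (u i - u j) < 4 * M + 1.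
      apply: le_lt_trans (bB2 SA (Qu i) (Qu j)) _; have := uM i; have := uM j; lra.
    have P0 : 0 < 4 * M + 1 by rewrite ltr_wpDl// mulr_ge0.
    move: P0; move: (4 * M + 1) (A _ _) => P X P0 XP.
    rewrite (_ : _ * X = (d / 2) * (X / P)); last by field; rewrite !gt_eqF.
    by rewrite gtr_pMr ?divr_gt0// ltr_pdivrMr// mul1r.
  lra.
have near1 n : exists T, U T /\ forall i j, T i -> T j ->
    b (u i - u j) (u i - u j) < n.+1%:R^-1.
  by have [|T UT hT] := near_ n.+1%:R^-1; [rewrite invr_gt0|exists T].
have [T /all_and2[UT hT]] := choice near1.
have pick n : exists i, (n <= i)%N /\ forall k, (k < n.+1)%N -> T k i.
  have h : \forall i \near U, (n <= i)%N by apply: ooU; exact: nbhs_infty_ge.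
  have h' : \forall i \near U, forall k, (k < n.+1)%N -> T k i.
    by apply: filter_forall_ltn => k; exact: UT.
  by have [i []] := filter_ex (filterI h h'); exists i.
have [s /all_and2[sn hs]] := choice pick.
exists s => // d d0.
have [N _ hN] : \forall n \near \oo, n.+1%:R^-1 < d.
  exact: near_infty_natSinv_lt (PosNum d0).
exists N => n m nN mN /=; apply: lt_trans (hN N (leqnn _)).
by apply: hT; apply: hs; rewrite ltnS.
Qed.

End CompactFromBasis.

(** * The energy space *)
Section RealBounds.
Variable R : realType.
Implicit Types x y z : R.

Lemma sum3_ge x y z : 0 <= x -> 0 <= y -> 0 <= z ->
  [/\ x <= x + (y + z), y <= x + (y + z), z <= x + (y + z) & 0 <= x + (y + z)].
Proof. by move=> *; split; lra. Qed.

Lemma sum3_lt x y z e : x < e / 3 -> y < e / 3 -> z < e / 3 -> x + (y + z) < e.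
Proof. by move=> *; lra. Qed.

Lemma sum3_lin c d x y z x' y' z' :
  c * x + x' + (c * y + y') + d * (c * z + z') = c * (x + y + d * z) + (x' + y' + d * z').
Proof. by ring. Qed.

Lemma tilt_real (c k p q p0 q0 p1 q1 : R) : p = c * p0 + p1 -> q = c * q0 + q1 ->
  p - k * q = c * (p0 - k * q0) + (p1 - k * q1).
Proof. by move=> -> ->; ring. Qed.

(** The elementary inequality behind the equivalence of the forms. *)
Lemma form_real (a c1 C1 c2 A B E K t z p q : R) : 0 < a -> 0 < c1 -> 0 < C1 -> 0 <= c2 ->
  c1 * t <= A -> A <= C1 * t -> c1 * q <= B -> B <= C1 * q -> c1 * z <= E -> E <= C1 * z ->
  K <= c2 * q -> t <= 2 * p + 2 * K -> p <= 2 * t + 2 * K ->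
  0 <= z -> 0 <= p -> 0 <= q -> 0 <= t ->
  c1 / (2 + (2 * c2 + 1) + a^-1) * (z + (p + q)) <= A + B + a * E <=
  C1 * (2 + (2 * c2 + 1) + a) * (z + (p + q)).
Proof.
move=> a_gt0 c1_gt0 C1p C2 l1 u1 l2 u2 l3 u3 k1 t1 t2 p0 p1 p2 p3.
have ai : 0 < a^-1 by rewrite invr_gt0.
have D0 : 0 < 2 + (2 * c2 + 1) + a^-1 by lra.
apply/andP; split.
  rewrite mulrAC ler_pdivrMr//.
  have E0 : 0 <= E by apply: le_trans l3; rewrite mulr_ge0// ltW.
  have A0 : 0 <= A by apply: le_trans l1; rewrite mulr_ge0// ltW.
  have B0 : 0 <= B by apply: le_trans l2; rewrite mulr_ge0// ltW.
  have main : c1 * (z + (p + q)) <= 2 * A + (2 * c2 + 1) * B + E.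
    have h1 : c1 * p <= 2 * A + 2 * c2 * B.
      apply: (@le_trans _ _ (c1 * (2 * t + 2 * c2 * q))).
        by apply: ler_wpM2l; [exact: ltW|lra].
      have : 2 * c2 * (c1 * q) <= 2 * c2 * B by apply: ler_wpM2l => //; rewrite mulr_ge0.
      lra.
    lra.
  apply: le_trans main _.
  have aE : a * E * a^-1 = E by field; rewrite gt_eqF.
  have : 0 <= a * E by rewrite mulr_ge0// ltW.
  have h0 : 0 <= c2 * A by rewrite mulr_ge0.
  have h1 : 0 <= c2 * B by rewrite mulr_ge0.
  have h2 : 0 <= A / a by rewrite divr_ge0// ltW.
  have h3 : 0 <= B / a by rewrite divr_ge0// ltW.
  have h4 : 0 <= c2 * (a * E) by rewrite !mulr_ge0// ltW.
  rewrite !mulrDr !mulrDl; lra.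
have h1 : A <= C1 * (2 * p + 2 * c2 * q) by apply: le_trans u1 _; apply: ler_wpM2l; [exact: ltW|lra].
have h2 : a * E <= a * (C1 * z) by apply: ler_wpM2l => //; exact: ltW.
have q1 : 0 <= C1 * p by rewrite mulr_ge0// ltW.
have q2 : 0 <= C1 * q by rewrite mulr_ge0// ltW.
have q3 : 0 <= C1 * z by rewrite mulr_ge0// ltW.
have q4 : 0 <= c2 * (C1 * p) by rewrite mulr_ge0.
have q5 : 0 <= c2 * (C1 * z) by rewrite mulr_ge0.
have q6 : 0 <= a * (C1 * p) by rewrite mulr_ge0// ltW.
have q7 : 0 <= a * (C1 * q) by rewrite mulr_ge0// ltW.
rewrite !mulrDr !mulrDl; lra.
Qed.

End RealBounds.

Section H1.
Variable R : realType.
Local Notation T := (measurableTypeR R * measurableTypeR R)%type.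
Local Notation sq := (sqi (lebO R)).
Local Notation ip := (ip2 (lebO R)).
Local Notation wp := (@weak_partial R).
Implicit Types (u v w : T -> R) (i : 'I_2).

Lemma H1_sqi u : H1 u -> sq u.
Proof. by case=> /Lfun2P. Qed.

Lemma wpP i u : H1 u -> is_weak_partial i u (wp i u).
Proof. by move=> [_ /(_ i) h]; exact: (@xgetPex _ (cst 0) [set v | is_weak_partial i u v]). Qed.

Lemma wp_sqi i u : H1 u -> sq (wp i u).
Proof. by move=> /(wpP i)[/Lfun2P]. Qed.

Lemma H1_lin c u v : H1 u -> H1 v -> H1 (c *: u + v).
Proof.
move=> hu hv; have [su sv] := (H1_sqi hu, H1_sqi hv); split=> [|i].
  by apply/Lfun2P; exact: sqi_lin.
exists (c *: wp i u + wp i v); apply: weak_lin => //; exact: wpP.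
Qed.

Lemma wp_lin i c u v : H1 u -> H1 v -> wp i (c *: u + v) = c *: wp i u + wp i v %[ae lebO R].
Proof.
move=> hu hv; apply: (@weak_unique _ i (c *: u + v)); first exact/wpP/H1_lin.
by apply: weak_lin; [exact: H1_sqi|exact: H1_sqi|exact: wpP|exact: wpP].
Qed.

Lemma ae_eqT u v w : u = v %[ae lebO R] -> v = w %[ae lebO R] -> u = w %[ae lebO R].
Proof. by apply: filterS2 => x h1 h2 D; rewrite h1// h2. Qed.

Lemma H1_ae u v : sq v -> u = v %[ae lebO R] -> H1 u -> H1 v.
Proof.
move=> sv E hu; split=> [|i]; first exact/Lfun2P.
by exists (wp i u); apply: weak_ae E (wpP i hu) => //; exact: H1_sqi.
Qed.

Lemma smooth_H1 u : smooth2 u -> H1 u.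
Proof.
move=> su; split=> [|i]; first exact/Lfun2P/cont_sqi/smooth_cont.
by eexists; exact: smooth_weak.
Qed.

Lemma smooth_wp i u : smooth2 u -> wp i u = (fun x => 'D_(basis2 R i) u x) %[ae lebO R].
Proof.
by move=> su; apply: (@weak_unique _ i u); [exact/wpP/smooth_H1|exact: smooth_weak].
Qed.

Definition nH u : R := ip u u + (ip (wp ord0 u) (wp ord0 u) + ip (wp ord_max u) (wp ord_max u)).

Let S := ip2_semiip (lebO R).

Lemma ip_ae u u' v v' : sq u -> sq u' -> sq v -> sq v' -> u = u' %[ae lebO R] ->
  v = v' %[ae lebO R] -> ip u v = ip u' v'.
Proof.
move=> hu hu' hv hv' E E'; apply: Rintegral_ae.
- by apply: measurable_funM; [exact: hu.1|exact: hv.1].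
- by apply: measurable_funM; [exact: hu'.1|exact: hv'.1].
- by move: E E'; apply: filterS2 => x h1 h2 D; rewrite h1// h2.
Qed.

Lemma sub_lin u v : u - v = -1 *: v + u.
Proof. by rewrite scaleN1r addrC. Qed.

Lemma H1B u v : H1 u -> H1 v -> H1 (u - v).
Proof. by move=> hu hv; rewrite sub_lin; exact: H1_lin. Qed.

Lemma wpB i u v : H1 u -> H1 v -> wp i (u - v) = wp i u - wp i v %[ae lebO R].
Proof. by move=> hu hv; rewrite !sub_lin; exact: wp_lin. Qed.

Lemma ip_wpB i u v w : H1 u -> H1 v -> sq w -> w = wp i v %[ae lebO R] ->
  ip (wp i (u - v)) (wp i (u - v)) = ip (wp i u - w) (wp i u - w).
Proof.
move=> hu hv hw E.
have h1 : sq (wp i (u - v)) by apply: wp_sqi; exact: H1B.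
have h2 : sq (wp i u - w) by apply: (sipB S) => //; exact: wp_sqi.
have e : wp i (u - v) = wp i u - w %[ae lebO R].
  apply: ae_eqT (wpB i hu hv) _; move: E; apply: filterS => x h D.
  by have := h D; rewrite /= => e; rewrite /GRing.add /GRing.opp /= e.
exact: ip_ae.
Qed.

Lemma nH_parts u : H1 u -> [/\ ip u u <= nH u, forall i, ip (wp i u) (wp i u) <= nH u & 0 <= nH u].
Proof.
move=> hu; have a0 := sip_ge0 S (H1_sqi hu).
have a1 := sip_ge0 S (wp_sqi ord0 hu); have a2 := sip_ge0 S (wp_sqi ord_max hu).
have [b0 b1 b2 b3] := sum3_ge a0 a1 a2; split; [exact: b0| |exact: b3] => i.
have [->|->] : i = ord0 \/ i = ord_max.
- by case: i => [[|[|]]//] h; [left|right]; apply/val_inj.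
- exact: b1.
- exact: b2.
Qed.

(** ** Quadratic forms with bounded measurable coefficients *)
Section Form.
Variables (a : R) (kap J rho : T -> R) (C0 c1 C1 : R).
Hypotheses (a_gt0 : 0 < a) (C0_ge0 : 0 <= C0) (c1_gt0 : 0 < c1).
Hypotheses (mk : measurable_fun setT kap) (mJ : measurable_fun setT J) (mrho : measurable_fun setT rho).
Hypotheses (kC : forall x, `|kap x| <= C0) (Jb : forall x, c1 <= J x <= C1)
  (rb : forall x, c1 <= rho x <= C1).

Definition kmul u : T -> R := fun x => kap x * u x.
Definition tilt u : T -> R := wp ord0 u - kmul (wp ord_max u).
Definition aform u v : R :=
  wip (lebO R) J (tilt u) (tilt v) + wip (lebO R) rho (wp ord_max u) (wp ord_max v)
  + a * wip (lebO R) J u v.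

Let SJ := wip_semiip (lebO R) mJ c1_gt0 Jb.
Let Sr := wip_semiip (lebO R) mrho c1_gt0 rb.

Lemma C1_gt0 : 0 < C1.
Proof. by have /andP[h1 h2] := Jb (0, 0); apply: lt_le_trans c1_gt0 (le_trans h1 h2). Qed.

Lemma kap_sqi u : sq u -> sq (kmul u).
Proof. by move=> hu; exact: sqi_mulw mk kC. Qed.

Lemma tilt_sqi u : H1 u -> sq (tilt u).
Proof.
by move=> hu; apply: (sipB S); [exact: wp_sqi|apply: kap_sqi; exact: wp_sqi].
Qed.

Lemma tilt_lin c u v : H1 u -> H1 v -> tilt (c *: u + v) = c *: tilt u + tilt v %[ae lebO R].
Proof.
move=> hu hv; move: (wp_lin ord0 c hu hv) (wp_lin ord_max c hu hv); apply: (@filterS2 _ _ (ae_filter_ringOfSetsType (lebO R))) => x h1 h2 D.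
have E (f g : T -> R) : (c *: f + g) x = c * f x + g x by [].
have E' f : tilt f x = wp ord0 f x - kap x * wp ord_max f x by [].
by rewrite E !E'; apply: tilt_real; rewrite -E; [exact: h1|exact: h2].
Qed.

Lemma wip_aeW (W : T -> R) u u' v : measurable_fun setT W -> sq u -> sq u' -> sq v ->
  u = u' %[ae lebO R] -> wip (lebO R) W u v = wip (lebO R) W u' v.
Proof.
move=> mW hu hu' hv E; apply: Rintegral_ae.
- by apply: measurable_funM => //; apply: measurable_funM; [exact: hu.1|exact: hv.1].
- by apply: measurable_funM => //; apply: measurable_funM; [exact: hu'.1|exact: hv.1].
- by apply: filterS E => x h D; rewrite h.
Qed.

Lemma aform_semiip : semiip (@H1 R) aform.
Proof.
split.
- exact: smooth_H1 (smooth_cst 0).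
- exact: H1_lin.
- move=> c u v w hu hv hw; rewrite /aform; have hc := H1_lin c hu hv.
  have tu := tilt_sqi hu; have tv := tilt_sqi hv; have tw := tilt_sqi hw.
  have du := wp_sqi ord_max hu; have dv := wp_sqi ord_max hv; have dw := wp_sqi ord_max hw.
  rewrite (wip_aeW mJ (tilt_sqi hc) _ tw (tilt_lin c hu hv)); last exact: sqi_lin.
  rewrite (wip_aeW mrho (wp_sqi ord_max hc) _ dw (wp_lin ord_max c hu hv)); last exact: sqi_lin.
  rewrite (sip_lin SJ c tu tv tw) (sip_lin Sr c du dv dw).
  rewrite (sip_lin SJ c (H1_sqi hu) (H1_sqi hv) (H1_sqi hw)).
  exact: sum3_lin.
- move=> u v hu hv; rewrite /aform.
  rewrite (sip_sym SJ (tilt_sqi hu) (tilt_sqi hv)) (sip_sym Sr (wp_sqi _ hu) (wp_sqi _ hv)).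
  by rewrite (sip_sym SJ (H1_sqi hu) (H1_sqi hv)).
- move=> u hu; rewrite /aform addr_ge0// ?addr_ge0 ?mulr_ge0 ?(ltW a_gt0)//.
  + exact: sip_ge0 SJ _ (tilt_sqi hu).
  + exact: sip_ge0 Sr _ (wp_sqi _ hu).
  + exact: sip_ge0 SJ _ (H1_sqi hu).
Qed.

Lemma ip_kap u : sq u -> ip (kmul u) (kmul u) <= C0 ^+ 2 * ip u u.
Proof.
move=> hu; have hk := kap_sqi hu; rewrite /ip2 -RintegralZl//; last exact: sqi_mul_int.
apply: le_Rintegral => //; first exact: sqi_mul_int.
  by have := integrableZl measurableT (C0 ^+ 2) (sqi_mul_int hu hu).
move=> x _; rewrite -[leLHS]/(kap x * u x * (kap x * u x)) -[leRHS]/(C0 ^+ 2 * (u x * u x)).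
rewrite mulrACA -!expr2 ler_wpM2r ?sqr_ge0//.
by rewrite -(real_normK (num_real (kap x))) lerXn2r ?nnegrE.
Qed.

(** The mixed term [kap * d_2 u] in [tilt] is controlled by the term with [rho],
    so that [d_1 u] can be recovered from [tilt u]. *)
Lemma aform_equiv : exists cl : R, exists2 cu : R, 0 < cl &
  forall u, H1 u -> cl * nH u <= aform u u <= cu * nH u.
Proof.
have C1p := C1_gt0.
have D0 : 0 < 2 + (2 * C0 ^+ 2 + 1) + a^-1.
  by rewrite ltr_wpDr ?invr_ge0 ?(ltW a_gt0)// addr_gt0//; have := sqr_ge0 C0; lra.
exists (c1 / (2 + (2 * C0 ^+ 2 + 1) + a^-1)), (C1 * (2 + (2 * C0 ^+ 2 + 1) + a)); first exact: divr_gt0.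
move=> u hu.
have su := H1_sqi hu; have d0 := wp_sqi ord0 hu; have d1 := wp_sqi ord_max hu; have tu := tilt_sqi hu.
have /andP[l1 u1] := wip_le mJ c1_gt0 Jb tu.
have /andP[l2 u2] := wip_le mrho c1_gt0 rb d1.
have /andP[l3 u3] := wip_le mJ c1_gt0 Jb su.
have sk := kap_sqi d1.
have t1 := bB2 S d0 sk.
have t2 := bD2 S tu sk; rewrite /tilt subrK -/(tilt u) in t2.
exact: (form_real a_gt0 c1_gt0 C1p (sqr_ge0 C0) l1 u1 l2 u2 l3 u3 (ip_kap d1) t1 t2
  (sip_ge0 S su) (sip_ge0 S d0) (sip_ge0 S d1) (sip_ge0 S tu)).
Qed.

Lemma scauchy_le (b b' : (T -> R) -> (T -> R) -> R) c (f : (T -> R) -> T -> R) (u : nat -> T -> R) :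
  0 < c -> scauchy b u -> (forall n m, c * b' (f (u n) - f (u m)) (f (u n) - f (u m)) <= b (u n - u m) (u n - u m)) ->
  scauchy b' (f \o u).
Proof.
move=> c0 h hle e e0; have [N hN] := h _ (mulr_gt0 c0 e0).
exists N => n m hn hm; rewrite -(ltr_pM2l c0); exact: le_lt_trans (hle n m) (hN n m hn hm).
Qed.

(** Cauchy sequences for the form are Cauchy for the function and both weak derivatives,
    and weak derivatives pass to limits in [L2]. *)
Lemma form_complete : scomplete (@H1 R) aform.
Proof.
have [cl [cu cl0 eq]] := aform_equiv.
move=> u hu cu_.
have eqB n m := eq _ (H1B (hu n) (hu m)).
have cau i : scauchy ip (wp i \o u).
  apply: (scauchy_le cl0 cu_) => n m; have /andP[h _] := eqB n m; apply: le_trans h.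
  rewrite ler_pM2l//; have [_ h _] := nH_parts (H1B (hu n) (hu m)); apply: le_trans (h i).
  rewrite (ip_wpB (hu n) (hu m) (wp_sqi i (hu m)))//; exact: ae_eq_refl.
have cau0 : scauchy ip u.
  apply: (@scauchy_le _ _ _ id u cl0 cu_) => n m; have /andP[h _] := eqB n m; apply: le_trans h.
  by rewrite ler_pM2l//; have [h _ _] := nH_parts (H1B (hu n) (hu m)).
have [w hw cw] := ip2_complete (fun n => H1_sqi (hu n)) cau0.
have wd i : exists2 v, sq v & sconv ip (wp i \o u) v.
  exact: ip2_complete (fun n => wp_sqi i (hu n)) (cau i).
have wk i v : sq v -> sconv ip (wp i \o u) v -> is_weak_partial i w v.
  by move=> hv cv; exact: weak_cvg (fun n => H1_sqi (hu n)) (fun n => wpP i (hu n)) hw hv cw cv.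
have Hw : H1 w.
  split=> [|i]; first exact/Lfun2P.
  by have [v hv cv] := wd i; exists v; exact: wk.
exists w => // e e0.
pose C := `|cu| + 1; have C0' : 0 < C by rewrite ltr_wpDl.
have e3 : 0 < e / C / 3 by rewrite !divr_gt0.
have lim i : exists N, forall n, (N <= n)%N -> ip (wp i (u n - w)) (wp i (u n - w)) < e / C / 3.
  have [v hv cv] := wd i; have [N hN] := cv _ e3; exists N => n /hN.
  rewrite (ip_wpB (hu n) Hw hv)//; apply: (@weak_unique _ i w); [exact: wk|exact: wpP].
have [N0 h0] := cw _ e3; have [N1 h1] := lim ord0; have [N2 h2] := lim ord_max.
exists (maxn N0 (maxn N1 N2)) => n; rewrite !geq_max => /andP[/h0 k0 /andP[/h1 k1 /h2 k2]].
have hn := H1B (hu n) Hw; have /andP[_ h] := eq _ hn; apply: le_lt_trans h _.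
have [_ _ n0] := nH_parts hn.
apply: (@le_lt_trans _ _ (C * nH (u n - w))).
  by rewrite ler_wpM2r// /C (le_trans (ler_norm _))// lerDl.
by rewrite mulrC -ltr_pdivlMr//; exact: sum3_lt k0 k1 k2.
Qed.

Lemma form_pairP : form_pair sq (@H1 R) (wip (lebO R) J) aform a.
Proof.
split=> //.
- exact: aform_semiip.
- move=> u hu cu; have C1p := C1_gt0.
  have cau : scauchy ip u.
    apply: (@scauchy_le _ _ _ id u c1_gt0 cu) => n m.
    by have /andP[] := wip_le mJ c1_gt0 Jb (sipB S (hu n) (hu m)).
  have [v hv cv] := ip2_complete hu cau; exists v => // e e0.
  have [N hN] := cv _ (divr_gt0 e0 C1p); exists N => n /hN h.
  have /andP[_ h'] := wip_le mJ c1_gt0 Jb (sipB S (hu n) hv).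
  by apply: le_lt_trans h' _; rewrite mulrC -ltr_pdivlMr.
- exact: form_complete.
- exact: H1_sqi.
- move=> u hu; rewrite /aform lerDr addr_ge0//.
  + exact: sip_ge0 SJ _ (tilt_sqi hu).
  + exact: sip_ge0 Sr _ (wp_sqi _ hu).
- move=> u v hu hv h0; apply: (H1_ae hu _ hv).
  have hd := sipB S hu (H1_sqi hv).
  have := wip_null mJ c1_gt0 Jb hd h0; apply: filterS => x /= h D.
  by symmetry; apply/subr0_eq; exact: h.
- move=> u hu h0; have su := H1_sqi hu.
  have E := wip_null mJ c1_gt0 Jb su h0.
  have z i : wp i u = cst 0 %[ae lebO R].
    apply: (@weak_unique _ i (cst 0)).
      by apply: weak_ae E (wpP i hu) => //; exact: sqi0.
    have := smooth_weak i (@smooth_cst R 0).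
    by rewrite (_ : (fun x => _) = cst 0)//; apply/funext => x; rewrite derive_cst.
  have [cl [cu cl0 eq]] := aform_equiv.
  have n0 : nH u = 0.
    have s0 := sqi0 (lebO R); have w0 := wp_sqi ord0 hu; have w1 := wp_sqi ord_max hu.
    have z0 : ip (cst 0) (cst 0) = 0.
      exact: (b0l S s0).
    transitivity (0 + (0 + 0) : R); last by rewrite !addr0.
    congr (_ + (_ + _)).
    - exact: etrans (ip_ae su s0 su s0 E E) z0.
    - exact: etrans (ip_ae w0 s0 w0 s0 (z _) (z _)) z0.
    - exact: etrans (ip_ae w1 s0 w1 s0 (z _) (z _)) z0.
  have /andP[h1 h2] := eq _ hu; move: h1 h2; rewrite n0 !mulr0 => h1 h2.
  by apply/eqP; rewrite eq_le h1 h2.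
Qed.

End Form.
End H1.

(** ** The cosine eigenbasis of the square *)
Opaque weak_partial.

Section Cosine.
Variable R : realType.
Local Notation T := (measurableTypeR R * measurableTypeR R)%type.
Local Notation sq := (sqi (lebO R)).
Local Notation ip := (ip2 (lebO R)).
Local Notation wp := (@weak_partial R).

Definition idx (i : 'I_2) (p : nat * nat) : nat := if i == ord0 then p.1 else p.2.
Definition idx' (i : 'I_2) (p : nat * nat) : nat := if i == ord0 then p.2 else p.1.

Lemma ccE i p (x : R * R) : cc p x = cs (idx i p) (coord2 i x) * cs (idx' i p) (other i x).
Proof. by rewrite /cc /idx /idx' /coord2 /other; case: (i == ord0); rewrite // mulrC. Qed.

Lemma smooth_cc p : smooth2 (cc p : R * R -> R).
Proof.
rewrite (_ : cc p = fun x => cs (idx ord0 p) (coord2 ord0 x) * cs (idx' ord0 p) (other ord0 x)); last first.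
  by apply/funext => x; exact: ccE.
by apply: smooth_prod => k; exact: C1k_cs.
Qed.

Definition ncst (m : nat) : R := if m == 0%N then 1 else Num.sqrt 2.
Definition dcs (m : nat) (t : R) : R := - (ncst m * (m%:R * pi)) * sin (m%:R * pi * t).

Lemma der_cs m (t : R) : is_derive t 1 (cs m) (dcs m t).
Proof. by apply: (der_eq (derZ (ncst m) (der_cos (m%:R * pi) t))); rewrite /dcs; ring. Qed.

Lemma der_dcs m (t : R) : is_derive t 1 (dcs m) (- (m%:R * pi) ^+ 2 * cs m t).
Proof.
apply: (der_eq (derZ (- (ncst m * (m%:R * pi))) (der_sin (m%:R * pi) t))).
by rewrite /cs -/(ncst m); ring.
Qed.

Lemma C1k_dcs k m : C1k k (dcs m).
Proof. exact: (C1k_mul (C1k_cst k _) (C1k_trig k _).2). Qed.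

Lemma dcs_bound m : exists C, forall t, 0 < t < 1 -> `|dcs m t| <= C * t /\ `|dcs m t| <= C * (1 - t).
Proof.
exists ((m%:R * pi) ^+ 2 * 2) => t /andP[t0 t1].
have d0 : dcs m 0 = 0 by rewrite /dcs !mulr0 sin0 mulr0.
have d1 : dcs m 1 = 0 by rewrite /dcs mulr1 sin_npi mulr0.
have c : continuous (dcs m) by exact: C1k_cont (C1k_dcs 0 m).
have b (s : R) : `|- (m%:R * pi) ^+ 2 * cs m s| <= (m%:R * pi) ^+ 2 * 2.
  rewrite mulNr normrN normrM ger0_norm ?sqr_ge0//.
  by apply: ler_wpM2l; [exact: sqr_ge0|exact: cs_bound].
have := @mvt_norm _ (dcs m) (fun s => - (m%:R * pi) ^+ 2 * cs m s) 0 t _ (ltW t0)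
  (continuous_subspaceT c) (fun s _ => der_dcs m s) (fun s _ => b s).
have := @mvt_norm _ (dcs m) (fun s => - (m%:R * pi) ^+ 2 * cs m s) t 1 _ (ltW t1)
  (continuous_subspaceT c) (fun s _ => der_dcs m s) (fun s _ => b s).
by rewrite d0 d1 subr0 subr0 sub0r normrN.
Qed.

(** The cosines satisfy the Neumann condition: their normal derivative vanishes on the
    boundary, so no boundary term appears for [psi] in [H1]. *)
Lemma ip_grad_cc i p psi : H1 psi ->
  ip (wp i (cc p)) (wp i psi) = ((idx i p)%:R * pi) ^+ 2 * ip (cc p) psi.
Proof.
move=> hpsi; set m := idx i p; have sp := H1_sqi hpsi; have sw := wp_sqi i hpsi.
have [C hC] := dcs_bound m.
have := weak_by_parts sp (wpP i hpsi) (fun k => C1k_dcs k m) (fun k => C1k_cs R k (idx' i p))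
  (fun t => der_dcs m t) hC.
have e : wp i (cc p) = (fun x => dcs m (coord2 i x) * cs (idx' i p) (other i x)) %[ae lebO R].
  apply: ae_eqT (smooth_wp i (smooth_cc p)) _; apply: nearW => x _.
  rewrite (_ : cc p = fun x => cs m (coord2 i x) * cs (idx' i p) (other i x)); last first.
    by apply/funext => y; exact: ccE.
  by rewrite derive_slice; have [_ h] := prod_der (cs (idx' i p)) i x (der_cs m); exact: h.
have sd : sq (fun x => dcs m (coord2 i x) * cs (idx' i p) (other i x)).
  apply: cont_sqi; apply: prod_cont; [exact: C1k_cont (C1k_dcs 0 m)|exact: cs_cont].
rewrite (ip_ae (wp_sqi i (smooth_H1 (smooth_cc p))) sd sw sw e (ae_eq_refl _ _ _)).
have sc : sq (cc p) by exact/cont_sqi/smooth_cont/smooth_cc.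
have e1 : \int[lebO R]_x (psi x * (- (m%:R * pi) ^+ 2 * cs m (coord2 i x) * cs (idx' i p) (other i x))) =
    - (m%:R * pi) ^+ 2 * \int[lebO R]_x (cc p x * psi x).
  rewrite -RintegralZl//; last exact: sqi_mul_int sc sp.
  by apply: eq_Rintegral => x _; rewrite (ccE i) -/m; ring.
rewrite e1 mulNr => /oppr_inj h; rewrite /ip2 h.
by apply: eq_Rintegral => x _; rewrite mulrC.
Qed.

Lemma nat2_bij : exists pq : (nat -> nat * nat) * (nat * nat -> nat), cancel pq.1 pq.2 /\ cancel pq.2 pq.1.
Proof.
have /card_set_bijP [f [_ finj fsurj]] := card_nat2.
have /choice [g hg] : forall n : nat, exists p, f p = n.
  by move=> n; have [p _ <-] := fsurj n I; exists p.
exists (g, f); split=> //= p; apply: finj; rewrite ?inE//; exact: hg.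
Qed.

Definition pk : nat -> nat * nat := (sval (cid nat2_bij)).1.
Definition qk : nat * nat -> nat := (sval (cid nat2_bij)).2.

Lemma pkK : cancel pk qk. Proof. by have [] := svalP (cid nat2_bij). Qed.
Lemma qkK : cancel qk pk. Proof. by have [] := svalP (cid nat2_bij). Qed.

Definition ee (k : nat) : T -> R := cc (pk k).
Definition nu0 (a : R) (k : nat) : R := a + (((pk k).1%:R * pi) ^+ 2 + ((pk k).2%:R * pi) ^+ 2).

Lemma ee_orth j k : ip (ee j) (ee k) = (j == k)%:R.
Proof. by rewrite /ip2 /ee cc_orth (inj_eq (can_inj pkK)). Qed.

Lemma ee_H1 k : H1 (ee k). Proof. exact/smooth_H1/smooth_cc. Qed.

Lemma ee_total u : sq u -> (forall k, ip u (ee k) = 0) -> u = cst 0 %[ae lebO R].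
Proof. by move=> su h; apply: cc_complete => // p; have := h (qk p); rewrite /ee qkK. Qed.

Lemma nu0_oo a : 0 < a -> forall M, exists N, forall k, (N <= k)%N -> M <= nu0 a k.
Proof.
move=> a0 M; pose L := (Num.truncn (`|M|)).+1.
exists (\max_(i < L) \max_(j < L) (qk (i : nat, j : nat)).+1) => k hk; rewrite leNgt; apply/negP => hM.
have big (n : nat) : (n%:R * pi) ^+ 2 < M -> (n < L)%N.
  move=> h; rewrite ltnNge; apply/negP => Ln.
  have M0 : 0 <= `|M| by [].
  have h1 : `|M| < L%:R by rewrite /L; have /andP[] := truncn_itv M0.
  have h2 : (L%:R : R) <= n%:R by rewrite ler_nat.
  have h3 : (1 : R) <= n%:R by rewrite ler1n; apply: leq_trans Ln.
  have p1 : (1 : R) <= pi by have := pi_ge2 R; lra.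
  have h4 := ler_norm M; have : n%:R <= (n%:R * pi) ^+ 2 :> R.
    have : n%:R <= n%:R * pi :> R by rewrite ler_peMr//; lra.
    move: (n%:R * pi) => q hq; rewrite expr2; nra.
  lra.
have p0 n : 0 <= (n%:R * pi) ^+ 2 :> R by rewrite sqr_ge0.
have h1 : ((pk k).1 < L)%N by apply: big; have := p0 (pk k).2; rewrite /nu0 in hM; lra.
have h2 : ((pk k).2 < L)%N by apply: big; have := p0 (pk k).1; rewrite /nu0 in hM; lra.
have := hk; rewrite leqNgt => /negP; apply.
have e : k = qk (pk k) by rewrite pkK.
rewrite {1}e [pk k]surjective_pairing.
apply: leq_trans (leq_bigmax (Ordinal h1)); exact: (leq_bigmax (Ordinal h2)).
Qed.

Definition one : T -> R := cst 1.
Definition zero : T -> R := cst 0.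
Definition aform0 (a : R) := aform a zero one one.

Lemma one_bound x : 2^-1 <= one x <= 2. Proof. by rewrite /one /=; lra. Qed.
Lemma zero_bound x : `|zero x| <= 0. Proof. by rewrite /zero /= normr0. Qed.

Lemma wip1 u v : wip (lebO R) one u v = ip u v. Proof. by rewrite ip2E. Qed.

Lemma tilt0 : tilt zero = wp ord0.
Proof.
by apply/funext => u; apply/funext => x; rewrite -[LHS]/(wp ord0 u x - 0 * _) mul0r subr0.
Qed.

Lemma nu_real (x y q m n a : R) : x = m * q -> y = n * q -> x + y + a * q = (a + (m + n)) * q.
Proof. by move=> -> ->; ring. Qed.

Lemma aform0E a u v : aform0 a u v =
  ip (wp ord0 u) (wp ord0 v) + ip (wp ord_max u) (wp ord_max v) + a * ip u v.
Proof.
by rewrite /aform0 /aform tilt0 ip2E.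
Qed.

Lemma form_pair0 a : 0 < a -> form_pair sq (@H1 R) (wip (lebO R) one) (aform0 a) a.
Proof.
move=> a0; apply: (@form_pairP _ a zero one one 0 2^-1 2) => //.
- exact: zero_bound.
- exact: one_bound.
- exact: one_bound.
Qed.

Lemma cos_eigenbasis a : 0 < a ->
  eigenbasis sq (@H1 R) (wip (lebO R) one) (aform0 a) ee (nu0 a).
Proof.
move=> a0; split.
- exact: ee_H1.
- by move=> j k; rewrite wip1 ee_orth.
- move=> k psi hpsi; rewrite wip1 aform0E.
  exact: (nu_real a (ip_grad_cc ord0 (pk k) hpsi) (ip_grad_cc ord_max (pk k) hpsi)).
- move=> u su h; rewrite wip1.
  have E : u = cst 0 %[ae lebO R] by apply: ee_total => // k; rewrite -wip1.
  have s0 := sqi0 (lebO R); rewrite (ip_ae su s0 su s0 E E).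
  exact: (b0l (ip2_semiip (lebO R)) s0).
Qed.

(** Every form with bounded coefficients inherits compactness, density and hence an
    eigenbasis. *)
Section General.
Variables (a : R) (kap J rho : T -> R) (C0 c1 C1 : R).
Hypotheses (a_gt0 : 0 < a) (C0_ge0 : 0 <= C0) (c1_gt0 : 0 < c1).
Hypotheses (mk : measurable_fun setT kap) (mJ : measurable_fun setT J) (mrho : measurable_fun setT rho).
Hypotheses (kC : forall x, `|kap x| <= C0) (Jb : forall x, c1 <= J x <= C1)
  (rb : forall x, c1 <= rho x <= C1).

Lemma aform0_equiv : exists cl : R, exists2 cu : R, 0 < cl &
  forall u, H1 u -> cl * nH u <= aform0 a u u <= cu * nH u.
Proof.
apply: (@aform_equiv _ a zero one one 0 2^-1 2) => //.
- exact: zero_bound.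
- exact: one_bound.
- exact: one_bound.
Qed.

Lemma form_equiv : exists cl : R, exists2 cu : R, 0 < cl /\ 0 < cu &
  forall u, H1 u -> cl * aform0 a u u <= aform a kap J rho u u <= cu * aform0 a u u.
Proof.
have [l [m l0 h]] := aform0_equiv.
have [l' [m' l0' h']] := aform_equiv a_gt0 C0_ge0 c1_gt0 mk mJ mrho kC Jb rb.
pose M := `|m| + 1; pose M' := `|m'| + 1.
have M0 : 0 < M by rewrite ltr_wpDl.
have M0' : 0 < M' by rewrite ltr_wpDl.
have mM : m <= M by rewrite /M (le_trans (ler_norm _))// lerDl.
have mM' : m' <= M' by rewrite /M' (le_trans (ler_norm _))// lerDl.
exists (l' / M), (M' / l); first by rewrite !divr_gt0.
move=> u hu; have /andP[h1 h2] := h _ hu; have /andP[h3 h4] := h' _ hu.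
have [_ _ n0] := nH_parts hu.
move: (nH u) (aform0 a u u) (aform _ _ _ _ u u) n0 h1 h2 h3 h4 => n A B n0 h1 h2 h3 h4.
have k2 := le_trans h2 (ler_wpM2r n0 mM); have k4 := le_trans h4 (ler_wpM2r n0 mM').
apply/andP; split.
  apply: le_trans h3; rewrite mulrAC ler_pdivrMr// -mulrA.
  by apply: ler_wpM2l; [exact: ltW|rewrite mulrC].
apply: (le_trans k4); rewrite mulrAC ler_pdivlMr// -mulrA.
by apply: ler_wpM2l; [exact: ltW|rewrite mulrC].
Qed.

(** Compactness for one form transfers to any equivalent one. *)
Lemma form_compact : compact_embedding (@H1 R) (wip (lebO R) J) (aform a kap J rho).
Proof.
move=> u M hu hM; have [cl [cu [cl0 cu0] eq]] := form_equiv.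
have [s s1 s2] := compact_of_basis (form_pair0 a_gt0) (cos_eigenbasis a_gt0) (nu0_oo a_gt0) hu
  (M := M / cl) (fun n => ltac:(have /andP[h _] := eq _ (hu n);
     rewrite ler_pdivlMr// mulrC; exact: le_trans h (hM n))).
exists s => // e e0.
have C1p : 0 < C1 by apply: C1_gt0 c1_gt0 Jb.
have [N hN] := s2 _ (divr_gt0 e0 C1p); exists N => n m hn hm; have := hN _ _ hn hm; rewrite wip1 => h.
have S := ip2_semiip (lebO R).
have /andP[_ h'] := wip_le mJ c1_gt0 Jb (sipB S (H1_sqi (hu (s n))) (H1_sqi (hu (s m)))).
by apply: le_lt_trans h' _; rewrite mulrC -ltr_pdivlMr.
Qed.

Theorem form_eigenbasis : exists e nu, eigenbasis sq (@H1 R) (wip (lebO R) J) (aform a kap J rho) e nu.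
Proof.
have C1p : 0 < C1 by apply: C1_gt0 c1_gt0 Jb.
have S := ip2_semiip (lebO R).
apply: (eigenbasis_ex (form_pairP a_gt0 C0_ge0 c1_gt0 mk mJ mrho kC Jb rb) form_compact).
- move=> u su d d0.
  have [N hN] := parseval (fp_b (form_pair0 a_gt0)) (fun k => H1_sqi (ee_H1 k))
    (eig_orth (cos_eigenbasis a_gt0)) (fp_bC (form_pair0 a_gt0)) (eig_total (cos_eigenbasis a_gt0))
    su (divr_gt0 d0 C1p).
  have hc : H1 (comb ee (fun k => wip (lebO R) one u (ee k)) N).
    exact: (Q_comb (form_pair0 a_gt0) (cos_eigenbasis a_gt0)).
  exists (comb ee (fun k => wip (lebO R) one u (ee k)) N) => //.
  have sd := sipB S su (H1_sqi hc).
  have /andP[_ h'] := wip_le mJ c1_gt0 Jb sd; apply: le_lt_trans h' _.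
  rewrite mulrC -ltr_pdivlMr// (bBBC S su (H1_sqi hc)) -wip1; exact: hN.
- exists ee, c1; split=> [//||c K]; first exact: ee_H1.
  have sc : sq (comb ee c K) by apply: (D_comb S) => k; exact: H1_sqi (ee_H1 k).
  have /andP[h _] := wip_le mJ c1_gt0 Jb sc; apply: le_trans h.
  rewrite ler_pM2l// (comb_norm S)//; [by move=> k; exact: H1_sqi (ee_H1 k)|exact: ee_orth].
Qed.

End General.
End Cosine.

(** ** The perturbed forms *)
Section Perturbed.
Variable R : realType.
Local Notation TR := (measurableTypeR R).
Local Notation T := (measurableTypeR R * measurableTypeR R)%type.
Local Notation sq := (sqi (lebO R)).
Local Notation wp := (@weak_partial R).
Variables (phi : R -> R -> R) (a eps : R).
Implicit Types (x : R * R) (u v : T -> R).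

Definition dphi (t : R) : R := derive1 (phi^~ eps) t.

(** [mild] gathers what the geometry needs once [eps] is small. *)
Definition mild : Prop := [/\ 0 < eps, Ck1 2 (phi^~ eps),
  forall t, 0 <= t <= 1 -> `|dphi t| <= 2^-1 &
  exists C, forall t, 0 <= t <= 1 -> `|phi t eps / eps| <= C].

Hypothesis good : eps = 0 \/ mild.

Definition al x : R := if eps == 0 then 0 else phi x.2 eps / eps * cos (x.1 / eps).
Definition Jx x : R := if eps == 0 then 1 else 1 + dphi x.2 * sin (x.1 / eps).

Lemma phi_der : eps != 0 -> forall t : R, is_derive t 1 (phi^~ eps) (dphi t).
Proof.
move=> e0 t; case: good => [e|[_ [h _] _ _]]; first by rewrite e eqxx in e0.
by apply: DeriveDef; [exact: (h 0%N)|rewrite /dphi derive1E].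
Qed.

Lemma dphi_cont : eps != 0 -> continuous dphi.
Proof.
move=> e0; case: good => [e|[_ [h _] _ _]]; first by rewrite e eqxx in e0.
by move=> t; apply: differentiable_continuous; apply/derivable1_diffP; exact: (h 1%N).
Qed.

Lemma phi_cont : eps != 0 -> continuous (phi^~ eps).
Proof. by move=> e0 t; exact: der_cont (phi_der e0 t). Qed.

Lemma der_scale (F : R -> R) (F' c t : R) : is_derive (t / c) 1 F F' ->
  is_derive t 1 (fun t : R => F (t / c)) (F' / c).
Proof.
move=> h; have hl : is_derive t 1 (fun t : R => t / c) c^-1.
  have := derZ c^-1 (derid t); rewrite mulr1; congr is_derive.
  by apply/funext => s; rewrite mulrC.
exact: (@der_comp _ F (fun t => t / c) t F' c^-1 h hl).
Qed.

Lemma DhE x : Dh phi eps x = \matrix_(i, j)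
  (if i == ord0 then (j == ord0)%:R else if j == ord0 then al x else Jx x).
Proof.
apply/matrixP => i j; rewrite !mxE derive_slice.
have D (F : R -> R) (d t : R) : is_derive t 1 F d -> 'D_1 F t = d by case.
have e01 : (ord_max == ord0 :> 'I_2) = false by [].
have ij (k : 'I_2) : k = ord0 \/ k = ord_max.
  by case: k => [[|[|]]//] h; [left|right]; apply/val_inj.
have [->|->] := ij i; rewrite /= ?eqxx ?e01.
  have -> : (fun y => coord2 ord0 (hmap phi eps y)) \o upd j x = fun t => (upd j x t).1.
    by apply/funext => t; rewrite /= /hmap; case: ifP.
  have [->|->] := ij j; rewrite ?eqxx ?e01.
    exact: (D _ _ _ (derid _)).
  exact: (D _ _ _ (derC _ _)).
have [e0|e0] := eqVneq eps 0.
  have -> : (fun y => coord2 ord_max (hmap phi eps y)) \o upd j x = fun t => (upd j x t).2.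
    by apply/funext => t; rewrite /= /hmap e0 eqxx.
  rewrite /al /Jx e0 eqxx; have [->|->] := ij j; rewrite ?eqxx ?e01.
    exact: (D _ _ _ (derC _ _)).
  exact: (D _ _ _ (derid _)).
have -> : (fun y => coord2 ord_max (hmap phi eps y)) \o upd j x =
    fun t => (upd j x t).2 + phi (upd j x t).2 eps * sin ((upd j x t).1 / eps).
  by apply/funext => t; rewrite /= /hmap (negbTE e0).
rewrite /al /Jx (negbTE e0); have [->|->] := ij j; rewrite ?eqxx ?e01.
  have h := derD (derC x.1 x.2) (derZ (phi x.2 eps) (der_scale (is_derive_sin (x.1 / eps)))).
  by rewrite (D _ _ _ h); ring.
have h := derD (derid x.2) (derM (phi_der e0 x.2) (derC x.2 (sin (x.1 / eps)))).
by rewrite (D _ _ _ h) mulr0 addr0.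
Qed.

Lemma JhE x : Jh phi eps x = Jx x.
Proof.
rewrite /Jh DhE (expand_det_row _ ord0) !big_ord_recl big_ord0 addr0 /cofactor !det_mx11 !mxE /=.
by rewrite mul0r addr0 mul1r addn0 expr0 mul1r.
Qed.

Lemma grad_epsE u x : Jx x != 0 ->
  grad_eps phi eps u x ord0 0 = wp ord0 u x - al x / Jx x * wp ord_max u x /\
  grad_eps phi eps u x ord_max 0 = (Jx x)^-1 * wp ord_max u x.
Proof.
move=> J0; pose N : 'M[R]_2 := \matrix_(i, j)
  (if i == ord0 then (j == ord0)%:R else if j == ord0 then - (al x / Jx x) else (Jx x)^-1).
have ND : N *m Dh phi eps x = 1%:M.
  apply/matrixP => i j; rewrite DhE !mxE !big_ord_recl big_ord0 !mxE addr0 /=.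
  case: i => [[|[|]]//] hi; case: j => [[|[|]]//] hj; rewrite /= ?mulr1 ?mul1r ?mulr0 ?mul0r ?addr0 ?add0r//.
    by rewrite [_^-1 * al x]mulrC addNr.
  by rewrite mulVf.
have [_ Du] := mulmx1_unit ND.
have iN : invmx (Dh phi eps x) = N.
  by rewrite -[LHS]mul1mx -ND -mulmxA mulmxV// mulmx1.
have e1 : lift ord0 ord0 = ord_max :> 'I_2 by exact/val_inj.
have expand (w : 'cV[R]_2) i : (N^T *m w) i 0 = N ord0 i * w ord0 0 + N ord_max i * w ord_max 0.
  by rewrite mxE !big_ord_recl big_ord0 addr0 !(mxE trmx_key) e1.
have gE i : weak_grad u x i 0 = wp i u x by rewrite mxE.
rewrite /grad_eps iN (expand _ ord0) (expand _ ord_max) (gE ord0) (gE ord_max).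
rewrite ![N _ _]mxE; split; first by rewrite /= mul1r mulNr.
by rewrite /= mul0r add0r.
Qed.

(** Freezing [x.2] outside the unit interval bounds the coefficients everywhere. *)
Definition froz x : R * R := (x.1, clamp 1 x.2).
Definition Jt : T -> R := fun x => Jx (froz x).
Definition kapt : T -> R := fun x => al (froz x) / Jx (froz x).
Definition rhot : T -> R := fun x => (Jx (froz x))^-1.

Lemma clamp01 (t : R) : 0 <= clamp 1 t <= (1 : R). Proof. exact/clamp_itv/ler01. Qed.

Lemma froz_Omega x : Omega R x -> froz x = x.
Proof.
move=> /(OmegaP ord0)[_ /andP[h1 h2]]; case: x h1 h2 => x1 x2 h1 h2.
by rewrite /froz clamp_id//= !ltW.
Qed.

Lemma Jx_bound x : 0 <= x.2 <= 1 -> 2^-1 <= Jx x <= 3 / 2.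
Proof.
move=> hx; rewrite /Jx; case: ifPn => [_|e0]; first by lra.
case: good => [e|[_ _ h _]]; first by rewrite e eqxx in e0.
have h1 := h _ hx; have h2 : `|sin (x.1 / eps)| <= 1 by rewrite ler_norml sin_geN1 sin_le1.
have : `|dphi x.2 * sin (x.1 / eps)| <= 2^-1 * 1 by rewrite normrM ler_pM.
by rewrite mulr1 ler_norml => /andP[]; lra.
Qed.

Lemma al_bound : exists2 C, 0 <= C & forall x, 0 <= x.2 <= 1 -> `|al x| <= C.
Proof.
case: good => [e|[e0 _ _ [C h]]].
  by exists 0 => // x _; rewrite /al e eqxx normr0.
exists `|C| => // x hx; rewrite /al gt_eqF// normrM -[leRHS]mulr1; apply: ler_pM => //.
  by apply: le_trans (h _ hx) (ler_norm _).
by rewrite ler_norml cos_geN1 cos_le1.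
Qed.

Lemma clamp_cont : continuous (clamp (1 : R)).
Proof.
move=> t; apply/cvgrPdist_le => e e0; near=> s; apply: le_trans (clamp_lip _ _ _) _.
near: s; exact: cvgr_dist_le.
Unshelve. all: end_near. Qed.

Lemma meas_fst_comp (F : R -> R) : continuous F -> measurable_fun (setT : set T) (fun x : T => F x.1).
Proof. by move=> cF; have [h _] := @meas1 R F ord0 cF. Qed.

Lemma meas_snd_comp (F : R -> R) : continuous F -> measurable_fun (setT : set T) (fun x : T => F x.2).
Proof. by move=> cF; have [_ h] := @meas1 R F ord0 cF. Qed.

Lemma cont_div (F : R -> R) (c : R) : continuous F -> continuous (fun t : R => F (t / c)).
Proof.
move=> cF t; apply: (@continuous_comp _ _ _ (fun t : R => t / c) F t); last exact: cF.
by apply: cvgM; [exact: cvg_id|exact: cvg_cst].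
Qed.

Lemma meas_al (g : R -> R) : continuous g ->
  measurable_fun (setT : set T) (fun x : T => al (x.1, g x.2)).
Proof.
move=> cg; rewrite /al /=; have [_|e0] := eqVneq eps 0; first exact: measurable_cst.
apply: measurable_funM; last by apply: (@meas_fst_comp (fun t => cos (t / eps))); apply: cont_div; exact: continuous_cos.
apply: measurable_funM; last exact: measurable_cst.
apply: (@meas_snd_comp (fun t => phi (g t) eps)) => t.
by apply: (@continuous_comp _ _ _ g (phi^~ eps)); [exact: cg|exact: phi_cont].
Qed.

Lemma meas_J (g : R -> R) : continuous g ->
  measurable_fun (setT : set T) (fun x : T => Jx (x.1, g x.2)).
Proof.
move=> cg; rewrite /Jx /=; have [_|e0] := eqVneq eps 0; first exact: measurable_cst.
apply: measurable_funD; first exact: measurable_cst.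
apply: measurable_funM; last by apply: (@meas_fst_comp (fun t => sin (t / eps))); apply: cont_div; exact: continuous_sin.
apply: (@meas_snd_comp (fun t => dphi (g t))) => t.
by apply: (@continuous_comp _ _ _ g dphi); [exact: cg|exact: dphi_cont].
Qed.

Lemma meas_inv (f : T -> R) : measurable_fun setT f -> measurable_fun setT (fun x => (f x)^-1).
Proof.
move=> mf; rewrite (_ : (fun x => _) = fun x => if f x == 0 then 0 else f x / (f x ^+ 2)); last first.
  by apply/funext => x; have [->|h] := eqVneq (f x) 0; [rewrite invr0|field].
have inv2 (g : T -> R) : measurable_fun setT g -> (forall x, 0 <= g x) ->
    measurable_fun setT (fun x => (g x)^-1).
  move=> mg g0; apply: (measurability _ (RGenOInfty.measurableE R)).
  move=> _ [_ [c ->] <-]; apply: measurableI => //.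
  have [c0|c0] := ltP c 0.
    rewrite (_ : _ @^-1` _ = setT)//; apply/seteqP; split=> // x _ /=.
    by rewrite in_itv /= andbT (lt_le_trans c0)// invr_ge0.
  rewrite (_ : _ @^-1` _ = g @^-1` [set y | 0 < y /\ (c = 0 \/ y < c^-1)]); last first.
    apply/seteqP; split=> x /=; rewrite in_itv /= andbT.
      move=> h; have gx : 0 < g x by rewrite -invr_gt0 (le_lt_trans c0).
      split=> //; have [->|cn] := eqVneq c 0; [by left|right].
      by rewrite -[g x]invrK ltf_pV2 ?posrE ?invr_gt0// lt_neqAle eq_sym cn.
    move=> [gx [->|h]]; first by rewrite invr_gt0.
    have [->|cn] := eqVneq c 0; first by rewrite invr_gt0.
    by rewrite -[c]invrK ltf_pV2 ?posrE ?invr_gt0// lt_neqAle eq_sym cn.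
  rewrite -[X in measurable X]setTI; apply: mg => //.
  have [->|cn] := eqVneq c 0.
    rewrite (_ : [set y | _] = `]0, +oo[%classic); first exact: measurable_itv.
    apply/seteqP; split=> y /=; rewrite in_itv /= andbT; first by case.
    by move=> y0; split=> //; left.
  rewrite (_ : [set y | _] = `]0, c^-1[%classic); first exact: measurable_itv.
  apply/seteqP; split=> y /=; rewrite in_itv /=.
    by move=> [-> [c1|->//]]; rewrite c1 eqxx in cn.
  by move=> /andP[-> h]; split=> //; right.
apply: measurable_fun_ifT.
- by apply: measurable_fun_eqr => //; exact: measurable_cst.
- exact: measurable_cst.
- apply: measurable_funM => //; apply: inv2; first exact: measurable_funX.
  by move=> x; exact: sqr_ge0.
Qed.

Lemma froz_meas : [/\ measurable_fun setT Jt, measurable_fun setT kapt & measurable_fun setT rhot].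
Proof.
have mJ : measurable_fun setT Jt by apply: (meas_J clamp_cont).
have mr : measurable_fun setT rhot by exact: meas_inv.
by split=> //; apply: measurable_funM => //; exact: (meas_al clamp_cont).
Qed.

Lemma Jt_bound x : 2^-1 <= Jt x <= 2.
Proof. by have := @Jx_bound (froz x) (clamp01 _); rewrite /Jt; lra. Qed.

Lemma rhot_bound x : 2^-1 <= rhot x <= 2.
Proof.
have /andP[h1 h2] := @Jx_bound (froz x) (clamp01 _); rewrite /rhot.
have p : 0 < Jx (froz x) by lra.
move: (Jx _) h1 h2 p => q h1 h2 p.
have e : q * q^-1 = 1 by rewrite divff// gt_eqF.
have i0 : 0 < q^-1 by rewrite invr_gt0.
by move: (q^-1) e i0 => y e i0; apply/andP; split; nra.
Qed.

Lemma kapt_bound : exists2 C, 0 <= C & forall x, `|kapt x| <= C.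
Proof.
have [C C0 h] := al_bound; exists (C * 2); first by rewrite mulr_ge0.
move=> x; rewrite /kapt normrM; apply: ler_pM => //; first exact/h/clamp01.
by have /andP[h1 h2] := rhot_bound x; rewrite ger0_norm// -/(rhot x); lra.
Qed.

Lemma pairingE u v : sq u -> sq v -> pairing phi eps u v = wip (lebO R) Jt u v.
Proof.
move=> su sv; have [mJ _ _] := froz_meas; apply: Rintegral_ae.
- apply: measurable_funM; first by apply: measurable_funM; [exact: su.1|exact: sv.1].
  apply: measurableT_comp => //; rewrite (_ : Jh phi eps = fun x => Jx (x.1, id x.2)).
    by apply: (@meas_J id) => t; exact: cvg_id.
  by apply/funext => -[x1 x2]; rewrite JhE.
- by apply: measurable_funM => //; apply: measurable_funM; [exact: su.1|exact: sv.1].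
- apply: ae_Omega => x Ox _; rewrite JhE /Jt froz_Omega//; congr (_ * _).
  have /andP[h _] := Jt_bound x; rewrite /Jt froz_Omega// in h.
  by rewrite ger0_norm//; lra.
Qed.

(** The matrix [(Dh)^(-T)] is triangular, and the quadratic form is the sum of the squares of
    [d_1 u - kap d_2 u] and [d_2 u], with weights. *)
Lemma AopE u v : H1 u -> H1 v -> Aop phi a eps u v = aform a kapt Jt rhot u v.
Proof.
move=> hu hv; have [mJ mk mr] := froz_meas; have [C C0 kC] := kapt_bound.
rewrite /Aop /aform (pairingE (H1_sqi hu) (H1_sqi hv)); congr (_ + _).
have w0u := wp_sqi ord0 hu; have w1u := wp_sqi ord_max hu.
have w0v := wp_sqi ord0 hv; have w1v := wp_sqi ord_max hv.
have tu := tilt_sqi mk kC hu; have tv := tilt_sqi mk kC hv.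
have JC x : `|Jt x| <= 2 by have /andP[h1 h2] := Jt_bound x; rewrite ger0_norm//; lra.
have rC x : `|rhot x| <= 2 by have /andP[h1 h2] := rhot_bound x; rewrite ger0_norm//; lra.
rewrite /wip -RintegralD//; [|exact: mul_int_w tu tv mJ JC|exact: mul_int_w w1u w1v mr rC].
have mid : continuous (@id R) by move=> t; exact: cvg_id.
have mJ1 := meas_J mid; have ma1 := meas_al mid; have mi1 := meas_inv mJ1.
pose G1 (w : T -> R) : T -> R := fun x => wp ord0 w x - al (x.1, id x.2) * (Jx (x.1, id x.2))^-1 * wp ord_max w x.
pose G2 (w : T -> R) : T -> R := fun x => (Jx (x.1, id x.2))^-1 * wp ord_max w x.
have mG1 w : H1 w -> measurable_fun setT (G1 w).
  move=> hw; apply: measurable_funB; first exact: (wp_sqi ord0 hw).1.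
  apply: measurable_funM; last exact: (wp_sqi ord_max hw).1.
  exact: measurable_funM.
have mG2 w : H1 w -> measurable_fun setT (G2 w).
  by move=> hw; apply: measurable_funM => //; exact: (wp_sqi ord_max hw).1.
have key x : ((grad_eps phi eps u x)^T *m grad_eps phi eps v x) 0 0 * `|Jh phi eps x| =
    (G1 u x * G1 v x + G2 u x * G2 v x) * `|Jx (x.1, id x.2)|.
  rewrite JhE -[(x.1, id x.2)]surjective_pairing; have [J0|J0] := eqVneq (Jx x) 0.
    by rewrite J0 normr0 !mulr0.
  have [u1 u2] := grad_epsE u J0; have [v1 v2] := grad_epsE v J0.
  rewrite mxE !big_ord_recl big_ord0 addr0 ![_^T _ _]mxE /G1 /G2 -[(x.1, id x.2)]surjective_pairing.
  have e : lift ord0 ord0 = ord_max :> 'I_2 by exact/val_inj.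
  by rewrite e u1 u2 v1 v2.
rewrite (_ : (fun x => _ * `|Jh phi eps x|) = fun x => (G1 u x * G1 v x + G2 u x * G2 v x) * `|Jx (x.1, id x.2)|); last first.
  by apply/funext => x; exact: key.
apply: Rintegral_ae.
- apply: measurable_funM; last exact: measurableT_comp.
  by apply: measurable_funD; apply: measurable_funM; [exact: mG1|exact: mG1|exact: mG2|exact: mG2].
- apply: measurable_funD.
    by apply: measurable_funM => //; apply: measurable_funM; [exact: tu.1|exact: tv.1].
  by apply: measurable_funM => //; apply: measurable_funM; [exact: w1u.1|exact: w1v.1].
- apply: ae_Omega => x Ox _.
  have tE w : tilt kapt w x = wp ord0 w x - kapt x * wp ord_max w x by [].
  rewrite !tE /G1 /G2 -[(x.1, id x.2)]surjective_pairing /kapt /Jt /rhot froz_Omega//.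
  have /andP[h _] := Jt_bound x; rewrite /Jt froz_Omega// in h.
  have J0 : 0 < Jx x by lra.
  rewrite (gtr0_norm J0); move: (wp ord0 u x) (wp ord_max u x) (wp ord0 v x) (wp ord_max v x) (al x) => p q r s t.
  by field; rewrite gt_eqF.
Qed.

(** ** The spectral data of the operator for one value of [eps] *)
Definition formA := aform a kapt Jt rhot.
Definition bJ := wip (lebO R) Jt.

Lemma formA_pair : 0 < a -> form_pair sq (@H1 R) bJ formA a.
Proof.
move=> a0; have [mJ mk mr] := froz_meas; have [C C0 kC] := kapt_bound.
by apply: (form_pairP a0 C0 _ mk mJ mr kC Jt_bound rhot_bound); rewrite invr_gt0.
Qed.

Lemma formA_basis : 0 < a -> exists e nu, eigenbasis sq (@H1 R) bJ formA e nu.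
Proof.
move=> a0; have [mJ mk mr] := froz_meas; have [C C0 kC] := kapt_bound.
by apply: (form_eigenbasis a0 C0 _ mk mJ mr kC Jt_bound rhot_bound); rewrite invr_gt0.
Qed.

Lemma formA_equiv : 0 < a -> exists cl : R, exists2 cu : R, 0 < cl /\ 0 < cu &
  forall u, H1 u -> cl * aform0 a u u <= formA u u <= cu * aform0 a u u.
Proof.
move=> a0; have [mJ mk mr] := froz_meas; have [C C0 kC] := kapt_bound.
by apply: (form_equiv a0 C0 _ mk mJ mr kC Jt_bound rhot_bound); rewrite invr_gt0.
Qed.

Lemma bJ_equiv u : sq u -> 2^-1 * ip2 (lebO R) u u <= bJ u u <= 2 * ip2 (lebO R) u u.
Proof.
by move=> su; have [mJ _ _] := froz_meas; apply: (wip_le mJ _ Jt_bound su); rewrite invr_gt0.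
Qed.

End Perturbed.

(** * Fractional powers *)
Section Kernel.
Variable R : realType.
Local Notation leb := (@lebesgue_measure R).
Local Notation pos := (`]0, +oo[%classic : set R).
Implicit Types (s y t : R).

Lemma powR_anti s (x y : R) : 0 <= s -> 0 < x <= y -> y `^ (- s) <= x `^ (- s).
Proof.
move=> s0 /andP[x0 xy]; have y0 := lt_le_trans x0 xy.
by rewrite !powRN lef_pV2 ?posrE ?powR_gt0// ge0_ler_powR ?nnegrE// ltW.
Qed.

(** The integral of [ker s y] over the half-line is [pi / sin (pi s) * y^(-s)]; only the
    order of magnitude [y^(-s)] is established. *)
Definition ker s y : R -> R := fun t => t `^ (- s) / (t + y).

Lemma ker_ge0 s y t : 0 <= y -> 0 <= t -> 0 <= ker s y t.
Proof. by move=> y0 t0; rewrite /ker divr_ge0 ?powR_ge0 ?addr_ge0. Qed.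

Lemma meas_ker s y : measurable_fun (setT : set R) (ker s y).
Proof.
apply: measurable_funM; first exact: (@measurable_powR R (- s)).
have mi : measurable_fun (setT : set (measurableTypeR R * measurableTypeR R)%type) (fun x => (x.1 + y)^-1).
  by apply: meas_inv; apply: measurable_funD => //; exact: measurable_cst.
have mp : measurable_fun (setT : set R) (fun t : R => (t, t) : (measurableTypeR R * measurableTypeR R)%type).
  exact: measurable_fun_pair.
exact: (measurableT_comp mi mp).
Qed.

Section Fixed.
Variables (s y : R).
Hypotheses (s01 : 0 < s < 1) (y0 : 0 < y).

Let C' : R := 4 / (s * (1 - s)).
Let K t := t `^ (1 - s) * (t + y)^-1 - C' * (t + y) `^ (- s).
Let K' t := (1 - s) * t `^ (- s) * (t + y)^-1 - t `^ (1 - s) * ((t + y)^-1 * (t + y)^-1)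
   + 4 / (1 - s) * ((t + y) `^ (- s) * (t + y)^-1).

Let s0 : 0 < s. Proof. by case/andP: s01. Qed.
Let s1 : 0 < 1 - s. Proof. by case/andP: s01; rewrite subr_gt0. Qed.

Lemma powRSB (x r : R) : 0 < x -> x `^ (r - 1) = x `^ r * x^-1.
Proof.
by move=> x0; rewrite powRD ?(gt_eqF x0) ?implybT// powR_inv1// ltW.
Qed.

Lemma der_K t : 0 < t -> is_derive t 1 K (K' t).
Proof.
move=> t0; have ty : 0 < t + y by rewrite addr_gt0.
have h1 : is_derive t 1 (fun t : R => t `^ (1 - s)) ((1 - s) * t `^ (1 - s - 1)) by exact: is_derive1_powR.
have h2 : is_derive t 1 (fun t : R => t + y) 1.
  by apply: (der_eq (derD (derid t) (derC t y))); rewrite addr0.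
have h3 : is_derive t 1 (fun t : R => (t + y)^-1) (- (t + y) ^- 2).
  have ne : t + y != 0 by rewrite gt_eqF.
  have := @is_deriveV R (fun t : R => t + y) t 1 1 ne h2.
  by move=> h; apply: (der_eq h); rewrite /GRing.scale /= mulr1.
have h4 := @der_comp _ (fun t : R => t `^ (- s)) (fun t : R => t + y) t _ _ (is_derive1_powR (- s) ty) h2.
apply: (der_eq (derB (derM h1 h3) (derZ C' h4))).
rewrite /K' (_ : 1 - s - 1 = - s); last by ring.
rewrite (powRSB _ ty) /C'.
have sn : s != 0 by rewrite gt_eqF.
have sn1 : 1 - s != 0 by rewrite gt_eqF.
move: (t `^ (- s)) (t `^ (1 - s)) ((t + y) `^ (- s)) => p q r.
have tyn : t + y != 0 by rewrite gt_eqF.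
by field; rewrite ?sn ?sn1 ?tyn.
Qed.

Lemma ker_le_K' t : 0 < t -> ker s y t <= 2 / (1 - s) * K' t.
Proof.
move=> t0; have ty : 0 < t + y by rewrite addr_gt0.
have e1 : t `^ (1 - s) = t `^ (- s) * t.
  by rewrite addrC powRD ?(gt_eqF t0) ?implybT// powRr1// ltW.
pose p := t `^ (- s); pose q := (t + y) `^ (- s); pose z := (t + y)^-1; pose x := t / (t + y).
have p0 : 0 <= p by exact: powR_ge0.
have q0 : 0 <= q by exact: powR_ge0.
have z0 : 0 < z by rewrite invr_gt0.
have x0 : 0 < x by rewrite divr_gt0.
have x1 : x <= 1 by rewrite ler_pdivrMr// mul1r lerDl ltW.
have -> : ker s y t = p * z by [].
have -> : K' t = (p * z) * ((1 - s) - x) + 4 / (1 - s) * (q * z).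
  by rewrite /K' e1 /x -/p -/q -/z; ring.
set m := p * z; have m0 : 0 <= m by rewrite mulr_ge0// ltW.
have d0 : 0 < 2 / (1 - s) by rewrite divr_gt0.
have dK : (1 - s) * (2 / (1 - s)) = 2 by field; rewrite gt_eqF.
rewrite mulrDr; have [xs|xs] := leP x ((1 - s) / 2).
  apply: (@le_trans _ _ (2 / (1 - s) * (m * (1 - s - x)))).
    apply: (@le_trans _ _ (2 / (1 - s) * (m * ((1 - s) / 2)))); first by rewrite le_eqVlt; apply/orP; left; apply/eqP; field; rewrite gt_eqF.
    by rewrite ler_pM2l//; apply: ler_wpM2l => //; lra.
  by rewrite lerDl !mulr_ge0 ?(ltW s1)// ?invr_ge0 ltW.
have pq : p <= 2 / (1 - s) * q.
  have xp : x `^ (- s) <= 2 / (1 - s).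
    apply: (@le_trans _ _ (((1 - s) / 2) `^ (- s))).
      by apply: powR_anti; [exact: ltW|rewrite divr_gt0//= ltW].
    rewrite -[2 / _]invrK invf_div; apply: (@le_trans _ _ (((1 - s) / 2) `^ (- 1))).
      have h : 0 < (1 - s) / 2 <= 1 by rewrite divr_gt0//=; lra.
      by apply: (ger_powR h); have /andP[] := s01; lra.
    by rewrite powR_inv1// divr_ge0// ltW.
  have -> : p = x `^ (- s) * q.
    by rewrite -powRM ?(ltW x0) ?(ltW ty)// /x divfK// gt_eqF.
  by rewrite ler_wpM2r.
have s1' : 0 < 1 - s by exact: s1.
have h1 : m * (-1) <= m * (1 - s - x) by apply: ler_wpM2l => //; lra.
have h2 : m <= 2 / (1 - s) * (q * z) by rewrite mulrA ler_wpM2r// ltW.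
have h3 : 2 * m <= 4 / (1 - s) * (q * z).
  have -> : 4 / (1 - s) * (q * z) = 2 * (2 / (1 - s) * (q * z)) by field; rewrite gt_eqF.
  by rewrite ler_wpM2l.
rewrite -mulrDr; apply: (@le_trans _ _ (2 / (1 - s) * m)); last by rewrite ler_pM2l//; lra.
by rewrite ler_peMl// ler_pdivlMr// mul1r; lra.
Qed.

Lemma K_bound (u v : R) : 0 < u -> 0 < v -> K v - K u <= (1 + C') * y `^ (- s).
Proof.
move=> u0 v0; have C0 : 0 <= C' by rewrite /C' divr_ge0 ?mulr_ge0// ltW.
have vy : 0 < v + y by rewrite addr_gt0.
have uy : 0 < u + y by rewrite addr_gt0.
have h1 : v `^ (1 - s) * (v + y)^-1 <= y `^ (- s).
  apply: (@le_trans _ _ ((v + y) `^ (1 - s) * (v + y)^-1)).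
    rewrite ler_wpM2r ?invr_ge0 ?(ltW vy)// ge0_ler_powR ?nnegrE ?(ltW s1) ?(ltW v0) ?(ltW vy)//.
    by rewrite lerDl ltW.
  rewrite -powRSB// (_ : 1 - s - 1 = - s); last by ring.
  by apply: powR_anti; rewrite ?(ltW s0)// y0 lerDr ltW.
have h2 : (u + y) `^ (- s) <= y `^ (- s) by apply: powR_anti; rewrite ?(ltW s0)// y0 lerDr ltW.
have h3 : C' * (u + y) `^ (- s) <= C' * y `^ (- s) by rewrite ler_wpM2l.
have h4 : 0 <= u `^ (1 - s) * (u + y)^-1 by rewrite mulr_ge0 ?powR_ge0// invr_ge0 ltW.
have h5 : 0 <= C' * (v + y) `^ (- s) by rewrite mulr_ge0 ?powR_ge0.
by rewrite /K mulrDl mul1r; lra.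
Qed.

Lemma cont_powR r t : 0 < t -> {for t, continuous (fun t : R => t `^ r)}.
Proof. by move=> t0; exact: der_cont (is_derive1_powR r t0). Qed.

Lemma cont_K' t : 0 < t -> {for t, continuous K'}.
Proof.
move=> t0; have ty : 0 < t + y by rewrite addr_gt0.
have ca : {for t, continuous (fun t : R => t + y)} by apply: cvgD; [exact: cvg_id|exact: cvg_cst].
have ci : {for t, continuous (fun t : R => (t + y)^-1)} by apply: cvgV => //; rewrite gt_eqF.
have cp : {for t, continuous (fun t : R => (t + y) `^ (- s))}.
  by apply: (@continuous_comp _ _ _ (fun t : R => t + y) (fun t : R => t `^ (- s))) => //; exact: cont_powR.
rewrite /prop_for /continuous_at /K'.
apply: cvgD; first apply: cvgB.
- apply: cvgM ci; apply: cvgM; [exact: cvg_cst|exact: cont_powR].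
- by apply: cvgM; [exact: cont_powR|exact: (cvgM ci ci)].
- by apply: cvgM; [exact: cvg_cst|exact: (cvgM cp ci)].
Qed.

Lemma int_K' (u v : R) : 0 < u < v ->
  (\int[leb]_(t in `[u, v]) (K' t)%:E = (K v - K u)%:E)%E.
Proof.
move=> /andP[u0 uv]; have v0 := lt_trans u0 uv.
rewrite (@continuous_FTC2 R K' K u v)//.
- by apply: cont_within => t /andP[ut _]; apply: cont_K'; exact: lt_le_trans ut.
- have dc t : u <= t -> derivable K t 1 by move=> ut; have [] := der_K (lt_le_trans u0 ut).
  split.
  + by move=> t; rewrite in_itv /= => /andP[ut _]; apply: dc; exact: ltW.
  + by apply: cvg_at_right_filter; exact: der_cont (der_K u0).
  + by apply: cvg_at_left_filter; exact: der_cont (der_K v0).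
- move=> t; rewrite in_itv /= => /andP[ut _].
  by rewrite derive1E; have [_ ->] := der_K (lt_trans u0 ut).
Qed.

Definition Cker : R := 2 / (1 - s) * (1 + C').

(** An explicit primitive dominates the kernel; monotone convergence over growing compact
    intervals then bounds the integral. *)
Lemma int_ker_le : (\int[leb]_(t in pos) (ker s y t)%:E <= (Cker * y `^ (- s))%:E)%E.
Proof.
pose F (n : nat) : set R := `[n.+2%:R^-1, n.+2%:R]%classic.
have Fpos n t : F n t -> 0 < t.
  by rewrite /F /= in_itv /= => /andP[h _]; apply: lt_le_trans h; rewrite invr_gt0 ltr0n.
have UF : \bigcup_n F n = pos.
  apply/seteqP; split=> [t [n _ /Fpos t0]|t]; first by rewrite /= in_itv /= t0.
  rewrite /= in_itv /= andbT => t0.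
  pose n := Num.truncn (t + t^-1); have := truncn_itv (_ : 0 <= t + t^-1).
  rewrite addr_ge0 ?invr_ge0 ?(ltW t0)// -/n => /(_ isT) /andP[_ hn].
  have ti : 0 < t^-1 by rewrite invr_gt0.
  have n2 : n.+1%:R <= n.+2%:R :> R by rewrite ler_nat.
  exists n => //; rewrite /F /= in_itv /=; apply/andP; split; last by lra.
  rewrite -[t]invrK lef_pV2 ?posrE//; lra.
have Fhomo : {homo F : n m / (n <= m)%N >-> (n <= m)%O}.
  move=> n m nm; apply/subsetPset => t; rewrite /F /= !in_itv /= => /andP[h1 h2].
  have h3 : n.+2%:R <= m.+2%:R :> R by rewrite ler_nat !ltnS.
  apply/andP; split; last exact: le_trans h2 h3.
  by apply: le_trans h1; rewrite lef_pV2 ?posrE ?ltr0n.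
have mk n : measurable_fun (F n) (fun t => (ker s y t)%:E).
  by apply/measurable_EFinP; apply: measurable_funTS; exact: meas_ker.
have k0 n t : F n t -> (0 <= (ker s y t)%:E)%E.
  by move=> /Fpos t0; rewrite lee_fin ker_ge0// ltW.
have mF n : measurable (F n) by exact: measurable_itv.
have := ge0_nondecreasing_set_cvg_integral (mu := leb) Fhomo mF mk k0.
rewrite UF => lim.
apply: (cvge_to_le lim); apply: nearW => n.
have uv : 0 < (n.+2%:R^-1 : R) < n.+2%:R.
  rewrite invr_gt0 ltr0n /= invf_plt ?posrE ?ltr0n//.
  apply: (@lt_trans _ _ 1); last by rewrite ltr1n.
  by rewrite invf_lt1 ?ltr0n// ltr1n.
have D0 : 0 <= 2 / (1 - s) by rewrite divr_ge0// ltW.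
apply: (@le_trans _ _ (\int[leb]_(t in F n) ((2 / (1 - s))%:E * (K' t)%:E))%E).
  apply: ge0_le_integral.
  - exact: mF.
  - by move=> t Ft; exact: k0 Ft.
  - exact: mk.
  - apply/measurable_EFinP; apply: measurable_funM; first exact: measurable_cst.
    apply: subspace_continuous_measurable_fun => //.
    by apply: cont_within => t Ft; apply: cont_K'; apply: (Fpos n); rewrite /F /= in_itv.
  - by move=> t Ft; rewrite -EFinM lee_fin; exact: ker_le_K' (Fpos _ _ Ft).
have h0 t : F n t -> (0 <= (K' t)%:E)%E.
  move=> Ft; have t0 := Fpos _ _ Ft; rewrite lee_fin.
  have := le_trans (ker_ge0 s (ltW y0) (ltW t0)) (ker_le_K' t0).
  by rewrite pmulr_rge0// divr_gt0.
have mK : measurable_fun (F n) (fun t => (K' t)%:E).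
  apply/measurable_EFinP; apply: subspace_continuous_measurable_fun => //.
  by apply: cont_within => t Ft; apply: cont_K'; apply: (Fpos n); rewrite /F /= in_itv.
have -> : (\int[leb]_(t in F n) ((2 / (1 - s))%:E * (K' t)%:E) =
    (2 / (1 - s))%:E * \int[leb]_(t in F n) (K' t)%:E)%E.
  by apply: ge0_integralZl => //; exact: mF.
have n0 : (0 : R) < n.+2%:R by rewrite ltr0n.
have i0 : (0 : R) < n.+2%:R^-1 by rewrite invr_gt0.
rewrite /F int_K'// -EFinM lee_fin /Cker.
by apply: le_trans (ler_wpM2l D0 (K_bound i0 n0)) _; rewrite mulrA.
Qed.

Lemma ker_int : leb.-integrable pos (EFin \o ker s y).
Proof.
apply/integrableP; split.
  by apply/measurable_EFinP; apply: measurable_funTS; exact: meas_ker.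
apply: le_lt_trans (ltry (Cker * y `^ (- s))); apply: le_trans int_ker_le.
rewrite le_eqVlt; apply/orP; left; apply/eqP; apply: eq_integral => t; rewrite inE /= in_itv /= andbT => t0.
by rewrite ger0_norm// ker_ge0// ltW.
Qed.

Definition bker : R := \int[leb]_(t in pos) ker s y t.

Lemma bkerE : (\int[leb]_(t in pos) (ker s y t)%:E)%E = bker%:E.
Proof. by rewrite /bker /Rintegral fineK//; exact: integrable_fin_num ker_int. Qed.

Lemma bker_bounds : y `^ (- s) / 6 <= bker <= Cker * y `^ (- s).
Proof.
apply/andP; split; last by rewrite -lee_fin -bkerE; exact: int_ker_le.
rewrite -lee_fin -bkerE.
have sub : `[y, 2 * y]%classic `<=` pos.
  by move=> t; rewrite /= !in_itv /= => /andP[h _]; rewrite (lt_le_trans y0 h).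
pose B : set R := `[y, 2 * y]%classic; pose c : R := (2 * y) `^ (- s) / (3 * y).
have mB : measurable B by exact: measurable_itv.
apply: (@le_trans _ _ (\int[leb]_(t in B) c%:E)%E).
  rewrite integral_cst//= lebesgue_measure_itv /= lte_fin ltr_pMl// ltr1n.
  rewrite -EFinB -EFinM lee_fin (_ : 2 * y - y = y); last by ring.
  have -> : c * y = (2 * y) `^ (- s) / 3 by rewrite /c; field; rewrite gt_eqF.
  rewrite powRM ?(ltW y0)//.
  have h : 2^-1 <= 2 `^ (- s) :> R.
    rewrite -powR_inv1//; apply: ler_powR; first by rewrite ler1n.
    by move: s01 => /andP[]; lra.
  have := ler_wpM2r (powR_ge0 y (- s)) h; lra.
apply: (@le_trans _ _ (\int[leb]_(t in B) (ker s y t)%:E)%E).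
  apply: ge0_le_integral => //.
  - by move=> t _; rewrite lee_fin divr_ge0 ?powR_ge0// mulr_ge0// ltW.
  - by apply/measurable_EFinP; apply: measurable_funTS; exact: meas_ker.
  - move=> t; rewrite /B /= in_itv /= => /andP[yt ty]; have t0 := lt_le_trans y0 yt.
    rewrite lee_fin /ker; apply: ler_pM; rewrite ?powR_ge0 ?invr_ge0 ?mulr_ge0 ?(ltW y0)//.
      by apply: powR_anti; rewrite ?(ltW s0)// t0.
    by rewrite lef_pV2 ?posrE ?mulr_gt0 ?addr_gt0//; lra.
apply: ge0_subset_integral => //.
- by apply/measurable_EFinP; apply: measurable_funTS; exact: meas_ker.
- by move=> t; rewrite /= in_itv /= andbT => t0; rewrite lee_fin ker_ge0// ltW.
Qed.

End Fixed.

Lemma kersum_int s (c y : nat -> R) n : 0 < s < 1 -> (forall k, 0 < y k) ->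
  leb.-integrable pos (EFin \o (fun t => \sum_(k < n) c k * ker s (y k) t)) /\
  \int[leb]_(t in pos) \sum_(k < n) c k * ker s (y k) t = \sum_(k < n) c k * bker s (y k).
Proof.
move=> s01 y0; have mpos : measurable (pos : set (measurableTypeR R)) by exact: measurable_itv.
pose f2 k t := c k * ker s (y k) t.
have i1 k : leb.-integrable pos (EFin \o f2 k).
  by have := integrableZl mpos (c k) (ker_int s01 (y0 k)).
elim: n => [|n [i2 IH]].
  rewrite big_ord0 (_ : (fun _ => _) = cst 0).
    by split; [exact: integrable0|rewrite /Rintegral integral0].
  by apply/funext => t; rewrite big_ord0.
rewrite big_ord_recr /= -IH (_ : (fun t => _) = fun t => \sum_(k < n) f2 k t + f2 n t); last first.
  by apply/funext => t; rewrite big_ord_recr.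
split; first by have := integrableD mpos i2 (i1 n).
by rewrite RintegralD//; congr (_ + _); apply: RintegralZl => //; exact: ker_int.
Qed.

End Kernel.

(** ** Fractional powers in coordinates *)
Section Fractional.
Variable R : realType.
Local Notation leb := (@lebesgue_measure R).
Local Notation pos := (`]0, +oo[%classic : set R).
Local Notation T := (measurableTypeR R * measurableTypeR R)%type.
Local Notation sq := (sqi (lebO R)).
Variables (phi : R -> R -> R) (a eps : R).
Hypotheses (a_gt0 : 0 < a) (good : eps = 0 \/ mild phi eps).
Local Notation b := (bJ phi eps).
Local Notation A := (formA phi a eps).
Variables (e : nat -> T -> R) (nu : nat -> R).
Hypothesis E : eigenbasis sq (@H1 R) b A e nu.
Implicit Types (u v w psi : T -> R) (s lam : R).

Let F : form_pair sq (@H1 R) b A a := formA_pair good a_gt0.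
Let S := fp_b F.
Let nu_a k : a <= nu k := nu_ge F E k.
Let nu_pos k : 0 < nu k := nu_gt0 F E k.
Let De k : sq (e k) := H1_sqi (eig_in E k).
Let oe := eig_orth E.

Lemma cvg_eqf (f g : nat -> R) (l : R) : (forall n, f n = g n) ->
  f n @[n --> \oo] --> l -> g n @[n --> \oo] --> l.
Proof. by move=> /funext ->. Qed.

Lemma pairE u v : sq u -> sq v -> pairing phi eps u v = b u v.
Proof. exact: pairingE. Qed.

Definition coef u : nat -> R := fun k => b u (e k).

Lemma resolventP lam w : 0 <= lam -> sq w -> H1 (resolvent phi a eps lam w) /\
  forall k, coef (resolvent phi a eps lam w) k = coef w k / (lam + nu k).
Proof.
move=> l0 sw; have [v hv vE] := resolvent_ex F E l0 sw.
have [h1 h2] : is_resolvent phi a eps lam w (resolvent phi a eps lam w).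
  apply: (@xgetPex _ (cst 0) [set v | is_resolvent phi a eps lam w v]).
  exists v; split=> // psi hp.
  rewrite (AopE a good hv hp) (pairE (H1_sqi hv) (H1_sqi hp)).
  by rewrite (pairE sw (H1_sqi hp)); exact: vE.
split=> // k; apply: (resolvent_coef F E l0 sw h1) => psi hp.
have := h2 _ hp; rewrite (AopE a good h1 hp) (pairE (H1_sqi h1) (H1_sqi hp)).
by rewrite (pairE sw (H1_sqi hp)).
Qed.

Lemma b_series u psi : sq u -> sq psi ->
  \sum_(k < n) coef u k * coef psi k @[n --> \oo] --> b u psi.
Proof.
move=> su sp; have c := parseval S De oe (fp_bC F) (eig_total E) sp.
have := sconv_ip S (fun n => D_comb S De (coef psi) n) sp su c.
rewrite (sip_sym S sp su); apply: cvg_eqf => n.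
have Dk (k : 'I_n) : sq (coef psi k *: e k) by exact: (sipZ S).
rewrite /comb (b_suml S _ Dk su); apply: eq_bigr => k _.
by rewrite (bZl S _ (De k) su) (sip_sym S (De k) su) mulrC.
Qed.

Section OnePower.
Variable s : R.
Hypothesis s01 : 0 < s < 1.

Definition gam : R := sin (pi * s) / pi.

Lemma gam_gt0 : 0 < gam.
Proof.
have /andP[s0 s1] := s01; have p0 := pi_gt0 R; rewrite divr_gt0//; apply: sin_gt0_pi.
by rewrite mulr_gt0//= gtr_pMr.
Qed.

(** The integral representation, tested against one eigenfunction. *)
Lemma negpow_coef w v : is_negpow phi a eps s w v ->
  forall k, coef v k = gam * (bker s (nu k) * coef w k).
Proof.
move=> [/Lfun2P sw /Lfun2P sv h] k.
have := h (e k) ((Lfun2P _ _).2 (De k)); rewrite (pairE sv (De k)) -/(coef v k) => ->.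
congr (_ * _); rewrite mulrC /bker -RintegralZl//; last exact: ker_int.
apply: eq_Rintegral => lam; rewrite inE /= in_itv /= andbT => l0.
have [hr cr] := resolventP (ltW l0) sw.
by rewrite (pairE (H1_sqi hr) (De k)) -[bJ _ _ _ _]/(coef _ _) cr /ker; ring.
Qed.

Lemma resolvent_bound lam w psi : 0 < lam -> sq w -> sq psi ->
  `|b (resolvent phi a eps lam w) psi| <= Num.sqrt (b w w) * Num.sqrt (b psi psi) / (lam + a).
Proof.
move=> l0 sw sp; have [hr cr] := resolventP (ltW l0) sw; have sr := H1_sqi hr.
have la : 0 < lam + a by rewrite addr_gt0.
have w0 := sip_ge0 S sw; have p0 := sip_ge0 S sp.
have rb : b (resolvent phi a eps lam w) (resolvent phi a eps lam w) <= b w w / (lam + a) ^+ 2.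
  apply: (parseval_norm S De oe (fp_bC F) (eig_total E) sr) => K.
  rewrite ler_pdivlMr ?exprn_gt0// mulr_suml; apply: le_trans (bessel S De oe K sw).
  apply: ler_sum => k _; rewrite -exprMn -[b _ (e k)]/(coef _ k) cr.
  rewrite -ler_sqrt ?sqr_ge0// !sqrtr_sqr -mulrA normrM ler_piMr//.
  have ln : 0 < lam + nu k by rewrite addr_gt0.
  rewrite ger0_norm ?mulr_ge0 ?invr_ge0 ?(ltW ln) ?(ltW la)// mulrC ler_pdivrMr// mul1r.
  by rewrite lerD2l nu_a.
rewrite -sqrtr_sqr -sqrtrM// -[lam + a]gtr0_norm// -sqrtr_sqr -sqrtrV ?sqr_ge0//.
rewrite -sqrtrM ?mulr_ge0// ler_sqrt; last by rewrite !mulr_ge0// invr_ge0 sqr_ge0.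
apply: le_trans (CS S sr sp) _; rewrite mulrAC ler_wpM2r//.
Qed.

Lemma negpow_ex w v : sq w -> sq v -> (forall k, coef v k = gam * (bker s (nu k) * coef w k)) ->
  is_negpow phi a eps s w v.
Proof.
move=> sw sv hv; split; [exact/Lfun2P|exact/Lfun2P|move=> psi /Lfun2P sp].
rewrite (pairE sv sp).
pose g lam := b (resolvent phi a eps lam w) psi.
pose f n lam := lam `^ (- s) * \sum_(k < n) coef w k / (lam + nu k) * coef psi k.
have gE lam : 0 < lam -> \sum_(k < n) coef w k / (lam + nu k) * coef psi k @[n --> \oo] --> g lam.
  move=> l0; have [hr cr] := resolventP (ltW l0) sw.
  have := b_series (H1_sqi hr) sp; apply: cvg_eqf => n.
  by apply: eq_bigr => k _; rewrite cr.
have fn lam n : 0 < lam -> f n lam = \sum_(k < n) coef w k * coef psi k * ker s (nu k) lam.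
  by move=> l0; rewrite /f mulr_sumr; apply: eq_bigr => k _; rewrite /ker; ring.
pose M := Num.sqrt (b w w) * Num.sqrt (b psi psi).
have M0 : 0 <= M by rewrite mulr_ge0// sqrtr_ge0.
have fb n lam : 0 < lam -> `|f n lam| <= M * ker s a lam.
  move=> l0; have [hr cr] := resolventP (ltW l0) sw.
  have sc : sq (comb e (coef psi) n) by exact: (D_comb S De).
  have -> : f n lam = lam `^ (- s) * b (resolvent phi a eps lam w) (comb e (coef psi) n).
    congr (_ * _); have Dk (k : 'I_n) : sq (coef psi k *: e k) by exact: (sipZ S).
    rewrite /comb (b_sumr S _ Dk (H1_sqi hr)); apply: eq_bigr => k _.
    by rewrite (bZr S _ (De k) (H1_sqi hr)) -[b _ (e k)]/(coef _ k) cr mulrC.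
  rewrite normrM ger0_norm ?powR_ge0// /ker mulrCA ler_wpM2l ?powR_ge0//.
  apply: le_trans (resolvent_bound l0 sw sc) _; rewrite /M.
  rewrite ler_wpM2r ?invr_ge0 ?addr_ge0 ?(ltW l0) ?(ltW a_gt0)// ler_wpM2l ?sqrtr_ge0//.
  rewrite ler_sqrt ?(sip_ge0 S sp)// (comb_norm S De oe); exact: (bessel S De oe n sp).
have mpos : measurable (pos : set (measurableTypeR R)) by exact: measurable_itv.
have kint y : 0 < y -> leb.-integrable pos (EFin \o ker s y) by move=> y0; exact: ker_int.
have mk y : measurable_fun pos (ker s y) by apply: measurable_funTS; exact: meas_ker.
have mf n : measurable_fun pos (fun lam => lam `^ (- s) * \sum_(k < n) coef w k / (lam + nu k) * coef psi k).
  apply: (eq_measurable_fun (fun lam => \sum_(k < n) coef w k * coef psi k * ker s (nu k) lam)).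
    by move=> lam; rewrite inE /= in_itv /= andbT => l0; rewrite -fn.
  by apply: measurable_sum => k; apply: measurable_funM => //; exact: measurable_cst.
have lim lam : pos lam -> f n lam @[n --> \oo] --> lam `^ (- s) * g lam.
  by rewrite /= in_itv /= andbT => l0; apply: cvgM; [exact: cvg_cst|exact: gE].
have mg : measurable_fun pos (fun lam => lam `^ (- s) * g lam) by exact: measurable_fun_cvg mf lim.
have intf n : \int[leb]_(lam in pos) f n lam = \sum_(k < n) coef w k * coef psi k * bker s (nu k).
  rewrite (_ : \int[leb]_(lam in pos) f n lam =
    \int[leb]_(lam in pos) \sum_(k < n) coef w k * coef psi k * ker s (nu k) lam); last first.
    by apply: eq_Rintegral => lam; rewrite inE /= in_itv /= andbT => l0; exact: fn.
  by have [_ ->] := @kersum_int R s (fun k => coef w k * coef psi k) nu n s01 nu_pos.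
have [] := @dominated_convergence _ _ _ leb pos mpos
  (fun n lam => (f n lam)%:E) (fun lam => (lam `^ (- s) * g lam)%:E) (fun lam => (M * ker s a lam)%:E).
- by move=> n; apply/measurable_EFinP; exact: mf.
- exact/measurable_EFinP.
- by apply: aeW => lam pl; apply: cvg_EFin; [near=> n|exact: lim].
- by have := integrableZl mpos M (kint _ a_gt0).
- by apply: aeW => lam n; rewrite /= in_itv /= andbT => l0; rewrite lee_fin; exact: fb.
move=> ig _ lime.
have limr : \int[leb]_(lam in pos) f n lam @[n --> \oo] --> \int[leb]_(lam in pos) (lam `^ (- s) * g lam).
  by apply: fine_cvg; rewrite fineK; [exact: lime|exact: integrable_fin_num].
have lim2 : gam * \int[leb]_(lam in pos) f n lam @[n --> \oo] --> gam * \int[leb]_(lam in pos) (lam `^ (- s) * g lam).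
  by apply: cvgM limr; exact: cvg_cst.
have := b_series sv sp.
rewrite (_ : (fun n => _) = fun n => gam * \int[leb]_(lam in pos) f n lam); last first.
  apply/funext => n; rewrite intf mulr_sumr; apply: eq_bigr => k _; rewrite hv; ring.
move=> lim3.
have bE : b v psi = gam * \int[leb]_(lam in pos) (lam `^ (- s) * g lam).
  by apply: cvg_unique lim3 lim2; exact: norm_hausdorff.
apply: (etrans bE); congr (_ * _).
apply: eq_Rintegral => lam; rewrite inE /= in_itv /= andbT => l0.
have [hr _] := resolventP (ltW l0) sw.
by rewrite (pairE (H1_sqi hr) sp).
Unshelve. all: end_near. Qed.

Let C := Cker s.
Lemma Cker_gt0 : 0 < C.
Proof.
have /andP[s0 s1] := s01; have s1' : 0 < 1 - s by rewrite subr_gt0.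
by rewrite /C /Cker mulr_gt0 ?divr_gt0// ltr_wpDr// divr_ge0 ?mulr_ge0// ltW.
Qed.

Lemma nuS k : 0 < nu k `^ s. Proof. exact: powR_gt0. Qed.

Lemma nuSN k : nu k `^ s * nu k `^ (- s) = 1.
Proof. by rewrite powRN divff// gt_eqF// nuS. Qed.

Lemma ip_b u : sq u -> b u u <= 2 * ip2 (lebO R) u u /\ ip2 (lebO R) u u <= 2 * b u u.
Proof. by move=> su; have /andP[h1 h2] := bJ_equiv good su; split; lra. Qed.

Lemma negpow_wle w u N : is_negpow phi a eps s w u -> 0 <= N -> b w w <= N ^+ 2 ->
  wle nu s (coef u) (gam * C * N).
Proof.
move=> h N0 hN; have hu := negpow_coef h; case: h => /Lfun2P sw _ _.
have g0 := gam_gt0; have C0 := Cker_gt0.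
have bw : bl2 (coef w) N by move=> K; apply: le_trans (bessel S De oe K sw) hN.
apply: (bl2_le _ _ bw); first by rewrite mulr_ge0// ltW.
move=> k; have /andP[_ hb] := bker_bounds s01 (nu_pos k).
have /andP[hb0 _] := bker_bounds s01 (nu_pos k).
have b0 : 0 <= bker s (nu k) by apply: le_trans hb0; rewrite divr_ge0// powR_ge0.
rewrite hu; move: gam g0 => gm g0.
rewrite !normrM (ger0_norm (powR_ge0 _ _)) (gtr0_norm g0) (ger0_norm b0).
rewrite (_ : nu k `^ s * _ = gm * (nu k `^ s * bker s (nu k)) * `|coef w k|); last by ring.
rewrite ler_wpM2r// ler_pM2l//.
apply: le_trans (ler_wpM2l (powR_ge0 _ _) hb) _.
by rewrite mulrCA nuSN mulr1.
Qed.

Lemma wle_negpow u N : sq u -> 0 <= N -> wle nu s (coef u) N ->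
  exists2 w, is_negpow phi a eps s w u & b w w <= (6 / gam * N) ^+ 2.
Proof.
move=> su N0 hN; have g0 := gam_gt0.
have bp k : 0 < bker s (nu k).
  have /andP[h _] := bker_bounds s01 (nu_pos k).
  by apply: lt_le_trans h; rewrite divr_gt0// powR_gt0.
pose c k := coef u k / (gam * bker s (nu k)).
have cb : bl2 c (6 / gam * N).
  apply: (bl2_le _ _ hN); first by rewrite divr_ge0// ltW.
  move=> k; rewrite /c !normrM normfV (ger0_norm (powR_ge0 _ _)) (gtr0_norm (mulr_gt0 g0 (bp k))).
  have gb : 0 < gam * bker s (nu k) by exact: mulr_gt0.
  rewrite ler_pdivrMr//.
  have /andP[h _] := bker_bounds s01 (nu_pos k).
  have -> : 6 / gam * (nu k `^ s * `|coef u k|) * (gam * bker s (nu k)) =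
      (nu k `^ s * (6 * bker s (nu k))) * `|coef u k| by field; rewrite gt_eqF.
  rewrite ler_peMl// -[X in X <= _](nuSN k) ler_pM2l ?nuS//; lra.
have [w [sw wc _]] := riesz_fischer S De oe (fp_bC F) cb.
exists w.
  apply: negpow_ex => // k; rewrite -[coef w k]/(b w (e k)) wc /c; field.
  by rewrite !gt_eqF.
by apply: (parseval_norm S De oe (fp_bC F) (eig_total E) sw) => K; under eq_bigr do rewrite wc; exact: cb.
Qed.

(** The coefficients of a negative power are those of [w] times integrals of the kernel,
    which lie between two multiples of [nu_k^(-s)]; this suffices to identify its range. *)
Lemma XspaceP u : Xspace phi a eps s u <-> sq u /\ exists2 N, 0 <= N & wle nu s (coef u) N.
Proof.
split=> [[w h]|[su [N N0 hN]]]; last first.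
  by have [w h _] := wle_negpow su N0 hN; exists w.
have [/Lfun2P sw /Lfun2P su _] := h; split=> //.
have w0 := sip_ge0 S sw.
exists (gam * C * Num.sqrt (b w w)).
  by apply: mulr_ge0; [exact: (mulr_ge0 (ltW gam_gt0) (ltW Cker_gt0))|exact: sqrtr_ge0].
by apply: negpow_wle h _ _; rewrite ?sqrtr_ge0// sqr_sqrtr.
Qed.

Lemma XnormE u : Xspace phi a eps s u -> exists2 w, is_negpow phi a eps s w u &
  Xnorm phi a eps s u = Num.sqrt (ip2 (lebO R) w w).
Proof.
move=> hu; have h := @xgetPex _ (cst 0) [set w | is_negpow phi a eps s w u] hu.
exists (Apow phi a eps s u) => //.
by case: h => /Lfun2P sw _ _; rewrite /Xnorm /L2norm L2normE.
Qed.

Definition cX : R := gam * C * 2.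
Lemma cX_ge0 : 0 <= cX.
Proof. by apply: mulr_ge0 => //; exact: (mulr_ge0 (ltW gam_gt0) (ltW Cker_gt0)). Qed.

Lemma Xnorm_ge0 u : 0 <= Xnorm phi a eps s u.
Proof. by rewrite /Xnorm /L2norm fine_ge0// Lnorm_ge0. Qed.

Lemma Xnorm_wle u : Xspace phi a eps s u -> wle nu s (coef u) (cX * Xnorm phi a eps s u).
Proof.
move=> /XnormE [w h ->]; have [/Lfun2P sw _ _] := h; have w0 := sip_ge0 (ip2_semiip (lebO R)) sw.
rewrite /cX -mulrA; apply: negpow_wle h _ _; first by rewrite mulr_ge0// sqrtr_ge0.
by rewrite exprMn sqr_sqrtr//; have [h _] := ip_b sw; apply: le_trans h _; rewrite ler_wpM2r//; lra.
Qed.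

Definition CX : R := 12 / gam.
Lemma CX_ge0 : 0 <= CX.
Proof. by rewrite /CX divr_ge0// ltW ?gam_gt0. Qed.

Lemma wle_Xnorm u N : sq u -> 0 <= N -> wle nu s (coef u) N -> Xnorm phi a eps s u <= CX * N.
Proof.
move=> su N0 hN.
have hX : Xspace phi a eps s u by apply/XspaceP; split=> //; exists N.
have [w h ->] := XnormE hX; have hw := negpow_coef h; have [/Lfun2P sw _ _] := h.
have [w' h' bw'] := wle_negpow su N0 hN; have hw' := negpow_coef h'; have [/Lfun2P sw' _ _] := h'.
have g0 := gam_gt0.
have cE k : coef w k = coef w' k.
  have /andP[hb _] := bker_bounds s01 (nu_pos k).
  have bp : bker s (nu k) != 0 by rewrite gt_eqF// (lt_le_trans _ hb)// divr_gt0// powR_gt0.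
  have := hw k; rewrite hw' => /(mulfI (negbT (gt_eqF g0))) /(mulfI bp).
  by [].
have bw : b w w <= (6 / gam * N) ^+ 2.
  apply: (parseval_norm S De oe (fp_bC F) (eig_total E) sw) => K.
  under eq_bigr do rewrite -[b w (e _)]/(coef w _) cE.
  exact: le_trans (bessel S De oe K sw') bw'.
have q0 : 0 <= CX * N by rewrite mulr_ge0// CX_ge0.
rewrite -[leRHS]ger0_norm// -sqrtr_sqr ler_sqrt ?sqr_ge0//.
have [_ h2] := ip_b sw; apply: le_trans h2 _.
have -> : CX * N = 2 * (6 / gam * N) by rewrite /CX; ring.
rewrite exprMn; have := sqr_ge0 (6 / gam * N); lra.
Qed.

End OnePower.
End Fractional.

(** * Interpolation between equivalent forms *)
Section Heinz.
Variables (R : realType) (V : lmodType R).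
Variables (D Q : V -> Prop) (b0 b1 A0 A1 : V -> V -> R) (c0 c1 : R).
Variables (e f : nat -> V) (nu mu : nat -> R).
Hypotheses (F0 : form_pair D Q b0 A0 c0) (F1 : form_pair D Q b1 A1 c1).
Hypotheses (E0 : eigenbasis D Q b0 A0 e nu) (E1 : eigenbasis D Q b1 A1 f mu).
Variable M : R.
Hypotheses (M_ge0 : 0 <= M) (bM : forall u, D u -> b1 u u <= M * b0 u u)
  (AM : forall u, Q u -> A1 u u <= M * A0 u u).
Implicit Types (c : nat -> R) (lam : R).
Local Notation leb := (@lebesgue_measure R).
Local Notation pos := (`]0, +oo[%classic : set R).

Let S0 := fp_b F0.
Let S1 := fp_b F1.
Let QD := fp_sub F0.
Let eD k : D (e k) := QD (eig_in E0 k).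
Let fD k : D (f k) := QD (eig_in E1 k).
Let nu_pos k : 0 < nu k := nu_gt0 F0 E0 k.
Let mu_pos k : 0 < mu k := nu_gt0 F1 E1 k.

(** Comparison of the K-functionals of the two forms at [lam]: the minimiser for
    the first one is a competitor for the second one. *)
Lemma K_compare c L K lam : 0 < lam ->
  \sum_(k < K) mu k / (lam + mu k) * b1 (comb e c L) (f k) ^+ 2 <=
  M * \sum_(k < L) nu k / (lam + nu k) * c k ^+ 2.
Proof.
move=> l0; pose d k := c k * (lam / (lam + nu k)).
set u := comb e c L; pose v := comb e d L.
have Dc g : D (comb e g L) by exact: (D_comb S0 eD).
have Qv : Q v by exact: (Q_comb F0 E0).
have uvE : u - v = comb e (fun k => c k * (nu k / (lam + nu k))) L.
  rewrite /u /v /comb -sumrB; apply: eq_bigr => k _; rewrite -scalerBl; congr (_ *: _).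
  have := nu_pos k => n0; rewrite /d; field; by rewrite gt_eqF// addr_gt0.
have h1 : \sum_(k < K) b1 (u - v) (f k) ^+ 2 <= M * b0 (u - v) (u - v).
  have Duv : D (u - v) by exact: (sipB S0 (Dc c) (Dc d)).
  apply: le_trans (bM Duv); exact: (bessel S1 fD (eig_orth E1) K Duv).
have h2 : \sum_(k < K) mu k * b1 v (f k) ^+ 2 <= M * A0 v v.
  by apply: le_trans (AM Qv); exact: (A_bessel F1 E1).
have h2' : \sum_(k < K) mu k / lam * b1 v (f k) ^+ 2 <= M * (A0 v v / lam).
  rewrite mulrA ler_pdivlMr// mulr_suml; apply: le_trans h2; apply: ler_sum => k _.
  by rewrite mulrAC divfK// gt_eqF.
apply: le_trans (_ : M * (b0 (u - v) (u - v) + A0 v v / lam) <= _).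
  rewrite mulrDr; apply: le_trans (lerD h1 h2'); rewrite -big_split /=; apply: ler_sum => k _.
  rewrite (bBl S1 (Dc c) (Dc d) (fD k)) -/u -/v.
  move: (b1 u _) (b1 v _) (mu_pos k) => x y; move: (mu k) => m m0.
  have lm : 0 < lam + m by rewrite addr_gt0.
  rewrite -subr_ge0.
  have -> : (x - y) ^+ 2 + m / lam * y ^+ 2 - m / (lam + m) * x ^+ 2 =
    (lam + m) / lam * (y - lam / (lam + m) * x) ^+ 2 by field; rewrite !gt_eqF.
  by rewrite mulr_ge0 ?sqr_ge0// divr_ge0// ltW.
rewrite ler_wpM2l// uvE (comb_norm S0 eD (eig_orth E0)) (A_comb_comb F0 E0) mulr_suml -big_split /=.
rewrite le_eqVlt; apply/orP; left; apply/eqP; apply: eq_bigr => k _; rewrite /d.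
have n0 := nu_pos k; field; by rewrite !gt_eqF// addr_gt0.
Qed.

Section Exponent.
Variable s : R.
Hypothesis s_half : 0 < s <= 2^-1.

Lemma powR_sq (x : R) : 0 < x -> (x `^ s) ^+ 2 = x `^ (2 * s).
Proof. by move=> x0; rewrite -powR_mulrn ?powR_ge0// -powRrM mulrC. Qed.

Definition Ch : R := 6 * Cker (1 - 2 * s) + 1.

Lemma heinz_comb c L N : 0 <= N -> \sum_(k < L) (nu k `^ s * c k) ^+ 2 <= N ^+ 2 ->
  bl2 (fun k => mu k `^ s * b1 (comb e c L) (f k)) (Num.sqrt (M * `|Ch|) * N).
Proof.
move=> N0 hN K; set u := comb e c L.
have /andP[s0 sh] := s_half.
rewrite exprMn sqr_sqrtr ?mulr_ge0//.
have C1 : 1 <= `|Ch| -> \sum_(k < K) (mu k `^ s * b1 u (f k)) ^+ 2 <= M * 1 * N ^+ 2 ->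
    \sum_(k < K) (mu k `^ s * b1 u (f k)) ^+ 2 <= M * `|Ch| * N ^+ 2.
  by move=> h; move/le_trans; apply; rewrite ler_wpM2r ?sqr_ge0// ler_wpM2l.
have [sE|sn] := eqVneq s 2^-1.
  have e1 x : 0 < x -> (x `^ s) ^+ 2 = x.
    by move=> x0; rewrite powR_sq// sE divff// powRr1// ltW.
  have Ch1 : 1 <= `|Ch|.
    rewrite /Ch sE divff// subrr /Cker mul0r invr0 mulr0 addr0 mulr1 subr0 divr1.
    by rewrite ger0_norm; lra.
  apply: C1 => //; rewrite mulr1.
  under eq_bigr do rewrite exprMn e1//.
  apply: le_trans (A_bessel F1 E1 K (Q_comb F0 E0 c L)) _.
  apply: le_trans (AM (Q_comb F0 E0 c L)) _; rewrite (A_comb_comb F0 E0) ler_wpM2l//.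
  apply: le_trans hN; apply: ler_sum => k _; by rewrite exprMn e1.
have s2 : s < 2^-1 by rewrite lt_neqAle sn.
have g01 : 0 < 1 - 2 * s < 1 by apply/andP; split; lra.
set g := 1 - 2 * s.
have ck0 : 0 < Cker g.
  have gs : 0 < 1 - g by rewrite /g; lra.
  have g0 : 0 < g by rewrite /g; lra.
  by rewrite /Cker mulr_gt0 ?divr_gt0// ltr_wpDr// divr_ge0 ?mulr_ge0// ltW.
have ChE : `|Ch| = 6 * Cker g + 1 by rewrite ger0_norm// /Ch -/g; lra.
pose cm k := mu k * b1 u (f k) ^+ 2; pose cn k := nu k * c k ^+ 2.
have [i1 v1] := @kersum_int R g cm mu K g01 mu_pos.
have [i2 v2] := @kersum_int R g cn nu L g01 nu_pos.
have mpos : measurable (pos : set (measurableTypeR R)) by exact: measurable_itv.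
have main : \sum_(k < K) cm k * bker g (mu k) <= M * \sum_(k < L) cn k * bker g (nu k).
  rewrite -v1 -v2 -RintegralZl//; apply: le_Rintegral => //.
    by have := integrableZl mpos M i2.
  move=> lam; rewrite /= in_itv /= andbT => l0.
  have := ler_wpM2l (powR_ge0 lam (- g)) (@K_compare c L K lam l0).
  rewrite mulrCA !mulr_sumr /cm /cn /ker => h.
  apply: le_trans (le_trans h _); rewrite le_eqVlt; apply/orP; left; apply/eqP.
    by apply: eq_bigr => k _; rewrite /u; ring.
  by apply: eq_bigr => k _; ring.
have pE (x : R) : 0 < x -> x * x `^ (- g) = x `^ (2 * s).
  move=> x0; rewrite -{1}(powRr1 (ltW x0)) -powRD ?(gt_eqF x0) ?implybT//; congr (_ `^ _).
  by rewrite /g; ring.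
apply: (@le_trans _ _ (6 * \sum_(k < K) cm k * bker g (mu k))).
  rewrite mulr_sumr; apply: ler_sum => k _; rewrite exprMn powR_sq// -pE//.
  have /andP[h _] := bker_bounds g01 (mu_pos k).
  have := ler_wpM2l (mulr_ge0 (ltW (mu_pos k)) (sqr_ge0 (b1 u (f k)))) h.
  rewrite /cm; lra.
apply: (le_trans (ler_wpM2l _ main)) => //.
have : \sum_(k < L) cn k * bker g (nu k) <= Cker g * N ^+ 2.
  apply: le_trans (ler_wpM2l (ltW ck0) hN); rewrite mulr_sumr; apply: ler_sum => k _.
  rewrite exprMn powR_sq// -pE//.
  have /andP[_ h] := bker_bounds g01 (nu_pos k).
  have := ler_wpM2l (mulr_ge0 (ltW (nu_pos k)) (sqr_ge0 (c k))) h.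
  by rewrite /cn; move/le_trans; apply; rewrite le_eqVlt; apply/orP; left; apply/eqP; ring.
move/(ler_wpM2l M_ge0) => h; rewrite ChE.
have : 0 <= M * N ^+ 2 by rewrite mulr_ge0// sqr_ge0.
by rewrite mulrCA; lra.
Qed.

(** Loewner-Heinz inequality: [y^(2 s)] is comparable to the integral of
    [lam^(2 s - 1) * y / (lam + y)], and [K_compare] holds for every [lam]. *)
Theorem heinz u N : D u -> 0 <= N -> wle nu s (fun k => b0 u (e k)) N ->
  wle mu s (fun k => b1 u (f k)) (Num.sqrt (M * `|Ch|) * N).
Proof.
move=> Du N0 hN; apply: (@bl2_lim _ (fun L k => mu k `^ s * b1 (comb e (fun k => b0 u (e k)) L) (f k))).
  move=> k; apply: cvgM; first exact: cvg_cst.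
  apply: (sconv_ip S1 (fun n => D_comb S0 eD _ n) Du (fD k)) => d d0.
  have M1 : 0 < M + 1 by rewrite ltr_wpDl.
  have [n0 hn] := parseval S0 eD (eig_orth E0) (fp_bC F0) (eig_total E0) Du (divr_gt0 d0 M1).
  exists n0 => n /hn h; have Dd : D (comb e (fun k => b0 u (e k)) n - u).
    by apply: (sipB S0) => //; exact: (D_comb S0 eD).
  apply: le_lt_trans (bM Dd) _; move: h; rewrite ltr_pdivlMr//; apply: le_lt_trans.
  by rewrite mulrC ler_wpM2l ?(sip_ge0 S0)// lerDl.
by move=> L; apply: heinz_comb => //; exact: hN.
Qed.

End Exponent.
End Heinz.

Section SpacesAgree.
Variable R : realType.
Local Notation T := (measurableTypeR R * measurableTypeR R)%type.
Local Notation sq := (sqi (lebO R)).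
Variables (phi : R -> R -> R) (a : R).
Hypothesis a_gt0 : 0 < a.

Lemma formA_compare eps eps' : (eps = 0 \/ mild phi eps) -> (eps' = 0 \/ mild phi eps') ->
  exists2 M, 0 <= M & (forall u, sq u -> bJ phi eps' u u <= M * bJ phi eps u u) /\
    (forall u, H1 u -> formA phi a eps' u u <= M * formA phi a eps u u).
Proof.
move=> g g'; have [l [m [l0 m0] h]] := formA_equiv g a_gt0.
have [l' [m' [l0' m0'] h']] := formA_equiv g' a_gt0.
exists (4 + m' / l); first by rewrite addr_ge0// divr_ge0// ltW.
split=> u hu.
  have /andP[h1 h2] := bJ_equiv g hu; have /andP[h3 h4] := bJ_equiv g' hu.
  have q0 : 0 <= m' / l by rewrite divr_ge0// ltW.
  have p0 : 0 <= bJ phi eps u u.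
    by apply: le_trans h1; rewrite mulr_ge0 ?invr_ge0// (sip_ge0 (ip2_semiip (lebO R)) hu).
  have := mulr_ge0 q0 p0; lra.
have /andP[h1 h2] := h _ hu; have /andP[h3 h4] := h' _ hu.
have p0 : 0 <= formA phi a eps u u by exact: sip_ge0 (fp_A (formA_pair g a_gt0)) _ hu.
apply: le_trans h4 _; rewrite mulrDl; apply: ler_wpDl; first by rewrite mulr_ge0.
rewrite mulrAC ler_pdivlMr// -mulrA; apply: ler_wpM2l; first exact: ltW.
by rewrite mulrC.
Qed.

(** The forms for different [eps] are comparable, so [heinz] applies both ways. *)
Lemma spaces_agree eps eps' s e nu e' nu' : (eps = 0 \/ mild phi eps) -> (eps' = 0 \/ mild phi eps') ->
  eigenbasis sq (@H1 R) (bJ phi eps) (formA phi a eps) e nu ->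
  eigenbasis sq (@H1 R) (bJ phi eps') (formA phi a eps') e' nu' -> 0 < s <= 2^-1 ->
  exists2 C, 0 <= C & forall u N, sq u -> 0 <= N -> wle nu s (coef phi eps e u) N ->
    wle nu' s (coef phi eps' e' u) (C * N).
Proof.
move=> g g' E E' sh; have [M M0 [hb hA]] := formA_compare g g'.
exists (Num.sqrt (M * `|Ch s|)); first exact: sqrtr_ge0.
move=> u N su N0 hN.
exact: (heinz (formA_pair g a_gt0) (formA_pair g' a_gt0) E E' M0 hb hA sh su N0 hN).
Qed.

Lemma formA0 : [/\ bJ phi 0 = wip (lebO R) (@one R) & formA phi a 0 = aform0 a].
Proof.
have e1 : Jt phi 0 = @one R by apply/funext => x; rewrite /Jt /Jx eqxx.
have e2 : kapt phi 0 = @zero R by apply/funext => x; rewrite /kapt /al eqxx mul0r.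
have e3 : rhot phi 0 = @one R by apply/funext => x; rewrite /rhot /Jx eqxx invr1.
by rewrite /bJ /formA /aform0 e1 e2 e3.
Qed.

Lemma basis0 : eigenbasis sq (@H1 R) (bJ phi 0) (formA phi a 0) (@ee R) (nu0 a).
Proof. by have [-> ->] := formA0; exact: cos_eigenbasis. Qed.

End SpacesAgree.

(** * Embeddings of the fractional spaces *)
Section Block.
Variable R : realType.
Local Notation T := (measurableTypeR R * measurableTypeR R)%type.
Implicit Types (c : nat -> R) (p : R).

(** The largest ratio [`|x j| / w j] bounds the sum, which avoids convexity. *)
Lemma powR_sum_le p J (x w : 'I_J -> R) : 0 < p -> (forall j, 0 < w j) ->
  `|\sum_j x j| `^ p <= (\sum_j w j) `^ p * \sum_j (w j) `^ (- p) * `|x j| `^ p.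
Proof.
move=> p0 w0; case: J x w w0 => [|J] x w w0.
  by rewrite !big_ord0 normr0 powR0 ?gt_eqF// mulr0.
have [j0 hj] : exists j0, forall j, `|x j| / w j <= `|x j0| / w j0.
  exists [arg max_(i > ord0) (`|x i| / w i)]%O.
  by case: Order.TotalTheory.arg_maxP => // i _ h j; exact: h.
have W0 : 0 <= \sum_j w j by apply: sumr_ge0 => j _; exact: ltW.
have h1 : `|\sum_j x j| <= (\sum_j w j) * (`|x j0| / w j0).
  apply: le_trans (ler_norm_sum _ _ _) _; rewrite mulr_suml; apply: ler_sum => j _.
  by rewrite mulrC -ler_pdivrMr.
have q0 : 0 <= `|x j0| / w j0 by rewrite divr_ge0// ltW.
apply: (@le_trans _ _ (((\sum_j w j) * (`|x j0| / w j0)) `^ p)).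
  by rewrite ge0_ler_powR ?nnegrE ?(ltW p0)// mulr_ge0.
rewrite powRM// ler_wpM2l ?powR_ge0// powRM ?invr_ge0 ?(ltW (w0 _))//.
have -> : (w j0)^-1 `^ p = w j0 `^ (- p) by rewrite -powR_inv1 ?(ltW (w0 _))// -powRrM mulN1r.
rewrite (bigD1 j0)//= mulrC lerDl; apply: sumr_ge0 => j _.
by rewrite mulr_ge0 ?powR_ge0.
Qed.

Lemma powR_sqr (x r : R) : 0 <= x -> (x ^+ 2) `^ r = (x `^ r) ^+ 2.
Proof. by move=> x0; rewrite !expr2 powRM. Qed.

Lemma geo_sum_le (r : R) J : 0 <= r < 1 -> \sum_(j < J) r ^+ j <= (1 - r)^-1.
Proof.
move=> /andP[r0 r1]; have d0 : 0 < 1 - r by rewrite subr_gt0.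
have E : (1 - r) * \sum_(j < J) r ^+ j = 1 - r ^+ J.
  elim: J => [|J IH]; first by rewrite big_ord0 mulr0 expr0 subrr.
  by rewrite big_ord_recr /= mulrDr IH exprS; ring.
by rewrite -[leRHS]mul1r ler_pdivlMr// mulrC E gerBl exprn_ge0.
Qed.

Definition lev (k : nat) : nat := maxn (pk k).1 (pk k).2.

Lemma count_box (K N : nat) : (\sum_(k < K | (lev k < N)%N) 1 <= N * N)%N.
Proof.
case: N => [|N]; first by rewrite big_pred0.
rewrite sum1_card.
have inj : {in [pred k : 'I_K | (lev k < N.+1)%N] &, injective
    (fun k : 'I_K => (inord (pk k).1, inord (pk k).2) : 'I_N.+1 * 'I_N.+1)}.
  move=> i j; rewrite !inE /lev !gtn_max => /andP[i1 i2] /andP[j1 j2] [h1 h2].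
  apply/val_inj/(can_inj pkK).
  have e1 : (pk i).1 = (pk j).1 by rewrite -(inordK i1) h1 inordK.
  have e2 : (pk i).2 = (pk j).2 by rewrite -(inordK i2) h2 inordK.
  by rewrite [LHS]surjective_pairing [RHS]surjective_pairing e1 e2.
rewrite -(card_in_image inj); apply: leq_trans (max_card _) _.
by rewrite card_prod !card_ord.
Qed.

(** Cauchy-Schwarz over at most [N^2] frequencies. *)
Lemma sup_block c K N (x : T) : (forall k, (k < K)%N -> c k != 0 -> (lev k < N)%N) ->
  `|comb (@ee R) c K x| <= 4 * N%:R * Num.sqrt (\sum_(k < K) c k ^+ 2).
Proof.
move=> hc.
have combE : comb (@ee R) c K x = \sum_(k < K) c k * ee k x.
  by rewrite /comb fct_sumE; apply: eq_bigr.
rewrite combE; apply: (@le_trans _ _ (4 * \sum_(k < K | (lev k < N)%N) `|c k|)).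
  apply: le_trans (ler_norm_sum _ _ _) _; rewrite mulr_sumr [leRHS]big_mkcond /=.
  apply: ler_sum => k _; have [ck|ck] := eqVneq (c k) 0.
    by rewrite ck mul0r normr0; case: ifP => // _; rewrite mulr0.
  by rewrite (hc _ (ltn_ord k) ck) normrM mulrC ler_wpM2r// cc_bound.
rewrite -mulrA ler_wpM2l//.
have s0 : 0 <= \sum_(k < K | (lev k < N)%N) `|c k| by apply: sumr_ge0.
rewrite -(ger0_norm s0) -sqrtr_sqr -[N%:R]ger0_norm ?ler0n// -sqrtr_sqr -sqrtrM ?sqr_ge0//.
rewrite ler_sqrt ?mulr_ge0 ?sqr_ge0//; last by apply: sumr_ge0 => i _; exact: sqr_ge0.
set P := fun k : 'I_K => (lev k < N)%N; rewrite -/(P _).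
have cs : (\sum_(k < K | P k) `|c k|) ^+ 2 <= (\sum_(k < K | P k) 1) * \sum_(k < K | P k) `|c k| ^+ 2.
  rewrite expr2 big_distrlr /=.
  have -> : (\sum_(k < K | P k) 1) * \sum_(k < K | P k) `|c k| ^+ 2 =
      \sum_(i < K | P i) \sum_(j < K | P j) 2^-1 * (`|c i| ^+ 2 + `|c j| ^+ 2) :> R.
    rewrite mulr_suml; under eq_bigr do rewrite mul1r.
    under [RHS]eq_bigr do under eq_bigr do rewrite mulrDr.
    under [RHS]eq_bigr do rewrite big_split /=.
    rewrite big_split /= [X in _ = X + _]exchange_big /= -!big_split /=.
    by apply: eq_bigr => i _; apply: eq_bigr => j _; lra.
  apply: ler_sum => i _; apply: ler_sum => j _.
  by have := sqr_ge0 (`|c i| - `|c j|); rewrite sqrrB; lra.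
apply: le_trans cs _; apply: ler_pM.
- by apply: sumr_ge0.
- by apply: sumr_ge0 => i _; exact: sqr_ge0.
- by rewrite -(natr_sum R _ P (fun=> 1%N)) -natrX ler_nat -mulnn; exact: count_box.
- rewrite big_mkcond /=; apply: ler_sum => k _; rewrite real_normK ?num_real//.
  by case: ifP => // _; exact: sqr_ge0.
Qed.

Section Measure.
Variables (m : {measure set T -> \bar R}) (th B : R).
Hypotheses (th0 : 0 <= th) (B0 : 0 <= B).
(** [th] measures the loss between the [L2] norm for [m] and for the square. *)
Hypothesis block2 : forall c K N, (0 < N)%N -> (forall k, (k < K)%N -> c k != 0 -> (lev k < N)%N) ->
  (\int[m]_x ((comb (@ee R) c K x) ^+ 2)%:E <= (B * N%:R `^ th * \sum_(k < K) c k ^+ 2)%:E)%E.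

Variables (p s a : R).
Hypotheses (p2 : 2 <= p) (s0 : 0 < s) (a0 : 0 < a) (gap : 1 - (2 - th) / p < 2 * s).

Let del : R := 2 * s - 1 + (2 - th) / p.
Let del0 : 0 < del. Proof. by rewrite /del; move: gap; lra. Qed.
Let a' : R := Num.min a 1 / 2.
Let a'0 : 0 < a'. Proof. by rewrite /a' divr_gt0// lt_min a0 ltr01. Qed.
Let p0 : 0 < p. Proof. exact: lt_le_trans p2. Qed.

Lemma meas_comb c K : measurable_fun setT (comb (@ee R) c K).
Proof.
rewrite (_ : comb _ _ _ = fun x => \sum_(k < K) c k * ee k x); last first.
  by apply/funext => x; rewrite /comb fct_sumE; apply: eq_bigr.
apply: measurable_sum => k; apply: measurable_funM; first exact: measurable_cst.
exact: meas_cc.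
Qed.

Lemma meas_pow (u : T -> R) q : measurable_fun setT u ->
  measurable_fun setT (fun x => (`|u x| `^ q)%:E).
Proof.
move=> mu; apply/measurable_EFinP.
apply: (measurableT_comp (@measurable_powR R q)); exact: measurableT_comp.
Qed.

Lemma nu0_lev k : a' * (lev k).+1%:R ^+ 2 <= nu0 a k.
Proof.
rewrite /nu0 /lev; move: (pk k) => [m1 m2] /=.
have pi1 : (1 : R) <= pi by have := pi_ge2 R; lra.
have sqb (n : nat) : (n%:R : R) ^+ 2 <= (n%:R * pi) ^+ 2.
  by rewrite exprMn ler_peMr ?sqr_ge0// -[leLHS](expr1n _ 2) lerXn2r ?nnegrE//; lra.
have mx : (maxn m1 m2)%:R ^+ 2 <= m1%:R ^+ 2 + m2%:R ^+ 2 :> R.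
  by case: (leqP m1 m2) => _; rewrite ?lerDl ?lerDr sqr_ge0.
have h1 : a' <= a / 2 by rewrite /a' ler_pM2r ?invr_gt0// ge_min lexx.
have h2 : a' <= 2^-1 by rewrite /a' -[leRHS]mul1r ler_pM2r ?invr_gt0// ge_min lexx orbT.
have h3 : (maxn m1 m2).+1%:R ^+ 2 <= 2 + 2 * (maxn m1 m2)%:R ^+ 2 :> R.
  by rewrite -natr1; have := sqr_ge0 ((maxn m1 m2)%:R - 1 : R); nra.
have h4 := sqb m1; have h5 := sqb m2.
have h6 := sqr_ge0 ((maxn m1 m2)%:R : R).
apply: le_trans (ler_wpM2l (ltW a'0) h3) _.
move: ((maxn m1 m2)%:R ^+ 2) ((m1%:R * pi) ^+ 2) ((m2%:R * pi) ^+ 2) mx h4 h5 h6 => X Y Z mx h4 h5 h6.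
have := ler_wpM2r h6 h2; lra.
Qed.

Definition blk c (j k : nat) : R := if (2 ^ j <= (lev k).+1 < 2 ^ j.+1)%N then c k else 0.

Lemma blk_sum c K : exists J, forall J', (J <= J')%N ->
  comb (@ee R) c K = \sum_(j < J') comb (@ee R) (blk c j) K.
Proof.
exists (\max_(k < K) (lev k).+1) => J hJ; rewrite /comb exchange_big /=; apply: eq_bigr => k _.
pose j0 := trunc_log 2 (lev k).+1.
have /andP[l1 l2] := trunc_log_bounds (isT : (1 < 2)%N) (ltn0Sn (lev k)).
have jJ : (j0 < J)%N.
  apply: leq_trans hJ; apply: leq_trans (leq_bigmax k); rewrite ltnS.
  have := ltn_expl j0 (isT : (1 < 2)%N) => h; rewrite -ltnS; exact: leq_trans h l1.
rewrite (bigD1 (Ordinal jJ))//= big1 ?addr0.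
  by rewrite /blk -/j0 l1 l2.
move=> j jj; rewrite /blk; case: ifP => [/andP[h1 h2]|_]; last exact: scale0r.
exfalso; move/eqP: jj; apply; apply/val_inj => /=.
have lt1 : (j < j0.+1)%N by rewrite -(ltn_exp2l _ _ (isT : (1 < 2)%N)); exact: leq_ltn_trans h1 l2.
have lt2 : (j0 < j.+1)%N by rewrite -(ltn_exp2l _ _ (isT : (1 < 2)%N)); exact: leq_ltn_trans l1 h2.
by apply/eqP; rewrite eqn_leq -ltnS lt1 -ltnS lt2.
Qed.

Lemma blk_coef c K j : \sum_(k < K) (nu0 a k `^ s * c k) ^+ 2 <= 1 ->
  \sum_(k < K) blk c j k ^+ 2 <= a' `^ (- (2 * s)) * ((2 ^+ j) `^ (- (2 * s))) ^+ 2.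
Proof.
move=> hc; have P : 0 < (2 ^+ j : R) by rewrite exprn_gt0.
apply: (@le_trans _ _ (\sum_(k < K) (a' `^ (- (2 * s)) * ((2 ^+ j) `^ (- (2 * s))) ^+ 2) * (nu0 a k `^ s * c k) ^+ 2)); last first.
  rewrite -mulr_sumr -[leRHS]mulr1 ler_wpM2l// mulr_ge0 ?powR_ge0// sqr_ge0.
have e1 (x : R) : 0 < x -> (x `^ s) ^+ 2 = x `^ (2 * s).
  by move=> x0; rewrite -powR_mulrn ?powR_ge0// -powRrM mulrC.
apply: ler_sum => k _; rewrite /blk; case: ifP => [/andP[h1 _]|_]; last first.
  by rewrite expr0n /= mulr_ge0 ?sqr_ge0// mulr_ge0 ?powR_ge0// sqr_ge0.
rewrite exprMn mulrA -[leLHS]mul1r ler_wpM2r ?sqr_ge0//.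
have n0 : 0 < nu0 a k by apply: lt_le_trans (nu0_lev k); rewrite mulr_gt0// exprn_gt0.
have h2 : a' * (2 ^+ j) ^+ 2 <= nu0 a k.
  apply: le_trans (nu0_lev k); rewrite ler_pM2l// lerXn2r ?nnegrE ?(ltW P)//.
  by rewrite -natrX ler_nat.
rewrite e1//; apply: (@le_trans _ _ (a' `^ (- (2 * s)) * ((2 ^+ j) `^ (- (2 * s))) ^+ 2 * (a' * (2 ^+ j) ^+ 2) `^ (2 * s))).
  rewrite powRM ?(ltW a'0) ?sqr_ge0// !powRN.
  have -> : ((2 ^+ j) ^+ 2) `^ (2 * s) = ((2 ^+ j) `^ (2 * s)) ^+ 2 :> R.
    exact: powR_sqr (ltW P).
  have q1 : a' `^ (2 * s) != 0 by rewrite gt_eqF// powR_gt0.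
  have q2 : (2 ^+ j : R) `^ (2 * s) != 0 by rewrite gt_eqF// powR_gt0.
  by rewrite le_eqVlt; apply/orP; left; apply/eqP; field; rewrite q1 q2.
rewrite ler_wpM2l ?mulr_ge0 ?powR_ge0 ?sqr_ge0// ge0_ler_powR ?nnegrE//.
- by rewrite mulr_ge0// ltW.
- by rewrite mulr_ge0 ?sqr_ge0// ltW.
- exact: ltW.
Qed.

Definition Cb : R := (8 `^ (p - 2) * (B * 2 `^ th)) * (a' `^ (- (2 * s))) `^ (p / 2).

Lemma Cb_ge0 : 0 <= Cb.
Proof. by rewrite /Cb !mulr_ge0// ?powR_ge0. Qed.

Lemma blk_Lp c K j : \sum_(k < K) (nu0 a k `^ s * c k) ^+ 2 <= 1 ->
  (\int[m]_x (`|comb (@ee R) (blk c j) K x| `^ p)%:E <= (Cb * (2 ^+ j) `^ (- (del * p)))%:E)%E.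
Proof.
move=> hc; set u := comb _ _ _; set P : R := 2 ^+ j.
have P0 : 0 < P by rewrite exprn_gt0.
set G := \sum_(k < K) blk c j k ^+ 2.
have G0 : 0 <= G by apply: sumr_ge0 => k _; exact: sqr_ge0.
have hN k : (k < K)%N -> blk c j k != 0 -> (lev k < 2 ^ j.+1)%N.
  move=> _; rewrite /blk; case: ifP => [/andP[_ h] _|_]; last by rewrite eqxx.
  exact: ltnW.
have N0 : (0 < 2 ^ j.+1)%N by rewrite expn_gt0.
have NE : (2 ^ j.+1)%:R = 2 * P :> R by rewrite natrX exprS.
set X := 4 * (2 * P) * Num.sqrt G.
have X0 : 0 <= X by rewrite !mulr_ge0 ?sqrtr_ge0// ltW.
have pt x : `|u x| `^ p <= X `^ (p - 2) * u x ^+ 2.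
  have h := sup_block x hN; rewrite NE -/u -/G -/X in h.
  have [ux|ux] := eqVneq (u x) 0.
    by rewrite ux normr0 powR0 ?gt_eqF// expr0n mulr0.
  have un : 0 < `|u x| by rewrite normr_gt0.
  rewrite -(real_normK (num_real (u x))) -[`|u x| ^+ 2]powR_mulrn//.
  have -> : `|u x| `^ p = `|u x| `^ (p - 2) * `|u x| `^ 2%:R.
    by rewrite -powRD ?(gt_eqF un) ?implybT//; congr (_ `^ _); ring.
  by rewrite ler_wpM2r ?powR_ge0// ge0_ler_powR ?nnegrE// subr_ge0.
have mu : measurable_fun setT u by exact: meas_comb.
apply: (@le_trans _ _ (\int[m]_x ((X `^ (p - 2))%:E * (u x ^+ 2)%:E))%E).
  apply: ge0_le_integral => //.
  - exact: meas_pow.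
  - by apply/measurable_EFinP; apply: measurable_funM => //; exact: measurable_funX.
  - by move=> x _; rewrite -EFinM lee_fin.
rewrite ge0_integralZl//; last 3 first.
- by apply/measurable_EFinP; exact: measurable_funX.
- by move=> x _; rewrite lee_fin sqr_ge0.
- by rewrite lee_fin powR_ge0.
apply: le_trans (lee_wpmul2l _ (block2 N0 hN)) _; first by rewrite lee_fin powR_ge0.
rewrite -EFinM lee_fin NE -/G.
have Gb : G <= a' `^ (- (2 * s)) * (P `^ (- (2 * s))) ^+ 2 by exact: blk_coef.
set Y := a' `^ (- (2 * s)) * (P `^ (- (2 * s))) ^+ 2 in Gb.
have Y0 : 0 <= Y by exact: le_trans Gb.
have XY : X `^ (p - 2) * G <= (8 * P) `^ (p - 2) * Y `^ (p / 2).
  have -> : X = 8 * P * Num.sqrt G by rewrite /X; ring.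
  rewrite powRM ?mulr_ge0 ?sqrtr_ge0 ?(ltW P0)// -mulrA ler_wpM2l ?powR_ge0//.
  rewrite -powR12_sqrt// -powRrM.
  have [->|Gn] := eqVneq G 0; first by rewrite mulr0 powR_ge0.
  have -> : G `^ (2^-1 * (p - 2)) * G = G `^ (p / 2).
    rewrite -{2}(powRr1 G0) -powRD; last by rewrite Gn implybT.
    by congr (_ `^ _); lra.
  by rewrite ge0_ler_powR ?nnegrE// divr_ge0// ltW.
apply: (@le_trans _ _ (B * (2 * P) `^ th * ((8 * P) `^ (p - 2) * Y `^ (p / 2)))).
  by rewrite mulrCA ler_wpM2l// mulr_ge0 ?powR_ge0.
have YE : Y `^ (p / 2) = (a' `^ (- (2 * s))) `^ (p / 2) * P `^ (- (2 * s) * p).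
  rewrite /Y (@powRM _ (a' `^ _)) ?powR_ge0 ?sqr_ge0//; congr (_ * _).
  by rewrite -powR_mulrn ?powR_ge0// -!powRrM; congr (_ `^ _); field.
rewrite /Cb YE (@powRM _ 2) ?(ltW P0)// (@powRM _ 8) ?(ltW P0)//.
have E : P `^ th * P `^ (p - 2) * P `^ (- (2 * s) * p) = P `^ (- (del * p)).
  rewrite -!powRD ?(gt_eqF P0) ?implybT//; congr (_ `^ _); rewrite /del; field; by rewrite gt_eqF.
by rewrite -E le_eqVlt; apply/orP; left; apply/eqP; ring.
Qed.

(** Weights: half of the gain [del] is spent on summing over the blocks. *)
Let w (j : nat) : R := (2 `^ (- (del / 2))) ^+ j.
Let q : R := 2 `^ (- (del / 2)).
Let q01 : 0 < q < 1.
Proof.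
rewrite /q powR_gt0//= powRN invf_lt1 ?powR_gt0//.
rewrite -[X in X < _](powR1x (del / 2)); apply: gt0_ltr_powR; rewrite ?nnegrE//.
  by rewrite divr_gt0.
by rewrite ltr1n.
Qed.

Definition CL : R := (1 - q)^-1 `^ p * (Cb / (1 - q `^ p)).

Let qp01 : 0 < q `^ p < 1.
Proof.
have /andP[q0 q1] := q01; rewrite powR_gt0//= -[X in _ < X](powR1x p).
by apply: gt0_ltr_powR; rewrite ?nnegrE// ltW.
Qed.

Lemma CL_ge0 : 0 <= CL.
Proof.
have /andP[q0 q1] := qp01.
by rewrite /CL mulr_ge0 ?powR_ge0// divr_ge0 ?Cb_ge0// subr_ge0 ltW.
Qed.

Lemma Lp_comb1 c K : \sum_(k < K) (nu0 a k `^ s * c k) ^+ 2 <= 1 ->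
  (\int[m]_x (`|comb (@ee R) c K x| `^ p)%:E <= CL%:E)%E.
Proof.
move=> hc; have [J hJ] := blk_sum c K; have /andP[q0 q1] := q01; have /andP[r0 r1] := qp01.
pose u j := comb (@ee R) (blk c j) K.
have uE x : comb (@ee R) c K x = \sum_(j < J) u j x by rewrite (hJ J (leqnn _)) fct_sumE.
have w0 j : 0 < w j by rewrite exprn_gt0.
have W0 : 0 <= \sum_(j < J) w j by apply: sumr_ge0 => j _; exact: ltW.
have W1 : \sum_(j < J) w j <= (1 - q)^-1 by apply: geo_sum_le; rewrite (ltW q0).
have mu j : measurable_fun setT (u j) by exact: meas_comb.
apply: (@le_trans _ _ (\int[m]_x (((1 - q)^-1 `^ p)%:E * \sum_(j < J) ((w j `^ (- p))%:E * (`|u j x| `^ p)%:E)))%E).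
  apply: ge0_le_integral => //.
  - by apply: meas_pow; exact: meas_comb.
  - rewrite (_ : (fun x => _) = EFin \o (fun x => (1 - q)^-1 `^ p * \sum_(j < J) w j `^ (- p) * `|u j x| `^ p)); last first.
      by apply/funext => x; rewrite /= EFinM sumEFin.
    apply/measurable_EFinP; apply: measurable_funM; first exact: measurable_cst.
    apply: measurable_sum => j; apply: measurable_funM; first exact: measurable_cst.
    by have /measurable_EFinP := meas_pow p (mu j).
  - move=> x _; under eq_bigr do rewrite -EFinM; rewrite sumEFin -EFinM lee_fin uE.
    apply: le_trans (powR_sum_le _ p0 (fun j : 'I_J => w0 j)) _.
    rewrite ler_wpM2r//; first by apply: sumr_ge0 => j _; rewrite mulr_ge0 ?powR_ge0.
    by rewrite ge0_ler_powR ?nnegrE ?(ltW p0)// invr_ge0 subr_ge0 ltW.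
have mt j : measurable_fun setT (fun x => ((w j `^ (- p))%:E * (`|u j x| `^ p)%:E)%E).
  apply: emeasurable_funM; first exact: measurable_cst.
  exact: meas_pow.
have t0 j x : (0 <= (w j `^ (- p))%:E * (`|u j x| `^ p)%:E)%E by rewrite -EFinM lee_fin mulr_ge0 ?powR_ge0.
rewrite ge0_integralZl//; last 3 first.
- by apply: emeasurable_sum => j.
- by move=> x _; apply: sume_ge0.
- by rewrite lee_fin powR_ge0.
rewrite ge0_integral_sum//.
rewrite /CL EFinM; apply: lee_wpmul2l; first by rewrite lee_fin powR_ge0.
apply: (@le_trans _ _ (\sum_(j < J) (Cb * (q `^ p) ^+ j)%:E)%E).
  apply: lee_sum => j _; rewrite ge0_integralZl//; last 2 first.
  - exact: meas_pow.
  - by rewrite lee_fin powR_ge0.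
  apply: le_trans (lee_wpmul2l _ (blk_Lp j hc)) _; first by rewrite lee_fin powR_ge0.
  rewrite -EFinM lee_fin le_eqVlt; apply/orP; left; apply/eqP.
  have e1 (x : R) r : 0 <= x -> (x ^+ j) `^ r = (x `^ r) ^+ j.
    by move=> x0; rewrite -powR_mulrn// -powRrM mulrC powRrM powR_mulrn ?powR_ge0.
  rewrite /w -/q !e1 ?(ltW q0)// mulrCA -exprMn; congr (_ * _ ^+ _).
  rewrite /q -!powRrM -powRD ?implybT//; last by rewrite pnatr_eq0 implybT.
  by congr (_ `^ _); field.
rewrite sumEFin lee_fin -mulr_sumr ler_wpM2l ?Cb_ge0//.
by apply: geo_sum_le; rewrite (ltW r0).
Qed.

(** On a dyadic block, [Lp] is interpolated between the supremum and [L2]; the strict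
    inequality [gap] makes the contributions of the blocks decay geometrically. *)
Theorem Lp_comb c K N : 0 <= N -> \sum_(k < K) (nu0 a k `^ s * c k) ^+ 2 <= N ^+ 2 ->
  (\int[m]_x (`|comb (@ee R) c K x| `^ p)%:E <= (CL * N `^ p)%:E)%E.
Proof.
move=> N0 hN; have [NE|Nn] := eqVneq N 0.
  have c0 k : (k < K)%N -> c k = 0.
    move=> kK; move: hN; rewrite NE expr0n /= => h.
    have s0' : \sum_(k < K) (nu0 a k `^ s * c k) ^+ 2 == 0.
      by rewrite eq_le h sumr_ge0// => i _; exact: sqr_ge0.
    have n0 : 0 < nu0 a k by apply: lt_le_trans (nu0_lev k); rewrite mulr_gt0// exprn_gt0.
    move: s0'; rewrite psumr_eq0; last by move=> i _; exact: sqr_ge0.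
    move=> /allP /(_ (Ordinal kK) (mem_index_enum _)); rewrite /= sqrf_eq0 mulf_eq0 => /orP[|/eqP//].
    by rewrite gt_eqF// powR_gt0.
  have -> : comb (@ee R) c K = 0 by rewrite /comb big1// => k _; rewrite c0 ?scale0r.
  rewrite (eq_integral (cst 0%E)); last by move=> x _; rewrite /= normr0 powR0 ?gt_eqF.
  by rewrite integral0 lee_fin mulr_ge0 ?powR_ge0// CL_ge0.
have Np : 0 < N by rewrite lt_neqAle eq_sym Nn.
have h1 : \sum_(k < K) (nu0 a k `^ s * (N^-1 * c k)) ^+ 2 <= 1.
  under eq_bigr do rewrite mulrCA exprMn; rewrite -mulr_sumr exprVn mulrC ler_pdivrMr ?exprn_gt0//.
  by rewrite mul1r.
have := @Lp_comb1 (fun k => N^-1 * c k) K h1.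
have e1 : comb (@ee R) c K = N *: comb (@ee R) (fun k => N^-1 * c k) K.
  rewrite /comb scaler_sumr; apply: eq_bigr => k _; rewrite scalerA; congr (_ *: _).
  by rewrite mulrA divff// mul1r.
set u := comb _ (fun k => N^-1 * c k) K in e1 *; have mu : measurable_fun setT u by exact: meas_comb.
move=> h; rewrite e1.
rewrite (eq_integral (fun x => (N `^ p)%:E * (`|u x| `^ p)%:E)%E); last first.
  move=> x _; rewrite -EFinM; congr EFin.
  have zE (v : T -> R) : (N *: v) x = N * v x by [].
  by rewrite zE normrM (gtr0_norm Np) powRM// ltW.
rewrite ge0_integralZl//; last 2 first.
- exact: meas_pow.
- by rewrite lee_fin powR_ge0.
by rewrite mulrC EFinM; apply: lee_wpmul2l => //; rewrite lee_fin powR_ge0.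
Qed.

End Measure.
End Block.

Section BlockMeasures.
Variable R : realType.
Local Notation TR := (measurableTypeR R).
Local Notation T := (measurableTypeR R * measurableTypeR R)%type.
Local Notation muI := (@muI R).
Implicit Types (c : nat -> R).

Lemma block2_lebO c K N : (0 < N)%N -> (forall k, (k < K)%N -> c k != 0 -> (lev k < N)%N) ->
  (\int[lebO R]_x ((comb (@ee R) c K x) ^+ 2)%:E <= (1 * N%:R `^ 0 * \sum_(k < K) c k ^+ 2)%:E)%E.
Proof.
move=> _ _; have S := ip2_semiip (lebO R).
have hs : sqi (lebO R) (comb (@ee R) c K) by apply: (D_comb S) => k; exact: cc_sqi.
rewrite ge0_fine_Rintegral; [|by move=> x; rewrite sqr_ge0|by case: hs].
rewrite lee_fin powRr0 !mul1r -(comb_norm S (fun k => @cc_sqi R (pk k)) (@ee_orth R)).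
by rewrite le_eqVlt; apply/orP; left; apply/eqP; apply: eq_Rintegral => x _; exact: expr2.
Qed.

(** ** Integrals over the boundary *)

(** An edge is a coordinate line: the coordinate [fdir k] is frozen at [fval k]. *)
Definition fdir (k : nat) : 'I_2 := if odd k then ord0 else ord_max.
Definition fval (k : nat) : R := if (k < 2)%N then 1 else 0.

Lemma edgeE (k : 'I_4) (t : R) : edge k t = upd (fdir k) (t, t) (fval k).
Proof. by case: k => [[|[|[|[|]]]]]. Qed.

Lemma meas_edge (w : T -> R) k : measurable_fun setT w ->
  measurable_fun setT (fun t : TR => w (edge k t)).
Proof. by move=> mw; apply: measurableT_comp mw _; exact: measurable_edge. Qed.

Lemma leb01_muI (f : TR -> \bar R) : measurable_fun setT f -> (forall t, (0 <= f t)%E) ->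
  (\int[leb01 R]_t f t = \int[muI]_t f t)%E.
Proof.
move=> mf f0; rewrite !ge0_integral_mrestr//.
rewrite -integral_itv_bndo_bndc; last exact: measurable_funTS.
by rewrite -integral_itv_obnd_cbnd//; exact: measurable_funTS.
Qed.

Lemma sigma_ge0 (f : T -> R) : measurable_fun setT f -> (forall x, 0 <= f x) ->
  (\int[sigma R]_x (f x)%:E = \sum_(k < 4) \int[muI]_t (f (edge k t))%:E)%E.
Proof.
move=> mf f0; have mf' : measurable_fun setT (EFin \o f) by exact/measurable_EFinP.
have -> := @ge0_integral_measure_sum _ _ _ (@edge_measure R) setT measurableT (EFin \o f)
  (fun x _ => f0 x) mf' 4.
apply: eq_bigr => k _; rewrite (@ge0_integral_pushforward _ _ _ _ _ (edge k) (measurable_edge k) (leb01 R) setT (EFin \o f))//.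
rewrite preimage_setT leb01_muI//.
- by apply: measurableT_comp => //; exact: measurable_edge.
- by move=> t; rewrite /= lee_fin.
- by move=> t _; rewrite /= lee_fin.
Qed.

Lemma muI_le (f : TR -> R) C : measurable_fun setT f -> (forall t, 0 <= f t) ->
  (forall t : R, 0 < t < 1 -> f t <= C) -> (\int[muI]_t (f t)%:E <= C%:E)%E.
Proof.
move=> mf f0 hC; rewrite ge0_integral_mrestr//; last exact/measurable_EFinP.
have C0 : 0 <= C by apply: le_trans (hC 2^-1 _) => //; apply/andP; split; lra.
have h := @ge0_le_integral _ _ R (@lebesgue_measure R) `](0 : R), 1[%classic (measurable_itv _)
  (EFin \o f) (cst C%:E).
apply: le_trans (h _ _ _ _) _.
- by move=> t _; rewrite lee_fin.
- by apply/measurable_EFinP; exact: measurable_funTS.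
- exact: measurable_cst.
- by move=> t /=; rewrite in_itv/= => ht; rewrite lee_fin; exact: hC.
by rewrite integral_cst//= lebesgue_measure_itv/= lte_fin ltr01 oppr0 adde0 mule1.
Qed.

Lemma prod_bound (c d x y : R) : `|x| <= 2 -> `|y| <= 2 -> c * x * (d * y) <= 2 * (c ^+ 2 + d ^+ 2).
Proof.
move=> hx hy; apply: le_trans (ler_norm _) _; rewrite !normrM.
have h1 : `|c| * `|x| <= `|c| * 2 by rewrite ler_wpM2l.
have h2 : `|d| * `|y| <= `|d| * 2 by rewrite ler_wpM2l.
apply: le_trans (ler_pM _ _ h1 h2) _; rewrite ?mulr_ge0//.
rewrite -(real_normK (num_real c)) -(real_normK (num_real d)).
by have := sqr_ge0 (`|c| - `|d|); rewrite sqrrB; lra.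
Qed.

(** Cosine sums with frequencies below [N] lose a factor [N] on a line: at most
    [N] of the two-dimensional frequencies have a given component. *)
Lemma block2_slice c K N i y : (forall k, (k < K)%N -> c k != 0 -> (lev k < N)%N) ->
  (\int[muI]_t ((comb (@ee R) c K (upd i (t, t) y)) ^+ 2)%:E <= (4 * N%:R * \sum_(k < K) c k ^+ 2)%:E)%E.
Proof.
move=> hc; pose m k := idx' i (pk k); pose g k : R := c k * cs (idx i (pk k)) y.
have E t : comb (@ee R) c K (upd i (t, t) y) = \sum_(k < K) g k * cs (m k) t.
  rewrite /comb fct_sumE; apply: eq_bigr => k _.
  rewrite -[LHS]/(c k * cc (pk k) (upd i (t, t) y)) (ccE i) coord2_upd other_upd mulrA.
  by congr (_ * cs _ _); rewrite /other; case: (i == ord0).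
have E2 t : (comb (@ee R) c K (upd i (t, t) y)) ^+ 2 =
    \sum_(k < K) \sum_(l < K) g k * g l * (cs (m k) t * cs (m l) t).
  rewrite E expr2 big_distrlr /=; apply: eq_bigr => k _; apply: eq_bigr => l _; ring.
have int1 k l : muI.-integrable setT (EFin \o (fun t => g k * g l * (cs (m k) t * cs (m l) t))).
  apply: (@muI_bounded_int _ _ (`|g k * g l| * 4)).
    by apply: measurable_funM => //; apply: measurable_funM; exact: meas_cs.
  move=> t; rewrite normrM ler_wpM2l// normrM (_ : 4 = 2 * 2); last by ring.
  by apply: ler_pM => //; exact: cs_bound.
have int2 k := @Rintegral_sum _ _ _ muI _ (index_enum 'I_K) _ (fun l : 'I_K => int1 k l).
have [I3 J3] := @Rintegral_sum _ _ _ muI _ (index_enum 'I_K) _ (fun k : 'I_K => (int2 k).2).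
under eq_integral do rewrite E2.
rewrite ge0_fine_Rintegral//; last by move=> t; rewrite -E2 sqr_ge0.
rewrite lee_fin I3.
pose P (k : nat) := (lev k < N)%N.
apply: (@le_trans _ _ (\sum_(k < K) \sum_(l < K) ((m k == m l) && P k && P l)%:R * (2 * (c k ^+ 2 + c l ^+ 2)))).
  apply: ler_sum => k _; rewrite (int2 k).1; apply: ler_sum => l _.
  rewrite RintegralZl//; last first.
    apply: (@muI_bounded_int _ _ 4); first by apply: measurable_funM; exact: meas_cs.
    move=> t; rewrite normrM (_ : 4 = 2 * 2); last by ring.
    by apply: ler_pM => //; exact: cs_bound.
  rewrite cs_orth; case: (m k == m l); last by rewrite mulr0 mul0r.
  have [ck|ck] := eqVneq (c k) 0; first by rewrite /g ck !mul0r mulr_ge0// ?mulr_ge0// addr_ge0// sqr_ge0.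
  have [cl|cl] := eqVneq (c l) 0.
    by rewrite /g cl mul0r mulr0 mul0r mulr_ge0// ?mulr_ge0// addr_ge0// sqr_ge0.
  rewrite /P !hc//= mul1r mulr1.
  exact: prod_bound (cs_bound _ _) (cs_bound _ _).
have cnt k : \sum_(l < K) ((m k == m l) && P k && P l)%:R <= N%:R :> R.
  apply: (@le_trans _ _ (\sum_(l < K) (P l && (m l == m k))%:R)).
    apply: ler_sum => l _; rewrite ler_nat eq_sym; by case: (P l); case: (P k); case: (m l == _).
  rewrite -natr_sum ler_nat -big_mkcond sum1_card.
  case: N @P hc => [|N] P hc; first by rewrite eq_card0.
  have inj : {in [pred l : 'I_K | P l && (m l == m k)] &, injective
      (fun l : 'I_K => inord (idx i (pk l)) : 'I_N.+1)}.
    move=> p q; rewrite !inE /P /lev !gtn_max => /andP[/andP[p1 p2] /eqP pm] /andP[/andP[q1 q2] /eqP qm] h.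
    have b (r : nat * nat) : (r.1 < N.+1)%N -> (r.2 < N.+1)%N -> (idx i r < N.+1)%N by rewrite /idx; case: ifP.
    have e1 : idx i (pk p) = idx i (pk q) by rewrite -(inordK (b _ p1 p2)) h inordK// b.
    apply/val_inj/(can_inj pkK); move: e1 (etrans pm (esym qm)); rewrite /m /idx /idx'.
    case: (pk p) => [p3 p4]; case: (pk q) => [q3 q4]; by case: ifP => _ /= -> ->.
  by rewrite -(card_in_image inj); apply: leq_trans (max_card _) _; rewrite card_ord.
have -> : \sum_(k < K) \sum_(l < K) ((m k == m l) && P k && P l)%:R * (2 * (c k ^+ 2 + c l ^+ 2)) =
    \sum_(k < K) 4 * c k ^+ 2 * \sum_(l < K) ((m k == m l) && P k && P l)%:R.
  under eq_bigr do under eq_bigr do rewrite mulrDr mulrDr.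
  under eq_bigr do rewrite big_split /=.
  rewrite big_split /= [X in _ + X]exchange_big /= -big_split /=; apply: eq_bigr => k _.
  rewrite mulr_sumr -big_split /=; apply: eq_bigr => l _.
  by rewrite (eq_sym (m l)) -!andbA (andbC (P l)); ring.
rewrite mulr_sumr; apply: ler_sum => k _; rewrite [4 * N%:R * _]mulrAC.
by rewrite ler_wpM2l// mulr_ge0// sqr_ge0.
Qed.

Lemma block2_sigma c K N : (0 < N)%N -> (forall k, (k < K)%N -> c k != 0 -> (lev k < N)%N) ->
  (\int[sigma R]_x ((comb (@ee R) c K x) ^+ 2)%:E <= (16 * N%:R `^ 1 * \sum_(k < K) c k ^+ 2)%:E)%E.
Proof.
move=> N0 hc; rewrite sigma_ge0; last 2 first.
- by apply: measurable_funX; exact: meas_comb.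
- by move=> x; exact: sqr_ge0.
apply: (@le_trans _ _ (\sum_(k < 4) (4 * N%:R * \sum_(k < K) c k ^+ 2)%:E)%E).
  apply: lee_sum => k _; under eq_integral do rewrite edgeE.
  exact: block2_slice.
rewrite sumEFin lee_fin sumr_const card_ord powRr1// -mulr_natl.
by rewrite le_eqVlt; apply/orP; left; apply/eqP; ring.
Qed.

(** A continuous function is bounded only on the closed square, which carries [sigma];
    hence square integrability is checked edge by edge. *)
Lemma sigma_sqi (w : T -> R) : measurable_fun setT w ->
  (forall k : 'I_4, (\int[muI]_t (w (edge k t) ^+ 2)%:E < +oo)%E) -> sqi (sigma R) w.
Proof.
move=> mw h; split=> //; apply/integrableP; split.
  by apply/measurable_EFinP; exact: measurable_funX.
under eq_integral do rewrite gee0_abs ?lee_fin ?sqr_ge0//.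
rewrite sigma_ge0; [|exact: measurable_funX|by move=> x; exact: sqr_ge0].
by apply: lte_sum_pinfty => k _; exact: h.
Qed.

Lemma sigma_cont (w : R * R -> R) : continuous w -> sqi (sigma R) w.
Proof.
move=> cw; have mw := cont_measurable2 cw; have [C hC] := cont_bounded2 cw.
apply: sigma_sqi => // k; apply: (@le_lt_trans _ _ ((C ^+ 2)%:E)); last exact: ltry.
apply: muI_le.
- by apply: measurable_funX; exact: meas_edge.
- by move=> t; exact: sqr_ge0.
- move=> t /andP[t0 t1]; rewrite -(real_normK (num_real (w _))).
  have h : `|w (edge k t)| <= C.
    by apply: hC; case: k => [[|[|[|[|]]]]]//= _; apply/andP; split; lra.
  by rewrite ler_sqr ?nnegrE//; apply: le_trans h.
Qed.

(** ** The trace inequality *)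

Lemma le_Rint_Omega (f g : T -> R) : (lebO R).-integrable setT (EFin \o f) ->
  (lebO R).-integrable setT (EFin \o g) -> (forall x, Omega R x -> f x <= g x) ->
  \int[lebO R]_x f x <= \int[lebO R]_x g x.
Proof.
move=> jf jg fg; rewrite -subr_ge0 -RintegralB//.
have mgf : measurable_fun setT (fun x => g x - f x).
  move/integrableP : jf => [/measurable_EFinP mf _].
  by move/integrableP : jg => [/measurable_EFinP mg _]; exact: measurable_funB.
rewrite (@Rintegral_ae _ _ (fun x => `|g x - f x|))//.
- by apply: Rintegral_ge0 => x _.
- exact: measurableT_comp.
- by apply: ae_Omega => x Ox _; rewrite ger0_norm// subr_ge0 fg.
Qed.

Lemma face_real (q w d : R) : `|q| <= 1 -> q * (w * d + w * d) + w * w * 1 <= 2 * (w * w) + d * d.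
Proof.
rewrite ler_norml => /andP[h1 h2].
have h3 := sqr_ge0 (w - d); have h4 := sqr_ge0 (w + d); nra.
Qed.

(** With [q] affine in the direction of the normal, [w^2] on the edge is the integral of
    the derivative of [q w^2] along the normal. *)
Lemma face_bound (w : R * R -> R) (k : 'I_4) : smooth2 w ->
  (\int[muI]_t (w (edge k t) ^+ 2)%:E <= (3 * nH w)%:E)%E.
Proof.
move=> sw; set i := fdir k; set y := fval k.
have [dw sdw] := smooth_der i sw.
pose q : R * R -> R := fun x => coord2 i x - (1 - y).
have sq_ : smooth2 q.
  have C1k_id m : C1k m (id : R -> R).
    case: m => [|m]; first by move=> t; exact: cvg_id.
    by exists (cst 1) => [t|]; [exact: derid|exact: C1k_cst].
  have h := @smooth_prod R (fun t => 1 * t + (- (1 - y))) (cst 1) i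
    (fun m => C1k_affine 1 (- (1 - y)) (C1k_id m)) (fun m => C1k_cst m 1).
  by rewrite (_ : q = fun x => (1 * coord2 i x + - (1 - y)) * cst 1 (other i x))//; apply/funext => x; rewrite /q mul1r mulr1.
have dq x : 'D_(basis2 R i) q x = 1.
  rewrite derive_slice (_ : q \o upd i x = fun t => t - (1 - y)); last first.
    by apply/funext => t; rewrite /q /= coord2_upd.
  have h : is_derive (coord2 i x) (1 : R) (fun t : R => t - (1 - y)) 1.
    by apply: (der_eq (derB (derid _) (derC _ (1 - y)))); rewrite subr0.
  by case: h.
have sww : smooth2 (w \* w) by exact: smooth_mul.
have hI := @int_slice _ i (q \* (w \* w)) _ (smooth_mul sq_ sww) (fun x => erefl).
have [Ow Odw] : sqi (lebO R) w /\ sqi (lebO R) (fun x => 'D_(basis2 R i) w x).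
  by split; apply: cont_sqi; exact: smooth_cont.
have [h1 h2 _] := nH_parts (smooth_H1 sw).
have h3 : ip2 (lebO R) (fun x => 'D_(basis2 R i) w x) (fun x => 'D_(basis2 R i) w x) <= nH w.
  have s3 := wp_sqi i (smooth_H1 sw); have E3 := smooth_wp i sw.
  by rewrite -(ip_ae s3 Odw s3 Odw E3 E3).
have slE (t : R) : w (edge k t) ^+ 2 = (q \* (w \* w)) (upd i (t, t) 1) - (q \* (w \* w)) (upd i (t, t) 0).
  rewrite edgeE -/i -/y /= /q !coord2_upd /y /fval.
  by case: (k < 2)%N => /=; ring.
under eq_integral do rewrite slE.
have mg : measurable_fun setT (fun t : TR => w (edge k t) ^+ 2).
  exact: (measurable_funX 2 (meas_edge k (cont_measurable2 (smooth_cont sw)))).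
have [C hC] := cont_bounded2 (smooth_cont sw).
rewrite ge0_fine_Rintegral; last 2 first.
- by move=> t; rewrite -slE sqr_ge0.
- rewrite (_ : (fun t => _) = fun t => w (edge k t) ^+ 2); last by apply/funext => t; rewrite slE.
  apply/integrableP; split; first exact/measurable_EFinP.
  under eq_integral do rewrite gee0_abs ?lee_fin ?sqr_ge0//.
  apply: (@le_lt_trans _ _ ((C ^+ 2)%:E)); last exact: ltry.
  apply: muI_le => // [t|t /andP[t0 t1]]; first exact: sqr_ge0.
  rewrite -(real_normK (num_real (w _))).
  have h : `|w (edge k t)| <= C.
    by apply: hC; case: (k) => [[|[|[|[|]]]]]//= _; apply/andP; split; lra.
  by rewrite ler_sqr ?nnegrE//; apply: le_trans h.
rewrite lee_fin -hI; have ww := sqi_mul_int Ow Ow; have dd := sqi_mul_int Odw Odw.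
have J2 : (lebO R).-integrable setT (EFin \o (fun x => 2 * (w x * w x))) by exact: (integrableZl measurableT 2 ww).
have J : (lebO R).-integrable setT (EFin \o (fun x => 2 * (w x * w x) + 'D_(basis2 R i) w x * 'D_(basis2 R i) w x)).
  exact: (integrableD measurableT J2 dd).
apply: le_trans (le_Rint_Omega (g := fun x => 2 * (w x * w x) + 'D_(basis2 R i) w x * 'D_(basis2 R i) w x) _ J _) _.
- by apply: sqi_int; apply: cont_sqi; apply: smooth_cont; exact: (smooth_der i (smooth_mul sq_ sww)).2.
- move=> x /(OmegaP i)[/andP[x0 x1] _]; rewrite derive_mul// derive_mul// dq; apply: face_real.
  by rewrite /q /y /fval; case: ifP => _; rewrite ler_norml; apply/andP; split; lra.
rewrite RintegralD// RintegralZl//.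
move: h1 h3; rewrite /ip2; lra.
Qed.

Lemma dist3 (x y z u v d : R) : 0 < d -> x <= 2 * y + 2 * z -> y <= 2 * u + 2 * v ->
  u < d / 16 -> z < d / 16 -> v < d / 16 -> x < d.
Proof. by lra. Qed.

Lemma trace_ineq (w : R * R -> R) : smooth2 w -> ip2 (sigma R) w w <= 12 * nH w.
Proof.
move=> sw; have [mw iw] := sigma_cont (smooth_cont sw).
have -> : ip2 (sigma R) w w = \int[sigma R]_x (w x ^+ 2) by apply: eq_Rintegral => x _; rewrite expr2.
rewrite -lee_fin -ge0_fine_Rintegral//; last by move=> x; exact: sqr_ge0.
rewrite sigma_ge0; [|exact: measurable_funX|by move=> x; exact: sqr_ge0].
apply: (@le_trans _ _ (\sum_(k < 4) (3 * nH w)%:E)%E); first by apply: lee_sum => k _; exact: face_bound.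
by rewrite sumEFin lee_fin sumr_const card_ord -mulr_natl; lra.
Qed.
End BlockMeasures.

(** ** Traces *)
Section Traces.
Variable R : realType.
Local Notation T := (measurableTypeR R * measurableTypeR R)%type.
Local Notation sq := (sqi (lebO R)).
Variables (phi : R -> R -> R) (a : R).
Hypothesis a_gt0 : 0 < a.
Local Notation e := (@ee R).
Local Notation nu := (nu0 a).
Local Notation X := (Xspace phi a 0).
Implicit Types (u v w : T -> R).

Let S := ip2_semiip (lebO R).
Let Ss := ip2_semiip (sigma R).

Definition c0 u : nat -> R := fun k => ip2 (lebO R) u (e k).

Lemma coef0 u : coef phi 0 e u = c0 u.
Proof. by apply/funext => k; rewrite /coef /c0; have [-> _] := @formA0 R phi a; rewrite ip2E. Qed.

Lemma c0_lin c u v : sq u -> sq v -> c0 (c *: u + v) = fun k => c * c0 u k + c0 v k.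
Proof. by move=> su sv; apply/funext => k; apply: (sip_lin S) => //; exact: cc_sqi. Qed.

Lemma X0P s u : 0 < s < 1 -> X s u <-> sq u /\ exists2 N, 0 <= N & wle nu s (c0 u) N.
Proof. by move=> s01; rewrite -coef0; exact: (XspaceP a_gt0 (or_introl erefl) (basis0 phi a_gt0) s01). Qed.

Lemma comb_lin c d c' K : comb e (fun k => c * d k + c' k) K = c *: comb e d K + comb e c' K.
Proof.
rewrite /comb scaler_sumr -big_split /=; apply: eq_bigr => k _.
by rewrite scalerDl scalerA.
Qed.

Lemma comb_smooth c K : smooth2 (comb e c K : R * R -> R).
Proof. by apply: smooth_sum => k; exact: smooth_cc. Qed.

Lemma comb_sigma c K : sqi (sigma R) (comb e c K).
Proof. exact/sigma_cont/smooth_cont/comb_smooth. Qed.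

Lemma smooth_sigma w : smooth2 w -> sqi (sigma R) w.
Proof. by move=> sw; exact/sigma_cont/smooth_cont. Qed.

(** The trace in coordinates: the sum of the traces of the Fourier components. *)
Definition tr u v : Prop := sqi (sigma R) v /\ sconv (ip2 (sigma R)) (comb e (c0 u)) v.

(** The Fourier series of a smooth function converges in [H1], hence on the boundary. *)
Lemma tr_smooth w : smooth2 w -> tr w w.
Proof.
move=> sw; split; first exact: smooth_sigma.
have [cl [cu cl0 eqv]] := @aform0_equiv R a a_gt0.
have hw := smooth_H1 sw; move=> d d0.
have := A_parseval (form_pair0 a_gt0) (cos_eigenbasis a_gt0) hw.
rewrite -(ip2E (lebO R)) => /(_ (d * cl / 12)) [|N hN]; first by rewrite divr_gt0// mulr_gt0.
exists N => n nN; have := hN n nN; rewrite -[fun k => _]/(c0 w) => h.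
have sd : smooth2 (comb e (c0 w) n - w : R * R -> R).
  rewrite (_ : _ - _ = -1 *: w + comb e (c0 w) n); last by rewrite scaleN1r addrC.
  by apply: smooth_lin => //; exact: comb_smooth.
apply: le_lt_trans (trace_ineq sd) _; have /andP[h1 _] := eqv _ (smooth_H1 sd).
have := le_lt_trans h1 h; move: (nH _) => z; rewrite -ltr_pdivlMl// mulrC => h2.
apply: lt_le_trans (_ : 12 * (d * cl / 12 / cl) <= _); first by rewrite ltr_pM2l.
by rewrite le_eqVlt; apply/orP; left; apply/eqP; field; rewrite gt_eqF.
Qed.

Lemma sum_tail (V : zmodType) (c : nat -> V) K L : (K <= L)%N ->
  \sum_(k < L) (if (k < K)%N then 0 else c k) = \sum_(k < L) c k - \sum_(k < K) c k.
Proof.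
move=> KL; rewrite (sum_split (fun k => if (k < K)%N then 0 else c k) KL) (sum_split c KL).
rewrite big1 => [|k _]; last by rewrite ltn_ord.
rewrite add0r addrAC subrr add0r; apply: eq_bigr => k _.
by rewrite ltnNge leq_addr.
Qed.

Lemma powR_norm_cvg p (x : nat -> R) y : 0 < p -> x n @[n --> \oo] --> y ->
  `|x n| `^ p @[n --> \oo] --> `|y| `^ p.
Proof.
move=> p0 xy; have [y0|y0] := eqVneq y 0; last first.
  have c := @cont_powR R p `|y|; apply: (continuous_cvg _ (c _)); first by rewrite normr_gt0.
  exact: cvg_norm.
rewrite y0 normr0 powR0 ?gt_eqF//; apply/cvgrPdist_lt => d d0.
have /cvgrPdist_lt x0 : x n @[n --> \oo] --> (0 : R) by rewrite -y0.
apply: filterS (x0 _ (powR_gt0 p^-1 d0)) => n.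
rewrite !sub0r !normrN (ger0_norm (powR_ge0 _ _)) => h.
have := @gt0_ltr_powR _ p p0 `|x n| (d `^ p^-1); rewrite !nnegrE powR_ge0 => /(_ _ _ h).
by rewrite -powRrM mulVf ?gt_eqF// powRr1 ?(ltW d0)//; apply.
Qed.

Section Order.
Variable s : R.
Hypothesis s_range : 1 / 4 < s <= 1 / 2.
Let s0 : 0 < s. Proof. by move: s_range => /andP[]; lra. Qed.
Let s01 : 0 < s < 1. Proof. by move: s_range => /andP[]; lra. Qed.
Let gap2 : 1 - (2 - 1) / 2 < 2 * s. Proof. by move: s_range => /andP[]; lra. Qed.
Let C := CL 1 16 2 s a.
Let C0 : 0 <= C.
Proof. by apply: CL_ge0 => //; lra. Qed.

(** The case [p = 2] of [Lp_comb], whose condition is then [1 / 4 < s]. *)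
Lemma comb_sigma_le (c : nat -> R) K N : 0 <= N -> \sum_(k < K) (nu k `^ s * c k) ^+ 2 <= N ^+ 2 ->
  ip2 (sigma R) (comb e c K) (comb e c K) <= C * N ^+ 2.
Proof.
move=> N0 hN; have [mc ic] := comb_sigma c K.
have h := @Lp_comb R (sigma R) 1 16 (ler0n R 16) (@block2_sigma R) 2 s a (lexx _) s0 a_gt0 gap2 c K N N0 hN.
have -> : ip2 (sigma R) (comb e c K) (comb e c K) = \int[sigma R]_x (comb e c K x ^+ 2).
  by apply: eq_Rintegral => x _; rewrite expr2.
rewrite -lee_fin -ge0_fine_Rintegral//; last by move=> x; exact: sqr_ge0.
move: h; rewrite powR_mulrn//.
have pe x : `|comb e c K x| `^ 2 = comb e c K x ^+ 2.
  by rewrite (powR_mulrn 2 (normr_ge0 _)) real_normK ?num_real.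
apply: le_trans; rewrite le_eqVlt; apply/orP; left; apply/eqP; apply: eq_integral => x _; congr EFin; symmetry; exact: pe.
Qed.

(** Any two approximations are compared through the partial Fourier sums, whose boundary
    norms are controlled uniformly by [comb_sigma_le]. *)
Lemma trace_limit u v (un : nat -> T -> R) : sqi (sigma R) v -> X s u ->
  (forall n, smooth2 (un n)) -> (forall n, X s (un n)) ->
  Xnorm phi a 0 s (fun x => un n x - u x) @[n --> \oo] --> 0 ->
  L2norm (sigma R) (fun x => un n x - v x) @[n --> \oo] --> 0 -> tr u v.
Proof.
move=> sv Xu sun Xun cX0 cL; split=> // d d0.
have [su _] := (X0P u s01).1 Xu.
have sn n : sqi (sigma R) (un n) by exact: smooth_sigma.
pose x n := cX s * Xnorm phi a 0 s (fun x => un n x - u x).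
pose y n := L2norm (sigma R) (fun x => un n x - v x).
have cx : C * (x n * x n) @[n --> \oo] --> 0.
  rewrite -(mulr0 C) -(mul0r 0); have h : x n @[n --> \oo] --> 0.
    by rewrite -(mulr0 (cX s)); apply: cvgM => //; exact: cvg_cst.
  by apply: cvgM; [exact: cvg_cst|exact: cvgM].
have cy : y n * y n @[n --> \oo] --> 0 by rewrite -(mul0r 0); exact: cvgM.
have d16 : 0 < d / 16 by rewrite divr_gt0.
have [N1 _ h1] : \forall n \near \oo, C * (x n * x n) < d / 16 by exact: (cvgr_lt _ cx).
have [N2 _ h2] : \forall n \near \oo, y n * y n < d / 16 by exact: (cvgr_lt _ cy).
pose n := maxn N1 N2; have [_ /(_ _ d16)[K0 hK]] := tr_smooth (sun n).
have {h1} h1 := h1 n (leq_maxl _ _); have {h2} h2 := h2 n (leq_maxr _ _).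
exists K0 => K /hK h3; have sc c := comb_sigma c K.
have [sunO _] := (X0P (un n) s01).1 (Xun n).
have dE : un n - u = -1 *: u + un n by rewrite scaleN1r addrC.
have sd : sq (un n - u) by rewrite dE; exact: sqi_lin.
have Xd : X s (un n - u).
  have [_ [M M0 hM]] := (X0P u s01).1 Xu; have [_ [M' M0' hM']] := (X0P (un n) s01).1 (Xun n).
  apply/X0P => //; split=> //; exists (M' + M); first exact: addr_ge0.
  apply: (wle_eq (c := c0 (un n) - c0 u)); last exact: wleB.
  by move=> k; rewrite dE c0_lin// mulN1r addrC.
have hd : wle nu s (c0 (un n - u)) (x n).
  by rewrite -coef0; apply: (Xnorm_wle a_gt0 (or_introl erefl) (basis0 phi a_gt0) s01).
have x0 : 0 <= x n by rewrite mulr_ge0 ?cX_ge0 ?Xnorm_ge0.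
have eA : ip2 (sigma R) (comb e (c0 u) K - comb e (c0 (un n)) K) (comb e (c0 u) K - comb e (c0 (un n)) K) < d / 16.
  rewrite (bBBC Ss)//; apply: le_lt_trans h1; rewrite -expr2.
  rewrite (_ : _ - _ = comb e (c0 (un n - u)) K); first exact: comb_sigma_le.
  by rewrite dE c0_lin// comb_lin scaleN1r addrC.
have eD : ip2 (sigma R) (un n - v) (un n - v) < d / 16.
  have hs : sqi (sigma R) (un n - v) by exact: (sipB Ss).
  apply: le_lt_trans h2; rewrite /y /L2norm (L2normE hs) -expr2 sqr_sqrtr//.
  exact: (sip_ge0 Ss hs).
have t1 := b_tri Ss (sc (c0 u)) (sn n) sv.
have t2 := b_tri Ss (sc (c0 u)) (sc (c0 (un n))) (sn n).
exact: (dist3 d0 t1 t2 eA eD h3).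
Qed.

(** Partial Fourier sums converge in [X s] and their restrictions form a Cauchy
    sequence in [L2] of the boundary. *)
Lemma is_trace_ex u : X s u -> exists v, is_trace phi a u v.
Proof.
move=> Xu; have [su [N N0 hN]] := (X0P u s01).1 Xu.
have tail := @series_cauchy R (fun k => (nu k `^ s * c0 u k) ^+ 2) (N ^+ 2) (fun k => sqr_ge0 _) hN.
pose un := comb e (c0 u).
have C1 : 0 < C + 1 by rewrite ltr_wpDl.
have cau : scauchy (ip2 (sigma R)) un.
  move=> d d0; have [|K0 hK] := tail (d / (C + 1)); first by rewrite divr_gt0.
  have key m n : (K0 <= m)%N -> (m <= n)%N -> ip2 (sigma R) (un n - un m) (un n - un m) < d.
    move=> Km mn; have h := hK _ _ Km mn; rewrite -(sum_tail (fun k => (nu k `^ s * c0 u k) ^+ 2) mn) in h.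
    have z0 : 0 <= \sum_(k < n) (if (k < m)%N then 0 else (nu k `^ s * c0 u k) ^+ 2).
      by apply: sumr_ge0 => k _; case: ifP => // _; exact: sqr_ge0.
    rewrite (_ : un n - un m = comb e (fun k => if (k < m)%N then 0 else c0 u k) n); last first.
      rewrite /un /comb -(sum_tail (fun k => c0 u k *: e k) mn); apply: eq_bigr => k _.
      by case: ifP => // _; rewrite scale0r.
    have g := @comb_sigma_le (fun k => if (k < m)%N then 0 else c0 u k) n _ (sqrtr_ge0 _).
    apply: le_lt_trans (g (\sum_(k < n) (if (k < m)%N then 0 else (nu k `^ s * c0 u k) ^+ 2)) _) _.
      by rewrite sqr_sqrtr//; apply: ler_sum => k _; case: ifP => // _; rewrite mulr0 expr0n.
    rewrite sqr_sqrtr//.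
    rewrite ltr_pdivlMr// in h; apply: le_lt_trans h; by rewrite mulrC ler_wpM2l// lerDl ler01.
  exists K0 => n m Kn Km; have [mn|/ltnW nm] := leqP m n; first exact: key.
  by rewrite (bBBC Ss (comb_sigma _ _) (comb_sigma _ _)); exact: key.
have [v sv cv] := ip2_complete (comb_sigma _) cau.
have uO n : sq (un n) by apply: (D_comb S) => k; exact: cc_sqi.
have cun n : c0 (un n) = fun k => if (k < n)%N then c0 u k else 0.
  by apply/funext => k; exact: (comb_coef S (fun k => @cc_sqi R (pk k)) (@ee_orth R)).
have Xun n : X s (un n).
  apply/X0P => //; split=> //; exists N => // K; rewrite cun; apply: le_trans (hN K).
  by apply: ler_sum => k _; case: ifP => // _; rewrite mulr0 expr0n sqr_ge0.
exists v; split; first exact/Lfun2P.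
exists s => //; split=> //; exists un; split=> //.
- by move=> n; exact: comb_smooth.
- apply/cvgrPdist_lt => d d0; pose z := d / (CX s + 1).
  have Cp : 0 < CX s + 1 by rewrite ltr_wpDl// CX_ge0.
  have z0 : 0 < z by rewrite divr_gt0.
  have [|K0 hK] := tail (z ^+ 2); first by rewrite exprn_gt0.
  exists K0 => // n Kn; rewrite sub0r normrN ger0_norm ?Xnorm_ge0//.
  have dE : (fun x => un n x - u x) = -1 *: u + un n by rewrite scaleN1r addrC.
  rewrite dE; apply: (@le_lt_trans _ _ (CX s * z)).
    apply: (wle_Xnorm a_gt0 (or_introl erefl) (basis0 phi a_gt0) s01); [exact: sqi_lin|exact: ltW|].
    rewrite coef0 c0_lin// cun => K.
    apply: (@le_trans _ _ (\sum_(k < maxn n K) (if (k < n)%N then 0 else (nu k `^ s * c0 u k) ^+ 2))); last first.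
      by rewrite (sum_tail (fun k => (nu k `^ s * c0 u k) ^+ 2) (leq_maxl n K)); apply/ltW/hK => //; exact: leq_maxl.
    apply: le_trans (@ler_sum_widen R (fun k => if (k < n)%N then 0 else (nu k `^ s * c0 u k) ^+ 2) _ _ _ (leq_maxr n K)).
      apply: ler_sum => k _; case: ifP => _; first by rewrite mulN1r addNr mulr0 expr0n.
      by rewrite addr0 mulN1r mulrN sqrrN.
    by move=> k; case: ifP => // _; exact: sqr_ge0.
  by rewrite /z mulrA ltr_pdivrMr// [d * _]mulrC ltr_pM2r// ltrDl ltr01.
- apply/cvgrPdist_lt => d d0; have [|K0 hK] := cv (d ^+ 2); first by rewrite exprn_gt0.
  exists K0 => // n Kn; have hs : sqi (sigma R) (un n - v) by apply: (sipB Ss) => //; exact: comb_sigma.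
  rewrite sub0r normrN /L2norm (L2normE hs) ger0_norm ?sqrtr_ge0//.
  rewrite -(ltr_pXn2r (n := 2)) ?nnegrE ?sqrtr_ge0 ?(ltW d0)// sqr_sqrtr; first exact: hK.
  exact: (sip_ge0 Ss hs).
Qed.

End Order.

Lemma is_trace_tr u v : is_trace phi a u v -> tr u v.
Proof.
move=> [/Lfun2P sv [s hs [Xu [un [h1 h2 h3 h4]]]]]; exact: (trace_limit hs sv Xu h1 h2 h3 h4).
Qed.

Lemma traceP s u : 1 / 4 < s <= 1 / 2 -> X s u -> tr u (trace phi a u).
Proof.
move=> hs Xu; have [v hv] := is_trace_ex hs Xu.
by apply: is_trace_tr; exact: (@xgetPex _ (cst 0) [set v | is_trace phi a u v] (ex_intro _ v hv)).
Qed.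

Lemma tr_unique u v w : tr u v -> tr u w -> v = w %[ae sigma R].
Proof.
move=> [sv cv] [sw cw]; have := sconv_null Ss (comb_sigma _) sv sw cv cw.
move=> /(ip2_null (sipB Ss sv sw)); apply: filterS => x h D.
by apply/eqP; rewrite -subr_eq0; apply/eqP; exact: h.
Qed.

Lemma tr_lin c u v u' v' : sq u -> sq u' -> tr u v -> tr u' v' -> tr (c *: u + u') (c *: v + v').
Proof.
move=> su su' [sv cv] [sv' cv']; split; first exact: sqi_lin.
move=> d d0; have c2 : 0 < 4 * (c ^+ 2 + 1) by rewrite mulr_gt0// ltr_wpDl// sqr_ge0.
have [|K1 h1] := cv (d / (4 * (c ^+ 2 + 1))); first by rewrite divr_gt0.
have [|K2 h2] := cv' (d / 4); first by rewrite divr_gt0.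
exists (maxn K1 K2) => n; rewrite geq_max => /andP[/h1 {}h1 /h2 {}h2].
rewrite c0_lin// comb_lin.
have -> : c *: comb e (c0 u) n + comb e (c0 u') n - (c *: v + v') =
  c *: (comb e (c0 u) n - v) + (comb e (c0 u') n - v') by rewrite scalerBr opprD addrACA.
have s1 : sqi (sigma R) (comb e (c0 u) n - v) by apply: (sipB Ss) => //; exact: comb_sigma.
have s2 : sqi (sigma R) (comb e (c0 u') n - v') by apply: (sipB Ss) => //; exact: comb_sigma.
have s3 := sipZ Ss c s1.
apply: le_lt_trans (bD2 Ss s3 s2) _; rewrite (bZl Ss)// (bZr Ss)//.
move: (sip_ge0 Ss s1) h1 h2; move: (ip2 _ _ _) (ip2 _ _ _) => x y x0; rewrite ltr_pdivlMr// => h1 h2.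
have := sqr_ge0 c; nra.
Qed.

(** Fatou's lemma along partial Fourier sums that converge almost everywhere. *)
Lemma tr_Lp p s : 2 <= p -> 0 < s -> 1 - 1 / p < 2 * s -> exists2 C, 0 <= C &
  forall u v N, 0 <= N -> wle nu s (c0 u) N -> tr u v ->
    (\int[sigma R]_x (`|v x| `^ p)%:E <= (C * N `^ p)%:E)%E.
Proof.
move=> p2 s0 gap; have gap' : 1 - (2 - 1) / p < 2 * s by have -> : 2 - 1 = 1 :> R by ring.
exists (CL 1 16 p s a); first by apply: CL_ge0 => //; lra.
move=> u v N N0 hN [sv cv].
have [t [ht tv]] := ae_subseq (comb_sigma _) sv cv.
have p0 : 0 < p by exact: lt_le_trans p2.
have -> : (fun x => (`|v x| `^ p)%:E) = (fun x => `| `|v x| `^ p|%:E).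
  by apply/funext => x; congr EFin; symmetry; apply: ger0_norm; exact: powR_ge0.
apply: (@fatou_lim _ _ _ (sigma R) (fun k x => `|comb e (c0 u) (t k) x| `^ p)).
- by move=> k; apply/measurable_EFinP; apply: meas_pow; exact: meas_comb.
- by move=> k x; exact: powR_ge0.
- by apply/measurable_EFinP; apply: meas_pow; case: sv.
- by apply: filterS tv => x h; exact: powR_norm_cvg.
- apply: nearW => k.
  exact: (@Lp_comb R (sigma R) 1 16 (ler0n R 16) (@block2_sigma R) p s a p2 s0 a_gt0 gap' (c0 u) (t k) N N0 (hN _)).
Qed.

Lemma Lp_lebO p s : 2 <= p -> 0 < s -> 1 - 2 / p < 2 * s -> exists2 C, 0 <= C &
  forall u N, 0 <= N -> sq u -> wle nu s (c0 u) N ->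
    (\int[lebO R]_x (`|u x| `^ p)%:E <= (C * N `^ p)%:E)%E.
Proof.
move=> p2 s0 gap; have gap' : 1 - (2 - 0) / p < 2 * s by rewrite subr0.
exists (CL 0 1 p s a); first by apply: CL_ge0 => //; lra.
move=> u N N0 su hN.
have F0 := form_pair0 a_gt0; have E0 := cos_eigenbasis a_gt0.
have := parseval (fp_b F0) (fun k => fp_sub F0 (eig_in E0 k)) (eig_orth E0) (fp_bC F0) (eig_total E0) su.
rewrite -(ip2E (lebO R)) => cv.
have sO k : sq (comb e (c0 u) k) by apply: (D_comb S) => j; exact: cc_sqi.
have [t [ht tv]] := ae_subseq sO su cv.
have p0 : 0 < p by exact: lt_le_trans p2.
have -> : (fun x => (`|u x| `^ p)%:E) = (fun x => `| `|u x| `^ p|%:E).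
  by apply/funext => x; congr EFin; symmetry; apply: ger0_norm; exact: powR_ge0.
apply: (@fatou_lim _ _ _ (lebO R) (fun k x => `|comb e (c0 u) (t k) x| `^ p)).
- by move=> k; apply/measurable_EFinP; apply: meas_pow; exact: meas_comb.
- by move=> k x; exact: powR_ge0.
- by apply/measurable_EFinP; apply: meas_pow; case: su.
- by apply: filterS tv => x h; exact: powR_norm_cvg.
- apply: nearW => k.
  exact: (@Lp_comb R (lebO R) 0 1 ler01 (@block2_lebO R) p s a p2 s0 a_gt0 gap' (c0 u) (t k) N N0 (hN _)).
Qed.
End Traces.

(** * The nonlinearity *)
Section Nemytskii.
Variable R : realType.
Implicit Types (lam : R).

Lemma young_pow lam (x y : R) : 0 < lam -> 0 <= x -> 0 <= y ->
  (x `^ lam) ^+ 2 * y ^+ 2 <= x `^ (2 * (lam + 1)) + y `^ (2 * (lam + 1)).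
Proof.
move=> l0 x0 y0.
have E z : 0 <= z -> (z `^ lam) ^+ 2 * z ^+ 2 = z `^ (2 * (lam + 1)).
  move=> z0; have nz : lam + 1 != 0 by rewrite gt_eqF// addr_gt0.
  rewrite [2 * _]mulrC powRrM (powR_mulrn 2 (powR_ge0 _ _)) powRD ?(negbTE nz)//.
  by rewrite powRr1// exprMn.
have [xy|/ltW yx] := leP x y.
  apply: le_trans (_ : (y `^ lam) ^+ 2 * y ^+ 2 <= _); last by rewrite E// lerDr powR_ge0.
  by rewrite ler_wpM2r ?sqr_ge0// ler_sqr ?nnegrE ?powR_ge0// ge0_ler_powR ?nnegrE// ltW.
apply: le_trans (_ : (x `^ lam) ^+ 2 * x ^+ 2 <= _); last by rewrite E// lerDl powR_ge0.
by rewrite ler_wpM2l ?sqr_ge0// ler_sqr ?nnegrE.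
Qed.

(** Scaling by the size [m] of the increment makes the estimate linear in [m]. *)
Lemma growth_sqr lam (L x y z m : R) : 0 < lam -> 0 < m -> 0 < L ->
  `|z| <= L * (1 + `|x| `^ lam + `|y| `^ lam) * `|x - y| ->
  z ^+ 2 <= 3 * L ^+ 2 * m ^+ 2 * (1 + `|x| `^ (2 * (lam + 1)) + `|y| `^ (2 * (lam + 1))
    + 3 * m `^ (- (2 * (lam + 1))) * `|x - y| `^ (2 * (lam + 1))).
Proof.
move=> l0 m0 L0 hz; pose d := `|x - y| / m; have d0 : 0 <= d by rewrite divr_ge0// ltW.
have dE : `|x - y| = m * d by rewrite /d mulrC divfK ?gt_eqF.
have -> : 3 * m `^ (- (2 * (lam + 1))) * `|x - y| `^ (2 * (lam + 1)) = 3 * d `^ (2 * (lam + 1)).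
  rewrite dE powRM ?(ltW m0)// -mulrA [m `^ _ * _]mulrA -powRD ?(gt_eqF m0) ?implybT//.
  by rewrite addNr powRr0 mul1r.
have := young_pow l0 ler01 d0; have := young_pow l0 (normr_ge0 x) d0; have := young_pow l0 (normr_ge0 y) d0.
have hz2 : z ^+ 2 <= (L * (1 + `|x| `^ lam + `|y| `^ lam) * (m * d)) ^+ 2.
  rewrite -(real_normK (num_real z)) -dE ler_sqr ?nnegrE//.
  by rewrite !mulr_ge0 ?(ltW L0)// !addr_ge0 ?powR_ge0.
rewrite !powR1x expr1n mul1r; move: (`|x| `^ lam) (`|y| `^ lam) hz2 => A B hz2.
move: (`|x| `^ _) (`|y| `^ _) (d `^ _) => X Y D h1 h2 h3.
apply: le_trans hz2 _.
have -> : (L * (1 + A + B) * (m * d)) ^+ 2 = (L ^+ 2 * m ^+ 2) * ((1 + A + B) ^+ 2 * d ^+ 2) by ring.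
have -> : 3 * L ^+ 2 * m ^+ 2 * (1 + X + Y + 3 * D) = (L ^+ 2 * m ^+ 2) * (3 * (1 + X + Y + 3 * D)) by ring.
apply: ler_wpM2l; first by apply: mulr_ge0; exact: sqr_ge0.
have h4 : (1 + A + B) ^+ 2 <= 3 * (1 + A ^+ 2 + B ^+ 2).
  by have := sqr_ge0 (1 - A); have := sqr_ge0 (1 - B); have := sqr_ge0 (A - B); nra.
by have := ler_wpM2r (sqr_ge0 d) h4; nra.
Qed.

Context dT (T : measurableType dT) (mu : {measure set T -> \bar R}).
Variables (f : R -> R) (lam L K0 : R).
Hypotheses (cf : continuous f) (l0 : 0 < lam) (L0 : 0 < L) (muK : (mu setT <= K0%:E)%E).
Hypothesis grow : forall x y, `|f x - f y| <= L * (1 + `|x| `^ lam + `|y| `^ lam) * `|x - y|.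
Implicit Types (U V F psi W : T -> R).
Local Notation p := (2 * (lam + 1)).
Local Notation S := (ip2_semiip mu).

Let mpow U : measurable_fun setT U -> measurable_fun setT (fun x : T => (`|U x| `^ p)%:E).
Proof.
move=> mU; apply/measurable_EFinP.
by apply: (measurableT_comp (@measurable_powR R p)); exact: measurableT_comp.
Qed.

Lemma meas_nem U : measurable_fun setT U -> measurable_fun setT (f \o U).
Proof. by move=> mU; apply: measurableT_comp => //; exact: cont_measurable. Qed.

(** The growth exponent [p = 2 (lam + 1)] is the one for which [U^lam (U - V)] is square
    integrable as soon as [U] and [V] are in [Lp]. *)
Lemma nem_lip U V B P m : measurable_fun setT U -> measurable_fun setT V -> 0 < m ->
  (\int[mu]_x (`|U x| `^ p)%:E <= B%:E)%E -> (\int[mu]_x (`|V x| `^ p)%:E <= B%:E)%E ->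
  (\int[mu]_x (`|U x - V x| `^ p)%:E <= (P * m `^ p)%:E)%E ->
  sqi mu ((f \o U) - (f \o V)) /\
  ip2 mu ((f \o U) - (f \o V)) ((f \o U) - (f \o V)) <= 3 * L ^+ 2 * (K0 + B + B + 3 * P) * m ^+ 2.
Proof.
move=> mU mV m0 hU hV hD; set F := _ - _.
have mD : measurable_fun setT (fun x => U x - V x) by exact: measurable_funB.
have mF : measurable_fun setT F by apply: measurable_funB; exact: meas_nem.
have mp0 : 0 <= 3 * m `^ (- p) by rewrite mulr_ge0// powR_ge0.
have k0 : 0 <= 3 * L ^+ 2 * m ^+ 2.
  by apply: mulr_ge0; [apply: mulr_ge0 => //|]; exact: sqr_ge0.
have key : (\int[mu]_x (F x ^+ 2)%:E <= (3 * L ^+ 2 * (K0 + B + B + 3 * P) * m ^+ 2)%:E)%E.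
  have pw0 (u : T -> R) (x : T) : (0 <= (`|u x| `^ p)%:E)%E by rewrite lee_fin powR_ge0.
  have q0 (x : T) : (0 <= (3 * m `^ (- p))%:E * (`|U x - V x| `^ p)%:E)%E.
    by rewrite mule_ge0// ?lee_fin// powR_ge0.
  have pU0 x := pw0 U x; have pV0 x := pw0 V x; have mU' := mpow mU; have mV' := mpow mV.
  have m1 : measurable_fun setT (fun x => 1 + (`|U x| `^ p)%:E)%E by exact: emeasurable_funD.
  have m2 : measurable_fun setT (fun x => 1 + (`|U x| `^ p)%:E + (`|V x| `^ p)%:E)%E by exact: emeasurable_funD.
  have m3 : measurable_fun setT (fun x => (3 * m `^ (- p))%:E * (`|U x - V x| `^ p)%:E)%E.
    by apply: emeasurable_funM; [exact: measurable_cst|exact: mpow].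
  have n2 x : (0 <= 1 + (`|U x| `^ p)%:E + (`|V x| `^ p)%:E)%E by rewrite !adde_ge0.
  apply: (@le_trans _ _ (\int[mu]_x ((3 * L ^+ 2 * m ^+ 2)%:E * (1 + (`|U x| `^ p)%:E + (`|V x| `^ p)%:E
      + (3 * m `^ (- p))%:E * (`|U x - V x| `^ p)%:E)))%E).
    apply: ge0_le_integral => //.
    - by move=> x _; rewrite lee_fin sqr_ge0.
    - by apply/measurable_EFinP; exact: measurable_funX.
    - by apply: emeasurable_funM; [exact: measurable_cst|exact: emeasurable_funD].
    - by move=> x _; have := growth_sqr l0 m0 L0 (grow (U x) (V x)); rewrite -lee_fin; exact.
  rewrite ge0_integralZl//; last 2 first.
  - exact: emeasurable_funD.
  - by move=> x _; exact: adde_ge0.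
  rewrite (_ : 3 * L ^+ 2 * (K0 + B + B + 3 * P) * m ^+ 2 =
    (3 * L ^+ 2 * m ^+ 2) * (K0 + B + B + (3 * m `^ (- p)) * (P * m `^ p))); last first.
    have -> : 3 * m `^ (- p) * (P * m `^ p) = 3 * P * (m `^ (- p) * m `^ p) by ring.
    by rewrite -powRD ?(gt_eqF m0) ?implybT// addNr powRr0; ring.
  rewrite [X in (_ <= X)%E]EFinM; apply: lee_wpmul2l; first by rewrite lee_fin.
  rewrite !EFinD ge0_integralD//; apply: leeD; last first.
    rewrite ge0_integralZl//; last exact: mpow.
    by rewrite [X in (_ <= X)%E]EFinM; apply: lee_wpmul2l; rewrite ?lee_fin.
  rewrite ge0_integralD//; last by move=> x _; exact: adde_ge0.
  apply: leeD => //; rewrite ge0_integralD//.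
  by apply: leeD => //; rewrite integral_cst// mul1e.
have sF : sqi mu F.
  split=> //; apply/integrableP; split; first by apply/measurable_EFinP; exact: measurable_funX.
  under eq_integral do rewrite gee0_abs ?lee_fin ?sqr_ge0//.
  by apply: le_lt_trans key _; rewrite ltry.
split=> //; move: key; rewrite ge0_fine_Rintegral; [|by move=> x; exact: sqr_ge0|by case: sF].
by rewrite lee_fin; apply: le_trans; rewrite le_eqVlt; apply/orP; left; apply/eqP; apply: eq_Rintegral => x _; rewrite expr2.
Qed.

Lemma Rintegral_aeq U V : measurable_fun setT U -> measurable_fun setT V -> U = V %[ae mu] ->
  \int[mu]_x U x = \int[mu]_x V x.
Proof.
move=> mU mV h; rewrite /Rintegral; congr fine; apply: ae_eq_integral => //.
- exact/measurable_EFinP.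
- exact/measurable_EFinP.
- by apply: filterS h => x hx D; rewrite /= hx.
Qed.

Lemma sqi_cst c : sqi mu (cst c).
Proof.
split; first exact: measurable_cst.
apply/integrableP; split; first by apply/measurable_EFinP; exact: (measurable_cst (c ^+ 2)).
rewrite (eq_integral (cst (`|c ^+ 2|%:E)))// integral_cst// lte_mul_pinfty//.
by apply: le_lt_trans muK _; rewrite ltry.
Qed.

Lemma nem_sqi U (B : R) : measurable_fun setT U -> (\int[mu]_x (`|U x| `^ p)%:E <= B%:E)%E -> sqi mu (f \o U).
Proof.
move=> mU hU; have B0 : 0 <= B.
  by rewrite -lee_fin; apply: le_trans hU; apply: integral_ge0 => x _; rewrite lee_fin powR_ge0.
have p0 : p != 0 by rewrite mulf_neq0// gt_eqF// addr_gt0.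
have [||h _] := @nem_lip U (cst 0) B B 1 mU (measurable_cst _) ltr01 hU.
- rewrite (eq_integral (cst 0%E)); first by rewrite integral0 lee_fin.
  by move=> x _; rewrite /= normr0 powR0.
- by rewrite powR1x mulr1; under eq_integral do rewrite subr0.
rewrite (_ : f \o U = ((f \o U) - (f \o cst 0)) + cst (f 0)); first by apply: (sipD S) => //; exact: sqi_cst.
by apply/funext => x; rewrite -[RHS]/(f (U x) - f 0 + f 0) subrK.
Qed.

(** Cauchy-Schwarz with a bounded weight. *)
Lemma pair_bound F psi W (Q C : R) : sqi mu F -> sqi mu psi -> measurable_fun setT W -> 0 <= C ->
  (forall x : T, `|W x| <= C) -> ip2 mu psi psi <= Q ->
  (\int[mu]_x (F x * psi x * W x)) ^+ 2 <= ip2 mu F F * (C ^+ 2 * Q).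
Proof.
move=> sF sp mW C0 hW hQ; have sw := sqi_mulw sp mW hW.
have -> : \int[mu]_x (F x * psi x * W x) = ip2 mu F (fun x => W x * psi x).
  by apply: eq_Rintegral => x _; ring.
apply: le_trans (CS S sF sw) _; rewrite ler_wpM2l ?(sip_ge0 S)//.
apply: (@le_trans _ _ (C ^+ 2 * ip2 mu psi psi)); last by rewrite ler_wpM2l ?sqr_ge0.
rewrite /ip2 -RintegralZl//; last exact: sqi_mul_int.
apply: le_Rintegral => //; [exact: sqi_mul_int|by have := integrableZl measurableT (C ^+ 2) (sqi_mul_int sp sp)|].
move=> x _; rewrite (_ : W x * psi x * (W x * psi x) = W x ^+ 2 * (psi x * psi x)); last by ring.
rewrite ler_wpM2r//; first by rewrite -expr2 sqr_ge0.
by rewrite -(real_normK (num_real (W x))) ler_sqr ?nnegrE.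
Qed.

Lemma nem_pair U V psi W (B P m n Q C : R) : measurable_fun setT U -> measurable_fun setT V -> 0 < m ->
  (\int[mu]_x (`|U x| `^ p)%:E <= B%:E)%E -> (\int[mu]_x (`|V x| `^ p)%:E <= B%:E)%E ->
  (\int[mu]_x (`|U x - V x| `^ p)%:E <= (P * m `^ p)%:E)%E ->
  sqi mu psi -> measurable_fun setT W -> 0 <= C -> (forall x : T, `|W x| <= C) ->
  0 <= n -> ip2 mu psi psi <= Q * n ^+ 2 ->
  `|\int[mu]_x (f (U x) * psi x * W x) - \int[mu]_x (f (V x) * psi x * W x)| <=
  Num.sqrt (3 * L ^+ 2 * (K0 + B + B + 3 * P) * (C ^+ 2 * Q)) * m * n.
Proof.
move=> mU mV m0 hU hV hD sp mW C0 hW n0 hQ; have [sF hF] := nem_lip mU mV m0 hU hV hD.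
have sU := nem_sqi mU hU; have sV := nem_sqi mV hV.
have jU := mul_int_w sU sp mW hW; have jV := mul_int_w sV sp mW hW.
have -> : \int[mu]_x (f (U x) * psi x * W x) - \int[mu]_x (f (V x) * psi x * W x) =
    \int[mu]_x (((f \o U) - (f \o V)) x * psi x * W x).
  rewrite -RintegralB//; apply: eq_Rintegral => x _.
  by rewrite -!mulrBl.
have := pair_bound sF sp mW C0 hW hQ; move: (\int[mu]_x _) => I hI.
rewrite -sqrtr_sqr -(ger0_norm (ltW m0)) -(ger0_norm n0) -!sqrtr_sqr.
have h0 : 0 <= C ^+ 2 * (Q * n ^+ 2) by rewrite mulr_ge0 ?sqr_ge0//; apply: le_trans hQ; exact: (sip_ge0 S).
rewrite -mulrA -sqrtrM ?sqr_ge0// mulrC -sqrtrM; last by apply: mulr_ge0; exact: sqr_ge0.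
apply: ler_wsqrtr; apply: le_trans hI _; apply: le_trans (ler_wpM2r h0 hF) _.
by rewrite le_eqVlt; apply/orP; left; apply/eqP; ring.
Qed.

End Nemytskii.

Section BoundaryWeight.
Variable R : realType.
Local Notation T := (measurableTypeR R * measurableTypeR R)%type.
Variables (phi : R -> R -> R) (eps : R).
Hypothesis good : eps = 0 \/ mild phi eps.
Local Notation dphi := (dphi phi eps).

Lemma ae_sigma (P : T -> Prop) : (forall x, 0 <= x.1 <= 1 -> 0 <= x.2 <= 1 -> P x) ->
  {ae sigma R, forall x, P x}.
Proof.
move=> hP; exists (~` (`[0, 1] `*` `[0, 1])); split.
- by apply: measurableC; apply: measurableX; exact: measurable_itv.
- rewrite -[LHS]/(\sum_(k < 4) leb01 R (edge k @^-1` ~` (`[0, 1] `*` `[0, 1]))) big1// => k _.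
  rewrite -[LHS]/(lebesgue_measure (_ `&` _)) (_ : _ `&` _ = set0) ?measure0//.
  apply/seteqP; split=> // t [h]; rewrite /= in_itv/= => ht; apply: h.
  by case: k => [[|[|[|[|]]]]]//= _; split; rewrite /= in_itv/= ?ht ?lexx ?ler01.
- move=> x /= nP [h1 h2]; apply: nP; apply: hP; first by move: h1; rewrite /= in_itv.
  by move: h2; rewrite /= in_itv.
Qed.

Definition topw (t : R) : R :=
  if eps == 0 then pi^-1 * \int[@lebesgue_measure R]_(y in `[0, pi]) Num.sqrt (1 + cos y ^+ 2)
  else Num.sqrt (1 + cos (t / eps) ^+ 2).

(** The argument [h] is the identity for [theta] itself and the clamping to the unit
    interval for a version of [theta] that is bounded on the whole plane. *)
Definition thetaG (h : R -> R) : T -> R := fun x =>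
  if x.2 == 1 then topw x.1 else if x.1 == 1 then
    (if eps == 0 then 1 else 1 + dphi (h x.2) * sin (1 / eps)) else 1.

Lemma thetaE : theta phi eps = thetaG id.
Proof. by apply/funext => x; rewrite /theta /thetaG /topw; case: ifP. Qed.

Lemma meas_thetaG h : continuous h -> measurable_fun setT (thetaG h).
Proof.
move=> ch.
have m1 : measurable_fun (setT : set T) (fun x : T => topw x.1).
  rewrite /topw; have [_|_] := eqVneq eps 0; first exact: measurable_cst.
  apply: (measurableT_comp (f := fun y : R => Num.sqrt (1 + y ^+ 2))); last first.
    exact: (meas_fst_comp (cont_div (@continuous_cos R))).
  apply: cont_measurable => y; apply: continuous_comp; last exact: sqrt_continuous.
  apply: cvgD; first exact: cvg_cst.
  exact: exprn_continuous.
have m2 : measurable_fun (setT : set T) (fun x : T => if eps == 0 then 1 else 1 + dphi (h x.2) * sin (1 / eps)).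
  have [_|e0] := eqVneq eps 0; first exact: measurable_cst.
  apply: (meas_snd_comp (F := fun t => 1 + dphi (h t) * sin (1 / eps))) => t.
  apply: cvgD; first exact: cvg_cst.
  by apply: cvgM; [apply: continuous_comp; [exact: ch|exact: (dphi_cont good)]|exact: cvg_cst].
apply: measurable_fun_ifT => //; last apply: measurable_fun_ifT => //.
- by apply: measurable_fun_eqr => //; exact: measurable_snd.
- by apply: measurable_fun_eqr => //; exact: measurable_fst.
Qed.

Definition thetat : T -> R := thetaG (clamp 1).

Lemma theta_thetat : theta phi eps = thetat %[ae sigma R].
Proof.
rewrite thetaE; apply: ae_sigma => x _ x2 _; rewrite /thetat /thetaG clamp_id//.
Qed.

Lemma meas_thetat : measurable_fun setT thetat.
Proof. by apply: meas_thetaG; exact: clamp_cont. Qed.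

Lemma int_theta (F : T -> R) : measurable_fun setT F ->
  \int[sigma R]_x (F x * theta phi eps x) = \int[sigma R]_x (F x * thetat x).
Proof.
move=> mF; apply: (@Rintegral_aeq _ _ _ (sigma R) (fun x => F x * theta phi eps x) (fun x => F x * thetat x)).
- by apply: measurable_funM => //; rewrite thetaE; apply: meas_thetaG => t; exact: cvg_id.
- by apply: measurable_funM => //; exact: meas_thetat.
- by apply: (@filterS _ _ (ae_filter_ringOfSetsType (sigma R)) _ _ _ theta_thetat) => x h D; rewrite (h D).
Qed.

Lemma thetat_bound : exists2 C, 0 <= C & forall x, `|thetat x| <= C.
Proof.
exists (`|topw 0| + 2) => [|x]; first by rewrite addr_ge0.
rewrite /thetat /thetaG; case: ifP => _.
  rewrite /topw; case: ifP => _; first by rewrite lerDl.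
  apply: le_trans (_ : 2 <= _); last by rewrite lerDr.
  rewrite ger0_norm ?sqrtr_ge0// -(ler_pXn2r (n := 2)) ?nnegrE ?sqrtr_ge0//.
  have c1 : cos (x.1 / eps) ^+ 2 <= 1 by rewrite -(cos2Dsin2 (x.1 / eps)) lerDl sqr_ge0.
  have c0 : 0 <= cos (x.1 / eps) ^+ 2 by exact: sqr_ge0.
  by rewrite sqr_sqrtr; lra.
have t0 : 0 <= `|topw 0| by [].
case: ifP => _; last by rewrite normr1; lra.
have [_|e0] := eqVneq eps 0; first by rewrite normr1; lra.
case: good => [e|[_ _ h _]]; first by rewrite e eqxx in e0.
have h1 := h _ (clamp01 x.2); have h2 : `|sin (1 / eps)| <= 1 by rewrite ler_norml sin_geN1 sin_le1.
have h3 : `|dphi (clamp 1 x.2) * sin (1 / eps)| <= 2^-1 * 1 by rewrite normrM ler_pM.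
by apply: le_trans (ler_normD _ _) _; rewrite normr1; lra.
Qed.
End BoundaryWeight.

Section HopBounds.
Variable R : realType.
Local Notation T := (measurableTypeR R * measurableTypeR R)%type.
Local Notation sq := (sqi (lebO R)).
Variables (phi : R -> R -> R) (a eps : R) (f g : R -> R) (lam1 lam2 L1 L2 et s' : R).
Hypotheses (a_gt0 : 0 < a) (good : eps = 0 \/ mild phi eps)
  (GC : growth_conditions f g lam1 lam2 L1 L2).
Hypotheses (et1 : 1 / 2 - 1 / (2 * (lam1 + 1)) < et) (et2 : 1 / 2 - 1 / (4 * (lam2 + 1)) < et)
  (et4 : 1 / 4 < et) (s'_range : 1 / 4 < s' <= 1 / 2).
Local Notation p1 := (2 * (lam1 + 1)).
Local Notation p2 := (2 * (lam2 + 1)).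
Local Notation hop := (Hop phi a f g eps).
Local Notation trc := (trace phi a).
Implicit Types (u v psi : T -> R).

Definition s0 : R := Num.min et (1 / 2).

Let l1 : 0 < lam1. Proof. by case: (growth_pos GC). Qed.
Let l2 : 0 < lam2. Proof. by case: (growth_pos GC). Qed.
Let L1p : 0 < L1. Proof. by case: (growth_pos GC). Qed.
Let L2p : 0 < L2. Proof. by case: (growth_pos GC). Qed.

Let der_continuous (h : R -> R) : (forall x, derivable h x 1) -> continuous h.
Proof. by move=> dh x; apply: differentiable_continuous; apply/derivable1_diffP. Qed.
Let cf : continuous f. Proof. by apply: der_continuous => x; exact: ((growth_f_C1 GC).1 0%N). Qed.
Let cg : continuous g. Proof. by apply: der_continuous => x; exact: ((growth_g_C2 GC).1 0%N). Qed.

Lemma s0_range : 1 / 4 < s0 <= 1 / 2.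
Proof. by rewrite /s0 lt_min et4 ge_min lexx orbT andbT /=; lra. Qed.
Let s0_gt0 : 0 < s0. Proof. by have /andP[] := s0_range; lra. Qed.
Let s'_gt0 : 0 < s'. Proof. by have /andP[] := s'_range; lra. Qed.

Let gap1 : 1 - 2 / p1 < 2 * s0.
Proof.
have -> : 2 / p1 = (lam1 + 1)^-1 by field; rewrite gt_eqF// addr_gt0.
have i0 : 0 < (lam1 + 1)^-1 by rewrite invr_gt0 addr_gt0.
have h : 1 / (2 * (lam1 + 1)) = (lam1 + 1)^-1 / 2 by field; rewrite gt_eqF// addr_gt0.
by rewrite /s0; case: (leP et (1 / 2)) => _; move: et1; rewrite h; lra.
Qed.

Let gap2 : 1 - 1 / p2 < 2 * s0.
Proof.
have h : 1 / (4 * (lam2 + 1)) = 1 / p2 / 2 by field; rewrite gt_eqF// addr_gt0.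
have i0 : 0 < 1 / p2 by rewrite divr_gt0// mulr_gt0// addr_gt0.
by rewrite /s0; case: (leP et (1 / 2)) => _; move: et2; rewrite h; lra.
Qed.

Let p1_2 : 2 <= p1. Proof. by have := l1; lra. Qed.
Let p2_2 : 2 <= p2. Proof. by have := l2; lra. Qed.

Let sigma_fin : exists K0, (sigma R setT <= K0%:E)%E.
Proof.
exists 4; rewrite -[X in (X <= _)%E]mul1e -integral_cst// (sigma_ge0 (f := cst 1))//.
apply: (@le_trans _ _ (\sum_(k < 4) 1%:E)%E).
  by apply: lee_sum => k _; exact: muI_le.
by rewrite sumEFin lee_fin sumr_const card_ord.
Qed.

Let L2_ip d (S : measurableType d) (mu : {measure set S -> \bar R}) (h : S -> R) (c : R) : sqi mu h ->
  (\int[mu]_x (`|h x| `^ 2)%:E <= c%:E)%E -> ip2 mu h h <= c.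
Proof.
move=> [mh ih] hc; rewrite -lee_fin -ge0_fine_Rintegral; last 2 first.
- by move=> x; rewrite -expr2 sqr_ge0.
- by rewrite (_ : (fun x => _) = fun x => h x ^+ 2)//; apply/funext => x; rewrite expr2.
apply: le_trans hc; rewrite le_eqVlt; apply/orP; left; apply/eqP; apply: eq_integral => x _.
by rewrite (powR_mulrn 2 (normr_ge0 _)) real_normK ?num_real// expr2.
Qed.

Definition bdd s u r : Prop := [/\ sq u, 0 <= r & wle (nu0 a) s (c0 u) r].

Lemma bddX s u r : 0 < s < 1 -> bdd s u r -> Xspace phi a 0 s u.
Proof. by move=> hs [su r0 hr]; apply/X0P => //; split=> //; exists r. Qed.

Lemma bdd_tr s u r : 1 / 4 < s <= 1 / 2 -> bdd s u r -> tr u (trc u).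
Proof. by move=> hs hu; apply: (traceP a_gt0 hs); apply: bddX hu; case/andP: hs; lra. Qed.

Let Om : (lebO R setT <= 1%:E)%E. Proof. by rewrite lebO_setT. Qed.

Let sum_dist (x1 y1 x2 y2 A B m n : R) : `|x1 - y1| <= A * m * n -> `|x2 - y2| <= B * m * n ->
  `|x1 + x2 - (y1 + y2)| <= (A + B) * m * n.
Proof.
move=> h1 h2; rewrite !mulrDl; apply: le_trans (lerD h1 h2).
by rewrite (_ : _ - (y1 + y2) = (x1 - y1) + (x2 - y2)) ?ler_normD//; ring.
Qed.

(** The weights of [Hop] are replaced by versions that are bounded on the whole plane;
    they agree almost everywhere. *)
Definition hopO u psi : R := \int[lebO R]_x (f (u x) * psi x * Jt phi eps x).
Definition hopS u psi : R := \int[sigma R]_x (g (trc u x) * trc psi x * thetat phi eps x).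

Lemma hop_split u psi r n : bdd s0 u r -> bdd s' psi n -> 
  [/\ sq (f \o u), sqi (sigma R) (g \o trc u), sqi (sigma R) (trc psi) & hop u psi = hopO u psi + hopS u psi].
Proof.
move=> hu hp; have [su r0 hr] := hu; have [sp n0 hn] := hp.
have [tu _] := bdd_tr s0_range hu; have [tp _] := bdd_tr s'_range hp.
have [C1 C10 hC1] := Lp_lebO a_gt0 p1_2 s0_gt0 gap1.
have [C2 C20 hC2] := tr_Lp a_gt0 p2_2 s0_gt0 gap2.
have [K0 hK0] := sigma_fin.
have sf := nem_sqi cf l1 L1p Om (growth_f GC) su.1 (hC1 _ _ r0 su hr).
have sg := nem_sqi cg l2 L2p hK0 (growth_g GC) tu.1 (hC2 _ _ _ r0 hr (bdd_tr s0_range hu)).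
have E1 : \int[lebO R]_x (f (u x) * psi x * `|Jh phi eps x|) = hopO u psi by exact: (pairingE good sf sp).
have E2 : \int[sigma R]_x (g (trc u x) * trc psi x * theta phi eps x) = hopS u psi.
  by apply: (int_theta good (F := fun x => g (trc u x) * trc psi x)); apply: measurable_funM; [exact: sg.1|exact: tp.1].
by split; [exact: sf|exact: sg|exact: tp|exact: (f_equal2 (fun x y : R => x + y) E1 E2)].
Qed.

(** [nem_pair] on the square and on its boundary, with the embeddings into [Lp] for the
    exponents dictated by the growth of [f] and of [g]. *)
Lemma hop_lip0 r : 0 <= r -> exists2 L, 0 <= L & forall u v psi m n, 0 < m ->
  bdd s0 u r -> bdd s0 v r -> wle (nu0 a) s0 (fun k => c0 u k - c0 v k) m -> bdd s' psi n ->
  `|hop u psi - hop v psi| <= L * m * n.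
Proof.
move=> r0; have [mJ _ _] := froz_meas good.
have [C1 C10 hC1] := Lp_lebO a_gt0 p1_2 s0_gt0 gap1.
have [C2 C20 hC2] := tr_Lp a_gt0 p2_2 s0_gt0 gap2.
have q1 : 1 - 2 / 2 < 2 * s' by have := s'_gt0; lra.
have q2 : 1 - 1 / 2 < 2 * s' by have /andP[] := s'_range; lra.
have [Q1 Q10 hQ1] := Lp_lebO a_gt0 (lexx 2) s'_gt0 q1.
have [Q2 Q20 hQ2] := tr_Lp a_gt0 (lexx 2) s'_gt0 q2.
have [K0 hK0] := sigma_fin; have [B B0 hB] := thetat_bound good.
have mth := meas_thetat good.
have Jb x : `|Jt phi eps x| <= 2 by have /andP[h1 h2] := Jt_bound good x; rewrite ger0_norm//; lra.
exists (Num.sqrt (3 * L1 ^+ 2 * (1 + C1 * r `^ p1 + C1 * r `^ p1 + 3 * C1) * (2 ^+ 2 * Q1)) +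
  Num.sqrt (3 * L2 ^+ 2 * (K0 + C2 * r `^ p2 + C2 * r `^ p2 + 3 * C2) * (B ^+ 2 * Q2))).
  by rewrite addr_ge0 ?sqrtr_ge0.
move=> u v psi m n m0 hu hv hm hp; have [su _ hru] := hu; have [sv _ hrv] := hv; have [sp n0 hn] := hp.
have tu := bdd_tr s0_range hu; have tv := bdd_tr s0_range hv; have tp := bdd_tr s'_range hp.
have [_ _ _ ->] := hop_split hu hp; have [_ _ _ ->] := hop_split hv hp.
have dE : u - v = -1 *: v + u by rewrite scaleN1r addrC.
have sd : sq (u - v) by rewrite dE; exact: sqi_lin.
have hd : wle (nu0 a) s0 (c0 (u - v)) m.
  by apply: wle_eq hm => k; rewrite dE c0_lin// mulN1r addrC.
have td : tr (u - v) (trc u - trc v).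
  rewrite dE (_ : trc u - trc v = -1 *: trc v + trc u); last by rewrite scaleN1r addrC.
  exact: tr_lin.
have ip1 : ip2 (lebO R) psi psi <= Q1 * n ^+ 2.
  by apply: L2_ip => //; have := hQ1 _ _ n0 sp hn; rewrite (powR_mulrn 2 n0).
have ipS : ip2 (sigma R) (trc psi) (trc psi) <= Q2 * n ^+ 2.
  by apply: L2_ip; [exact: tp.1|]; have := hQ2 _ _ _ n0 hn tp; rewrite (powR_mulrn 2 n0).
have b1 := nem_pair cf l1 L1p Om (growth_f GC) su.1 sv.1 m0 (hC1 _ _ r0 su hru) (hC1 _ _ r0 sv hrv)
  (hC1 _ _ (ltW m0) sd hd) sp mJ (ler0n R 2) Jb n0 ip1.
have b2 := nem_pair cg l2 L2p hK0 (growth_g GC) tu.1.1 tv.1.1 m0 (hC2 _ _ _ r0 hru tu) (hC2 _ _ _ r0 hrv tv)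
  (hC2 _ _ _ (ltW m0) hd td) tp.1 mth B0 hB n0 ipS.
exact: (sum_dist b1 b2).
Qed.

Lemma hop_bound0 : exists2 M, 0 <= M & forall psi n, bdd s' psi n -> `|hop 0 psi| <= M * n.
Proof.
have [mJ _ _] := froz_meas good.
have q1 : 1 - 2 / 2 < 2 * s' by have := s'_gt0; lra.
have q2 : 1 - 1 / 2 < 2 * s' by have /andP[] := s'_range; lra.
have [Q1 Q10 hQ1] := Lp_lebO a_gt0 (lexx 2) s'_gt0 q1.
have [Q2 Q20 hQ2] := tr_Lp a_gt0 (lexx 2) s'_gt0 q2.
have [B B0 hB] := thetat_bound good.
have mth := meas_thetat good.
have Jb x : `|Jt phi eps x| <= 2 by have /andP[h1 h2] := Jt_bound good x; rewrite ger0_norm//; lra.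
have h0 : bdd s0 0 0.
  split=> //; first exact: (sqi0 (lebO R)).
  apply: bl2_eq (bl2_0 0) => k; rewrite /c0 (b0l (ip2_semiip (lebO R)) (@cc_sqi R (pk k))) mulr0//.
exists (Num.sqrt (ip2 (lebO R) (f \o 0) (f \o 0) * (2 ^+ 2 * Q1)) +
  Num.sqrt (ip2 (sigma R) (g \o trc 0) (g \o trc 0) * (B ^+ 2 * Q2))).
  by rewrite addr_ge0 ?sqrtr_ge0.
move=> psi n hp; have [sp n0 hn] := hp; have [sf sg stp ->] := hop_split h0 hp.
have tp := bdd_tr s'_range hp.
have ip1 : ip2 (lebO R) psi psi <= Q1 * n ^+ 2.
  by apply: L2_ip => //; have := hQ1 _ _ n0 sp hn; rewrite (powR_mulrn 2 n0).
have ipS : ip2 (sigma R) (trc psi) (trc psi) <= Q2 * n ^+ 2.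
  by apply: L2_ip; [exact: tp.1|]; have := hQ2 _ _ _ n0 hn tp; rewrite (powR_mulrn 2 n0).
have b1 := pair_bound sf sp mJ (ler0n R 2) Jb ip1.
have b2 := pair_bound sg stp mth B0 hB ipS.
have fin (I K C Q : R) : I ^+ 2 <= K * (C ^+ 2 * (Q * n ^+ 2)) -> `|I| <= Num.sqrt (K * (C ^+ 2 * Q)) * n.
  move=> h; rewrite -sqrtr_sqr -(ger0_norm n0) -sqrtr_sqr mulrC -sqrtrM ?sqr_ge0//.
  apply: ler_wsqrtr; apply: le_trans h _.
  by rewrite le_eqVlt; apply/orP; left; apply/eqP; ring.
by rewrite mulrDl; apply: le_trans (ler_normD _ _) (lerD (fin _ _ _ _ b1) (fin _ _ _ _ b2)).
Qed.

Lemma hop_lin0 u psi psi' r n n' c : bdd s0 u r -> bdd s' psi n -> bdd s' psi' n' ->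
  hop u (c *: psi + psi') = c * hop u psi + hop u psi'.
Proof.
move=> hu hp hp'; have [sp n0 hn] := hp; have [sp' n0' hn'] := hp'.
have hc : bdd s' (c *: psi + psi') (`|c| * n + n').
  split; [exact: sqi_lin|by rewrite addr_ge0// mulr_ge0|rewrite c0_lin//].
  apply: wleD => //; first by rewrite mulr_ge0.
  by apply: bl2_le hn => // k; rewrite mulrCA normrM.
have [sf sg tp ->] := hop_split hu hp; have [_ _ tp' ->] := hop_split hu hp'.
have [_ _ tc ->] := hop_split hu hc.
have SJ := fp_b (formA_pair good a_gt0).
have -> : hopO u (c *: psi + psi') = c * hopO u psi + hopO u psi'.
  by rewrite -[LHS]/(bJ phi eps (f \o u) _) (bDr SJ)// ?(bZr SJ)//; exact: (sipZ SJ).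
have [B B0 hB] := thetat_bound good.
have mth := meas_thetat good.
have sw := sqi_mulw sg mth hB; have S := ip2_semiip (sigma R).
have E w : hopS u w = ip2 (sigma R) (trc w) (fun x => thetat phi eps x * (g \o trc u) x).
  by apply: eq_Rintegral => x _; rewrite /=; ring.
have st : sqi (sigma R) (c *: trc psi + trc psi') by exact: sqi_lin.
have -> : hopS u (c *: psi + psi') = c * hopS u psi + hopS u psi'.
  rewrite !E -(sip_lin S)//; apply/eqP; rewrite -subr_eq0 -(bBl S)//; apply/eqP.
  have Z : trc (c *: psi + psi') - (c *: trc psi + trc psi') = cst 0 %[ae sigma R].
    have := tr_unique (bdd_tr s'_range hc) (tr_lin c sp sp' (bdd_tr s'_range hp) (bdd_tr s'_range hp')).
    apply: filterS => x h D; rewrite -[LHS]/(trc (c *: psi + psi') x - (c *: trc psi + trc psi') x) (h D).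
    exact: subrr.
  have := ae_wip0 (measurable_cst (1 : R)) (sipB S tc st).1 sw.1 Z.
  by rewrite -ip2E.
by move: (hopO _ _) (hopO _ _) (hopS _ _) (hopS _ _) => x1 x2 x3 x4; ring.
Qed.

End HopBounds.

(** * The evolution problem in coordinates *)
Section Series.
Variable R : realType.
Implicit Types (x y : nat -> R).

Lemma bl2_CS x y M N K : 0 <= M -> 0 <= N -> bl2 x M -> bl2 y N -> `|\sum_(k < K) x k * y k| <= M * N.
Proof.
move=> M0 N0 hx hy.
have main z : bl2 z M -> \sum_(k < K) z k * y k <= M * N.
  move=> hz; have [NE|Nn] := eqVneq N 0.
    rewrite NE in hy; rewrite big1 ?mulr_ge0// => k _.
    by have := bl2_coef k (lexx 0) hy; rewrite normr_le0 => /eqP ->; rewrite mulr0.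
  have Np : 0 < N by rewrite lt_neqAle eq_sym Nn.
  have h : \sum_(k < K) (y k / N) ^+ 2 <= 1.
    under eq_bigr do rewrite exprMn; rewrite -mulr_suml exprVn ler_pdivrMr ?exprn_gt0// mul1r.
    exact: hy.
  have := bl2_pair (d := fun k => y k / N) M0 hz h; under eq_bigr do rewrite mulrA.
  by rewrite -mulr_suml ler_pdivrMr.
rewrite ler_norml main// andbT lerNl -sumrN.
by under eq_bigr do rewrite -mulNr; exact: (main _ (bl2N hx)).
Qed.

Lemma bl2_cvg x y M N : 0 <= M -> 0 <= N -> bl2 x M -> bl2 y N -> cvgn (fun n => \sum_(k < n) x k * y k).
Proof.
move=> M0 N0 hx hy.
have mono (z : nat -> R) B : bl2 z B -> cvgn (fun n => \sum_(k < n) z k ^+ 2).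
  move=> hz; apply: nondecreasing_is_cvgn.
    by move=> m n mn; apply: (@ler_sum_widen _ (fun k => z k ^+ 2)) => // k; exact: sqr_ge0.
  by exists (B ^+ 2) => _ [n _ <-]; exact: hz.
have h1 := mono _ _ (bl2D M0 N0 hx hy); have h2 := mono _ _ (bl2B M0 N0 hx hy).
rewrite (_ : (fun n => _) = (fun n => 4^-1 * (\sum_(k < n) (x k + y k) ^+ 2 - \sum_(k < n) (x k - y k) ^+ 2))).
  have [[l1 c1] [l2 c2]] := ((cvg_ex _).1 h1, (cvg_ex _).1 h2).
  apply/cvg_ex; exists (4^-1 * (l1 - l2)).
  by apply: cvgM; [exact: cvg_cst|exact: (cvgB c1 c2)].
by apply/funext => n; rewrite -sumrB mulr_sumr; apply: eq_bigr => k _; field.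
Qed.
Lemma sum_trunc (c : nat -> R) K n : (forall k, 0 <= c k) -> (forall k, (K <= k)%N -> c k = 0) ->
  \sum_(k < n) c k <= \sum_(k < K) c k.
Proof.
move=> c0 cK; apply: le_trans (ler_sum_widen c0 (leq_maxr K n)) _.
rewrite (sum_split c (leq_maxl K n)) [X in _ + X]big1 ?addr0// => k _.
by rewrite cK// leq_addr.
Qed.
End Series.

Section Coordinates.
Variable R : realType.
Local Notation T := (measurableTypeR R * measurableTypeR R)%type.
Local Notation sq := (sqi (lebO R)).
Variables (phi : R -> R -> R) (a eps : R) (f g : R -> R) (lam1 lam2 L1 L2 be et : R).
Hypotheses (a_gt0 : 0 < a) (good : eps = 0 \/ mild phi eps)
  (GC : growth_conditions f g lam1 lam2 L1 L2).
Hypotheses (et1 : 1 / 2 - 1 / (2 * (lam1 + 1)) < et) (et2 : 1 / 2 - 1 / (4 * (lam2 + 1)) < et)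
  (et4 : 1 / 4 < et) (et_be : et < be + 1) (be_range : - (1 / 2) <= be < - (1 / 4)).
Variables (e : nat -> T -> R) (nu : nat -> R).
Local Notation b := (bJ phi eps).
Local Notation A := (formA phi a eps).
Hypothesis E : eigenbasis sq (@H1 R) b A e nu.
Local Notation hop := (Hop phi a f g eps).
Local Notation coef := (coef phi eps e).
Local Notation X0 := (Xspace phi a 0 (- be)).
Implicit Types (u v psi : T -> R) (c d : nat -> R).

(** Any order strictly between [1 / 4] and [- be]. *)
Definition s' : R := (1 / 4 - be) / 2.

Lemma s'_range : 1 / 4 < s' < - be.
Proof. by have /andP[h1 h2] := be_range; rewrite /s'; apply/andP; split; lra. Qed.
Let s'_half : 1 / 4 < s' <= 1 / 2.
Proof. by have /andP[h1 h2] := s'_range; have /andP[h3 h4] := be_range; apply/andP; split; lra. Qed.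

Let F := formA_pair good a_gt0.
Let S := fp_b F.
Let eQ := eig_in E.
Let eD k : sq (e k). Proof. exact: (fp_sub F (eQ k)). Qed.
Let nu_a := nu_ge F E.
Let nu_p k : 0 < nu k. Proof. exact: lt_le_trans a_gt0 (nu_a k). Qed.

Lemma coef_lin t u v : sq u -> sq v -> coef (t *: u + v) = fun k => t * coef u k + coef v k.
Proof. by move=> su sv; apply/funext => k; exact: (sip_lin S). Qed.

Lemma coefB u v : sq u -> sq v -> coef (u - v) = fun k => coef u k - coef v k.
Proof.
move=> su sv; rewrite (_ : u - v = -1 *: v + u); last by rewrite scaleN1r addrC.
by rewrite coef_lin//; apply/funext => k; rewrite mulN1r addrC.
Qed.

Lemma sqB u v : sq u -> sq v -> sq (u - v).
Proof. exact: (sipB S). Qed.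

Lemma coef_comb c K k : coef (comb e c K) k = if (k < K)%N then c k else 0.
Proof. exact: (comb_coef S eD (eig_orth E)). Qed.

Lemma comb_sq c K : sq (comb e c K).
Proof. exact: (D_comb S eD). Qed.

(** ** Comparison with the unperturbed scale *)

Lemma to0 s : 0 < s <= 2^-1 -> exists2 C, 0 <= C & forall u n, sq u -> 0 <= n ->
  wle nu s (coef u) n -> bdd a s u (C * n).
Proof.
move=> hs; have [C C0 hC] := spaces_agree a_gt0 good (or_introl erefl) E (basis0 phi a_gt0) hs.
exists C => // u n su n0 hu; split=> //; first exact: mulr_ge0.
by rewrite -(coef0 phi a); exact: hC.
Qed.

Lemma of0 s : 0 < s <= 2^-1 -> exists2 C, 0 <= C & forall u n, bdd a s u n -> wle nu s (coef u) (C * n).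
Proof.
move=> hs; have [C C0 hC] := spaces_agree a_gt0 (or_introl erefl) good (basis0 phi a_gt0) E hs.
by exists C => // u n [su n0 hu]; apply: hC => //; rewrite (coef0 phi a).
Qed.

Lemma to_s0 : exists2 C, 0 <= C & forall u n, sq u -> 0 <= n -> wle nu et (coef u) n -> bdd a (s0 et) u (C * n).
Proof.
have /andP[r1 r2] := s0_range et4; have [|C C0 hC] := @to0 (s0 et); first by apply/andP; split; lra.
exists (C * a `^ (s0 et - et)); first by rewrite mulr_ge0// powR_ge0.
move=> u n su n0 hu; rewrite -mulrA; apply: hC => //; first by rewrite mulr_ge0// powR_ge0.
by apply: (wle_exp a_gt0 nu_a) => //; rewrite /s0 ge_min lexx.
Qed.

(** ** The nonlinearity in coordinates *)

Lemma hop_lip r : 0 <= r -> exists2 L, 0 <= L & forall u v psi m n, sq u -> sq v -> sq psi ->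
  0 <= m -> 0 <= n -> wle nu et (coef u) r -> wle nu et (coef v) r ->
  wle nu et (fun k => coef u k - coef v k) m -> wle nu s' (coef psi) n ->
  `|hop u psi - hop v psi| <= L * m * n.
Proof.
move=> r0; have [C C0 hC] := to_s0; have [|D D0 hD] := @to0 s'; first by have /andP[] := s'_half; lra.
have [L L0 hL] := hop_lip0 a_gt0 good GC et1 et2 et4 s'_half (mulr_ge0 C0 r0).
exists (L * C * D); first by rewrite !mulr_ge0.
move=> u v psi m n su sv sp m0 n0 hu hv hm hp.
have hp' := hD _ _ sp n0 hp; have hu' := hC _ _ su r0 hu; have hv' := hC _ _ sv r0 hv.
have [_ _ hm'] : bdd a (s0 et) (u - v) (C * m) by apply: hC => //; [exact: sqB|rewrite coefB].
have hm2 : wle (nu0 a) (s0 et) (fun k => c0 u k - c0 v k) (C * m).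
  apply: wle_eq hm' => k; rewrite (_ : u - v = -1 *: v + u); last by rewrite scaleN1r addrC.
  by rewrite c0_lin// mulN1r addrC.
have key x : 0 < x -> `|hop u psi - hop v psi| <= L * (C * m + x) * (D * n).
  move=> x0; apply: hL => //; first by rewrite ltr_wpDl// mulr_ge0.
  by apply: wle_mon hm2; rewrite mulr_ge0//= lerDl ltW.
apply/ler_addgt0Pr => x x0; set q := L * (D * n); have q0 : 0 <= q by rewrite !mulr_ge0.
have q1 : 0 < q + 1 by rewrite ltr_wpDl.
apply: le_trans (key (x / (q + 1)) _) _; first by rewrite divr_gt0.
have h : q * (x / (q + 1)) <= x by rewrite mulrA ler_pdivrMr// [q * x]mulrC ler_wpM2l ?(ltW x0)// lerDl.
by move: h; rewrite /q; move: (x / _) => y; nra.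
Qed.

Lemma hop_zero : exists2 M, 0 <= M & forall psi n, sq psi -> 0 <= n -> wle nu s' (coef psi) n ->
  `|hop 0 psi| <= M * n.
Proof.
have [|D D0 hD] := @to0 s'; first by have /andP[] := s'_half; lra.
have [M M0 hM] := hop_bound0 a_gt0 good GC et1 et2 et4 s'_half.
exists (M * D); first exact: mulr_ge0.
by move=> psi n sp n0 hp; rewrite -mulrA; apply: hM; exact: hD.
Qed.

Lemma coef_0 k : coef 0 k = 0. Proof. exact: (b0l S). Qed.

Lemma hop_bound r : 0 <= r -> exists2 M, 0 <= M & forall u psi n, sq u -> wle nu et (coef u) r ->
  sq psi -> 0 <= n -> wle nu s' (coef psi) n -> `|hop u psi| <= M * n.
Proof.
move=> r0; have [L L0 hL] := hop_lip r0; have [M M0 hM] := hop_zero.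
exists (L * r + M); first by rewrite addr_ge0// mulr_ge0.
move=> u psi n su hu sp n0 hp; rewrite mulrDl -(subrK (hop 0 psi) (hop u psi)).
apply: le_trans (ler_normD _ _) _; apply: lerD; last exact: hM.
apply: hL => //; first exact: (sip0 S).
  by apply: bl2_eq (bl2_0 r) => k; rewrite coef_0 mulr0.
by apply: wle_eq hu => k; rewrite coef_0 subr0.
Qed.

Lemma hop_lin u r t psi psi' n n' : sq u -> 0 <= r -> wle nu et (coef u) r -> sq psi -> 0 <= n ->
  wle nu s' (coef psi) n -> sq psi' -> 0 <= n' -> wle nu s' (coef psi') n' ->
  hop u (t *: psi + psi') = t * hop u psi + hop u psi'.
Proof.
move=> su r0 hu sp n0 hp sp' n0' hp'.
have [C C0 hC] := to_s0; have [|D D0 hD] := @to0 s'; first by have /andP[] := s'_half; lra.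
exact: (hop_lin0 a_gt0 good GC et1 et2 et4 s'_half t (hC _ _ su r0 hu) (hD _ _ sp n0 hp) (hD _ _ sp' n0' hp')).
Qed.

Section Functional.
Variables (G : (T -> R) -> R) (M : R).
Hypotheses (M0 : 0 <= M)
  (Gb : forall psi n, sq psi -> 0 <= n -> wle nu s' (coef psi) n -> `|G psi| <= M * n)
  (Gl : forall t psi psi' n n', sq psi -> 0 <= n -> wle nu s' (coef psi) n -> sq psi' -> 0 <= n' ->
    wle nu s' (coef psi') n' -> G (t *: psi + psi') = t * G psi + G psi').

Lemma comb_wle c K : exists2 n, 0 <= n & wle nu s' (coef (comb e c K)) n.
Proof.
exists (Num.sqrt (\sum_(k < K) (nu k `^ s' * c k) ^+ 2)); first exact: sqrtr_ge0.
move=> n; rewrite sqr_sqrtr; last by apply: sumr_ge0 => k _; exact: sqr_ge0.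
apply: le_trans (@sum_trunc _ (fun k => (nu k `^ s' * coef (comb e c K) k) ^+ 2) K n _ _) _; [by move=> k; exact: sqr_ge0| |].
  by move=> k Kk; rewrite coef_comb ltnNge Kk mulr0 expr0n.
by apply: ler_sum => k _; rewrite coef_comb ltn_ord.
Qed.

Lemma G_comb c K : G (comb e c K) = \sum_(k < K) c k * G (e k).
Proof.
elim: K => [|K IH].
  rewrite /comb !big_ord0; apply/eqP; rewrite -normr_le0 -(mulr0 M); apply: Gb => //; first exact: (sip0 S).
  by apply: bl2_eq (bl2_0 0) => k; rewrite coef_0 mulr0.
have eE : e K = comb e (fun k => (k == K)%:R) K.+1.
  rewrite /comb big_ord_recr /= eqxx scale1r big1 ?add0r// => k _.
  by rewrite (ltn_eqF (ltn_ord k)) scale0r.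
have [n n0 hn] := comb_wle (fun k => (k == K)%:R) K.+1; rewrite -eE in hn.
have [n' n0' hn'] := comb_wle c K.
have -> : comb e c K.+1 = c K *: e K + comb e c K by rewrite /comb big_ord_recr /= addrC.
by rewrite (Gl (c K) (eD K) n0 hn (comb_sq c K) n0' hn') IH big_ord_recr /= addrC.
Qed.

(** Duality: the coefficients of [G] have a finite norm of order [- s']. *)
Lemma G_wle : wle nu (- s') (fun k => G (e k)) M.
Proof.
apply: bl2_dual => // K d d1.
have -> : \sum_(k < K) nu k `^ (- s') * G (e k) * d k = G (comb e (fun k => nu k `^ (- s') * d k) K).
  by rewrite G_comb; apply: eq_bigr => k _; ring.
apply: le_trans (ler_norm _) _; rewrite -[M]mulr1; apply: Gb => //; first exact: comb_sq.
move=> n; rewrite expr1n; apply: le_trans d1.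
apply: le_trans (@sum_trunc _ (fun k => (nu k `^ s' * coef (comb e (fun k => nu k `^ (- s') * d k) K) k) ^+ 2) K n _ _) _; [by move=> k; exact: sqr_ge0| |].
  by move=> k Kk; rewrite coef_comb ltnNge Kk mulr0 expr0n.
apply: ler_sum => k _; rewrite coef_comb ltn_ord mulrA -powRD ?(gt_eqF (nu_p k)) ?implybT//.
by rewrite addrN powRr0 mul1r.
Qed.

(** The partial sums of [psi] converge to [psi] for the norm of order [s']. *)
Lemma G_series psi n : sq psi -> 0 <= n -> wle nu s' (coef psi) n ->
  \sum_(k < K) G (e k) * coef psi k @[K --> \oo] --> G psi.
Proof.
move=> sp n0 hp; apply/cvgrPdist_lt => x x0; pose y := x / (M + 1).
have M1 : 0 < M + 1 by rewrite ltr_wpDl.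
have y0 : 0 < y by rewrite divr_gt0.
have tail := @series_cauchy R (fun k => (nu k `^ s' * coef psi k) ^+ 2) (n ^+ 2) (fun k => sqr_ge0 _) hp.
have [|N hN] := tail (y ^+ 2); first by rewrite exprn_gt0.
exists N => // K NK /=; under eq_bigr do rewrite mulrC.
have [n' n0' hn'] := comb_wle (coef psi) K; have sc := comb_sq (coef psi) K.
rewrite -G_comb -[G psi - _]addrC -mulN1r -(Gl (-1) sc n0' hn' sp n0 hp).
apply: (@le_lt_trans _ _ (M * y)).
  apply: Gb; [exact: sqi_lin|exact: ltW|rewrite coef_lin// => L].
  apply: (@le_trans _ _ (\sum_(k < maxn K L) (if (k < K)%N then 0 else (nu k `^ s' * coef psi k) ^+ 2))); last first.
    by rewrite (sum_tail (fun k => (nu k `^ s' * coef psi k) ^+ 2) (leq_maxl K L)); apply/ltW/hN => //; exact: leq_maxl.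
  apply: le_trans (@ler_sum_widen R (fun k => if (k < K)%N then 0 else (nu k `^ s' * coef psi k) ^+ 2) _ _ _ (leq_maxr K L)).
    apply: ler_sum => k _; rewrite coef_comb; case: ifP => _; first by rewrite mulN1r addNr mulr0 expr0n.
    by rewrite mulr0 add0r.
  by move=> k; case: ifP => // _; exact: sqr_ge0.
by rewrite /y mulrA ltr_pdivrMr// [M * x]mulrC ltr_pM2l// ltrDl.
Qed.
End Functional.

Definition fn c : T -> R := xget (cst 0) [set u : T -> R | sq u /\ coef u = c].

Lemma fnP s c r : 0 <= s -> wle nu s c r -> sq (fn c) /\ coef (fn c) = c.
Proof.
move=> s0 hc; have h := wle_exp a_gt0 nu_a s0 hc.
have [|u [su uc _]] := riesz_fischer S eD (eig_orth E) (fp_bC F) (c := c) (M := (a `^ (0 - s) * r) ^+ 2).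
  move=> K; apply: le_trans (h K); rewrite le_eqVlt; apply/orP; left; apply/eqP; apply: eq_bigr => k _.
  by rewrite powRr0 mul1r.
apply: (@xgetPex _ (cst 0) [set u : T -> R | sq u /\ coef u = c]).
by exists u; split=> //; apply/funext.
Qed.

Definition Hc c k := hop (fn c) (e k).

Let et0 : 0 <= et. Proof. by apply: le_trans (ltW et4); rewrite divr_ge0. Qed.

Lemma Hc_lip r : 0 <= r -> exists2 L, 0 <= L & forall c d m, 0 <= m -> wle nu et c r -> wle nu et d r ->
  wle nu et (fun k => c k - d k) m -> wle nu (- s') (fun k => Hc c k - Hc d k) (L * m).
Proof.
move=> r0; have [L L0 hL] := hop_lip r0; exists L => // c d m m0 hc hd hm.
have [sc cc] := fnP et0 hc; have [sd cd] := fnP et0 hd.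
apply: (@G_wle (fun psi => hop (fn c) psi - hop (fn d) psi)); first exact: mulr_ge0.
- by move=> psi n sp n0 hp; apply: hL; rewrite ?cc ?cd.
- move=> t psi psi' n n' sp n0 hp sp' n0' hp'.
  rewrite -cc in hc; rewrite -cd in hd.
  rewrite (hop_lin t sc r0 hc sp n0 hp sp' n0' hp') (hop_lin t sd r0 hd sp n0 hp sp' n0' hp').
  by move: (hop _ _) (hop _ _) (hop _ _) (hop _ _) => x1 x2 x3 x4; ring.
Qed.

Lemma Hc_wle c r : 0 <= r -> wle nu et c r -> exists2 M, 0 <= M & wle nu (- s') (Hc c) M.
Proof.
move=> r0 hc; have [M M0 hM] := hop_bound r0; exists M => //.
have [sc cc] := fnP et0 hc; rewrite -{1}cc in hc.
apply: (@G_wle (hop (fn c))) => //; first by move=> psi n sp n0 hp; exact: hM.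
by move=> t psi psi' n n' sp n0 hp sp' n0' hp'; exact: (hop_lin t sc r0 hc sp n0 hp sp' n0' hp').
Qed.

(** Functions with equal coordinates agree almost everywhere, but their images are
    compared through [hop_lip] with increment [0], as traces are not pointwise. *)
Lemma hop_fn u r psi n : sq u -> 0 <= r -> wle nu et (coef u) r -> sq psi -> 0 <= n ->
  wle nu s' (coef psi) n -> hop u psi = hop (fn (coef u)) psi.
Proof.
move=> su r0 hu sp n0 hp; have [sf cf] := fnP et0 hu; have [L L0 hL] := hop_lip r0.
apply/eqP; rewrite -subr_eq0 -normr_le0 -(mul0r n) -(mulr0 L); apply: hL; rewrite ?cf//.
by apply: bl2_eq (bl2_0 0) => k; rewrite subrr mulr0.
Qed.

Lemma hop_series u r psi n : sq u -> 0 <= r -> wle nu et (coef u) r -> sq psi -> 0 <= n ->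
  wle nu s' (coef psi) n -> \sum_(k < K) Hc (coef u) k * coef psi k @[K --> \oo] --> hop u psi.
Proof.
move=> su r0 hu sp n0 hp; have [M M0 hM] := hop_bound r0.
have [sf cf] := fnP et0 hu; have -> : hop u psi = hop (fn (coef u)) psi := hop_fn su r0 hu sp n0 hp.
have hu' : wle nu et (coef (fn (coef u))) r by rewrite cf.
apply: (G_series M0 _ _ sp n0 hp); first by move=> p k sq_ k0 hk; exact: hM.
by move=> t p1 p2 n1 n2 sp1 n10 hp1 sp2 n20 hp2; exact: (hop_lin t sf r0 hu' sp1 n10 hp1 sp2 n20 hp2).
Qed.

End Coordinates.

(** * Local solutions *)
Lemma der_of_lim (R : realType) (f : R -> R) (x l : R) :
  (forall d : R, 0 < d -> \forall h \near (0 : R)^', `|h^-1 * (f (x + h) - f x) - l| <= d) ->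
  is_derive x 1 f l.
Proof.
move=> H; have cv : h^-1 *: ((f \o shift x) (h *: 1) - f x) @[h --> (0 : R)^'] --> l.
  apply/cvgrPdist_le => d d0; apply: filterS (H d d0) => h.
  by rewrite distrC /= scaler1 [h + x]addrC.
by apply: DeriveDef; [apply/cvg_ex; exists l|exact: (cvg_lim _ cv)].
Qed.

Section LocalSolutions.
Variable R : realType.
Local Notation T := (measurableTypeR R * measurableTypeR R)%type.
Local Notation sq := (sqi (lebO R)).
Variables (phi : R -> R -> R) (a eps : R) (f g : R -> R) (lam1 lam2 L1 L2 be et : R).
Hypotheses (a_gt0 : 0 < a) (good : eps = 0 \/ mild phi eps)
  (GC : growth_conditions f g lam1 lam2 L1 L2).
Hypotheses (et1 : 1 / 2 - 1 / (2 * (lam1 + 1)) < et) (et2 : 1 / 2 - 1 / (4 * (lam2 + 1)) < et)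
  (et4 : 1 / 4 < et) (et_be : et < be + 1) (be_range : - (1 / 2) <= be < - (1 / 4)).
Variables (e : nat -> T -> R) (nu : nat -> R).
Local Notation b := (bJ phi eps).
Local Notation A := (formA phi a eps).
Hypothesis E : eigenbasis sq (@H1 R) b A e nu.
Local Notation hop := (Hop phi a f g eps).
Local Notation coef := (coef phi eps e).
Local Notation X0 := (Xspace phi a 0 (- be)).
Local Notation N0 := (Xnorm phi a 0 (- be)).
Local Notation X := (Xspace phi a eps).
Local Notation s' := (s' be).
Local Notation Hcf := (Hc phi a eps f g e).
Local Notation fn := (fn phi eps e).
Implicit Types (u v psi : T -> R) (c d : nat -> R).

Let F := formA_pair good a_gt0.
Let S := fp_b F.
Let eD k : sq (e k). Proof. exact: (fp_sub F (eig_in E k)). Qed.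
Let sqB u v : sq u -> sq v -> sq (u - v) := @sipB _ _ _ _ S u v.
Let nu_a := nu_ge F E.
Let nu_p k : 0 < nu k. Proof. exact: lt_le_trans a_gt0 (nu_a k). Qed.
Let be_half : 0 < - be <= 2^-1. Proof. by have /andP[] := be_range; lra. Qed.
Let be01 : 0 < - be < 1. Proof. by have /andP[] := be_range; lra. Qed.
Let be1 : 0 < be + 1 < 1. Proof. by have /andP[] := be_range; lra. Qed.
Let et01 : 0 < et < 1. Proof. by have /andP[h1 h2] := be1; have := et4; have := et_be; lra. Qed.
Let et0 : 0 <= et. Proof. by have /andP[/ltW] := et01. Qed.

Lemma XP s u : 0 < s < 1 -> X s u <-> sq u /\ exists2 N, 0 <= N & wle nu s (coef u) N.
Proof. by move=> hs; exact: (XspaceP a_gt0 good E hs u). Qed.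

Lemma e_wle k s : wle nu s (coef (e k)) (nu k `^ s).
Proof.
move=> K; apply: le_trans (@sum_trunc _ (fun j => (nu j `^ s * coef (e k) j) ^+ 2) k.+1 K _ _) _.
- by move=> j; exact: sqr_ge0.
- by move=> j kj; rewrite /coef (eig_orth E) (ltn_eqF kj) mulr0 expr0n.
rewrite big_ord_recr /= big1 ?add0r; last first.
  by move=> j _; rewrite /coef (eig_orth E) (gtn_eqF (ltn_ord j)) mulr0 expr0n.
by rewrite /coef (eig_orth E) eqxx mulr1.
Qed.

(** ** Functionals given by coordinates *)

(** An element of the dual space with coefficients [d]; the series converges on [X0] when the
    norm of order [be] of [d] is finite. *)
Definition Lf d psi : R := limn (fun n => \sum_(k < n) d k * coef psi k).

Lemma X0_wle : exists2 C, 0 <= C & forall psi, X0 psi -> sq psi /\ wle nu (- be) (coef psi) (C * N0 psi).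
Proof.
have [C C0 hC] := of0 a_gt0 good E be_half.
exists (C * cX (- be)); first by rewrite mulr_ge0// cX_ge0.
move=> psi hp; have [sp _] := (X0P phi a_gt0 psi be01).1 hp; split=> //.
rewrite -mulrA; apply: hC; split=> //; first by rewrite mulr_ge0 ?cX_ge0 ?Xnorm_ge0.
by rewrite -(coef0 phi a); exact: (Xnorm_wle a_gt0 (or_introl erefl) (basis0 phi a_gt0) be01 hp).
Qed.

Lemma X0_s' psi : X0 psi -> sq psi /\ exists2 n, 0 <= n & wle nu s' (coef psi) n.
Proof.
have [C C0 hC] := X0_wle => /hC[sp hp]; split=> //.
exists (a `^ (s' - (- be)) * (C * N0 psi)); first by rewrite !mulr_ge0 ?powR_ge0 ?Xnorm_ge0.
by apply: (wle_exp a_gt0 nu_a) => //; have /andP[_ /ltW] := s'_range be_range.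
Qed.

Let pairE d psi n : \sum_(k < n) d k * coef psi k =
  \sum_(k < n) (nu k `^ be * d k) * (nu k `^ (- be) * coef psi k).
Proof.
apply: eq_bigr => k _; rewrite mulrACA -powRD ?(gt_eqF (nu_p k)) ?implybT//.
by rewrite addrN powRr0 mul1r.
Qed.

Lemma Lf_cvg d M psi : 0 <= M -> wle nu be d M -> X0 psi ->
  \sum_(k < n) d k * coef psi k @[n --> \oo] --> Lf d psi.
Proof.
move=> M0 hd; have [C C0 hC] := X0_wle => /hC[sp hp].
suff h : cvgn (fun n => \sum_(k < n) d k * coef psi k) by exact: h.
rewrite (_ : (fun n => _) = (fun n => \sum_(k < n) (nu k `^ be * d k) * (nu k `^ (- be) * coef psi k))).
  by apply: (bl2_cvg M0 _ hd hp); rewrite mulr_ge0 ?Xnorm_ge0.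
by apply/funext => n; exact: pairE.
Qed.

Lemma Lf_bounded : exists2 C, 0 <= C & forall d M, 0 <= M -> wle nu be d M ->
  dual_bounded phi a be (C * M) (Lf d).
Proof.
have [C C0 hC] := X0_wle; exists C => // d M M0 hd psi hX.
have [sp hp] := hC _ hX; have cv := Lf_cvg M0 hd hX.
have n0 : 0 <= C * N0 psi by rewrite mulr_ge0 ?Xnorm_ge0.
have b n : `|\sum_(k < n) d k * coef psi k| <= M * (C * N0 psi) by rewrite pairE; exact: (bl2_CS n M0 n0 hd hp).
rewrite (_ : C * M * N0 psi = M * (C * N0 psi)); last by ring.
rewrite ler_norml; apply/andP; split.
  by apply: (cvgr_to_ge cv); apply: nearW => n; have := b n; rewrite ler_norml => /andP[].
by apply: (cvgr_to_le cv); apply: nearW => n; have := b n; rewrite ler_norml => /andP[].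
Qed.

Lemma X0_lin t psi psi' : X0 psi -> X0 psi' -> X0 (t *: psi + psi').
Proof.
move=> /(X0P phi a_gt0 _ be01)[sp [n n0 hn]] /(X0P phi a_gt0 _ be01)[sp' [n' n0' hn']].
apply/(X0P phi a_gt0 _ be01); split; first exact: sqi_lin.
exists (`|t| * n + n'); first by rewrite addr_ge0// mulr_ge0.
rewrite c0_lin//; apply: wleD => //; first by rewrite mulr_ge0.
by apply: bl2_le hn => // k; rewrite mulrCA normrM.
Qed.

Lemma Lf_lin d M t psi psi' : 0 <= M -> wle nu be d M -> X0 psi -> X0 psi' ->
  Lf d (t *: psi + psi') = t * Lf d psi + Lf d psi'.
Proof.
move=> M0 hd hX hX'; have cv := Lf_cvg M0 hd (X0_lin t hX hX').
have cv' : \sum_(k < n) d k * coef (t *: psi + psi') k @[n --> \oo] --> t * Lf d psi + Lf d psi'.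
  apply: cvg_eqf (cvgD (cvgM (cvg_cst t) (Lf_cvg M0 hd hX)) (Lf_cvg M0 hd hX')) => n.
  rewrite -[LHS]/(t * (\sum_(k < n) d k * coef psi k) + \sum_(k < n) d k * coef psi' k) mulr_sumr -big_split /=.
  have [sp _] := X0_s' hX; have [sp' _] := X0_s' hX'.
  by apply: eq_bigr => k _; rewrite (coef_lin a_gt0 good E)//; ring.
by apply: (cvg_unique _ cv cv'); exact: norm_hausdorff.
Qed.

Lemma Lf_dual d M : 0 <= M -> wle nu be d M -> Xdual phi a be (Lf d).
Proof.
move=> M0 hd; split; first by move=> t psi psi' hX hX'; exact: (Lf_lin t M0 hd hX hX').
by have [C C0 hC] := Lf_bounded; exists (C * M); exact: hC.
Qed.

Let nu_split k : nu k `^ be * nu k = nu k `^ (be + 1).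
Proof. by rewrite powRD ?(gt_eqF (nu_p k)) ?implybT// powRr1// ltW. Qed.

Lemma wle_nu c M : wle nu (be + 1) c M -> wle nu be (fun k => nu k * c k) M.
Proof. by apply: bl2_eq => k; rewrite mulrA nu_split. Qed.

Lemma H1_of u M : sq u -> wle nu (be + 1) (coef u) M -> H1 u.
Proof.
move=> su hu; have h : 2^-1 <= be + 1 by have /andP[] := be_range; lra.
have w := wle_exp a_gt0 nu_a h hu.
apply: (Q_of_coef F E su (M := (a `^ (2^-1 - (be + 1)) * M) ^+ 2)) => K; apply: le_trans (w K).
apply: ler_sum => k _; rewrite exprMn -(powR_mulrn 2 (powR_ge0 _ _)) -powRrM.
by rewrite mulVf// powRr1// ltW.
Qed.

Lemma X0_H1 psi : H1 psi -> X0 psi.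
Proof.
move=> hp; have sp := H1_sqi hp; apply/(X0P phi a_gt0 _ be01); split=> //.
have [//|C C0 hC] := @to0 R phi a eps a_gt0 good e nu E (- be).
have w : wle nu 2^-1 (coef psi) (Num.sqrt (A psi psi)).
  move=> K; rewrite sqr_sqrtr ?(sip_ge0 (fp_A F))//; apply: le_trans (A_bessel F E K hp).
  apply: ler_sum => k _; rewrite exprMn -(powR_mulrn 2 (powR_ge0 _ _)) -powRrM.
  by rewrite mulVf// powRr1// ltW.
have /andP[_ h] := be_half; have w' := wle_exp a_gt0 nu_a h w.
have [_ n0 hn] := hC _ _ sp (mulr_ge0 (powR_ge0 _ _) (sqrtr_ge0 _)) w'.
by eexists; [exact: n0|exact: hn].
Qed.

Lemma Lf_Abeta u M : sq u -> 0 <= M -> wle nu (be + 1) (coef u) M ->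
  is_Abeta phi a eps be u (Lf (fun k => nu k * coef u k)).
Proof.
move=> su M0 hu; have h := H1_of su hu; have hd := wle_nu hu.
split=> //; first exact: (Lf_dual M0 hd).
move=> psi hp; rewrite (AopE a good h hp).
have cv := Lf_cvg M0 hd (X0_H1 hp); have cv' := A_series F E h hp.
by apply: (cvg_unique _ cv cv'); exact: norm_hausdorff.
Qed.

Let rhsc c := rhs nu Hcf c.

(** On [X0] the nonlinearity is the sum of its coordinates, because [X0] embeds in the
    space of order [s']. *)
Lemma equation u r M : sq u -> 0 <= r -> wle nu et (coef u) r -> 0 <= M -> wle nu (be + 1) (coef u) M ->
  (exists2 M', 0 <= M' & wle nu be (rhsc (coef u)) M') /\
  forall psi, X0 psi -> Lf (rhsc (coef u)) psi + Lf (fun k => nu k * coef u k) psi = hop u psi.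
Proof.
move=> su r0 hr M0 hM.
have [K K0 hK] := Hc_wle a_gt0 good GC et1 et2 et4 be_range E r0 hr.
have /andP[_ /ltW s'b] := s'_range be_range.
have hK' : wle nu be (Hcf (coef u)) (a `^ (be - (- s')) * K) by apply: (wle_exp a_gt0 nu_a) hK; lra.
have p0 : 0 <= a `^ (be - (- s')) * K by rewrite mulr_ge0 ?powR_ge0.
have hR := wleB p0 M0 hK' (wle_nu hM).
split; first by eexists; [exact: addr_ge0 p0 M0|exact: hR].
move=> psi hX; have [sp [n n0 hn]] := X0_s' hX.
have c1 := Lf_cvg (addr_ge0 p0 M0) hR hX; have c2 := Lf_cvg M0 (wle_nu hM) hX.
have c3 := hop_series a_gt0 good GC et1 et2 et4 be_range E su r0 hr sp n0 hn.
have c4 : \sum_(k < n) Hcf (coef u) k * coef psi k @[n --> \oo] -->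
    Lf (rhsc (coef u)) psi + Lf (fun k => nu k * coef u k) psi.
  apply: cvg_eqf (cvgD c1 c2) => m; rewrite -big_split /=; apply: eq_bigr => k _.
  by rewrite -mulrDl subrK.
by apply: (cvg_unique _ c4 c3); exact: norm_hausdorff.
Qed.

Lemma ae_of_coef u v : sq u -> sq v -> (forall k, coef u k = coef v k) -> u = v %[ae lebO R].
Proof.
move=> su sv h; have sd := sqB su sv.
have z : b (u - v) (u - v) = 0.
  apply: (eig_total E) => // k; rewrite -[LHS]/(coef (u - v) k) (coefB a_gt0 good E su sv).
  by rewrite h subrr.
have [mJ _ _] := froz_meas good.
have := wip_null mJ (c1 := 2^-1) (C1 := 2) _ (Jt_bound good) sd z; rewrite invr_gt0 => /(_ (ltr0n _ 2)).
apply: (@filterS _ _ (ae_filter_ringOfSetsType (lebO R))) => x hx D.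
by apply/eqP; rewrite -subr_eq0; apply/eqP; exact: hx.
Qed.

Lemma coef_ae u v : sq u -> sq v -> u = v %[ae lebO R] -> coef u = coef v.
Proof.
move=> su sv h; apply/funext => k; have [mJ _ _] := froz_meas good.
exact: (wip_aeW mJ su sv (eD k) h).
Qed.

Lemma X_wle u : X et u -> sq u /\ wle nu et (coef u) (cX et * Xnorm phi a eps et u).
Proof. by move=> hu; have [su _] := (XP u et01).1 hu; split=> //; exact: (Xnorm_wle a_gt0 good E et01 hu). Qed.

Lemma X_sub u v : X et u -> X et v -> X et (u - v).
Proof.
move=> /(XP _ et01)[su [m m0 hm]] /(XP _ et01)[sv [n n0 hn]].
apply/(XP _ et01); split; first exact: sqB.
by exists (m + n); [exact: addr_ge0|rewrite (coefB a_gt0 good E su sv); exact: wleB].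
Qed.

Let b' := - s'.
Let s'r := s'_range be_range.
Let et_b' : 0 <= et - b' < 1.
Proof. by rewrite /b'; move: s'r et_be et4 => /andP[h1 h2] h3 h4; apply/andP; split; lra. Qed.
Let be_b' : 0 <= be + 1 - b' < 1.
Proof. by rewrite /b'; move: s'r be1 => /andP[h1 h2] /andP[h3 h4]; apply/andP; split; lra. Qed.
Let be_le : be <= b'.
Proof. by rewrite /b'; move: s'r => /andP[h1 h2]; lra. Qed.
Let be_et : be < et < be + 1.
Proof. by move: be_range et4 et_be => /andP[h1 h2] h3 h4; apply/andP; split; lra. Qed.
Let HLip := Hc_lip a_gt0 good GC et1 et2 et4 be_range E.
Let z_wle : wle nu et (fun=> 0) 0.
Proof. by apply: bl2_eq (bl2_0 0) => k; rewrite mulr0. Qed.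
Let HZ := Hc_wle a_gt0 good GC et1 et2 et4 be_range E (lexx 0) z_wle.

(** The fixed point in coordinates, read back as functions; its difference quotients converge
    for the norm of order [be], which is the dual norm of [X0]. *)
Theorem existence t0 u0 : X et u0 -> exists t1, t0 < t1 /\
  exists u : R -> R * R -> R, local_solution phi a f g be et eps t0 t1 u0 u.
Proof.
move=> hu0; have [su0 hr0] := X_wle hu0; set r0 := _ * _ in hr0.
have r00 : 0 <= r0 by rewrite mulr_ge0 ?cX_ge0 ?Xnorm_ge0.
have [tau T01 [U gU UE]] := fixpoint_ex a_gt0 nu_a et_b' HLip HZ r00 hr0.
have [tau0 tau1] := andP T01.
exists (t0 + tau); split; first by rewrite ltrDl.
have r1 : 0 <= r0 + 1 by rewrite addr_ge0.
have fP t : sq (fn (U t)) /\ coef (fn (U t)) = U t := fnP a_gt0 good E et0 (gU.2 t).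
pose u t := fn (U (t - t0)); exists u.
have su t : sq (u t) by case: (fP (t - t0)).
have cu t : coef (u t) = U (t - t0) by case: (fP (t - t0)).
have hu t : wle nu et (coef (u t)) (r0 + 1) by rewrite cu; exact: gU.2.
split.
- by move=> t _; apply/(XP _ et01); split=> //; exists (r0 + 1).
- move=> t _; apply: cvg_within_filter; apply/cvgrPdist_lt => x x0; pose y := x / (CX et + 1).
  have C1 : 0 < CX et + 1 by rewrite ltr_wpDl// CX_ge0.
  have y0 : 0 < y by rewrite divr_gt0.
  have [d d0 hd] := gU.1 (t - t0) y y0.
  near=> s; rewrite sub0r normrN ger0_norm ?Xnorm_ge0//.
  apply: (@le_lt_trans _ _ (CX et * y)); last by rewrite /y mulrA ltr_pdivrMr// [x * _]mulrC ltr_pM2r// ltrDl ltr01.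
  apply: (wle_Xnorm a_gt0 good E et01 (u := u s - u t)); [exact: sqB|exact: ltW|].
  rewrite (coefB a_gt0 good E (su s) (su t)) !cu; apply: hd.
  rewrite (_ : s - t0 - (t - t0) = s - t); last by ring.
  by near: s; rewrite -(subr0 d); under eq_near do rewrite distrC subr0; exact: cvgr_dist_lt.
- apply: ae_of_coef => // k; rewrite cu subrr; exact: (sol_init T01 UE).
move=> t /andP[tt0 tt1]; have tT : 0 < t - t0 < tau by apply/andP; split; lra.
have tT' : 0 < t - t0 <= tau by move: tT => /andP[-> /ltW].
have [M M0 hM] := sol_reg a_gt0 nu_a be_b' be_et HLip HZ r00 hr0 T01 gU UE tT'.
rewrite -cu in hM; split; first by apply/(XP _ be1); split=> //; exists M.
have [[M' M0' hM'] eqn] := equation (su t) r1 (hu t) M0 hM.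
exists (Lf (rhs nu Hcf (coef (u t)))), (Lf (fun k => nu k * coef (u t) k)); split=> //.
- split; first exact: (Lf_dual M0' hM').
  move=> d d0; have [C C0 hC] := Lf_bounded.
  have C1 : 0 < C + 1 by rewrite ltr_wpDl.
  have y0 : 0 < d / (C + 1) by rewrite divr_gt0.
  have [de de0 hde] := sol_diff a_gt0 nu_a be_b' be_le be_et HLip HZ r00 hr0 T01 gU UE tT y0.
  near=> s; have s0 : s != 0 by near: s; exact: nbhs_dnbhs_neq.
  have sd : `|s| < de by near: s; exact: dnbhs0_lt.
  have [_] := hde s s0 sd; set df := fun k => _; move=> hdf psi hX.
  have [sp _] := X0_s' hX; have sD := sqB (su (t + s)) (su t).
  have cD : coef (u (t + s) - u t) = fun k => U (t - t0 + s) k - U (t - t0) k.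
    rewrite (coefB a_gt0 good E (su _) (su _)) !cu (_ : t + s - t0 = t - t0 + s)//; by ring.
  rewrite -[pairing _ _ _ _]/(pairing phi eps (u (t + s) - u t) psi) (pairingE good sD sp).
  have c1 := b_series a_gt0 good E sD sp; have c2 := Lf_cvg M0' hM' hX.
  have c3 := Lf_cvg (ltW y0) hdf hX.
  have c4 : \sum_(k < n) df k * coef psi k @[n --> \oo] -->
      s^-1 * b (u (t + s) - u t) psi - Lf (rhs nu Hcf (coef (u t))) psi.
    apply: cvg_eqf (cvgB (cvgM (cvg_cst s^-1) c1) c2) => n.
    rewrite -[LHS]/(s^-1 * (\sum_(k < n) coef (u (t + s) - u t) k * coef psi k)
       - \sum_(k < n) rhs nu Hcf (coef (u t)) k * coef psi k) mulr_sumr -sumrB.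
    by apply: eq_bigr => k _; rewrite /df cD cu; ring.
  have -> : s^-1 * wip (lebO R) (Jt phi eps) (u (t + s) - u t) psi - Lf (rhs nu Hcf (coef (u t))) psi = Lf df psi.
    by apply: (cvg_unique _ c4 c3); exact: norm_hausdorff.
  apply: le_trans (hC _ _ (ltW y0) hdf psi hX) _; rewrite ler_wpM2r ?Xnorm_ge0//.
  by rewrite mulrA ler_pdivrMr// [C * d]mulrC ler_wpM2l ?(ltW d0)// lerDl.
- exact: (Lf_Abeta (su t) M0 hM).
Unshelve. all: by end_near. Qed.

(** Testing the equation with the [k]-th eigenfunction gives the [k]-th differential
    equation of the system; eigenfunctions belong to [H1], where [A_eps] is the form. *)
Lemma solution_coords t0 t1 u0 (u : R -> R * R -> R) : local_solution phi a f g be et eps t0 t1 u0 u ->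
  let U t := coef (u (t0 + t)) in
  [/\ forall t, 0 <= t < t1 - t0 -> exists2 M, 0 <= M & wle nu et (U t) M,
      rcont nu et (t1 - t0) U &
      forall t k, 0 < t < t1 - t0 -> is_derive t 1 (U ^~ k) (rhs nu Hcf (U t) k)].
Proof.
move=> [hX hC _ hD] U.
have inT t : 0 <= t < t1 - t0 -> t0 <= t0 + t < t1 by move=> /andP[h1 h2]; apply/andP; split; lra.
have XU t : 0 <= t < t1 - t0 -> X et (u (t0 + t)) by move=> /inT /hX.
split.
- move=> t /XU /X_wle[_ h]; exists (cX et * Xnorm phi a eps et (u (t0 + t))) => //.
  by rewrite mulr_ge0 ?cX_ge0 ?Xnorm_ge0.
- move=> t x tT x0; have Ce : 0 < cX et + 1 by rewrite ltr_wpDl// cX_ge0.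
  have /cvgrPdist_lt/(_ _ (divr_gt0 x0 Ce)) := hC _ (inT _ tT).
  rewrite near_withinE => /nbhs_ballP[d d0 hd]; exists d => // s sT sd.
  have h1 : ball (t0 + t) d (t0 + s).
    by rewrite /ball/= (_ : t0 + t - (t0 + s) = t - s); [rewrite distrC|ring].
  have h2 : t0 + s \in `[t0, t1[ by rewrite in_itv/=; exact: inT.
  have := hd _ h1 h2; rewrite sub0r normrN ger0_norm ?Xnorm_ge0// => h3.
  have Xs := XU _ sT; have Xt := XU _ tT; have [_ w] := X_wle (X_sub Xs Xt).
  have [ss _] := X_wle Xs; have [st _] := X_wle Xt.
  rewrite (coefB a_gt0 good E ss st) in w.
  apply: wle_mon w; rewrite mulr_ge0 ?cX_ge0 ?Xnorm_ge0//=.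
  apply: le_trans (ler_wpM2l (cX_ge0 et01) (ltW h3)) _.
  by rewrite mulrA ler_pdivrMr// [_ * x]mulrC ler_wpM2l ?(ltW x0)// lerDl.
move=> t k tT; have [t0' tT1] := andP tT; have tI : 0 <= t < t1 - t0 by rewrite ltW.
have tt : t0 < t0 + t < t1 by apply/andP; split; lra.
have [Xb [du [Au [[_ hdu] [hH1 _ hA] heq]]]] := hD _ tt.
have [st [M M0 hM]] := (XP _ be1).1 Xb; have [_ hr] := X_wle (XU _ tI).
have Xe : X0 (e k) by apply: X0_H1; exact: (eig_in E).
have duE : du (e k) = rhs nu Hcf (U t) k.
  have AE : Au (e k) = nu k * U t k.
    rewrite (hA _ (eig_in E k)) (AopE a good hH1 (eig_in E k)); exact: (eig_coef F E).
  have r0 : 0 <= cX et * Xnorm phi a eps et (u (t0 + t)) by rewrite mulr_ge0 ?cX_ge0 ?Xnorm_ge0.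
  have HE := hop_fn a_gt0 good GC et1 et2 et4 be_range E st r0 hr (eD k) (powR_ge0 _ _) (e_wle k s').
  by rewrite /rhs -AE /Hc -/(U t) -HE -(heq _ Xe) addrK.
rewrite -duE; apply: der_of_lim => d d0.
have Ne : 0 < N0 (e k) + 1 by rewrite ltr_wpDl// Xnorm_ge0.
have h1 := hdu _ (divr_gt0 d0 Ne).
have h2 : \forall s \near (0 : R)^', `|s| < Num.min t (t1 - t0 - t).
  by apply: dnbhs0_lt; rewrite lt_min; apply/andP; split; lra.
apply: filterS2 h1 h2 => s h; rewrite lt_min => /andP[sa sb].
have := h _ Xe; have sT : 0 <= t + s < t1 - t0.
  by move: sa sb; rewrite !ltr_norml => /andP[? ?] /andP[? ?]; apply/andP; split; lra.
have [ss _] := X_wle (XU _ sT); have [s2 _] := X_wle (XU _ tI); rewrite addrA in ss.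
rewrite -[pairing _ _ _ _]/(pairing phi eps (u (t0 + t + s) - u (t0 + t)) (e k)).
rewrite (pairingE good (sqB ss s2) (eD k)) -[wip _ _ _ _]/(coef (u (t0 + t + s) - u (t0 + t)) k).
rewrite (coefB a_gt0 good E ss s2) -addrA => h3; apply: le_trans h3 _.
by rewrite mulrAC ler_pdivrMr// ler_wpM2l ?(ltW d0)// lerDl.
Qed.

(** Both solutions solve the same system of differential equations. *)
Theorem uniqueness (t0 : R) u0 (t1 t2 : R) (u v : R -> R * R -> R) : X et u0 ->
  local_solution phi a f g be et eps t0 t1 u0 u -> local_solution phi a f g be et eps t0 t2 u0 v ->
  forall t, t0 <= t -> t < t1 -> t < t2 -> u t = v t %[ae lebO R].
Proof.
move=> hu0 hu hv t tt0 tt1 tt2; have [su0 _] := X_wle hu0.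
have [bU cU dU] := solution_coords hu; have [bV cV dV] := solution_coords hv.
have [hXu _ iu _] := hu; have [hXv _ iv _] := hv.
pose T1 := Num.min (t1 - t0) (t2 - t0).
have sub1 x : x < T1 -> x < t1 - t0 by rewrite lt_min => /andP[].
have sub2 x : x < T1 -> x < t2 - t0 by rewrite lt_min => /andP[].
have i1 : t0 <= t < t1 by rewrite tt0.
have i2 : t0 <= t < t2 by rewrite tt0.
have i3 : t0 <= t0 < t1 by apply/andP; split; lra.
have i4 : t0 <= t0 < t2 by apply/andP; split; lra.
have [su _] := X_wle (hXu t i1); have [sv _] := X_wle (hXv t i2).
have [s0u _] := X_wle (hXu t0 i3); have [s0v _] := X_wle (hXv t0 i4).
apply: ae_of_coef => // k.
pose U x := coef (u (t0 + x)); pose V x := coef (v (t0 + x)).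
have tE : t0 + (t - t0) = t by ring.
have -> : coef (u t) k = U (t - t0) k by rewrite /U tE.
have -> : coef (v t) k = V (t - t0) k by rewrite /V tE.
have bU' x : 0 <= x < T1 -> exists2 M, 0 <= M & wle nu et (U x) M.
  by move=> /andP[x0 /sub1 xT]; apply: bU; rewrite x0.
have bV' x : 0 <= x < T1 -> exists2 M, 0 <= M & wle nu et (V x) M.
  by move=> /andP[x0 /sub2 xT]; apply: bV; rewrite x0.
have cU' : rcont nu et T1 U.
  move=> x d /andP[x0 /sub1 xT] d0; have [|de de0 h] := cU x d _ d0; first by rewrite x0.
  by exists de => // s /andP[s0 /sub1 sT] sx; apply: h; rewrite ?s0.
have cV' : rcont nu et T1 V.
  move=> x d /andP[x0 /sub2 xT] d0; have [|de de0 h] := cV x d _ d0; first by rewrite x0.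
  by exists de => // s /andP[s0 /sub2 sT] sx; apply: h; rewrite ?s0.
have dU' x j : 0 < x < T1 -> is_derive x 1 (U ^~ j) (rhs nu Hcf (U x) j).
  by move=> /andP[x0 /sub1 xT]; apply: dU; rewrite x0.
have dV' x j : 0 < x < T1 -> is_derive x 1 (V ^~ j) (rhs nu Hcf (V x) j).
  by move=> /andP[x0 /sub2 xT]; apply: dV; rewrite x0.
have UV0 j : U 0 j = V 0 j.
  by rewrite /U /V addr0 (coef_ae s0u su0 iu) (coef_ae s0v su0 iv).
have tT : 0 <= t - t0 < T1 by rewrite subr_ge0 tt0 /T1 lt_min !ltrD2r tt1.
exact: (uniq_global a_gt0 nu_a et_b' HLip bU' bV' cU' cV' dU' dV' UV0 k tT).
Qed.

End LocalSolutions.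

Theorem theorem7p7 (R : realType) (a : R) (phi : R -> R -> R) (eps1 : R) :
  0 < a -> perturbation phi eps1 ->
  \forall eps0 \near (0 : R)^'+,
  forall (f g : R -> R) (lam1 lam2 L1 L2 : R),
  growth_conditions f g lam1 lam2 L1 L2 ->
  forall beta eta : R, admissible lam1 lam2 beta eta ->
  forall eps : R, 0 <= eps <= eps0 ->
  forall (t0 : R) (u0 : R * R -> R), Xspace phi a eps eta u0 ->
  (exists t1 : R, t0 < t1 /\
     exists u : R -> R * R -> R,
       local_solution phi a f g beta eta eps t0 t1 u0 u) /\
  (forall (t1 t2 : R) (u v : R -> R * R -> R), t0 < t1 -> t0 < t2 ->
     local_solution phi a f g beta eta eps t0 t1 u0 u ->
     local_solution phi a f g beta eta eps t0 t2 u0 v ->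
     forall t : R, t0 <= t -> t < t1 -> t < t2 -> u t = v t %[ae lebO R]).
Proof.
move=> a0 P.
have h2 : 0 < (2^-1 : R) by rewrite invr_gt0.
have [d /= d0 hd] := @pert_deriv _ _ _ P _ h2.
near=> eps0 => f g lam1 lam2 L1 L2 GC be et [be_range [p1 [q1 [p2 [q2 [_ [_ q2_1 _] _ _ /andP[adm et_be]]]]]]] eps.
move=> /andP[e0 ee0].
have good : eps = 0 \/ mild phi eps.
  have [->|en] := eqVneq eps 0; [by left|right].
  have ep : 0 < eps by rewrite lt_neqAle eq_sym en.
  have ee1 : eps0 <= eps1 by near: eps0; apply: nbhs_right_le; exact: pert_gt0 P.
  have i1 : 0 < eps <= eps1 by rewrite ep (le_trans ee0).
  split=> //; first exact: (@pert_C2 _ _ _ P _ i1).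
    move=> t ht; apply: (hd eps) => //; rewrite /= sub0r normrN gtr0_norm//.
    by apply: le_lt_trans ee0 _; near: eps0; exact: nbhs_right_lt.
  by have [C hC] := pert_bounded P; exists C => t ht; exact: hC.
have [e [nu E]] := formA_basis good a0.
move: adm; rewrite /= !gt_max => /andP[_ /andP[_ /andP[et2 /andP[_ /andP[et4 et1]]]]].
have et4' : 1 / 4 < et.
  apply: le_lt_trans et4; have : q2^-1 <= 1 by rewrite invf_le1 ?(ltW q2_1)// (lt_trans ltr01).
  rewrite -[1 / (4 * q2)]/(1 * (4 * q2)^-1) invfM; lra.
move=> t0 u0 hu0; split.
  exact: (existence a0 good GC et1 et2 et4' et_be be_range E t0 hu0).
move=> t1 t2 u v _ _ hu hv.
exact: (uniqueness a0 good GC et1 et2 et4' et_be be_range E hu0 hu hv).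
Unshelve. all: by end_near. Qed.
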